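(* Let $n\ge 1$, let $d\ge 1$ be an odd integer, let $P$ be a nonzero homogeneous harmonic polynomial of degree $d$ on $\mathbb{R}^n$, and let $T$ be the higher Riesz transform with kernel $P(x)/|x|^{n+d}$. Then there is a constant $C$ such that $$T^{*}f(x)\le C\, M^2(Tf)(x),\qquad x\in\mathbb{R}^n,\quad f\in L^2(\mathbb{R}^n),$$ where $M^2=M\circ M$. (For $n=1$, $d=1$ this includes the Hilbert transform.)
   Context: A smooth homogeneous convolution singular integral operator on $\mathbb{R}^n$ is an operator $Tf(x)=\lim_{\epsilon\to 0}T^{\epsilon}f(x)$, where $T^{\epsilon}f(x)=\int_{|y|>\epsilon} f(x-y)K(y)\,dy$, with kernel $K(x)=\Omega(x)/|x|^n$, $\Omega$ real valued, homogeneous of degree $0$, with restriction to $S^{n-1}$ of class $C^\infty$ and $\int_{S^{n-1}}\Omega\,d\sigma=0$. The maximal singular integral is $T^{*}f(x)=\sup_{\epsilon>0}|T^{\epsilon}f(x)|$. A higher Riesz transform is such an operator with kernel $P(x)/|x|^{n+d}$, where $P$ is a homogeneous harmonic polynomial of degree $d\ge1$. $M$ is the Hardy–Littlewood maximal operator. *)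

(* Defs.v *)
From HB Require Import structures.
From mathcomp Require Import all_boot all_order all_algebra.
From mathcomp Require Import all_classical all_reals all_analysis.
From mathcomp Require mpoly.
Import (canonicals) mpoly.
Set Implicit Arguments. Unset Strict Implicit. Unset Printing Implicit Defensive.
Import Order.TTheory GRing.Theory Num.Theory.
Import numFieldNormedType.Exports.
Local Open Scope classical_set_scope.
Local Open Scope ring_scope.

Section HigherRiesz.
Variable R : realType.

Definition hr_enorm (n : nat) (x : 'rV[R]_n) : R :=
  Num.sqrt (\sum_(i < n) x ord0 i ^+ 2).

(* Lebesgue integral on R^n, defined as the iterated one-dimensional
   Lebesgue integral  int dx_1 ( int dx_2 ( ... int dx_n f(x) ) ).
   By Tonelli/Fubini it coincides with the integral against n-dimensional
   Lebesgue measure for nonnegative Borel functions and for integrable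
   Borel functions, which are the only cases used below. *)
Fixpoint hr_iint (n : nat) : ('rV[R]_n -> \bar R) -> \bar R :=
  match n return ('rV[R]_n -> \bar R) -> \bar R with
  | 0 => fun f => f 0
  | n'.+1 => fun f =>
      (\int[@lebesgue_measure R]_t
         hr_iint (fun v : 'rV[R]_n' => f (row_mx (\row_(_ < 1) t) v)))%E
  end.

Definition hr_borel_set (n : nat) (A : set 'rV[R]_n) : Prop :=
  <<s [set U : set 'rV[R]_n | open U] >> A.

Definition hr_borel_fun (n : nat) (f : 'rV[R]_n -> R) : Prop :=
  forall B : set R, measurable B -> hr_borel_set (f @^-1` B).

Definition hr_L2 (n : nat) (f : 'rV[R]_n -> R) : Prop :=
  hr_borel_fun f /\ (hr_iint (fun y => ((f y) ^+ 2)%:E) < +oo)%E.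

Definition hr_ae_Rn (n : nat) (Q : 'rV[R]_n -> Prop) : Prop :=
  exists N : set 'rV[R]_n, [/\ hr_borel_set N,
    hr_iint (fun y => (\1_N y)%:E) = 0%E & forall x, ~ N x -> Q x].

(* P is hr_homogeneous of degree d: the library's  d.-homog  (for total degree). *)
Definition hr_homogeneous (n d : nat) (P : mpoly.mpoly n R) : bool :=
  P \is mpoly.ishomog1 d (mpoly.Measure.clone n mpoly.mdeg _).

Definition hr_harmonic (n : nat) (P : mpoly.mpoly n R) : Prop :=
  \sum_(i < n) mpoly.mderiv i (mpoly.mderiv i P) = 0.

Definition hr_riesz_kernel (n d : nat) (P : mpoly.mpoly n R) (y : 'rV[R]_n) : R :=
  mpoly.meval (fun i => y ord0 i) P / hr_enorm y ^+ (n + d).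

Definition hr_Teps (n d : nat) (P : mpoly.mpoly n R) (f : 'rV[R]_n -> R)
    (eps : R) (x : 'rV[R]_n) : \bar R :=
  hr_iint (fun y => if eps < hr_enorm y then (f (x - y) * hr_riesz_kernel d P y)%:E
                 else 0%E).

Definition hr_Tstar (n d : nat) (P : mpoly.mpoly n R) (f : 'rV[R]_n -> R)
    (x : 'rV[R]_n) : \bar R :=
  ereal_sup [set (`| hr_Teps d P f eps x |)%E | eps in [set e : R | 0 < e]].

Definition hr_is_T (n d : nat) (P : mpoly.mpoly n R) (f g : 'rV[R]_n -> R) : Prop :=
  hr_ae_Rn (fun x => hr_Teps d P f eps x @[eps --> 0^'+] --> (g x)%:E).

Definition hr_ball_vol (n : nat) (x : 'rV[R]_n) (r : R) : \bar R :=
  hr_iint (fun y => (\1_[set z | hr_enorm (z - x) < r] y)%:E).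

Definition hr_HLmax (n : nat) (h : 'rV[R]_n -> \bar R) (x : 'rV[R]_n) : \bar R :=
  ereal_sup [set (hr_iint (fun y => (\1_[set z | hr_enorm (z - x) < r] y)%:E
                                  * `| h y |) * ((fine (hr_ball_vol x r))^-1)%:E)%E
            | r in [set r : R | 0 < r]].

End HigherRiesz.

(* Main.v *)
Require Import Defs.
From HB Require Import structures.
From mathcomp Require Import all_boot all_order all_algebra.
From mathcomp Require Import all_classical all_reals all_analysis.
From mathcomp Require Import measurable_realfun.
From mathcomp Require mpoly.
Import (canonicals) mpoly.
From mathcomp Require Import ring lra.
Set Implicit Arguments. Unset Strict Implicit. Unset Printing Implicit Defensive.
Import Order.TTheory GRing.Theory Num.Theory.
Import numFieldNormedType.Exports.
Local Open Scope classical_set_scope.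
Local Open Scope ring_scope.

(** Write [H_k] and [Q_k] for the k-th time derivatives (up to sign) of the kernels
    H(t,y) = t^(-n/2) e^(-|y|^2/t) and Q(t,y) = P(y) t^(-n/2-d) e^(-|y|^2/t).
    Since P is harmonic, H_j(s) * Q_k(t) is a multiple of Q_(j+k)(s+t). The kernel
    of T is the superposition of the Q(t^2) with weight t^(d-1), so, with g = Tf,
    c H_k(s) * g is the integral of t^(d-1) Q_k(s+t^2) * f over t > 0.

    Let d = 2m+1 and let B be P times the indicator of the unit ball. There is a
    Lipschitz radial function F supported in the unit ball such that
    H_(m+1)(v) * B = Q_1(v) * F. Integrating H_1(xi^2) * F against g over xi > 0
    and using polar coordinates in (xi, t) collapses the time derivatives and gives
    <B, f> as an integral of g against a kernel which decays at infinity and is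
    O(1 + log (1 / | |y| - 1 |)) near the unit sphere. Such a weight is dominated by
    averages over a ball of averages of |g| over balls, hence the bound
    |<B, f>| <= C M(Mg)(0), and by dilation a bound on all balls. This is where
    M has to be iterated and where d must be odd.

    Finally the truncated integral of f differs from H_0(1) * g by integrals of P f
    against radial profiles, which are superpositions of balls. *)

(** * Borel sets and Lebesgue measure on row vectors *)

(** The function [g] is only given as an almost everywhere limit of truncations, so it must first be
    tied to [f] by an L2 bound on truncations. This is done without the Fourier transform: the
    pairing of Q(s) * f with Q(t) * f depends only on s + t, so the norm of a superposition is
    controlled by a square function, which telescopes against heat averages. Bounded sequences
    converging almost everywhere converge weakly, and this gives the formula for H_k(s) * g. The
    time s > 0 keeps all integrals absolutely convergent and is removed at the end.

    F is found on Gaussians: for B = P e^(-l |y|^2) the convolution rule gives F = l^(-(m+1)) L(l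
    |y|^2) e^(-l |y|^2), with L the Laguerre factor of H_m, of degree m. Hence each power |y|^(2i)
    comes with l^(-r) e^(-l |y|^2), r = m + 1 - i >= 1, an r-fold tail integral of the exponential
    in |y|^2. Superposing Gaussians to the indicator of the ball turns it into a multiple of (1 -
    |y|^2)^r, which vanishes on the sphere: F is Lipschitz. One time derivative of its heat flow
    then costs only 1 / max(t, | |y| - 1 |). *)

Fact rV_display : measure_display.
Proof. exact: default_measure_display. Qed.

Section rV_measurable.
Variables (R : realType) (n : nat).
Local Notation opens := [set U : set 'rV[R]_n | open U].
Let m0 : <<s opens >> set0. Proof. exact: sigma_algebra0. Qed.
Let mC A : <<s opens >> A -> <<s opens >> (~` A).
Proof. by move=> h; rewrite -setTD; exact: sigma_algebraCD. Qed.
Let mU (F : (set 'rV[R]_n)^nat) : (forall i, <<s opens >> (F i)) -> <<s opens >> (\bigcup_i F i).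
Proof. exact: sigma_algebra_bigcup. Qed.
HB.instance Definition _ := @isMeasurable.Build rV_display
  'rV[R]_n <<s opens >> m0 mC mU.
End rV_measurable.

Section measurability.
Variables (R : realType).

Lemma continuous_measurable_rV n (f : 'rV[R]_n -> R) :
  continuous f -> measurable_fun setT f.
Proof.
move=> cf; apply: (measurability _ (RGenOInfty.measurableE R)) => //.
move=> _ [_ [a ->] <-]; rewrite setTI; apply: sub_gen_smallest => /=.
by move/continuousP: cf; apply; exact: rray_open.
Qed.

Lemma measurable_coord n (i : 'I_n) :
  measurable_fun setT (fun x : 'rV[R]_n => x ord0 i).
Proof. by apply: continuous_measurable_rV; exact: coord_continuous. Qed.

(** Every open set is a countable union of cubes with rational centre and radius, and the preimage
    of a cube is a finite intersection of conditions on single coordinates. *)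
Lemma measurable_rVP d (T : measurableType d) n (h : T -> 'rV[R]_n) :
  (forall i, measurable_fun setT (fun x => h x ord0 i)) -> measurable_fun setT h.
Proof.
move=> mh; apply: (@measurability _ _ _ _ setT h [set U : set 'rV[R]_n | open U]) => //.
move=> _ [U oU <-]; rewrite setTI.
pose bx (q : 'rV[rat]_n * rat) : set 'rV[R]_n :=
  [set y | forall i, `|ratr (q.1 ord0 i) - y ord0 i| < ratr q.2].
have -> : U = \bigcup_(q in [set q | bx q `<=` U]) bx q.
  apply/seteqP; split=> [x Ux|x [q /= qU]]; last exact: qU.
  have /nbhs_ballP[e /= e0 eU] : nbhs x U by exact: open_nbhs_nbhs.
  (* The radius is below [e / 2] because both [x] and the points of the cube are only within [r] of
     its rational centre. *)
  have [r /andP[r0 re]] : exists r : rat, 0 < (ratr r : R) < e / 2.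
    have e20 : 0 < e / 2 by rewrite divr_gt0.
    by have [r] := rat_in_itvoo e20; rewrite in_itv/=; exists r.
  have /choice[c cP] : forall i, exists c : rat, `|(ratr c : R) - x ord0 i| < ratr r.
    move=> i; have : x ord0 i - ratr r < x ord0 i + ratr r by lra.
    move=> /rat_in_itvoo[c]; rewrite in_itv/= => /andP[c1 c2]; exists c.
    by rewrite ltr_norml; lra.
  exists (\row_i c i, r) => /=; last by move=> i; rewrite mxE; exact: cP.
  move=> y yb; apply: eU; rewrite /= /ball/=; split=> // i j; rewrite (ord1 i); have := yb j; rewrite /= mxE => hj.
  have := cP j; rewrite /ball/=; move: hj; rewrite !ltr_norml; lra.
rewrite preimage_bigcup bigcup_mkcond; apply: countable_bigcupT_measurable.
  exact: countableP.
move=> q; case: ifP => _ //.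
have -> : h @^-1` bx q = \bigcap_(i in [set: 'I_n])
    ((fun x => h x ord0 i) @^-1` [set y | `|ratr (q.1 ord0 i) - y| < ratr q.2]).
  by apply/seteqP; split=> x /= H i; [move=> _; exact: H|exact: (H i I)].
apply: fin_bigcap_measurable => [|i _]; first exact: finite_finset.
rewrite -[X in measurable X]setTI; apply: mh => //.
rewrite (_ : [set _ | _] = ball (ratr (q.1 ord0 i) : R) (ratr q.2)) //.
exact: measurable_ball.
Qed.

Lemma measurable_rVD d (T : measurableType d) n (f g : T -> 'rV[R]_n) :
  measurable_fun setT f -> measurable_fun setT g ->
  measurable_fun setT (fun x => f x + g x).
Proof.
move=> mf mg; apply: measurable_rVP => i; under eq_fun do rewrite mxE.
by apply: measurable_funD; exact: (measurableT_comp (measurable_coord i)).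
Qed.

Lemma measurable_rVN d (T : measurableType d) n (f : T -> 'rV[R]_n) :
  measurable_fun setT f -> measurable_fun setT (fun x => - f x).
Proof.
move=> mf; apply: measurable_rVP => i; under eq_fun do rewrite mxE.
by apply: measurableT_comp; [exact: oppr_measurable|exact: (measurableT_comp (measurable_coord i))].
Qed.

Lemma measurable_rVB d (T : measurableType d) n (f g : T -> 'rV[R]_n) :
  measurable_fun setT f -> measurable_fun setT g ->
  measurable_fun setT (fun x => f x - g x).
Proof. by move=> mf mg; apply: measurable_rVD => //; exact: measurable_rVN. Qed.

Lemma measurable_rVZ d (T : measurableType d) n (a : T -> R) (f : T -> 'rV[R]_n) :
  measurable_fun setT a -> measurable_fun setT f ->
  measurable_fun setT (fun x => a x *: f x).
Proof.
move=> ma mf; apply: measurable_rVP => i; under eq_fun do rewrite mxE.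
by apply: measurable_funM => //; exact: (measurableT_comp (measurable_coord i)).
Qed.

Lemma measurable_rVcons n :
  measurable_fun setT (fun z : measurableTypeR R * 'rV[R]_n => @row_mx R 1 1 n (\row_(_ < 1) z.1) z.2 : 'rV[R]_n.+1).
Proof.
apply: measurable_rVP => i; under eq_fun do rewrite mxE.
case: (splitP (i : 'I_(1 + n))) => j _.
- by under eq_fun do rewrite mxE; exact: measurable_fst.
- exact: (measurableT_comp (measurable_coord j)).
Qed.

Lemma measurable_rVuncons n :
  measurable_fun setT (fun x : 'rV[R]_n.+1 => (x ord0 ord0 : measurableTypeR R, @rsubmx R 1 1 n x)).
Proof.
apply: measurable_fun_pair => /=; first exact: measurable_coord.
apply: measurable_rVP => i; under eq_fun do rewrite mxE; exact: measurable_coord.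
Qed.

End measurability.

(** * Lebesgue measure on row vectors as an iterated product *)

Section lebesgue_rV.
Variables (R : realType).

Section step.
Variables (n : nat) (m : {sigma_finite_measure set 'rV[R]_n -> \bar R}).

Let cons (z : measurableTypeR R * 'rV[R]_n) : 'rV[R]_n.+1 := @row_mx R 1 1 n (\row_(_ < 1) z.1) z.2.
Let uncons (x : 'rV[R]_n.+1) : measurableTypeR R * 'rV[R]_n := (x ord0 ord0, @rsubmx R 1 1 n x).
Let mcons : measurable_fun setT cons. Proof. exact: measurable_rVcons. Qed.

Let consK : cancel cons uncons.
Proof.
move=> [t v]; rewrite /uncons /cons/=; congr pair; last by rewrite row_mxKr.
by rewrite mxE; case: splitP => // j _; rewrite mxE.
Qed.

(** The first coordinate is split off, in the order in which [hr_iint] integrates, so that the two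
    integrals unfold alike. *)
Definition lebesgue_rV_step : set 'rV[R]_n.+1 -> \bar R :=
  fun A => (@lebesgue_measure R \x m)%E (cons @^-1` A).

Let mpre A : measurable A -> measurable (cons @^-1` A).
Proof. by move=> mA; rewrite -[X in measurable X]setTI; exact: mcons. Qed.

Let step0 : lebesgue_rV_step set0 = 0%E.
Proof. by rewrite /lebesgue_rV_step preimage_set0 measure0. Qed.

Let step_ge0 A : (0 <= lebesgue_rV_step A)%E.
Proof. exact: measure_ge0. Qed.

Let step_sigma_additive : semi_sigma_additive lebesgue_rV_step.
Proof.
move=> F mF tF mUF; rewrite /lebesgue_rV_step preimage_bigcup.
apply: measure_semi_sigma_additive.
- by move=> i; exact: mpre.
- apply/trivIsetP => /= i j _ _ ij; rewrite -preimage_setI.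
  by move/trivIsetP : tF => /(_ _ _ _ _ ij) ->//; rewrite preimage_set0.
- by rewrite -preimage_bigcup; exact: mpre.
Qed.

HB.instance Definition _ := isMeasure.Build _ _ _
  lebesgue_rV_step step0 step_ge0 step_sigma_additive.

Let step_sigma_finite : sigma_finite setT lebesgue_rV_step.
Proof.
have [F TF Foo] : sigma_finite setT (@lebesgue_measure R \x m)%E.
  have /sigma_finiteP[F [TF ndF Foo]] := sigma_finiteT (@lebesgue_measure R).
  have /sigma_finiteP[G [TG ndG Goo]] := sigma_finiteT m.
  exists (fun k => F k `*` G k).
    rewrite -setXTT TF TG predeqE => -[x y]; split.
      move=> [/= [i _ Fx] [k _ Gy]]; exists (maxn i k) => //; split.
      - by move: x Fx; exact/subsetPset/ndF/leq_maxl.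
      - by move: y Gy; exact/subsetPset/ndG/leq_maxr.
    by move=> [k _ []/= ? ?]; split; exists k.
  move=> k; have [? ?] := Foo k; have [? ?] := Goo k; split; first exact: measurableX.
  by rewrite product_measure1E// lte_mul_pinfty// ge0_fin_numE.
exists (fun i => uncons @^-1` F i); first by rewrite -preimage_bigcup -TF.
move=> i; have [mF Fi] := Foo i; split.
  by rewrite -[X in measurable X]setTI; exact: measurable_rVuncons.
rewrite /lebesgue_rV_step -comp_preimage (_ : _ @^-1` _ = F i)//.
by apply/seteqP; split => z; rewrite /= consK.
Qed.

HB.instance Definition _ := Measure_isSigmaFinite.Build _ _ _
  lebesgue_rV_step step_sigma_finite.

End step.

Fixpoint lebesgue_rV (n : nat) : {sigma_finite_measure set 'rV[R]_n -> \bar R} :=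
  match n with
  | 0 => [the {sigma_finite_measure set 'rV[R]_0 -> \bar R} of \d_(0 : 'rV[R]_0)]
  | n'.+1 => [the {sigma_finite_measure set 'rV[R]_n'.+1 -> \bar R} of
     lebesgue_rV_step (lebesgue_rV n')]
  end.

Lemma hr_iint_ge0 n (f : 'rV[R]_n -> \bar R) :
  measurable_fun setT f -> (forall x, 0 <= f x)%E ->
  hr_iint f = (\int[lebesgue_rV n]_x f x)%E.
Proof.
elim: n f => [|n IH] f mf f0 /=; first by rewrite integral_dirac// diracT mul1e.
set cons := fun z : measurableTypeR R * 'rV[R]_n => @row_mx R 1 1 n (\row_(_ < 1) z.1) z.2 : 'rV[R]_n.+1.
have mcons : measurable_fun setT cons by exact: measurable_rVcons.
have E := ge0_integral_pushforward mcons (@lebesgue_measure R \x lebesgue_rV n)%E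
  measurableT mf (fun y _ => f0 y).
apply: etrans (etrans (esym E) _); last by apply: eq_measure_integral.
rewrite preimage_setT (fubini_tonelli1 (m1:=@lebesgue_measure R) (m2:=lebesgue_rV n) (f \o cons)); [|exact: (measurableT_comp mf mcons)|by move=> x; exact: f0].
apply: eq_integral => t _; rewrite IH//.
exact: (measurableT_comp (measurableT_comp mf mcons)
  (measurable_fun_pair (measurable_cst (t : measurableTypeR R)) (@measurable_id _ 'rV[R]_n setT))).
Qed.

End lebesgue_rV.

Section curried_tonelli.
Context d1 d2 (T1 : measurableType d1) (T2 : measurableType d2) (R : realType).
Variables (m1 : {sigma_finite_measure set T1 -> \bar R})
          (m2 : {sigma_finite_measure set T2 -> \bar R}).
Local Open Scope ereal_scope.

Lemma measurable_ge0_integral (f : T1 -> T2 -> \bar R) :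
  measurable_fun setT (fun z => f z.1 z.2) -> (forall x y, 0 <= f x y) ->
  measurable_fun setT (fun x => \int[m2]_y f x y).
Proof.
move=> mf f0.
exact: (measurable_fun_fubini_tonelli_F (m2:=m2) (fun z => f z.1 z.2) mf (fun z => f0 _ _)).
Qed.

Lemma tonelli (f : T1 -> T2 -> \bar R) :
  measurable_fun setT (fun z => f z.1 z.2) -> (forall x y, 0 <= f x y) ->
  \int[m1]_x \int[m2]_y f x y = \int[m2]_y \int[m1]_x f x y.
Proof.
move=> mf f0.
exact: (fubini_tonelli (m1:=m1) (m2:=m2) (fun z => f z.1 z.2) mf (fun z => f0 _ _)).
Qed.

End curried_tonelli.

(** * Affine changes of variables *)

Section affine.
Variables (R : realType).
Local Notation leb := (@lebesgue_measure R).

Lemma measurable_affine (a c : R) :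
  measurable_fun setT (fun t : measurableTypeR R => a + c * t : measurableTypeR R).
Proof. exact: measurable_funD (measurable_funM _ _). Qed.

Lemma lebesgue_measure_affine (a c : R) (A : set (measurableTypeR R)) : c != 0 ->
  measurable A ->
  leb A = (`|c|%:E * leb ((fun t => a + c * t)%R @^-1` A))%E.
Proof.
move=> c0 mA.
pose phi : measurableTypeR R -> measurableTypeR R := fun t => a + c * t.
have mphi : measurable_fun setT phi by exact: measurable_affine.
pose nu := mscale (NngNum (normr_ge0 c)) (pushforward leb phi).
suff -> : leb A = nu mphi A by [].
apply: lebesgue_measure_unique => //= _ [[x y]] _ <-.
rewrite /nu /mscale/= /pushforward.
have [cp|cn|c00] := ltgtP 0 c; last by rewrite c00 eqxx in c0.
- rewrite (_ : _ @^-1` _ = `](x - a) / c, (y - a) / c]%classic); last first.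
    apply/seteqP; split=> t /=; rewrite !in_itv/= /phi ltr_pdivrMr// ler_pdivlMr//.
      by move=> /andP[h1 h2]; apply/andP; split; lra.
    by move=> /andP[h1 h2]; apply/andP; split; lra.
  rewrite !lebesgue_measure_itv/= !lte_fin ltr_pM2r ?invr_gt0// ltrD2r.
  case: ifP => // _; last by rewrite mule0.
  rewrite -!EFinB -EFinM gtr0_norm//; congr (_ %:E); field.
  exact: lt0r_neq0.
(* A negative factor exchanges the open and the closed end of the interval, which its length does
   not see. *)
- rewrite (_ : _ @^-1` _ = `[(y - a) / c, (x - a) / c[%classic); last first.
    apply/seteqP; split=> t /=; rewrite !in_itv/= /phi ltr_ndivlMr// ler_ndivrMr//.
      by move=> /andP[h1 h2]; apply/andP; split; lra.
    by move=> /andP[h1 h2]; apply/andP; split; lra.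
  rewrite !lebesgue_measure_itv/= !lte_fin ltr_nM2r ?invr_lt0// ltrD2r.
  case: ifP => // _; last by rewrite mule0.
  rewrite -!EFinB -EFinM ltr0_norm//; congr (_ %:E); field.
  by rewrite lt_eqF.
Qed.

Lemma ge0_integral_affine (a c : R) (f : R -> \bar R) : c != 0 ->
  measurable_fun setT f -> (forall x, 0 <= f x)%E ->
  (\int[leb]_t f t = `|c|%:E * \int[leb]_t f (a + c * t)%R)%E.
Proof.
move=> c0 mf f0.
pose phi : measurableTypeR R -> measurableTypeR R := fun t => a + c * t.
have mphi : measurable_fun setT phi by exact: measurable_affine.
have E := ge0_integral_pushforward mphi leb measurableT mf (fun y _ => f0 y).
rewrite preimage_setT in E; rewrite -[X in (_ * X)%E]E.
pose nu := mscale (NngNum (normr_ge0 c)) (pushforward leb phi).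
rewrite (@eq_measure_integral _ _ _ setT (nu mphi)); last first.
  by move=> A mA _; exact: lebesgue_measure_affine.
by rewrite ge0_integral_mscale.
Qed.

Lemma measurable_rV_affine n (a : 'rV[R]_n) (c : R) :
  measurable_fun setT (fun y : 'rV[R]_n => a + c *: y).
Proof. by apply: measurable_rVD => //; exact: measurable_rVZ. Qed.

Lemma measurable_row_mx n (t : R) :
  measurable_fun setT (fun v : 'rV[R]_n => @row_mx R 1 1 n (\row_(_ < 1) t) v : 'rV[R]_n.+1).
Proof.
apply: measurable_rVP => i; under eq_fun do rewrite mxE.
case: (splitP (i : 'I_(1 + n))) => j _; last exact: measurable_coord.
by under eq_fun do rewrite mxE; exact: measurable_cst.
Qed.

Lemma lebesgue_rVS n (f : 'rV[R]_n.+1 -> \bar R) :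
  measurable_fun setT f -> (forall x, 0 <= f x)%E ->
  (\int[lebesgue_rV R n.+1]_y f y =
   \int[leb]_t \int[lebesgue_rV R n]_v f (@row_mx R 1 1 n (\row_(_ < 1) t) v))%E.
Proof.
move=> mf f0; rewrite -hr_iint_ge0//=; apply: eq_integral => t _.
rewrite hr_iint_ge0//.
exact: (measurableT_comp mf (measurable_row_mx t)).
Qed.

Lemma ge0_integral_rV_affine n (a : 'rV[R]_n) (c : R) (f : 'rV[R]_n -> \bar R) : c != 0 ->
  measurable_fun setT f -> (forall x, 0 <= f x)%E ->
  (\int[lebesgue_rV R n]_y f y =
   (`|c| ^+ n)%:E * \int[lebesgue_rV R n]_y f (a + c *: y)%R)%E.
Proof.
move=> c0; elim: n a f => [|n IH] a f mf f0.
  by rewrite expr0 mul1e; apply: eq_integral => x _; congr f; apply/rowP => -[].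
rewrite lebesgue_rVS// [in RHS]lebesgue_rVS//; last first.
  exact: (measurableT_comp mf (measurable_rV_affine _ _)).
pose a0 : R := a ord0 ord0; pose a1 : 'rV[R]_n := @rsubmx R 1 1 n a.
have mfc : measurable_fun setT (fun z : measurableTypeR R * 'rV[R]_n =>
    f (@row_mx R 1 1 n (\row_(_ < 1) z.1) z.2)).
  by have H := measurableT_comp mf (@measurable_rVcons R n); exact H.
have mft t : measurable_fun setT (fun v : 'rV[R]_n => f (@row_mx R 1 1 n (\row_(_ < 1) t) v)).
  exact: (measurableT_comp mf (measurable_row_mx t)).
rewrite (ge0_integral_affine a0 c0); last 2 first.
- by apply: (@measurable_ge0_integral _ _ (measurableTypeR R) _ R (lebesgue_rV R n) _ mfc).
- by move=> x; exact: integral_ge0.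
rewrite exprSr EFinM -muleA [in RHS]muleCA; congr (_ * _)%E.
have mF : measurable_fun setT (fun t : measurableTypeR R =>
    (\int[lebesgue_rV R n]_v f (a + c *: @row_mx R 1 1 n (\row_(_ < 1) t) v)%R)%E).
  apply: (@measurable_ge0_integral _ _ (measurableTypeR R) _ R (lebesgue_rV R n)
    (fun t v => f (a + c *: @row_mx R 1 1 n (\row_(_ < 1) t) v))) => //.
  have H := measurableT_comp (measurableT_comp mf (measurable_rV_affine a c))
    (@measurable_rVcons R n); exact H.
rewrite -(ge0_integralZl _ measurableT mF); last 2 first.
- by move=> t _; exact: integral_ge0.
- by rewrite lee_fin exprn_ge0.
apply: eq_integral => t _; rewrite (IH a1)//; congr (_ * _)%E.
apply: eq_integral => v _; congr f; apply/rowP => i; rewrite !mxE.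
case: (splitP (i : 'I_(1 + n))) => j ij; rewrite !mxE.
  by rewrite /a0 (_ : i = ord0)//; apply/val_inj => /=; move: ij; rewrite (ord1 j).
by congr (a _ _ + _); exact/val_inj.
Qed.

End affine.

(** * Integrable and square integrable functions *)

Section integration_toolkit.
Context d (T : measurableType d) (R : realType).
Variable mu : {measure set T -> \bar R}.
Implicit Types f g h : T -> R.

Definition intble f := mu.-integrable setT (EFin \o f).
Definition L2 f := measurable_fun setT f /\ intble (fun x => f x ^+ 2).

Lemma intble_measurable f : intble f -> measurable_fun setT f.
Proof. by move=> /integrableP[/measurable_EFinP]. Qed.

Lemma intble_le f g : measurable_fun setT f -> intble g ->
  (forall x, `|f x| <= g x) -> intble f.
Proof.
move=> mf ig fg; apply: le_integrable ig => //; first exact/measurable_EFinP.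
by move=> x _; rewrite /= lee_fin (le_trans (fg x))// ler_norm.
Qed.

Lemma intbleD f g : intble f -> intble g -> intble (fun x => f x + g x).
Proof. by move=> fi gi; have := integrableD measurableT fi gi. Qed.

Lemma intbleB f g : intble f -> intble g -> intble (fun x => f x - g x).
Proof. by move=> fi gi; have := integrableB measurableT fi gi. Qed.

Lemma intbleZ c f : intble f -> intble (fun x => c * f x).
Proof. by move=> fi; have := integrableZl measurableT c fi. Qed.

Lemma intble_norm f : intble f -> intble (fun x => `|f x|).
Proof. by move=> fi; have := integrable_norm fi. Qed.

Lemma intble_ge0P f : measurable_fun setT f -> (forall x, 0 <= f x) ->
  intble f <-> (\int[mu]_x (f x)%:E < +oo)%E.
Proof.
move=> mf f0; split=> [/integrableP[_]|fi].
  by under eq_integral do rewrite /= ger0_norm//.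
apply/integrableP; split; first exact/measurable_EFinP.
by under eq_integral do rewrite /= ger0_norm//.
Qed.

Lemma intble_normP f : measurable_fun setT f ->
  intble f <-> (\int[mu]_x (`|f x|)%:E < +oo)%E.
Proof.
move=> mf; split=> [/integrableP[_]//|fi].
by apply/integrableP; split=> //; exact/measurable_EFinP.
Qed.

Lemma RintE f : intble f -> (\int[mu]_x f x)%:E = (\int[mu]_x (f x)%:E)%E.
Proof. by move=> fi; rewrite /Rintegral fineK//; exact: integrable_fin_num. Qed.

Lemma Rint_le f g : intble f -> intble g -> (forall x, f x <= g x) ->
  \int[mu]_x f x <= \int[mu]_x g x.
Proof. by move=> fi gi fg; apply: le_Rintegral => // x _. Qed.

Lemma Rint_norm_le f g : intble f -> intble g -> (forall x, `|f x| <= g x) ->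
  `|\int[mu]_x f x| <= \int[mu]_x g x.
Proof.
move=> fi gi fg; apply: le_trans (le_normr_Rintegral measurableT fi) _.
by apply: Rint_le => //; exact: intble_norm.
Qed.

Lemma RintD f g : intble f -> intble g ->
  \int[mu]_x (f x + g x) = \int[mu]_x f x + \int[mu]_x g x.
Proof. by move=> *; exact: RintegralD. Qed.

Lemma RintB f g : intble f -> intble g ->
  \int[mu]_x (f x - g x) = \int[mu]_x f x - \int[mu]_x g x.
Proof. by move=> *; exact: RintegralB. Qed.

Lemma RintZ c f : intble f -> \int[mu]_x (c * f x) = c * \int[mu]_x f x.
Proof. by move=> *; exact: RintegralZl. Qed.

Lemma RintZr c f : intble f -> \int[mu]_x (f x * c) = (\int[mu]_x f x) * c.
Proof. by move=> *; exact: RintegralZr. Qed.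

Lemma Rint_eq f g : f =1 g -> \int[mu]_x f x = \int[mu]_x g x.
Proof. by move=> fg; apply: eq_Rintegral => x _. Qed.

Lemma Rint_ge0 f : (forall x, 0 <= f x) -> 0 <= \int[mu]_x f x.
Proof. by move=> f0; apply: Rintegral_ge0 => x _. Qed.

Lemma Rint_ae_eq f g : measurable_fun setT f -> measurable_fun setT g ->
  {ae mu, forall x, f x = g x} -> \int[mu]_x f x = \int[mu]_x g x.
Proof.
move=> mf mg fg; congr fine; apply: ae_eq_integral => //; try exact/measurable_EFinP.
by apply: filterS fg => x /= -> _.
Qed.

Lemma L2M f g : L2 f -> L2 g -> intble (fun x => f x * g x).
Proof.
move=> [mf f2] [mg g2]; apply: (@intble_le _ (fun x => f x ^+ 2 + g x ^+ 2)).
- exact: measurable_funM.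
- exact: intbleD.
- move=> x; rewrite normrM -(real_normK (num_real (f x))) -(real_normK (num_real (g x))).
  have := sqr_ge0 (`|f x| - `|g x|); have := sqr_ge0 (`|f x| + `|g x|); nra.
Qed.

Lemma L2_norm f : L2 f -> L2 (fun x => `|f x|).
Proof.
move=> [mf f2]; split; first exact: measurableT_comp.
by rewrite (_ : (fun _ => _) = (fun x => f x ^+ 2))//; apply/funext => x; rewrite real_normK ?num_real.
Qed.

Lemma L2Z c f : L2 f -> L2 (fun x => c * f x).
Proof.
move=> [mf f2]; split; first exact: measurable_funM.
by under eq_fun do rewrite exprMn; exact: intbleZ.
Qed.

Lemma L2D f g : L2 f -> L2 g -> L2 (fun x => f x + g x).
Proof.
move=> Lf Lg; split; first exact: measurable_funD Lf.1 Lg.1.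
under eq_fun do rewrite sqrrD.
apply: intbleD; last exact: Lg.2.
apply: intbleD; first exact: Lf.2.
by under eq_fun do rewrite -mulr_natl; apply: intbleZ; exact: L2M.
Qed.

Lemma L2B f g : L2 f -> L2 g -> L2 (fun x => f x - g x).
Proof.
move=> Lf Lg; under eq_fun do rewrite -mulN1r.
by apply: L2D => //; exact: L2Z.
Qed.

Lemma cauchy_schwarz_norm f g : L2 f -> L2 g ->
  (\int[mu]_x `|f x * g x|) ^+ 2 <= (\int[mu]_x (f x ^+ 2)) * (\int[mu]_x (g x ^+ 2)).
Proof.
move=> Lf Lg; set A := (X in _ <= X * _); set B := (X in _ <= _ * X); set C := Rintegral _ _ _.
have iC := intble_norm (L2M Lf Lg).
(* The quadratic in [lam] is the integral of (lam |f| - |g|)^2. Its minimum at [C / A] gives the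
   claim; if A = 0 and C is not 0, the value (B + 1) / (2 C) would make it equal to -1. *)
have H lam : 0 <= lam ^+ 2 * A - 2 * lam * C + B.
  have -> : lam ^+ 2 * A - 2 * lam * C + B = \int[mu]_x ((lam * `|f x| - `|g x|) ^+ 2).
    rewrite /A /B /C -!RintZ//; last exact: Lf.2.
    rewrite -RintB; [|by apply: intbleZ; exact: Lf.2|exact: intbleZ].
    rewrite -RintD; [|by apply: intbleB; apply: intbleZ => //; exact: Lf.2|exact: Lg.2].
    apply: Rint_eq => x; rewrite normrM -(real_normK (num_real (f x))) -(real_normK (num_real (g x))).
    ring.
  by apply: Rint_ge0 => x; exact: sqr_ge0.
have A0 : 0 <= A by apply: Rint_ge0 => x; exact: sqr_ge0.
have B0 : 0 <= B by apply: Rint_ge0 => x; exact: sqr_ge0.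
have C0 : 0 <= C by exact: Rint_ge0.
have [Az|An] := eqVneq A 0.
  rewrite Az mul0r; have [->|Cn] := eqVneq C 0; first by rewrite expr0n.
  have := H ((B + 1) / (2 * C)); rewrite Az mulr0 add0r.
  by rewrite (_ : - _ + B = - 1); [rewrite oppr_ge0 ler10|field].
have Ap : 0 < A by rewrite lt_neqAle eq_sym An.
have := H (C / A).
rewrite (_ : _ - _ + B = (A * B - C ^+ 2) / A); last by field.
by rewrite pmulr_lge0 ?invr_gt0// subr_ge0.
Qed.

Lemma cauchy_schwarz f g : L2 f -> L2 g ->
  (\int[mu]_x (f x * g x)) ^+ 2 <= (\int[mu]_x (f x ^+ 2)) * (\int[mu]_x (g x ^+ 2)).
Proof.
move=> Lf Lg; apply: le_trans (cauchy_schwarz_norm Lf Lg).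
rewrite -(real_normK (num_real (\int[mu]_x (f x * g x)))) lerXn2r ?nnegrE ?Rint_ge0//.
exact: le_normr_Rintegral (L2M Lf Lg).
Qed.

End integration_toolkit.

(** * Fubini for real-valued integrals *)

Section real_fubini.
Context d1 d2 (T1 : measurableType d1) (T2 : measurableType d2) (R : realType).
Variables (m1 : {sigma_finite_measure set T1 -> \bar R})
          (m2 : {sigma_finite_measure set T2 -> \bar R}).
Variable F : T1 -> T2 -> R.
Hypothesis mF : measurable_fun setT (fun z => F z.1 z.2).

Lemma measurable_Rint : measurable_fun setT (fun x => \int[m2]_y F x y).
Proof.
apply: measurableT_comp; first exact: fine_measurable.
pose E (z : T1 * T2) := (F z.1 z.2)%:E.
have mE : measurable_fun setT E by exact/measurable_EFinP.
rewrite (_ : (fun _ => _) = (fun x => \int[m2]_y E^\+%E (x, y) - \int[m2]_y E^\-%E (x, y))%E).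
  apply: emeasurable_funB.
    by apply: (@measurable_ge0_integral _ _ T1 T2 R m2 (fun x y => E^\+%E (x, y))) => //; rewrite (_ : (fun z => _) = E^\+%E); [exact: measurable_funepos|apply/funext => -[]].
  by apply: (@measurable_ge0_integral _ _ T1 T2 R m2 (fun x y => E^\-%E (x, y))) => //; rewrite (_ : (fun z => _) = E^\-%E); [exact: measurable_funeneg|apply/funext => -[]].
by apply/funext => x; rewrite [LHS]integralE; congr (_ - _)%E; apply: eq_integral => y _; rewrite ?funeposE ?funenegE.
Qed.

Hypothesis iF : (\int[m1]_x \int[m2]_y (`|F x y|)%:E < +oo)%E.

Let iF12 : (m1 \x m2)%E.-integrable setT (fun z => (F z.1 z.2)%:E).
Proof. by apply/integrable12ltyP => //; exact/measurable_EFinP. Qed.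

Lemma ae_intble_fubini : {ae m1, forall x, intble m2 (F x)}.
Proof. exact: ae_integrable1 iF12. Qed.

Let Rint_ae : {ae m1, forall x, (\int[m2]_y F x y)%:E = (\int[m2]_y (F x y)%:E)%E}.
Proof. by apply: filterS ae_intble_fubini => x; exact: RintE. Qed.

Lemma intble_fubini : intble m1 (fun x => \int[m2]_y F x y).
Proof.
have H := integrable_fubini_F iF12.
apply/integrableP; split; first exact/measurable_EFinP/measurable_Rint.
have /integrableP[mH] := H; apply: le_lt_trans.
rewrite le_eqVlt; apply/orP; left; apply/eqP/ae_eq_integral => //.
- by apply: measurableT_comp => //; exact/measurable_EFinP/measurable_Rint.
- exact: measurableT_comp.
- by apply: filterS Rint_ae => x /= + _; rewrite /fubini_F => <-.
Qed.

End real_fubini.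

Lemma Rfubini d1 d2 (T1 : measurableType d1) (T2 : measurableType d2) (R : realType)
    (m1 : {sigma_finite_measure set T1 -> \bar R})
    (m2 : {sigma_finite_measure set T2 -> \bar R}) (F : T1 -> T2 -> R) :
  measurable_fun setT (fun z => F z.1 z.2) ->
  (\int[m1]_x \int[m2]_y (`|F x y|)%:E < +oo)%E ->
  \int[m1]_x \int[m2]_y F x y = \int[m2]_y \int[m1]_x F x y.
Proof.
move=> mF iF.
have mF' : measurable_fun setT (fun z => F z.2 z.1).
  exact: (measurableT_comp mF (measurable_fun_pair measurable_snd measurable_fst)).
have iF' : (\int[m2]_y \int[m1]_x (`|F x y|)%:E < +oo)%E.
  rewrite -(@tonelli _ _ _ _ _ m1 m2 (fun x y => (`|F x y|)%:E))//.
  by apply/measurable_EFinP; exact: measurableT_comp.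
apply: EFin_inj; rewrite (RintE (intble_fubini mF iF)) (RintE (intble_fubini mF' iF')).
have iF12 : (m1 \x m2)%E.-integrable setT (fun z => (F z.1 z.2)%:E).
  by apply/integrable12ltyP => //; exact/measurable_EFinP.
transitivity (\int[m1]_x \int[m2]_y (F x y)%:E)%E.
  apply: ae_eq_integral => //; first exact/measurable_EFinP/measurable_Rint.
    exact: (measurable_fubini_F iF12).
  by apply: filterS (ae_intble_fubini mF iF) => x /= h _; exact: RintE.
rewrite (Fubini iF12); apply: ae_eq_integral => //.
- exact: (measurable_fubini_G iF12).
- exact/measurable_EFinP/measurable_Rint.
- by apply: filterS (ae_intble_fubini mF' iF') => x /= h _; rewrite RintE.
Qed.

(** * Euclidean norm, Gaussians and convolution *)

Section gaussian.
Variables (R : realType) (n : nat).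
Local Notation V := 'rV[R]_n.
Local Notation mu := (lebesgue_rV R n).
Implicit Types (x y : V) (f k : V -> R).

Definition sqn m (y : 'rV[R]_m) : R := \sum_(i < m) y ord0 i ^+ 2.

Lemma sqn_ge0 m (y : 'rV[R]_m) : 0 <= sqn y.
Proof. by apply: sumr_ge0 => i _; exact: sqr_ge0. Qed.

Lemma sqnZ m c (y : 'rV[R]_m) : sqn (c *: y) = c ^+ 2 * sqn y.
Proof. by rewrite /sqn mulr_sumr; apply: eq_bigr => i _; rewrite mxE exprMn. Qed.

Lemma sqnN m (y : 'rV[R]_m) : sqn (- y) = sqn y.
Proof. by apply: eq_bigr => i _; rewrite mxE sqrrN. Qed.

Lemma sqn0 m : sqn (0 : 'rV[R]_m) = 0.
Proof. by apply: big1 => i _; rewrite mxE expr0n. Qed.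

Lemma sqn_parallelogram m (x y : 'rV[R]_m) : sqn (x + y) + sqn (x - y) = 2 * (sqn x + sqn y).
Proof.
rewrite /sqn -!big_split/= mulr_sumr; apply: eq_bigr => i _; rewrite !mxE; ring.
Qed.

Lemma sqnD_le m (x y : 'rV[R]_m) : sqn (x + y) <= 2 * (sqn x + sqn y).
Proof. by rewrite -sqn_parallelogram lerDl sqn_ge0. Qed.

Lemma measurable_sqn m : measurable_fun setT (@sqn m).
Proof. by apply: measurable_sum => i; apply: measurable_funX; exact: measurable_coord. Qed.

Lemma hr_enormE m (y : 'rV[R]_m) : hr_enorm y = Num.sqrt (sqn y). Proof. by []. Qed.

Lemma sqr_hr_enorm m (y : 'rV[R]_m) : hr_enorm y ^+ 2 = sqn y.
Proof. by rewrite sqr_sqrtr// sqn_ge0. Qed.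

Lemma hr_enorm_ge0 m (y : 'rV[R]_m) : 0 <= hr_enorm y.
Proof. exact: sqrtr_ge0. Qed.

Lemma hr_enormZ m c (y : 'rV[R]_m) : hr_enorm (c *: y) = `|c| * hr_enorm y.
Proof. by rewrite !hr_enormE sqnZ sqrtrM ?sqr_ge0// sqrtr_sqr. Qed.

Lemma hr_enormN m (y : 'rV[R]_m) : hr_enorm (- y) = hr_enorm y.
Proof. by rewrite !hr_enormE sqnN. Qed.

Lemma coord_le_hr_enorm m (y : 'rV[R]_m) i : `|y ord0 i| <= hr_enorm y.
Proof.
rewrite -(ler_sqr (normr_ge0 _) (hr_enorm_ge0 _)) sqr_hr_enorm real_normK ?num_real//.
by rewrite /sqn (bigD1 i)//= lerDl sumr_ge0// => j _; exact: sqr_ge0.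
Qed.

Lemma hr_enorm_lt m (y : 'rV[R]_m) r : 0 <= r -> (hr_enorm y < r) = (sqn y < r ^+ 2).
Proof. by move=> r0; rewrite -sqr_hr_enorm ltr_sqr ?nnegrE ?hr_enorm_ge0. Qed.

Lemma hr_enorm_le m (y : 'rV[R]_m) r : 0 <= r -> (hr_enorm y <= r) = (sqn y <= r ^+ 2).
Proof. by move=> r0; rewrite -sqr_hr_enorm ler_sqr ?nnegrE ?hr_enorm_ge0. Qed.

Definition dotp m (x y : 'rV[R]_m) := \sum_(i < m) x ord0 i * y ord0 i.

Lemma sqnD m (x y : 'rV[R]_m) : sqn (x + y) = sqn x + 2 * dotp x y + sqn y.
Proof.
rewrite /sqn /dotp mulr_sumr -!big_split/=; apply: eq_bigr => i _; rewrite !mxE; ring.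
Qed.

Lemma dotp_sqr_le m (x y : 'rV[R]_m) : dotp x y ^+ 2 <= sqn x * sqn y.
Proof.
have H lam : 0 <= lam ^+ 2 * sqn x + 2 * lam * dotp x y + sqn y.
  have := sqn_ge0 (lam *: x + y); rewrite sqnD sqnZ.
  rewrite (_ : dotp (lam *: x) y = lam * dotp x y); first by rewrite mulrA.
  by rewrite /dotp mulr_sumr; apply: eq_bigr => i _; rewrite mxE mulrA.
have A0 := sqn_ge0 x; have [Az|An] := eqVneq (sqn x) 0.
  rewrite Az mul0r; have [->|Cn] := eqVneq (dotp x y) 0; first by rewrite expr0n.
  have := H (- (sqn y + 1) / (2 * dotp x y)); rewrite Az mulr0 add0r.
  by rewrite (_ : _ + sqn y = - 1); [rewrite oppr_ge0 ler10|field].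
have Ap : 0 < sqn x by rewrite lt_neqAle eq_sym An.
have := H (- dotp x y / sqn x).
rewrite (_ : _ + sqn y = (sqn x * sqn y - dotp x y ^+ 2) / sqn x); last by field.
by rewrite pmulr_lge0 ?invr_gt0// subr_ge0.
Qed.

Lemma dotp_le m (x y : 'rV[R]_m) : `|dotp x y| <= hr_enorm x * hr_enorm y.
Proof.
rewrite -ler_sqr ?nnegrE ?mulr_ge0 ?hr_enorm_ge0//.
by rewrite real_normK ?num_real// exprMn !sqr_hr_enorm dotp_sqr_le.
Qed.

Lemma hr_enormD m (x y : 'rV[R]_m) : hr_enorm (x + y) <= hr_enorm x + hr_enorm y.
Proof.
rewrite -ler_sqr ?nnegrE ?addr_ge0 ?hr_enorm_ge0// sqr_hr_enorm sqnD sqrrD !sqr_hr_enorm.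
have := dotp_le x y; rewrite ler_norml => /andP[_]; lra.
Qed.

Lemma hr_enorm_distl m (x y : 'rV[R]_m) : `|hr_enorm x - hr_enorm y| <= hr_enorm (x - y).
Proof.
have := hr_enormD (x - y) y; have := hr_enormD (y - x) x.
rewrite !subrK -(opprB x y) hr_enormN ler_norml => h1 h2; apply/andP; split; lra.
Qed.

Lemma measurable_hr_enorm m : measurable_fun setT (@hr_enorm R m).
Proof.
have H : measurable_fun setT (Num.sqrt : R -> R).
  by apply: continuous_measurable_fun; exact: sqrt_continuous.
by have := measurableT_comp H (@measurable_sqn m).
Qed.

Lemma measurable_gauss m a : measurable_fun setT (fun y : 'rV[R]_m => expR (- (a * sqn y))).
Proof.
have H : measurable_fun setT (fun y : 'rV[R]_m => - (a * sqn y)).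
  by apply: measurable_funN; apply: measurable_funM => //; exact: measurable_sqn.
by have := measurableT_comp (@measurable_expR R) H.
Qed.

Lemma integral_gauss1 m :
  (\int[lebesgue_rV R m]_y (expR (- sqn y))%:E = (Num.sqrt pi ^+ m)%:E)%E.
Proof.
have mg (p : nat) : measurable_fun setT (fun y : 'rV[R]_p => (expR (- sqn y))%:E).
  apply/measurable_EFinP; have := @measurable_gauss p 1.
  by under eq_fun do rewrite mul1r.
elim: m => [|m IH].
  by rewrite -hr_iint_ge0//= /sqn big_ord0 oppr0 expR0 expr0.
rewrite lebesgue_rVS//.
transitivity (\int[@lebesgue_measure R]_t ((Num.sqrt pi ^+ m)%:E * (gauss_fun t)%:E))%E.
  apply: eq_integral => t _; rewrite -IH muleC -ge0_integralZl//; [|exact: mg|by rewrite lee_fin gauss_fun_ge0].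
  apply: eq_integral => v _; rewrite -EFinM /gauss_fun -expRD; congr (expR _)%:E.
  rewrite /sqn big_ord_recl -opprD; congr (- (_ + _)).
    by rewrite mxE; case: splitP => // j _; rewrite mxE.
  apply: eq_bigr => i _; rewrite mxE; case: splitP => [j|j ij].
    by move=> h; have := ltn_ord j; rewrite -h.
  by congr (v _ _ ^+ 2); apply/val_inj; move: ij => /= [].
rewrite ge0_integralZl ?lee_fin ?exprn_ge0 ?sqrtr_ge0//; last 2 first.
- by apply/measurable_EFinP; exact: measurable_gauss_fun.
- by move=> t _; rewrite lee_fin gauss_fun_ge0.
by rewrite integralT_gauss -EFinM exprSr.
Qed.

Lemma intble_affine (a : V) (c : R) f : c != 0 -> intble mu f -> intble mu (fun y => f (a + c *: y)).
Proof.
move=> c0 fi; have mf := intble_measurable fi.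
have mfa := measurableT_comp mf (@measurable_rV_affine R n a c).
apply/intble_normP => //; have /intble_normP-/(_ mf) := fi.
rewrite (ge0_integral_rV_affine a c0)//; last by apply/measurable_EFinP/measurableT_comp.
have cn : 0 < `|c| ^+ n by rewrite exprn_gt0// normr_gt0.
rewrite muleC; move=> h; rewrite ltey; apply/eqP => h'; move: h; rewrite h'.
by rewrite gt0_mulye ?lte_fin.
Qed.

Lemma Rint_affine (a : V) (c : R) f : c != 0 -> intble mu f ->
  \int[mu]_y f y = `|c| ^+ n * \int[mu]_y f (a + c *: y).
Proof.
move=> c0 fi; apply: EFin_inj; rewrite EFinM !RintE//; last exact: intble_affine.
have mf := intble_measurable fi.
have mE : measurable_fun setT (EFin \o f) by exact/measurable_EFinP.
have ma := @measurable_rV_affine R n a c.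
rewrite [LHS]integralE [in RHS]integralE.
rewrite (ge0_integral_rV_affine a c0 (measurable_funepos mE))//.
rewrite (ge0_integral_rV_affine a c0 (measurable_funeneg mE))//.
have -> : (\int[mu]_y (EFin \o f)^\+%E (a + c *: y)%R =
    \int[mu]_y (EFin \o (fun y => f (a + c *: y)%R))^\+%E y)%E.
  by apply: eq_integral => y _; rewrite !funeposE.
have -> : (\int[mu]_y (EFin \o f)^\-%E (a + c *: y)%R =
    \int[mu]_y (EFin \o (fun y => f (a + c *: y)%R))^\-%E y)%E.
  by apply: eq_integral => y _; rewrite !funenegE.
rewrite -muleBr//; apply: fin_num_adde_defr.
by apply: integrable_pos_fin_num => //; exact: intble_affine.
Qed.

End gaussian.

(** Convolutions, kernels and energies are locked with this key, so that they are opened only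
    through their defining equations. *)
Fact hr_key : unit. Proof. exact: tt. Qed.

Section rapid.
Variables (R : realType) (n : nat).
Local Notation V := 'rV[R]_n.
Local Notation mu := (lebesgue_rV R n).
Implicit Types (f h k : V -> R).

(** The mass pi^(n/2) of [H 0 t], the same for all [t]. The kernels are not normalised, so each
    composition of two of them produces this factor. *)
Definition gam : R := locked_with hr_key (Num.sqrt pi ^+ n).

Lemma gamE : gam = Num.sqrt pi ^+ n. Proof. by rewrite /gam unlock. Qed.

Lemma gam_gt0 : 0 < gam.
Proof. by rewrite gamE exprn_gt0// sqrtr_gt0 pi_gt0. Qed.

Lemma intble_gauss a : 0 < a -> intble mu (fun y => expR (- (a * sqn y))).
Proof.
move=> a0; have i1 : intble mu (fun y => expR (- sqn y)).
  apply/intble_ge0P => [|x|]; last by rewrite integral_gauss1 ltry.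
    by have := @measurable_gauss R n 1; under eq_fun do rewrite mul1r.
  exact: expR_ge0.
have sa : Num.sqrt a != 0 by rewrite sqrtr_eq0 -ltNge.
have := intble_affine 0 sa i1; congr intble; apply/funext => y.
by rewrite add0r sqnZ sqr_sqrtr// ltW.
Qed.

Lemma Rint_gauss t : 0 < t -> \int[mu]_y expR (- (sqn y / t)) = Num.sqrt t ^+ n * gam.
Proof.
rewrite gamE.
move=> t0; have i1 : intble mu (fun y => expR (- sqn y)).
  by have := intble_gauss ltr01; under eq_fun do rewrite mul1r.
have ti : intble mu (fun y => expR (- (sqn y / t))).
  have := @intble_gauss t^-1; rewrite invr_gt0 => /(_ t0).
  by under eq_fun do rewrite mulrC.
have st : 0 < Num.sqrt t by rewrite sqrtr_gt0.
rewrite (Rint_affine 0 (lt0r_neq0 st) ti) gtr0_norm//; congr (_ * _).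
apply: EFin_inj; rewrite -integral_gauss1 -RintE//; congr (_ %:E).
by apply: Rint_eq => y; rewrite add0r sqnZ sqr_sqrtr ?ltW// mulrAC divff ?mul1r// lt0r_neq0.
Qed.

(** Gaussian domination covers the heat kernels as well as cutoffs supported in a ball, and makes
    every convolution with an L2 function absolutely convergent. *)
Definition rapid k := measurable_fun setT k /\
  exists C a, [/\ 0 <= C, 0 < a & forall y, `|k y| <= C * expR (- (a * sqn y))].

Lemma rapid_intble k : rapid k -> intble mu k.
Proof.
move=> [mk [C [a [C0 a0 kC]]]]; apply: intble_le mk _ kC.
by apply: intbleZ; exact: intble_gauss.
Qed.

Lemma rapid_measurable k : rapid k -> measurable_fun setT k.
Proof. by case. Qed.

Lemma rapid_bounded k : rapid k -> exists2 C, 0 <= C & forall y, `|k y| <= C.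
Proof.
move=> [mk [C [a [C0 a0 kC]]]]; exists C => // y; apply: le_trans (kC y) _.
by rewrite ler_piMr// -expR0 ler_expR oppr_le0 mulr_ge0 ?sqn_ge0// ltW.
Qed.

Lemma rapid_norm k : rapid k -> rapid (fun y => `|k y|).
Proof.
move=> [mk [C [a [C0 a0 kC]]]]; split; first exact: measurableT_comp.
by exists C, a; split=> // y; rewrite normr_id.
Qed.

Lemma rapid_le f k : measurable_fun setT f -> rapid k ->
  (forall y, `|f y| <= `|k y|) -> rapid f.
Proof.
move=> mf [mk [C [a [C0 a0 kC]]]] fk; split=> //; exists C, a; split=> // y.
exact: le_trans (fk y) (kC y).
Qed.

Lemma rapidM_bounded f k (M : R) : measurable_fun setT f -> (forall y, `|f y| <= M) -> rapid k ->
  rapid (fun y => f y * k y).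
Proof.
move=> mf fM [mk [C [a [C0 a0 kC]]]]; split; first exact: measurable_funM.
have M0 : 0 <= M by exact: le_trans (fM 0).
exists (M * C), a; split=> //; first exact: mulr_ge0.
by move=> y; rewrite normrM -mulrA ler_pM.
Qed.

Lemma rapidM k1 k2 : rapid k1 -> rapid k2 -> rapid (fun y => k1 y * k2 y).
Proof.
move=> r1 r2; have [M _ hM] := rapid_bounded r1.
by apply: (rapidM_bounded (M := M)) => //; exact: rapid_measurable.
Qed.

Lemma rapidZ c k : rapid k -> rapid (fun y => c * k y).
Proof. by move=> rk; apply: (rapidM_bounded (M := `|c|)). Qed.

Lemma rapidD k1 k2 : rapid k1 -> rapid k2 -> rapid (fun y => k1 y + k2 y).
Proof.
move=> [m1 [C1 [a1 [C10 a10 h1]]]] [m2 [C2 [a2 [C20 a20 h2]]]].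
split; first exact: measurable_funD.
exists (C1 + C2), (Num.min a1 a2); split; first exact: addr_ge0.
  by rewrite lt_min a10.
move=> y; apply: le_trans (ler_normD _ _) _; rewrite mulrDl lerD//.
  apply: le_trans (h1 y) _; rewrite ler_wpM2l// ler_expR lerN2 ler_wpM2r ?sqn_ge0//.
  by rewrite ge_min lexx.
apply: le_trans (h2 y) _; rewrite ler_wpM2l// ler_expR lerN2 ler_wpM2r ?sqn_ge0//.
by rewrite ge_min lexx orbT.
Qed.

Lemma rapid_L2 k : rapid k -> L2 mu k.
Proof.
move=> rk; split; first exact: rapid_measurable.
by under eq_fun do rewrite expr2; apply: rapid_intble; exact: rapidM.
Qed.

Lemma N1_neq0 : (-1 : R) != 0. Proof. by rewrite oppr_eq0 oner_eq0. Qed.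

Lemma intble_subl f x : intble mu f -> intble mu (fun y => f (x - y)).
Proof.
move=> fi; have := intble_affine x N1_neq0 fi.
by congr intble; apply/funext => y; rewrite scaleN1r.
Qed.

Lemma intble_subr f y : intble mu f -> intble mu (fun x => f (x - y)).
Proof.
move=> fi; have := intble_affine (- y) (oner_neq0 R) fi.
by congr intble; apply/funext => x; rewrite scale1r addrC.
Qed.

Lemma Rint_subl f x : intble mu f -> \int[mu]_y f (x - y) = \int[mu]_y f y.
Proof.
move=> fi; rewrite [RHS](Rint_affine x N1_neq0 fi) normrN1 expr1n mul1r.
by apply: Rint_eq => y; rewrite scaleN1r.
Qed.

Lemma Rint_subr f y : intble mu f -> \int[mu]_x f (x - y) = \int[mu]_x f x.
Proof.
move=> fi; rewrite [RHS](Rint_affine (- y) (oner_neq0 R) fi) normr1 expr1n mul1r.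
by apply: Rint_eq => x; rewrite scale1r addrC.
Qed.

Lemma Rint_opp f : intble mu f -> \int[mu]_y f (- y) = \int[mu]_y f y.
Proof.
by move=> fi; rewrite -(Rint_subl 0 fi); apply: Rint_eq => y; rewrite sub0r.
Qed.

Lemma measurable_subl x : measurable_fun setT (fun y : V => x - y).
Proof. exact: measurable_rVB. Qed.

Lemma measurable_subr y : measurable_fun setT (fun x : V => x - y).
Proof. exact: measurable_rVB. Qed.

Lemma L2_subl f x : L2 mu f -> L2 mu (fun y => f (x - y)).
Proof.
move=> [mf f2]; split; first exact: measurableT_comp mf (measurable_subl x).
exact: (intble_subl x f2).
Qed.

Lemma L2_subr f y : L2 mu f -> L2 mu (fun x => f (x - y)).
Proof.
move=> [mf f2]; split; first exact: measurableT_comp mf (measurable_subr y).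
exact: (intble_subr y f2).
Qed.

Definition conv (k f : V -> R) (x : V) : R :=
  locked_with hr_key (fun k f x => \int[mu]_y (k (x - y) * f y)) k f x.

Lemma convE k f x : conv k f x = \int[mu]_y (k (x - y) * f y).
Proof. by rewrite /conv unlock. Qed.

Lemma conv_funE k f : conv k f = fun x => \int[mu]_y (k (x - y) * f y).
Proof. by apply/funext => x; exact: convE. Qed.

Lemma measurable_sub2 : measurable_fun setT (fun z : V * V => z.1 - z.2).
Proof. exact: measurable_rVB. Qed.

Lemma measurable_conv k f : measurable_fun setT k -> measurable_fun setT f ->
  measurable_fun setT (conv k f).
Proof.
move=> mk mf; rewrite conv_funE; apply: (@measurable_Rint _ _ _ _ _ mu (fun x y : V => k (x - y) * f y)).
apply: measurable_funM; first exact: measurableT_comp mk measurable_sub2.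
exact: measurableT_comp mf measurable_snd.
Qed.

Lemma intble_conv k f x : L2 mu k -> L2 mu f -> intble mu (fun y => k (x - y) * f y).
Proof. by move=> Lk Lf; apply: L2M => //; exact: L2_subl. Qed.

Lemma conv_swap k f x : L2 mu k -> L2 mu f -> conv k f x = \int[mu]_y (k y * f (x - y)).
Proof.
move=> Lk Lf; rewrite convE -(Rint_subl x); last first.
  by apply: L2M => //; exact: L2_subl.
by apply: Rint_eq => y; rewrite subKr.
Qed.

Lemma conv_norm_bound k f x : L2 mu k -> L2 mu f ->
  conv k f x ^+ 2 <= (\int[mu]_y (k y ^+ 2)) * (\int[mu]_y (f y ^+ 2)).
Proof.
move=> Lk Lf; rewrite convE; apply: le_trans (cauchy_schwarz (L2_subl x Lk) Lf) _.
by rewrite (Rint_subl x Lk.2).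
Qed.

(** * Young's inequality for an integrable kernel *)

Section young.
Variables (k f : V -> R) (K : R).
Hypotheses (ik : intble mu k) (K0 : 0 < K) (kK : \int[mu]_y `|k y| <= K) (Lf : L2 mu f).

Let mk := intble_measurable ik.

Let mkf2 : measurable_fun setT (fun z : V * V => `|k (z.1 - z.2)| * f z.2 ^+ 2).
Proof.
apply: measurable_funM.
  by apply: measurableT_comp => //; exact: measurableT_comp mk measurable_sub2.
by apply: measurable_funX; exact: measurableT_comp Lf.1 measurable_snd.
Qed.

(** Cauchy-Schwarz for the weight |k(x - y)|, split as sqrt |k| times sqrt |k| f. Points where the
    right-hand side is infinite are discarded first. *)
Let pointwise x :
  ((conv k f x ^+ 2)%:E <= K%:E * \int[mu]_y (`|k (x - y)| * f y ^+ 2)%:E)%E.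
Proof.
have mx : measurable_fun setT (fun y : V => `|k (x - y)| * f y ^+ 2).
  apply: measurable_funM; last exact: measurable_funX Lf.1.
  by apply: measurableT_comp => //; exact: measurableT_comp mk (measurable_subl x).
have p0 y : 0 <= `|k (x - y)| * f y ^+ 2 by rewrite mulr_ge0 ?sqr_ge0.
have [foo|] := ltP (\int[mu]_y (`|k (x - y)| * f y ^+ 2)%:E)%E +oo%E; last first.
  by rewrite leye_eq => /eqP ->; rewrite gt0_muley ?lte_fin// leey.
have i2 : intble mu (fun y => `|k (x - y)| * f y ^+ 2) by apply/intble_ge0P.
rewrite -RintE// -EFinM lee_fin.
have ikx := intble_norm (intble_subl x ik).
have msq : measurable_fun setT (fun y : V => Num.sqrt `|k (x - y)|).
  have H : measurable_fun setT (Num.sqrt : R -> R).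
    by apply: continuous_measurable_fun; exact: sqrt_continuous.
  by have := measurableT_comp H (intble_measurable ikx).
have La : L2 mu (fun y => Num.sqrt `|k (x - y)|).
  by split=> //; under eq_fun do rewrite sqr_sqrtr//.
have Lb : L2 mu (fun y => Num.sqrt `|k (x - y)| * f y).
  split; first exact: measurable_funM msq Lf.1.
  by under eq_fun do rewrite exprMn sqr_sqrtr//.
have := cauchy_schwarz_norm La Lb.
have -> : \int[mu]_y (Num.sqrt `|k (x - y)| ^+ 2) = \int[mu]_y `|k y|.
  rewrite -(Rint_subl x (intble_norm ik)).
  by apply: Rint_eq => y; rewrite sqr_sqrtr.
have -> : \int[mu]_y ((Num.sqrt `|k (x - y)| * f y) ^+ 2) =
          \int[mu]_y (`|k (x - y)| * f y ^+ 2).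
  by apply: Rint_eq => y; rewrite exprMn sqr_sqrtr.
have E y : Num.sqrt `|k (x - y)| * (Num.sqrt `|k (x - y)| * f y) = `|k (x - y)| * f y.
  by rewrite mulrA -expr2 sqr_sqrtr.
have -> : \int[mu]_y `|Num.sqrt `|k (x - y)| * (Num.sqrt `|k (x - y)| * f y)| =
          \int[mu]_y `|k (x - y) * f y|.
  by apply: Rint_eq => y; rewrite E !normrM normr_id.
have ikf : intble mu (fun y => k (x - y) * f y).
  have i3 := intble_norm (L2M La Lb); apply: intble_le i3 _ => [|y].
    by apply: measurable_funM Lf.1; exact: measurableT_comp mk (measurable_subl x).
  by rewrite E !normrM normr_id.
move=> h; apply: (@le_trans _ _ ((\int[mu]_y `|k (x - y) * f y|) ^+ 2)).
  rewrite convE -(real_normK (num_real (\int[mu]_y _))) lerXn2r ?nnegrE ?Rint_ge0//.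
  exact: le_normr_Rintegral ikf.
apply: le_trans h _; apply: ler_wpM2r => //.
by apply: Rint_ge0.
Qed.

Let dbl : (\int[mu]_x \int[mu]_y (`|k (x - y)| * f y ^+ 2)%:E =
  ((\int[mu]_y `|k y|) * \int[mu]_y (f y ^+ 2))%:E)%E.
Proof.
rewrite tonelli; last 2 first.
- exact/measurable_EFinP.
- by move=> x y; rewrite lee_fin mulr_ge0 ?sqr_ge0.
rewrite EFinM (RintE Lf.2) -ge0_integralZl//; last 3 first.
- by apply/measurable_EFinP; apply: measurable_funX Lf.1.
- by move=> y _; rewrite lee_fin sqr_ge0.
- by rewrite lee_fin Rint_ge0.
apply: eq_integral => y _.
have H := intble_norm (intble_subr y ik).
under eq_integral do rewrite EFinM.
rewrite ge0_integralZr//; last 2 first.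
- by apply/measurable_EFinP; exact: intble_measurable H.
- by rewrite lee_fin sqr_ge0.
by rewrite -RintE// (Rint_subr y (intble_norm ik)).
Qed.

Let bound : (\int[mu]_x (conv k f x ^+ 2)%:E <= (K ^+ 2 * \int[mu]_y (f y ^+ 2))%:E)%E.
Proof.
apply: (@le_trans _ _ (\int[mu]_x (K%:E * \int[mu]_y (`|k (x - y)| * f y ^+ 2)%:E))%E).
  apply: ge0_le_integral => //.
  - by move=> x _; rewrite lee_fin sqr_ge0.
  - by apply/measurable_EFinP; apply: measurable_funX; exact: measurable_conv Lf.1.
  - apply: measurable_funeM; apply: (@measurable_ge0_integral _ _ _ _ _ mu (fun x y : V => (`|k (x - y)| * f y ^+ 2)%:E)).
      exact/measurable_EFinP.
    by move=> x y; rewrite lee_fin mulr_ge0 ?sqr_ge0.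
rewrite ge0_integralZl//; last 3 first.
- apply: (@measurable_ge0_integral _ _ _ _ _ mu (fun x y : V => (`|k (x - y)| * f y ^+ 2)%:E)).
    exact/measurable_EFinP.
  by move=> x y; rewrite lee_fin mulr_ge0 ?sqr_ge0.
- by move=> x _; apply: integral_ge0 => y _; rewrite lee_fin mulr_ge0 ?sqr_ge0.
- by rewrite lee_fin ltW.
rewrite dbl -EFinM lee_fin mulrA expr2 ler_wpM2r//.
  by apply: Rint_ge0 => y; exact: sqr_ge0.
by rewrite ler_wpM2l// ltW.
Qed.

Lemma young_L2 : L2 mu (conv k f).
Proof.
have mc : measurable_fun setT (conv k f) by exact: measurable_conv Lf.1.
split=> //; apply/intble_ge0P => [|x|]; [exact: measurable_funX|exact: sqr_ge0|].
exact: le_lt_trans bound (ltry _).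
Qed.

Lemma young : \int[mu]_x (conv k f x ^+ 2) <= K ^+ 2 * \int[mu]_y (f y ^+ 2).
Proof. by rewrite -lee_fin (RintE young_L2.2). Qed.

End young.

Lemma conv_L2 k f : rapid k -> L2 mu f -> L2 mu (conv k f).
Proof.
move=> rk Lf; apply: (@young_L2 _ _ (\int[mu]_y `|k y| + 1)) => //.
- exact: rapid_intble.
- by rewrite ltr_wpDl// Rint_ge0.
- by rewrite lerDl.
Qed.

Lemma conv_adjoint k f h : rapid k -> L2 mu f -> L2 mu h ->
  \int[mu]_x (h x * conv k f x) = \int[mu]_y (f y * \int[mu]_x (k (x - y) * h x)).
Proof.
move=> rk Lf Lh; have Lk := rapid_L2 rk; have ik := rapid_intble rk.
have mk := rapid_measurable rk.
pose F (x y : V) := h x * (k (x - y) * f y).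
have mF : measurable_fun setT (fun z : V * V => F z.1 z.2).
  apply: measurable_funM; first exact: measurableT_comp Lh.1 measurable_fst.
  apply: measurable_funM; first exact: measurableT_comp mk measurable_sub2.
  exact: measurableT_comp Lf.1 measurable_snd.
transitivity (\int[mu]_x \int[mu]_y F x y).
  by apply: Rint_eq => x; rewrite convE -RintZ//; exact: intble_conv.
rewrite Rfubini//.
  apply: Rint_eq => y; rewrite -RintZ; last by apply: L2M Lh; exact: L2_subr.
  by apply: Rint_eq => x; rewrite /F; ring.
have mk2 : measurable_fun setT (fun z : V * V => `|k (z.1 - z.2)|).
  by apply: measurableT_comp => //; exact: measurableT_comp mk measurable_sub2.
have mA : measurable_fun setT (fun z : V * V => (`|k (z.1 - z.2)| * h z.1 ^+ 2)%:E).
  apply/measurable_EFinP; apply: measurable_funM => //; apply: measurable_funX.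
  exact: measurableT_comp Lh.1 measurable_fst.
have mB : measurable_fun setT (fun z : V * V => (`|k (z.1 - z.2)| * f z.2 ^+ 2)%:E).
  apply/measurable_EFinP; apply: measurable_funM => //; apply: measurable_funX.
  exact: measurableT_comp Lf.1 measurable_snd.
have A0 x y : (0 <= (`|k (x - y)| * h x ^+ 2)%:E)%E by rewrite lee_fin mulr_ge0 ?sqr_ge0.
have B0 x y : (0 <= (`|k (x - y)| * f y ^+ 2)%:E)%E by rewrite lee_fin mulr_ge0 ?sqr_ge0.
have mA' x := measurable_fun_pair2 x mA.
have mB' x := measurable_fun_pair2 x mB.
have mF' x := measurable_fun_pair2 x mF.
(* The integrand is at most |k(x - y)| (h(x)^2 + f(y)^2), and each summand has a finite double
   integral because [k] is integrable. *)
apply: (@le_lt_trans _ _ (\int[mu]_x (\int[mu]_y (`|k (x - y)| * h x ^+ 2)%:E +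
    \int[mu]_y (`|k (x - y)| * f y ^+ 2)%:E))%E).
  apply: ge0_le_integral => //.
  - by move=> x _; exact: integral_ge0.
  - apply: (@measurable_ge0_integral _ _ _ _ _ mu (fun x y : V => `|F x y|%:E)) => //.
    by apply/measurable_EFinP; exact: measurableT_comp.
  - by apply: emeasurable_funD; apply: measurable_ge0_integral.
  - move=> x _; rewrite -ge0_integralD//; [|exact: mA'|exact: mB'].
    apply: ge0_le_integral => //.
    + apply/measurable_EFinP; apply: measurableT_comp => //.
      exact: mF'.
    + by apply: emeasurable_funD; [exact: mA'|exact: mB'].
    + move=> y _; rewrite -EFinD lee_fin /F !normrM -mulrDr mulrCA ler_wpM2l//.
      rewrite -(real_normK (num_real (h x))) -(real_normK (num_real (f y))).
      have := normr_ge0 (h x); have := normr_ge0 (f y); nra.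
rewrite ge0_integralD//; try by move=> x _; exact: integral_ge0.
  - rewrite [X in (_ + X)%E]tonelli//.
    have E1 (g : V -> R) : L2 mu g -> (\int[mu]_x \int[mu]_y (`|k (x - y)| * g x ^+ 2)%:E < +oo)%E.
      move=> Lg; under eq_integral => x _.
        under eq_integral do rewrite mulrC EFinM.
        rewrite ge0_integralZl//; [|by apply/measurable_EFinP; exact: intble_measurable (intble_norm (intble_subl x ik))|by rewrite lee_fin sqr_ge0].
        rewrite -RintE; last exact: intble_norm (intble_subl x ik).
        rewrite (Rint_subl x (intble_norm ik)) muleC.
        over.
      rewrite ge0_integralZl//; last 3 first.
      + by apply/measurable_EFinP; exact: measurable_funX Lg.1.
      + by move=> x _; rewrite lee_fin sqr_ge0.
      + by rewrite lee_fin Rint_ge0.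
      by rewrite -(RintE Lg.2) -EFinM ltry.
    rewrite lte_add_pinfty//; first exact: E1.
    under eq_integral => y _.
      under eq_integral do rewrite mulrC EFinM.
      rewrite ge0_integralZl//; [|by apply/measurable_EFinP; exact: intble_measurable (intble_norm (intble_subr y ik))|by rewrite lee_fin sqr_ge0].
      rewrite -RintE; last exact: intble_norm (intble_subr y ik).
      rewrite (Rint_subr y (intble_norm ik)) muleC.
      over.
    rewrite ge0_integralZl//; last 3 first.
    + by apply/measurable_EFinP; exact: measurable_funX Lf.1.
    + by move=> x _; rewrite lee_fin sqr_ge0.
    + by rewrite lee_fin Rint_ge0.
    by rewrite -(RintE Lf.2) -EFinM ltry.
  - by apply: measurable_ge0_integral.
  - by apply: measurable_ge0_integral.
Qed.

(** This is [conv_adjoint] with the translate of [k1] as test function. *)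
Lemma conv_assoc k1 k2 f x : rapid k1 -> rapid k2 -> L2 mu f ->
  conv k1 (conv k2 f) x = conv (conv k1 k2) f x.
Proof.
move=> r1 r2 Lf; rewrite [LHS]convE.
rewrite (conv_adjoint r2 Lf (L2_subl x (rapid_L2 r1))).
rewrite [RHS]convE; apply: Rint_eq => y; rewrite mulrC; congr (_ * _).
have i12 : intble mu (fun w => k1 (x - y - w) * k2 w).
  by apply: L2M (rapid_L2 r2); exact: L2_subl (rapid_L2 r1).
rewrite convE -(Rint_subr y i12); apply: Rint_eq => z.
by rewrite mulrC; congr (k1 _ * _); rewrite opprB addrA subrK.
Qed.

End rapid.

(** * Iterated integrals and balls *)

Section hr_iint_integral.
Variable R : realType.
Local Notation leb := (@lebesgue_measure R).

Lemma measurable_integral_slice d1 d2 (T1 : measurableType d1) (T2 : measurableType d2)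
    (m2 : {sigma_finite_measure set T2 -> \bar R}) (E : T1 * T2 -> \bar R) :
  measurable_fun setT E -> measurable_fun setT (fun x => \int[m2]_y E (x, y))%E.
Proof.
move=> mE.
rewrite (_ : (fun _ => _) = (fun x => \int[m2]_y E^\+%E (x, y) - \int[m2]_y E^\-%E (x, y))%E).
  apply: emeasurable_funB.
    by apply: (@measurable_ge0_integral _ _ T1 T2 R m2 (fun x y => E^\+%E (x, y))) => //; rewrite (_ : (fun z => _) = E^\+%E); [exact: measurable_funepos|apply/funext => -[]].
  by apply: (@measurable_ge0_integral _ _ T1 T2 R m2 (fun x y => E^\-%E (x, y))) => //; rewrite (_ : (fun z => _) = E^\-%E); [exact: measurable_funeneg|apply/funext => -[]].
by apply/funext => x; rewrite [LHS]integralE; congr (_ - _)%E; apply: eq_integral => y _; rewrite ?funeposE ?funenegE.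
Qed.

(** The parameter space is arbitrary so that, in the induction, the outer variable of integration
    can be absorbed into it. *)
Lemma measurable_hr_iint d (T : measurableType d) n (g : T * 'rV[R]_n -> \bar R) :
  measurable_fun setT g -> measurable_fun setT (fun s => hr_iint (fun v => g (s, v))).
Proof.
elim: n d T g => [|n IH] d T g mg /=; first exact: measurable_fun_pair1.
pose h (z : (T * measurableTypeR R) * 'rV[R]_n) : \bar R :=
  g (z.1.1, @row_mx R 1 1 n (\row_(_ < 1) z.1.2) z.2).
have mh : measurable_fun setT h.
  apply: (measurableT_comp mg); apply: measurable_fun_pair => /=.
    exact: (measurableT_comp measurable_fst measurable_fst).
  have m1 : measurable_fun setT (fun z : (T * measurableTypeR R) * 'rV[R]_n => (z.1.2, z.2)).
    apply: measurable_fun_pair => /=; last exact: measurable_snd.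
    exact: (measurableT_comp measurable_snd measurable_fst).
  by have H := measurableT_comp (@measurable_rVcons R n) m1; exact H.
have := @measurable_integral_slice _ _ T (measurableTypeR R) leb _ (IH _ _ h mh).
by [].
Qed.

(** Almost every slice of an integrable function is integrable, which is enough to use the induction
    hypothesis under the outer integral. *)
Lemma hr_iint_integrable n (f : 'rV[R]_n -> \bar R) :
  (lebesgue_rV R n).-integrable setT f -> hr_iint f = (\int[lebesgue_rV R n]_y f y)%E.
Proof.
elim: n f => [|n IH] f fi.
  have mf := measurable_int _ fi.
  by rewrite /= integral_dirac// diracT mul1e.
have mf := measurable_int _ fi.
pose cons (z : measurableTypeR R * 'rV[R]_n) : 'rV[R]_n.+1 :=
  @row_mx R 1 1 n (\row_(_ < 1) z.1) z.2.
have mcons : measurable_fun setT cons by exact: measurable_rVcons.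
have mfc : measurable_fun setT (f \o cons) by exact: measurableT_comp mf mcons.
have E1 : (\int[lebesgue_rV R n.+1]_y f y =
  \int[pushforward (leb \x lebesgue_rV R n)%E cons]_y f y)%E by exact: eq_measure_integral.
have fci : (leb \x lebesgue_rV R n)%E.-integrable setT (f \o cons).
  apply/integrableP; split=> //; have /integrableP[_] := fi; apply: le_lt_trans.
  rewrite le_eqVlt; apply/orP; left; apply/eqP.
  have mA : measurable_fun setT (fun y => `|f y|%E) by exact: measurableT_comp.
  have H := ge0_integral_pushforward mcons (leb \x lebesgue_rV R n)%E
    measurableT mA (fun y _ => abse_ge0 _).
  rewrite preimage_setT in H; rewrite -[LHS]H; exact: eq_measure_integral.
rewrite E1 (integral_pushforward mcons)// preimage_setT.
rewrite -integral12_prod_meas1//=; apply: ae_eq_integral => //.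
- exact: (@measurable_hr_iint _ (measurableTypeR R) n (f \o cons)).
- exact: measurable_integral_slice.
- have := ae_integrable1 fci; apply: filterS => t ti _ /=.
  by rewrite IH.
Qed.

Lemma hr_iint_intble n (f : 'rV[R]_n -> R) : intble (lebesgue_rV R n) f ->
  hr_iint (fun y => (f y)%:E) = (\int[lebesgue_rV R n]_y f y)%:E.
Proof. by move=> fi; rewrite RintE//; exact: hr_iint_integrable. Qed.

End hr_iint_integral.

Section balls.
Variables (R : realType) (n : nat).
Local Notation V := 'rV[R]_n.
Local Notation mu := (lebesgue_rV R n).

Lemma measurable_hr_lt (r : R) : measurable [set y : V | hr_enorm y < r].
Proof.
have := @measurable_hr_enorm R n measurableT `]-oo, r[%classic (measurable_itv _).
by rewrite setTI; congr measurable; apply/seteqP; split => y /=; rewrite in_itv.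
Qed.

Definition ind (P : bool) : R := if P then 1 else 0.

Lemma ind_ge0 P : 0 <= ind P. Proof. by case: P. Qed.
Lemma ind_le1 P : ind P <= 1. Proof. by case: P. Qed.
Lemma ind_norm P : `|ind P| = ind P. Proof. by rewrite ger0_norm// ind_ge0. Qed.

Lemma measurable_ind d (T : measurableType d) (P : T -> bool) :
  measurable_fun setT P -> measurable_fun setT (fun x => ind (P x)).
Proof. by move=> mP; apply: measurable_fun_if => //; exact: measurable_funS mP. Qed.

Lemma measurable_ind_lt d (T : measurableType d) (f g : T -> R) :
  measurable_fun setT f -> measurable_fun setT g ->
  measurable_fun setT (fun x => ind (f x < g x)).
Proof. by move=> mf mg; apply: measurable_ind; exact: measurable_fun_ltr. Qed.

Lemma measurable_ind_le d (T : measurableType d) (f g : T -> R) :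
  measurable_fun setT f -> measurable_fun setT g ->
  measurable_fun setT (fun x => ind (f x <= g x)).
Proof. by move=> mf mg; apply: measurable_ind; exact: measurable_fun_ler. Qed.

Lemma rapid_ball r : rapid (fun y : V => ind (hr_enorm y <= r)).
Proof.
split; first by apply: measurable_ind_le => //; exact: measurable_hr_enorm.
(* e^(r^2 - |y|^2) is at least 1 on the ball. *)
exists (expR (r ^+ 2)), 1; split=> [|//|y]; first exact: expR_ge0.
rewrite ind_norm /ind -expRD mul1r; case: ifPn => [h|_]; last exact: expR_ge0.
have r0 : 0 <= r by exact: le_trans (hr_enorm_ge0 _) h.
by rewrite -expR0 ler_expR subr_ge0 -hr_enorm_le.
Qed.

Lemma rapid_oball r : rapid (fun y : V => ind (hr_enorm y < r)).
Proof.
apply: rapid_le (rapid_ball r) _ => [|y].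
  by apply: measurable_ind_lt => //; exact: measurable_hr_enorm.
by rewrite !ind_norm /ind; case: (ltP (hr_enorm y) r) => [h|h]; [rewrite (ltW h)|case: ifP].
Qed.

Definition omega : R := \int[mu]_y ind (hr_enorm y < 1).

Lemma Rint_ball r : 0 < r -> \int[mu]_y ind (hr_enorm y < r) = omega * r ^+ n.
Proof.
move=> r0; have rn := lt0r_neq0 r0.
rewrite (Rint_affine 0 rn (rapid_intble (rapid_oball r))) gtr0_norm// mulrC; congr (_ * _).
apply: Rint_eq => y; rewrite add0r hr_enormZ gtr0_norm//.
by rewrite -ltr_pdivlMl// mulVf.
Qed.

Lemma omega_ge0 : 0 <= omega.
Proof. by apply: Rint_ge0 => y; exact: ind_ge0. Qed.

(** If the unit ball were null, so would be its dilates and hence the whole space, against the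
    positive Gaussian integral. *)
Lemma omega_gt0 : 0 < omega.
Proof.
rewrite lt_neqAle omega_ge0 andbT; apply/eqP => /esym w0.
have B0 k : mu [set y | hr_enorm y < k.+1%:R] = 0%E.
  have := integral_indic mu measurableT (measurable_hr_lt k.+1%:R); rewrite setIT => <-.
  transitivity (\int[mu]_y (ind (hr_enorm y < k.+1%:R))%:E)%E.
    apply: eq_integral => y _; rewrite indicE /ind.
    by case: ifPn => h; [rewrite mem_set|rewrite memNset//=; exact/negP].
  by rewrite -RintE; [rewrite Rint_ball ?w0 ?mul0r|exact: rapid_intble (rapid_oball _)].
have T0 : mu setT = 0%E.
  rewrite (_ : setT = \bigcup_k [set y : V | hr_enorm y < k.+1%:R]).
    apply/negligibleP; first by apply: bigcupT_measurable => k; exact: measurable_hr_lt.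
    apply: negligible_bigcup => k; apply/negligibleP; first exact: measurable_hr_lt.
    exact: B0.
  apply/seteqP; split=> // y _; exists (Num.truncn (hr_enorm y)) => //=.
  exact: truncnS_gt.
have := @integral_gauss1 R n.
have ig : intble mu (fun y => expR (- sqn y)).
  by have := @intble_gauss R n 1 ltr01; under eq_fun do rewrite mul1r.
have mg := intble_measurable ig; have mgE := (measurable_EFinP _ _).2 mg.
rewrite (null_set_integral measurableT mgE T0).
by move=> /(congr1 fine)/= h; have := gam_gt0 R n; rewrite gamE -h ltxx.
Qed.

Lemma hr_ball_volE (x : V) r : 0 < r -> hr_ball_vol x r = (omega * r ^+ n)%:E.
Proof.
move=> r0; have i := rapid_intble (rapid_oball r).
rewrite /hr_ball_vol (_ : (fun y => _) = (fun y => (ind (hr_enorm (y - x) < r))%:E)); last first.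
  apply/funext => y; rewrite indicE /ind; congr EFin.
  by case: ifPn => h; [rewrite mem_set|rewrite memNset//=; exact/negP].
rewrite hr_iint_intble; last exact: (intble_subr x i).
by rewrite (Rint_subr x i) Rint_ball.
Qed.

(** The sphere lies in the ball of radius 1 + e but not in the open unit ball, and the two volumes
    differ by omega ((1 + e)^n - 1), which tends to 0 with e. *)
Lemma sphere_null : (\int[mu]_y (ind (hr_enorm y == 1%R))%:E = 0)%E.
Proof.
have ie e : intble mu (fun y => ind (hr_enorm y < 1 + e)) by exact: rapid_intble (rapid_oball _).
have i0 : intble mu (fun y => ind (hr_enorm y == 1)).
  apply: intble_le (ie 1) _ => [|y].
    apply: measurable_ind; apply: measurable_fun_eqr => //; exact: measurable_hr_enorm.
  by rewrite ind_norm /ind; case: eqP => [->|_]; [rewrite ltrDl ltr01|case: ifP].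
rewrite -RintE//; congr EFin.
have := @ie 0; rewrite addr0 => i1.
suff H e : 0 < e -> \int[mu]_y ind (hr_enorm y == 1) <= omega * ((1 + e) ^+ n - 1).
  apply/eqP; rewrite eq_le Rint_ge0 ?andbT; last by move=> y; exact: ind_ge0.
  have c : omega * ((1 + k.+1%:R^-1) ^+ n - 1) @[k --> \oo] --> (0 : R).
    rewrite -[X in _ --> X](_ : omega * ((1 + 0) ^+ n - 1) = 0); last by rewrite addr0 expr1n subrr mulr0.
    apply: cvgMr; apply: cvgB; last exact: cvg_cst.
    have cx : (fun k : nat => 1 + k.+1%:R^-1 : R) @ \oo --> (1 + 0 : R).
      by apply: cvgD; [exact: cvg_cst|exact: cvg_harmonic].
    exact: (cvg_comp _ _ cx (@exprn_continuous R n (1 + 0))).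
  rewrite -(cvg_lim (@Rhausdorff R) c); apply: limr_ge; first exact: cvgP c.
  by apply: nearW => k; exact: H.
move=> e0; rewrite mulrBr mulr1 -Rint_ball ?addr_gt0// -[X in _ - X](mulr1) -[X in _ - _ * X](expr1n _ n) -Rint_ball//.
rewrite -RintB//; apply: Rint_le => //; first exact: intbleB.
move=> y; rewrite /ind; case: eqP => [->|_]; first by rewrite ltrDl e0 ltxx subr0.
case: (ltP _ 1) => h; last by rewrite subr0 ind_ge0.
by rewrite (lt_trans h) ?subrr// ltrDl.
Qed.

End balls.

(** * Heat profiles and polynomials *)

Section heat_profile.
Variable R : realType.

(** Laguerre-type polynomials. The recurrence is read off from minus the time derivative of
    t^(-N/2-k) p(u/t) e^(-u/t). *)
Fixpoint lag (N k : nat) : {poly R} :=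
  if k is k'.+1 then
    (N%:R / 2 + k'%:R)%:P * lag N k' - 'X * lag N k' + 'X * (lag N k')^`()
  else 1.

(* [psi N k t u] is the k-th derivative of t^(-N/2) e^(-u/t) in t, up to the sign (-1)^k. *)
Definition psi (N k : nat) (t u : R) : R :=
  (Num.sqrt t ^+ N)^-1 * (t ^+ k)^-1 * (lag N k).[u / t] * expR (- (u / t)).

Lemma is_derive_sqrtVX N (t : R) : 0 < t ->
  is_derive t 1 (fun t => (Num.sqrt t ^+ N)^-1) (- (N%:R / 2) / t * (Num.sqrt t ^+ N)^-1).
Proof.
move=> t0; have s0 : 0 < Num.sqrt t by rewrite sqrtr_gt0.
have d1 := is_derive1_sqrt t0.
have d2 : is_derive t 1 (fun t => Num.sqrt t ^+ N) (N%:R * Num.sqrt t ^+ N / (2 * Num.sqrt t ^+ 2)).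
  have H := is_deriveX N d1.
  rewrite (_ : (fun t => _) = (Num.sqrt : R -> R) ^+ N); last by apply/funext => x; rewrite !fctE.
  apply: (is_derive_eq H).
  rewrite /GRing.scale/=.
  clear H; case: N => [|N]; first by rewrite !mul0r.
  by rewrite /= [Num.sqrt t ^+ N.+1]exprS; field; rewrite lt0r_neq0.
rewrite sqr_sqrtr ?ltW// in d2.
have d3' := @is_deriveV R (fun t => Num.sqrt t ^+ N) t _ 1 (expf_neq0 N (lt0r_neq0 s0)) d2.
apply: (is_derive_eq d3').
rewrite /GRing.scale/=; have : Num.sqrt t ^+ N != 0 by rewrite expf_neq0// lt0r_neq0.
by move=> h; field; rewrite h lt0r_neq0.
Qed.

Lemma is_derive_VX k (t : R) : 0 < t ->
  is_derive t 1 (fun t => (t ^+ k)^-1) (- k%:R / t * (t ^+ k)^-1).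
Proof.
move=> t0.
have d2 : is_derive t 1 (fun t : R => t ^+ k) (k%:R * t ^+ k / t).
  have H := is_deriveX k (is_derive_id t (1 : R)).
  rewrite (_ : (fun t => _) = (id : R -> R) ^+ k); last by apply/funext => x; rewrite !fctE.
  apply: (is_derive_eq H).
  rewrite /GRing.scale/=.
  clear H; case: k => [|k]; first by rewrite !mul0r.
  by rewrite /= [t ^+ k.+1]exprS; field; rewrite lt0r_neq0.
have d3' := @is_deriveV R (fun t => t ^+ k) t _ 1 (expf_neq0 k (lt0r_neq0 t0)) d2.
apply: (is_derive_eq d3').
rewrite /GRing.scale/=; have : t ^+ k != 0 by rewrite expf_neq0// lt0r_neq0.
by move=> h; field; rewrite h lt0r_neq0.
Qed.

Lemma is_derive_divV (u t : R) : 0 < t -> is_derive t 1 (fun t => u / t) (- (u / t ^+ 2)).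
Proof.
move=> t0; have d3 := @is_deriveV R id t _ 1 (lt0r_neq0 t0) (is_derive_id t 1).
have d4 := @is_deriveZ R _ _ _ u t 1 _ d3.
apply: (is_derive_eq d4).
by rewrite /GRing.scale/=; field; rewrite lt0r_neq0.
Qed.

Lemma is_derive_psi N k (t u : R) : 0 < t ->
  is_derive t 1 (fun t => psi N k t u) (- psi N k.+1 t u).
Proof.
move=> t0; have d0 := is_derive_divV u t0.
have dA := is_derive_sqrtVX N t0; have dB := is_derive_VX k t0.
have dC : is_derive t 1 (fun t => (lag N k).[u / t]) (- (u / t ^+ 2) * (lag N k)^`().[u / t]).
  have := @is_derive1_comp R (horner (lag N k)) (fun t => u / t) t _ _ (is_derive_poly _ _) d0.
  by rewrite mulrC.
have dD : is_derive t 1 (fun t => expR (- (u / t))) (u / t ^+ 2 * expR (- (u / t))).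
  have := @is_derive1_comp R expR (fun t => - (u / t)) t _ _ (is_derive_expR _) (is_deriveN d0).
  by rewrite opprK mulrC.
have := is_deriveM (is_deriveM (is_deriveM dA dB) dC) dD.
rewrite /psi => H; apply: (is_derive_eq H).
rewrite !mulrfctE /GRing.scale/= !hornerE/= [t ^+ k.+1]exprS.
have sN : Num.sqrt t ^+ N != 0 by rewrite expf_neq0// lt0r_neq0// sqrtr_gt0.
have tk : t ^+ k != 0 by rewrite expf_neq0// lt0r_neq0.
by field; rewrite sN tk lt0r_neq0.
Qed.

Lemma le_expR (x : R) : x <= expR x.
Proof. by apply: le_trans (expR_ge1Dx x); rewrite lerDr. Qed.

(** Induction on the degree: one more factor [v] is at most 2/a times e^(a v / 2), so it costs half
    of the exponent. *)
Lemma poly_expR_bound (p : {poly R}) a : 0 < a ->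
  exists2 C, 0 <= C & forall v, 0 <= v -> `|p.[v]| <= C * expR (a * v).
Proof.
elim/poly_ind: p a => [|p c IH] a a0.
  by exists 0 => // v _; rewrite horner0 normr0 mul0r.
have a20 : 0 < a / 2 by rewrite divr_gt0.
have [C C0 hC] := IH _ a20.
set D : R := 2 / a.
exists (C * D + `|c|).
  by rewrite addr_ge0// mulr_ge0// divr_ge0// ltW.
move=> v v0; rewrite hornerMXaddC; apply: le_trans (ler_normD _ _) _.
rewrite mulrDl lerD//; last first.
  by rewrite ler_peMr// -expR0 ler_expR mulr_ge0// ltW.
rewrite normrM (ger0_norm v0).
have h : v <= D * expR (a / 2 * v).
  rewrite /D -ler_pdivrMl ?divr_gt0// invf_div; apply: le_trans (le_expR _).
  by rewrite le_eqVlt; apply/orP; left; apply/eqP; field.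
apply: le_trans (_ : C * expR (a / 2 * v) * (D * expR (a / 2 * v)) <= _).
  by apply: ler_pM => //; exact: hC.
rewrite (_ : a * v = a / 2 * v + a / 2 * v); last by field.
by rewrite expRD mulrACA.
Qed.

(** Half of the exponent u / t pays for the Laguerre factor; the other half remains. *)
Lemma psi_bound N k : exists2 C, 0 <= C & forall t u, 0 < t -> 0 <= u ->
  `|psi N k t u| <= C * (Num.sqrt t ^+ N)^-1 * (t ^+ k)^-1 * expR (- (u / (2 * t))).
Proof.
have h : (0 : R) < 1 / 2 by rewrite divr_gt0.
have [C C0 hC] := poly_expR_bound (lag N k) h.
exists C => // t u t0 u0; rewrite /psi !normrM.
have A0 : 0 <= (Num.sqrt t ^+ N)^-1 by rewrite invr_ge0 exprn_ge0// sqrtr_ge0.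
have B0 : 0 <= (t ^+ k)^-1 by rewrite invr_ge0 exprn_ge0// ltW.
rewrite (ger0_norm A0) (ger0_norm B0) (ger0_norm (expR_ge0 _)).
have := hC (u / t) (divr_ge0 u0 (ltW t0)) => hc.
apply: le_trans (_ : (Num.sqrt t ^+ N)^-1 * (t ^+ k)^-1 * (C * expR (1 / 2 * (u / t))) * expR (- (u / t)) <= _).
  by rewrite ler_wpM2r ?expR_ge0// ler_wpM2l// mulr_ge0.
have -> : expR (- (u / (2 * t))) = expR (1 / 2 * (u / t)) * expR (- (u / t)).
  by rewrite -expRD; congr expR; field; rewrite lt0r_neq0.
by rewrite le_eqVlt; apply/orP; left; apply/eqP; ring.
Qed.

Lemma psi_scale N k (th t u : R) : 0 < th -> 0 < t ->
  psi N k (th ^+ 2 * t) (th ^+ 2 * u) = (th ^+ (N + k.*2))^-1 * psi N k t u.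
Proof.
move=> th0 t0; rewrite /psi sqrtrM ?sqr_ge0// sqrtr_sqr gtr0_norm//.
rewrite !exprMn exprD -addnn [th ^+ (k + k)]exprD.
have -> : th ^+ 2 * u / (th ^+ 2 * t) = u / t.
  by field; rewrite !lt0r_neq0.
rewrite !invfM; move: (th ^+ N)^-1 (th ^+ k)^-1 (Num.sqrt t ^+ N)^-1 (t ^+ k)^-1 (_.[_]) (expR _) => a b c e p q; ring.
Qed.

Lemma measurable_inv d (T : measurableType d) (f : T -> R) :
  measurable_fun setT f -> measurable_fun setT (fun x => (f x)^-1).
Proof.
move=> mf.
(* Inversion is not continuous at 0, so it is assembled from e^(- ln) on the two half-lines, with
   the value 0 at 0. *)
pose h (y : R) := if 0 < y then expR (- ln y) else if y < 0 then - expR (- ln (- y)) else 0.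
have mh : measurable_fun setT h.
  have me (g : R -> R) : measurable_fun setT g -> measurable_fun setT (fun y : R => expR (- ln (g y))).
    by move=> mg; apply: measurableT_comp => //; apply: measurableT_comp => //; exact: measurableT_comp (@measurable_ln R) mg.
  apply: measurable_fun_ifT; first exact: measurable_fun_ltr.
    exact: me.
  apply: measurable_fun_ifT => //; first exact: measurable_fun_ltr.
  by apply: measurable_funN; apply: me; exact: measurable_funN.
rewrite (_ : (fun _ => _) = h \o f); first exact: measurableT_comp mh mf.
apply/funext => x /=; rewrite /h; case: ltrgt0P => [p|p|->]; last by rewrite invr0.
  by rewrite expRN lnK// posrE.
by rewrite expRN lnK ?posrE ?oppr_gt0// invrN opprK.
Qed.

Lemma measurable_psi d (T : measurableType d) N k (t u : T -> R) :
  measurable_fun setT t -> measurable_fun setT u ->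
  measurable_fun setT (fun x => psi N k (t x) (u x)).
Proof.
move=> mt mu; rewrite /psi.
have md : measurable_fun setT (fun x => u x / t x) by apply: measurable_funM => //; exact: measurable_inv.
have ms : measurable_fun setT (fun x => Num.sqrt (t x)).
  have H : measurable_fun setT (Num.sqrt : R -> R).
    by apply: continuous_measurable_fun; exact: sqrt_continuous.
  by have := measurableT_comp H mt.
apply: measurable_funM; last by apply: measurableT_comp => //; exact: measurable_funN.
apply: measurable_funM.
  by apply: measurable_funM; apply: measurable_inv; exact: measurable_funX.
have H : measurable_fun setT (horner (lag N k)).
  by apply: continuous_measurable_fun; exact: continuous_horner.
by have := measurableT_comp H md.
Qed.

End heat_profile.

Section poly_eval.
Variables (R : realType) (n : nat).
Local Notation V := 'rV[R]_n.
Local Notation mu := (lebesgue_rV R n).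
Local Notation poly := (mpoly.mpoly n R).
Local Notation ex := mpoly.fun_of_multinom.
Local Notation X_ m := (mpoly.mpolyX R m).
Implicit Types (P : poly).

Definition ev P (y : V) : R := mpoly.meval (fun i => y ord0 i) P.

Lemma evE P y : ev P y =
  \sum_(m <- mpoly.msupp P) mpoly.mcoeff m P * \prod_(i < n) y ord0 i ^+ ex m i.
Proof. exact: mpoly.mevalE. Qed.

Lemma measurable_ev P : measurable_fun setT (ev P).
Proof.
rewrite (_ : ev P = fun y => \sum_(m <- mpoly.msupp P)
    mpoly.mcoeff m P * \prod_(i < n) y ord0 i ^+ ex m i); last by apply/funext => y; exact: evE.
apply: measurable_sum => m; apply: measurable_funM => //.
apply: measurable_prod => i _; apply: measurable_funX; exact: measurable_coord.
Qed.

Definition homog d P := forall m, m \in mpoly.msupp P -> mpoly.mdeg m = d.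

Lemma evZ d P c y : homog d P -> ev P (c *: y) = c ^+ d * ev P y.
Proof.
move=> hP; rewrite !evE mulr_sumr !big_seq; apply: eq_bigr => m /hP md.
rewrite mulrCA; congr (_ * _).
rewrite -md mpoly.mdegE -prodrXr -big_split/=; apply: eq_bigr => i _.
by rewrite mxE exprMn.
Qed.

Lemma evN d P y : homog d P -> odd d -> ev P (- y) = - ev P y.
Proof. by move=> hP od; rewrite -scaleN1r (evZ _ _ hP) -signr_odd od expr1 mulN1r. Qed.

Definition polyC P : R := \sum_(m <- mpoly.msupp P) `|mpoly.mcoeff m P|.

Lemma polyC_ge0 P : 0 <= polyC P. Proof. by apply: sumr_ge0 => i _. Qed.

Lemma ev_bound d P y : homog d P -> `|ev P y| <= polyC P * hr_enorm y ^+ d.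
Proof.
move=> hP; rewrite evE mulr_suml; apply: le_trans (ler_norm_sum _ _ _) _.
rewrite !big_seq; apply: ler_sum => m /hP md; rewrite normrM ler_wpM2l//.
rewrite -md mpoly.mdegE -prodrXr normr_prod; apply: ler_prod => i _.
by rewrite normr_ge0 normrX lerXn2r ?nnegrE ?hr_enorm_ge0// coord_le_hr_enorm.
Qed.

Lemma ev_expR_bound d P a : homog d P -> 0 < a ->
  exists2 C, 0 <= C & forall y, `|ev P y| <= C * expR (a * sqn y).
Proof.
(* |y|^d <= 1 + |y|^(2d), and the right-hand side is a polynomial in |y|^2. *)
move=> hP a0; have [C C0 hC] := poly_expR_bound (1 + 'X^d) a0.
exists (polyC P * C) => [|y]; first by rewrite mulr_ge0// polyC_ge0.
apply: le_trans (ev_bound y hP) _; rewrite -mulrA ler_wpM2l ?polyC_ge0//.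
apply: le_trans (hC _ (sqn_ge0 y)); rewrite !hornerE ger0_norm; last first.
  by rewrite addr_ge0// exprn_ge0// sqn_ge0.
rewrite -sqr_hr_enorm -exprM mulnC exprM.
have := sqr_ge0 (hr_enorm y ^+ d - 1); have := exprn_ge0 d (hr_enorm_ge0 y).
nra.
Qed.

Lemma homog_mderiv d P i : homog d.+1 P -> homog d (mpoly.mderiv i P).
Proof.
move=> hP m; rewrite mpoly.mcoeff_msupp mpoly.mcoeff_mderiv => h.
have /hP : mpoly.mnm_add m (mpoly.mnm1 i) \in mpoly.msupp P.
  by rewrite mpoly.mcoeff_msupp; apply: contra_neq h => ->; rewrite mul0rn.
by rewrite mpoly.mdegD mpoly.mdeg1 addn1 => -[].
Qed.

Lemma homog0_cst P y : homog 0 P -> ev P y = ev P 0.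
Proof. by move=> hP; rewrite -(scale0r y) (evZ _ _ hP) expr0 mul1r. Qed.

Lemma evD P Q y : ev (P + Q) y = ev P y + ev Q y. Proof. exact: mpoly.mevalD. Qed.
Lemma evM P Q y : ev (P * Q) y = ev P y * ev Q y. Proof. exact: mpoly.mevalM. Qed.
Lemma evZr c P y : ev (c *: P) y = c * ev P y. Proof. exact: mpoly.mevalZ. Qed.
Lemma ev1 y : ev 1 y = 1. Proof. exact: mpoly.meval1. Qed.
Lemma ev0 y : ev 0 y = 0. Proof. exact: mpoly.meval0. Qed.
Lemma evX i y : ev (X_ (mpoly.mnm1 i)) y = y ord0 i. Proof. exact: mpoly.mevalXU. Qed.

Lemma ev_sum I (r : seq I) (p : pred I) (F : I -> poly) y :
  ev (\sum_(i <- r | p i) F i) y = \sum_(i <- r | p i) ev (F i) y.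
Proof. by elim/big_rec2: _ => [|i a b _ <-]; [exact: ev0|exact: evD]. Qed.

Definition e_ (i : 'I_n) : V := delta_mx ord0 i.

Lemma is_derive_ev P i (x : V) (h : R) : is_derive h (1 : R) (fun h : R => ev P (x + h *: e_ i))
  (ev (mpoly.mderiv i P) (x + h *: e_ i)).
Proof.
pose D p := forall h : R, is_derive h (1 : R) (fun h : R => ev p (x + h *: e_ i))
  (ev (mpoly.mderiv i p) (x + h *: e_ i)).
have D1 : D 1.
  move=> k; rewrite (_ : (fun _ => _) = cst 1); last by apply/funext => z; exact: ev1.
  by rewrite -mpoly.mpolyC1 mpoly.mderivC ev0; exact: is_derive_cst.
have DM p q : D p -> D q -> D (p * q).
  move=> dp dq k; rewrite (_ : (fun _ => _) =
     (fun h : R => ev p (x + h *: e_ i)) * (fun h : R => ev q (x + h *: e_ i))); last first.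
    by apply/funext => z; rewrite mulrfctE evM.
  have H := is_deriveM (dp k) (dq k); apply: (is_derive_eq H).
  by rewrite mpoly.mderivM evD !evM /GRing.scale/=; ring.
have DX j : D (X_ (mpoly.mnm1 j)).
  move=> k; rewrite (_ : (fun _ => _) = (fun h : R => x ord0 j + h * (i == j)%:R)); last first.
    by apply/funext => z; rewrite evX !mxE eqxx andTb eq_sym.
  have H := is_deriveD (is_derive_cst (x ord0 j) k (1 : R))
    (is_deriveM (is_derive_id k (1 : R)) (is_derive_cst ((i == j)%:R : R) k (1 : R))).
  apply: (is_derive_eq H); rewrite mpoly.mderivX evZr mpoly.mnm1E eq_sym /GRing.scale/= /cst.
  case: eqP => [->|_]; rewrite ?mul0r ?mulr0 ?add0r ?mulr1//.
  by rewrite -{1}(mpoly.add0m (mpoly.mnm1 i)) mpoly.addmK mpoly.mpolyX0 ev1 mulr1.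
have DXn p k : D p -> D (p ^+ k).
  by move=> dp; elim: k => [|k IH]; [rewrite expr0|rewrite exprS; exact: DM].
have Dm m : D (X_ m).
  by rewrite mpoly.mpolyXE_id; elim/big_ind: _ => // j _; exact: DXn.
suff : D P by [].
elim/mpoly.mpolyind: P => [k|c m p _ _ IH k].
  rewrite (_ : (fun _ => _) = cst 0); last by apply/funext => z; exact: ev0.
  by rewrite mpoly.mderiv0 ev0; exact: is_derive_cst.
rewrite (_ : (fun _ => _) = (fun h : R => c * ev (X_ m) (x + h *: e_ i)) + (fun h : R => ev p (x + h *: e_ i))); last first.
  by apply/funext => z; rewrite evD evZr.
have H := is_deriveD (is_deriveZ c (Dm m k)) (IH k).
apply: (is_derive_eq H).
by rewrite mpoly.mderivD evD mpoly.mderivZ evZr.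
Qed.

Lemma euler_monomial m (y : V) :
  \sum_(i < n) y ord0 i * ev (mpoly.mderiv i (X_ m)) y = (mpoly.mdeg m)%:R * ev (X_ m) y.
Proof.
rewrite mpoly.mdegE natr_sum mulr_suml; apply: eq_bigr => i _.
rewrite mpoly.mderivX evZr mulrCA.
have [->|mi] := eqVneq (ex m i) 0%N; first by rewrite !mul0r.
congr (_ * _); rewrite -evX -evM -mpoly.mpolyXD; congr (ev (X_ _) _).
by rewrite mpoly.addmC mpoly.submK// mpoly.lep1mP.
Qed.

Lemma euler d P (y : V) : homog d P ->
  \sum_(i < n) y ord0 i * ev (mpoly.mderiv i P) y = d%:R * ev P y.
Proof.
move=> hP.
have E i : ev (mpoly.mderiv i P) y = \sum_(m <- mpoly.msupp P)
    mpoly.mcoeff m P * ev (mpoly.mderiv i (X_ m)) y.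
  rewrite {1}[P]mpoly.mpolyE raddf_sum/= ev_sum; apply: eq_bigr => m _.
  by rewrite mpoly.mderivZ evZr.
have E' : ev P y = \sum_(m <- mpoly.msupp P) mpoly.mcoeff m P * ev (X_ m) y.
  by rewrite {1}[P]mpoly.mpolyE ev_sum; apply: eq_bigr => m _; rewrite evZr.
under eq_bigr do rewrite E mulr_sumr.
rewrite exchange_big/= E' mulr_sumr !big_seq.
apply: eq_bigr => m /hP md; rewrite mulrCA -md -euler_monomial mulr_sumr.
by apply: eq_bigr => i _; rewrite mulrCA.
Qed.

End poly_eval.

(** * The kernels H and Q *)

Section derive_integral.
Context d (T : measurableType d) (R : realType).
Variable mu : {measure set T -> \bar R}.

Lemma is_derive_Rint (f df : R -> T -> R) (a u v : R) (G : T -> R) :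
  u < a < v ->
  (forall t, u < t < v -> intble mu (f t)) ->
  (forall t y, u < t < v -> is_derive t (1 : R) (f ^~ y) (df t y)) ->
  (forall t y, u < t < v -> `|df t y| <= G y) ->
  (forall y, 0 <= G y) -> intble mu G ->
  is_derive a (1 : R) (fun t => \int[mu]_y f t y) (\int[mu]_y df a y).
Proof.
move=> auv fi fd fb G0 iG.
have Ia : a \in `]u, v[ by rewrite in_itv.
have I2 t : [set` `]u, v[] t -> u < t < v by rewrite /= in_itv.
have p1 t y : u < t < v -> partial1of2 f t y = df t y.
  by move=> /fd-/(_ y) H; rewrite partial1of2E; exact: derive_val.
have h1 t : [set` `]u, v[] t -> mu.-integrable setT (EFin \o f t) by move=> /I2; exact: fi.
have h2 t y : [set` `]u, v[] t -> setT y -> derivable (f ^~ y) t 1.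
  by move=> /I2/fd-/(_ y)[].
have h3 t y : [set` `]u, v[] t -> setT y -> `|partial1of2 f t y| <= G y.
  by move=> /I2 tI _; rewrite p1//; exact: fb.
have D := derivable_under_integral measurableT Ia h1 h2 G0 iG h3.
have E := differentiation_under_integral measurableT Ia h1 h2 G0 iG h3.
apply: DeriveDef; first exact: D.
rewrite -derive1E E; apply: Rint_eq => y; exact: p1.
Qed.

Lemma intble_sum (I : Type) (r : seq I) (f : I -> T -> R) : (forall i, intble mu (f i)) ->
  intble mu (fun y => \sum_(i <- r) f i y).
Proof.
move=> fi; elim: r => [|i r IH].
  by rewrite (_ : (fun _ => _) = cst 0); [exact: integrable0|apply/funext => y; rewrite big_nil].
by under eq_fun do rewrite big_cons; apply: intbleD.
Qed.

Lemma Rint_sum (I : Type) (r : seq I) (f : I -> T -> R) : (forall i, intble mu (f i)) ->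
  \int[mu]_y (\sum_(i <- r) f i y) = \sum_(i <- r) \int[mu]_y f i y.
Proof.
move=> fi; elim: r => [|i r IH].
  rewrite big_nil; under eq_Rintegral do rewrite big_nil.
  by rewrite Rintegral_cst//= mul0r.
rewrite big_cons -IH -RintD//; last exact: intble_sum.
by apply: Rint_eq => y; rewrite big_cons.
Qed.

End derive_integral.

Lemma homogM (R : realType) n d e (p q : mpoly.mpoly n R) :
  homog d p -> homog e q -> homog (d + e) (p * q).
Proof.
move=> hp hq m /mpoly.msuppM_le/allpairsP[/= -[m1 m2] [/= /hp <- /hq <- ->]].
exact: mpoly.mdegD.
Qed.

Lemma psi0 (R : realType) N (t u : R) : psi N 0 t u = (Num.sqrt t ^+ N)^-1 * expR (- (u / t)).
Proof. by rewrite /psi /= expr0 invr1 hornerC !mulr1. Qed.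

Section kernels.
Variables (R : realType) (n : nat).
Local Notation V := 'rV[R]_n.
Local Notation mu := (lebesgue_rV R n).
Local Notation poly := (mpoly.mpoly n R).
Implicit Types (P : poly).

(** The index 2d + n produces the time factor t^(-n/2-d). For harmonic P and k = 0 this is a
    constant multiple of the differential operator P(D) applied to the heat kernel, which is why
    convolution with [H] only adds the times. *)
Definition Q P d k (t : R) (y : V) : R :=
  locked_with hr_key (fun P d k t y => ev P y * psi (d.*2 + n) k t (sqn y)) P d k t y.
Definition H k (t : R) (y : V) : R := locked_with hr_key (fun k t y => psi n k t (sqn y)) k t y.

Lemma QE P d k t y : Q P d k t y = ev P y * psi (d.*2 + n) k t (sqn y).
Proof. by rewrite /Q unlock. Qed.

Lemma HE k t y : H k t y = psi n k t (sqn y).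
Proof. by rewrite /H unlock. Qed.

Lemma QH k t y : Q 1 0 k t y = H k t y.
Proof. by rewrite !QE HE ev1 mul1r. Qed.

Lemma homog1 : homog 0 (1 : poly).
Proof.
by move=> m; rewrite mpoly.msupp1 inE => /eqP ->; rewrite mpoly.mdeg0.
Qed.

Lemma measurable_Q P d k t : 0 < t -> measurable_fun setT (Q P d k t).
Proof.
move=> t0; rewrite (_ : Q P d k t = fun y => ev P y * psi (d.*2 + n) k t (sqn y)); last exact/funext/QE.
by apply: measurable_funM; [exact: measurable_ev|apply: measurable_psi => //; exact: measurable_sqn].
Qed.

(** A single Gaussian dominates all times near [t0]; this is what differentiation of convolutions in
    time requires. *)
Lemma Q_unif P d k t0 : homog d P -> 0 < t0 -> exists C a, [/\ 0 <= C, 0 < a &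
  forall t y, t0 / 2 < t < 2 * t0 -> `|Q P d k t y| <= C * expR (- (a * sqn y))].
Proof.
move=> hP t00; have [C C0 hC] := psi_bound R (d.*2 + n) k.
(* For t < 2 t0, [psi_bound] leaves the exponent |y|^2 / (4 t0); half of it absorbs the growth of
   P. *)
have a0 : 0 < 1 / (8 * t0) by rewrite divr_gt0// mulr_gt0.
have [D D0 hD] := ev_expR_bound hP a0.
have tt0 : 0 < t0 / 2 by rewrite divr_gt0.
exists (D * (C * (Num.sqrt (t0 / 2) ^+ (d.*2 + n))^-1 * ((t0 / 2) ^+ k)^-1)), (1 / (8 * t0)).
split=> //.
  by rewrite !mulr_ge0// invr_ge0 exprn_ge0// ?sqrtr_ge0// ltW.
move=> t y /andP[t1 t2]; have tp : 0 < t by exact: lt_trans t1.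
rewrite QE normrM; have s0 := sqn_ge0 y.
have B1 := hD y; have B2 := hC t (sqn y) tp s0.
set A := (Num.sqrt _ ^+ _)^-1; set B := (_ ^+ k)^-1.
have B3 : `|psi (d.*2 + n) k t (sqn y)| <= C * A * B * expR (- (sqn y / (4 * t0))).
  apply: le_trans B2 _; apply: ler_pM => //.
  - by rewrite !mulr_ge0// invr_ge0 exprn_ge0// ?sqrtr_ge0// ltW.
  - apply: ler_pM => //.
    + by rewrite !mulr_ge0// invr_ge0 exprn_ge0// sqrtr_ge0.
    + by rewrite invr_ge0 exprn_ge0// ltW.
    + rewrite ler_wpM2l// lef_pV2 ?posrE ?exprn_gt0 ?sqrtr_gt0//.
      by rewrite lerXn2r ?nnegrE ?sqrtr_ge0// ler_wsqrtr// ltW.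
    + rewrite lef_pV2 ?posrE ?exprn_gt0//.
      by rewrite lerXn2r ?nnegrE ?(ltW tt0) ?(ltW tp)// ltW.
  - rewrite ler_expR lerN2 ler_wpM2l// lef_pV2 ?posrE ?mulr_gt0//.
    by have := ltW t2; lra.
apply: le_trans (ler_pM (normr_ge0 _) (normr_ge0 _) B1 B3) _.
rewrite (_ : - (1 / (8 * t0) * sqn y) = 1 / (8 * t0) * sqn y - sqn y / (4 * t0)); last first.
  by field; rewrite lt0r_neq0.
by rewrite expRD le_eqVlt; apply/orP; left; apply/eqP; ring.
Qed.

Lemma rapid_Q P d k t : homog d P -> 0 < t -> rapid (Q P d k t).
Proof.
move=> hP t0; split; first exact: measurable_Q.
have [C [a [C0 a0 h]]] := Q_unif k hP t0; exists C, a; split=> // y; apply: h.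
by apply/andP; split; lra.
Qed.

Lemma rapid_H k t : 0 < t -> rapid (H k t).
Proof.
move=> t0; rewrite (_ : H k t = Q 1 0 k t); first exact: rapid_Q homog1 t0.
by apply/funext => y; rewrite QH.
Qed.

Lemma HN k t y : H k t (- y) = H k t y. Proof. by rewrite !HE sqnN. Qed.

Lemma QN P d k t y : homog d P -> odd d -> Q P d k t (- y) = - Q P d k t y.
Proof. by move=> hP od; rewrite !QE sqnN (evN _ hP od) mulNr. Qed.

Lemma is_derive_Q P d k (t : R) y : 0 < t ->
  is_derive t (1 : R) (fun t => Q P d k t y) (- Q P d k.+1 t y).
Proof.
move=> t0; have := is_deriveZ (ev P y) (is_derive_psi (d.*2 + n) k (sqn y) t0).
rewrite (_ : (fun t => Q P d k t y) = ev P y \*: (fun t => psi (d.*2 + n) k t (sqn y))); last first.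
  by apply/funext => r; exact: QE.
by move=> h; apply: (is_derive_eq h); rewrite QE /GRing.scale/= mulrN.
Qed.

Lemma Q_scale P d k th t y : homog d P -> 0 < th -> 0 < t ->
  Q P d k (th ^+ 2 * t) (th *: y) = (th ^+ (d + n + k.*2))^-1 * Q P d k t y.
Proof.
move=> hP th0 t0; rewrite !QE sqnZ psi_scale// (evZ _ _ hP) -addnn -!addnA [th ^+ (d + (d + _))]exprD.
by rewrite invfM; have := expf_neq0 d (lt0r_neq0 th0) => h; field; rewrite h expf_neq0// lt0r_neq0.
Qed.

Lemma conv_gauss (s t : R) (x : V) : 0 < s -> 0 < t ->
  conv (H 0 s) (H 0 t) x = gam R n * H 0 (s + t) x.
Proof.
move=> s0 t0; have st : 0 < s + t by rewrite addr_gt0.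
(* Completing the square: |x - y|^2 / s + |y|^2 / t = |x|^2 / (s + t) + |y - lam x|^2 / sg. *)
pose lam := t / (s + t); pose sg := s * t / (s + t).
have sg0 : 0 < sg by rewrite divr_gt0// mulr_gt0.
have E y : H 0 s (x - y) * H 0 t y =
   ((Num.sqrt s ^+ n)^-1 * (Num.sqrt t ^+ n)^-1 * expR (- (sqn x / (s + t)))) *
   expR (- (sqn (y - lam *: x) / sg)).
  rewrite !HE !psi0.
  rewrite mulrACA -[RHS]mulrA -!expRD; congr (_ * expR _).
  rewrite !sqnD !sqnN !sqnZ.
  have -> : dotp y (- (lam *: x)) = - lam * dotp y x.
    by rewrite /dotp mulr_sumr; apply: eq_bigr => i _; rewrite !mxE; ring.
  have -> : dotp x (- y) = - dotp y x.
    by rewrite /dotp -sumrN; apply: eq_bigr => i _; rewrite !mxE; ring.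
  by rewrite /lam /sg; field; rewrite !lt0r_neq0.
rewrite !convE; under eq_Rintegral do rewrite E.
have ig : intble mu (fun y : V => expR (- (sqn y / sg))).
  have := @intble_gauss R n sg^-1; rewrite invr_gt0 => /(_ sg0).
  by under eq_fun do rewrite mulrC.
rewrite RintZ; last exact: (intble_subr (lam *: x) ig).
rewrite (Rint_subr (lam *: x) ig) Rint_gauss// !HE !psi0.
rewrite /sg sqrtrM ?mulr_ge0 ?ltW// sqrtrM ?ltW// sqrtrV ?ltW// !exprMn exprVn.
have h1 : Num.sqrt s ^+ n != 0 by rewrite expf_neq0// lt0r_neq0// sqrtr_gt0.
have h2 : Num.sqrt t ^+ n != 0 by rewrite expf_neq0// lt0r_neq0// sqrtr_gt0.
have h3 : Num.sqrt (s + t) ^+ n != 0 by rewrite expf_neq0// lt0r_neq0// sqrtr_gt0.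
by field; rewrite h1 h2 h3.
Qed.

Definition DQ P d (i : 'I_n) t (y : V) : R :=
  (ev (mpoly.mderiv i P) y - 2 / t * y ord0 i * ev P y) * psi (d.*2 + n) 0 t (sqn y).

Lemma is_derive_sqn (i : 'I_n) (x : V) (h : R) :
  is_derive h (1 : R) (fun h : R => sqn (x + h *: e_ R i)) (2 * (x + h *: e_ R i) ord0 i).
Proof.
have se : sqn (e_ R i) = 1.
  rewrite /sqn (bigD1 i)//= big1 ?addr0.
    by rewrite mxE !eqxx expr1n.
  by move=> j ji; rewrite mxE eqxx (negbTE ji) expr0n.
have de : dotp x (e_ R i) = x ord0 i.
  rewrite /dotp (bigD1 i)//= big1 ?addr0.
    by rewrite mxE !eqxx mulr1.
  by move=> j ji; rewrite mxE eqxx (negbTE ji) mulr0.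
rewrite (_ : (fun _ => _) = (fun h => sqn x + 2 * x ord0 i * h + h ^+ 2)); last first.
  apply/funext => z; rewrite sqnD sqnZ se -{1}de.
  rewrite (_ : dotp x (z *: e_ R i) = z * dotp x (e_ R i)); first by ring.
  by rewrite /dotp mulr_sumr; apply: eq_bigr => j _; rewrite !mxE; ring.
have D1 := is_deriveZ (2 * x ord0 i) (is_derive_id h (1 : R)).
have D2 := is_deriveD (is_deriveD (is_derive_cst (sqn x) h (1 : R)) D1) (is_deriveX 2 (is_derive_id h (1 : R))).
apply: (is_derive_eq D2); rewrite /GRing.scale/= /cst !mxE !eqxx /= expr1; ring.
Qed.

Lemma is_derive_Qx P d i t (x : V) (h : R) : 0 < t ->
  is_derive h (1 : R) (fun h : R => Q P d 0 t (x + h *: e_ R i)) (DQ P d i t (x + h *: e_ R i)).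
Proof.
move=> t0; set z := x + h *: _.
have D1 := is_derive_ev P i x h.
have D2 : is_derive h (1 : R) (fun h : R => psi (d.*2 + n) 0 t (sqn (x + h *: e_ R i)))
   (- (2 / t * z ord0 i) * psi (d.*2 + n) 0 t (sqn z)).
  have Ds := is_deriveZ (- t^-1) (is_derive_sqn i x h).
  have De := @is_derive1_comp R expR _ h _ _ (is_derive_expR _) Ds; rewrite /GRing.scale/= -/z in De.
  have Dz := is_deriveZ ((Num.sqrt t ^+ (d.*2 + n))^-1) De.
  rewrite (_ : (fun _ => _) = (Num.sqrt t ^+ (d.*2 + n))^-1 \*: (expR \o (fun h : R => (- t^-1) * sqn (x + h *: e_ R i)))).
    apply: (is_derive_eq Dz); rewrite !psi0 /GRing.scale/=.
    rewrite -/z (_ : - t^-1 * sqn z = - (sqn z / t)); last by rewrite mulNr mulrC.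
    by ring.
  apply/funext => r; rewrite !psi0 /GRing.scale/=.
  by rewrite mulNr [t^-1 * _]mulrC.
have D3 := is_deriveM D1 D2; under eq_fun do rewrite QE; apply: (is_derive_eq D3).
by rewrite /DQ /GRing.scale/= -/z; ring.
Qed.

(** The two terms are multiples of [Q] for the i-th derivative of P and for y_i P, of degrees d - 1
    and d + 1; the index of [psi] moves by 2 with the degree, which costs a factor t. For d = 0 the
    first term vanishes. *)
Lemma rapid_DQ P d i t : homog d P -> 0 < t -> rapid (DQ P d i t).
Proof.
move=> hP t0; have tn := lt0r_neq0 t0.
have mD : measurable_fun setT (DQ P d i t).
  apply: measurable_funM; last by apply: measurable_psi => //; exact: measurable_sqn.
  apply: measurable_funB; first exact: measurable_ev.
  by apply: measurable_funM; [apply: measurable_funM => //; exact: measurable_coord|exact: measurable_ev].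
have h1 : Num.sqrt t != 0 by rewrite lt0r_neq0// sqrtr_gt0.
have hX : homog d.+1 (mpoly.mpolyX R (mpoly.mnm1 i) * P).
  by apply: (@homogM _ _ 1 d) => // m; rewrite mpoly.msuppX inE => /eqP ->; rewrite mpoly.mdeg1.
pose st := (Num.sqrt t ^+ 2).
pose p1 y := ev (mpoly.mderiv i P) y * psi (d.*2 + n) 0 t (sqn y).
have rp1 : rapid p1.
  case: d hP {hX mD} @p1 => [|d] hP p1.
    rewrite (_ : p1 = fun y => 0 * H 0 t y); first exact/rapidZ/rapid_H.
    apply/funext => y; rewrite /p1 (_ : mpoly.mderiv i P = 0) ?ev0 ?mul0r//.
    apply/mpoly.mpolyP => m; rewrite mpoly.mcoeff_mderiv mpoly.mcoeff0.
    rewrite (_ : mpoly.mcoeff _ P = 0) ?mul0rn//.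
    apply/eqP; apply: contraTT isT => h.
    have := hP (mpoly.mnm_add m (mpoly.mnm1 i)); rewrite mpoly.mcoeff_msupp h => /(_ isT).
    by rewrite mpoly.mdegD mpoly.mdeg1 addn1.
  have hd := @homog_mderiv _ _ _ _ i hP.
  rewrite (_ : p1 = fun y => st^-1 * Q (mpoly.mderiv i P) d 0 t y); first exact/rapidZ/rapid_Q.
  apply/funext => y; rewrite /p1 !QE !psi0 /st.
  rewrite (_ : (d.+1.*2 + n = 2 + (d.*2 + n))%N)// exprD.
  by have h2 := expf_neq0 (d.*2 + n) h1; field; rewrite h1 h2.
rewrite (_ : DQ P d i t = fun y => p1 y + (- (2 / t) * st) * Q (mpoly.mpolyX R (mpoly.mnm1 i) * P) d.+1 0 t y).
  by apply: rapidD => //; apply: rapidZ; exact: rapid_Q.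
apply/funext => y; rewrite /DQ !QE evM evX /p1 !psi0 /st.
rewrite (_ : (d.+1.*2 + n = 2 + (d.*2 + n))%N)// [_ ^+ (2 + _)]exprD.
by have h2 := expf_neq0 (d.*2 + n) h1; field; rewrite h1 h2 tn.
Qed.

Lemma is_derive_unique (f g : R -> R) (x a b : R) : 
  (\forall z \near x, f z = g z) -> is_derive x (1 : R) f a -> is_derive x (1 : R) g b -> a = b.
Proof.
move=> fg da db; have dc := near_eq_is_derive fg da.
by rewrite -(@derive_val _ _ _ _ _ _ _ dc) (@derive_val _ _ _ _ _ _ _ db).
Qed.

Lemma is_derive_conv_dir (k : V -> R) P d i (t : R) (x : V) (h : R) : rapid k -> homog d P -> 0 < t ->
  is_derive h (1 : R) (fun h : R => conv k (Q P d 0 t) (x + h *: e_ R i))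
    (conv k (DQ P d i t) (x + h *: e_ R i)).
Proof.
move=> rk hP t0; have rQ := rapid_Q 0 hP t0; have rD := rapid_DQ i hP t0.
have [C C0 hC] := rapid_bounded rD.
rewrite (conv_swap _ (rapid_L2 rk) (rapid_L2 rD)).
rewrite (_ : (fun h : R => conv _ _ _) = (fun h : R => \int[mu]_y (k y * Q P d 0 t ((x - y) + h *: e_ R i)))); last first.
  apply/funext => z; rewrite (conv_swap _ (rapid_L2 rk) (rapid_L2 rQ)).
  by apply: Rint_eq => y; rewrite addrAC.
have H := @is_derive_Rint _ _ R mu (fun (h : R) (y : V) => k y * Q P d 0 t ((x - y) + h *: e_ R i))
  (fun (h : R) y => k y * DQ P d i t ((x - y) + h *: e_ R i)) h (h - 1) (h + 1) (fun y => C * `|k y|).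
apply: (is_derive_eq (H _ _ _ _ _ _)).
- by apply/andP; split; lra.
- move=> z _; have := L2M (rapid_L2 rk) (L2_subl (x + z *: e_ R i) (rapid_L2 rQ)).
  by congr intble; apply/funext => y; rewrite addrAC.
- by move=> z y _; have := is_deriveZ (k y) (is_derive_Qx P d i (x - y) z t0).
- by move=> z y _; rewrite normrM mulrC ler_wpM2r.
- by move=> y; rewrite mulr_ge0.
- by apply: intbleZ; apply: intble_norm; exact: rapid_intble.
- by apply: Rint_eq => y; rewrite addrAC.
Qed.

Lemma is_derive_conv_time (k : V -> R) P d (j : nat) (t : R) (x : V) : rapid k -> homog d P -> 0 < t ->
  is_derive t (1 : R) (fun t : R => conv k (Q P d j t) x) (- conv k (Q P d j.+1 t) x).
Proof.
move=> rk hP t0; have [C [a [C0 a0 hC]]] := Q_unif j.+1 hP t0.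
have iQ := fun j t t0 => intble_conv x (rapid_L2 rk) (rapid_L2 (@rapid_Q P d j t hP t0)).
have H := @is_derive_Rint _ _ R mu (fun (t : R) (y : V) => k (x - y) * Q P d j t y)
  (fun (t : R) y => k (x - y) * - Q P d j.+1 t y) t (t / 2) (2 * t) (fun y => C * `|k (x - y)|).
rewrite convE; under eq_fun do rewrite convE.
apply: (is_derive_eq (H _ _ _ _ _ _)).
- by apply/andP; split; lra.
- by move=> z /andP[z0 _]; apply: iQ; apply: lt_trans z0; rewrite divr_gt0.
- move=> z y /andP[z0 _]; have zp : 0 < z by apply: lt_trans z0; rewrite divr_gt0.
  by have := is_deriveZ (k (x - y)) (is_derive_Q P d j y zp).
- move=> z y zI; rewrite normrM normrN mulrC ler_wpM2r//.
  apply: le_trans (hC z y zI) _; rewrite ler_piMr//.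
  by rewrite -expR0 ler_expR oppr_le0 mulr_ge0 ?sqn_ge0// ltW.
- by move=> y; rewrite mulr_ge0.
- by apply: intbleZ; apply: intble_norm; apply: intble_subl; exact: rapid_intble.
- rewrite -mulN1r -RintZ; last exact: iQ.
  by apply: Rint_eq => y; ring.
Qed.

Lemma conv_comm (k1 k2 : V -> R) (x : V) : rapid k1 -> rapid k2 -> conv k1 k2 x = conv k2 k1 x.
Proof.
move=> r1 r2; rewrite (conv_swap _ (rapid_L2 r1) (rapid_L2 r2)) convE.
by apply: Rint_eq => y; rewrite mulrC.
Qed.

Definition harm P := \sum_(i < n) mpoly.mderiv i (mpoly.mderiv i P) = 0.

Lemma harm_mderiv P i : harm P -> harm (mpoly.mderiv i P).
Proof.
rewrite /harm => hP; have H := congr1 (mpoly.mderiv i) hP; rewrite raddf_sum raddf0 in H; rewrite -[RHS]H.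
by apply: eq_bigr => j _; rewrite /= (mpoly.mderiv_comm i j) (mpoly.mderiv_comm i j).
Qed.

(** A kernel of degree d + 1 is a divergence of kernels of degree d: the Laplacian of P drops out
    and Euler's identity restores P from its derivatives. This is the step that raises the degree in
    [conv_H0Q0]. *)
Lemma Q_divergence P d (t : R) (y : V) : homog d.+1 P -> harm P -> 0 < t ->
  Q P d.+1 0 t y = - (2 * d.+1%:R)^-1 * \sum_(i < n) DQ (mpoly.mderiv i P) d i t y.
Proof.
move=> hP hh t0; rewrite /DQ -mulr_suml sumrB -ev_sum hh ev0 sub0r.
have -> : \sum_(i < n) 2 / t * y ord0 i * ev (mpoly.mderiv i P) y = 2 / t * (d.+1%:R * ev P y).
  by rewrite -(euler y hP) mulr_sumr; apply: eq_bigr => i _; rewrite mulrA.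
rewrite !QE !psi0 (_ : (d.+1.*2 + n = 2 + (d.*2 + n))%N)// exprD sqr_sqrtr ?ltW//.
have h1 : Num.sqrt t != 0 by rewrite lt0r_neq0// sqrtr_gt0.
have h2 := expf_neq0 (d.*2 + n) h1.
by field; rewrite h2 lt0r_neq0//= pnatr_eq0.
Qed.

(** Induction on the degree: convolution commutes with the divergence of [Q_divergence], and in
    degree 0 the claim is the Gaussian semigroup law. *)
Lemma conv_H0Q0 P d (s t : R) (x : V) : homog d P -> harm P -> 0 < s -> 0 < t ->
  conv (H 0 s) (Q P d 0 t) x = gam R n * Q P d 0 (s + t) x.
Proof.
move=> + + s0 t0; have st : 0 < s + t by rewrite addr_gt0.
elim: d P x => [|d IH] P x hP hh.
  have E r y : Q P 0 0 r y = ev P 0 * H 0 r y by rewrite QE HE (homog0_cst _ hP).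
  rewrite E mulrCA -conv_gauss// !convE -RintZ.
    by apply: Rint_eq => y; rewrite E mulrCA.
  by apply: intble_conv; apply: rapid_L2; exact: rapid_H.
have hd i := @homog_mderiv _ _ _ _ i hP.
have rH := rapid_H 0 s0.
have E i : conv (H 0 s) (DQ (mpoly.mderiv i P) d i t) x = gam R n * DQ (mpoly.mderiv i P) d i (s + t) x.
  have D1 := is_derive_conv_dir i x 0 rH (hd i) t0.
  have D2 := is_deriveZ (gam R n) (is_derive_Qx (mpoly.mderiv i P) d i x 0 st).
  have := is_derive_unique _ D1 D2; rewrite scale0r addr0; apply.
  by near=> z; rewrite IH//; exact: harm_mderiv.
rewrite Q_divergence// mulrCA mulr_sumr -(eq_bigr _ (fun i _ => E i)).
rewrite convE; under eq_bigr do rewrite convE.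
rewrite -Rint_sum; last by move=> i; apply: intble_conv; apply: rapid_L2 => //; exact: rapid_DQ.
rewrite -RintZ; last first.
  apply: intble_sum => i; apply: intble_conv; apply: rapid_L2 => //; exact: rapid_DQ.
by apply: Rint_eq => y; rewrite Q_divergence// mulrCA mulr_sumr.
Unshelve. all: by end_near. Qed.

Lemma is_derive_addl (f : R -> R) (s t a : R) : is_derive (s + t) (1 : R) f a ->
  is_derive t (1 : R) (fun t => f (s + t)) a.
Proof.
move=> df; have D := is_deriveD (is_derive_cst s t (1 : R)) (is_derive_id t (1 : R)).
have H := @is_derive1_comp R f (fun t => s + t) t _ _ df D.
by apply: (is_derive_eq H); rewrite add0r mulr1.
Qed.

(** The identity for j = k = 0 is differentiated in [t], then in [s]. Differentiation acts on the
    right factor, so for [s] the factors are exchanged and [H] is read as [Q 1 0]. *)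
Lemma conv_HQ P d (j k : nat) (s t : R) (x : V) : homog d P -> harm P -> 0 < s -> 0 < t ->
  conv (H j s) (Q P d k t) x = gam R n * Q P d (j + k) (s + t) x.
Proof.
move=> hP hh; elim: j k s t => [|j IHj] k s t s0 t0.
  elim: k t t0 => [|k IH] t t0; first exact: conv_H0Q0.
  have D1 := is_derive_conv_time k x (rapid_H 0 s0) hP t0.
  have D2 := is_deriveZ (gam R n) (is_derive_addl (is_derive_Q P d (0 + k) x (addr_gt0 s0 t0))).
  have := is_derive_unique _ D1 D2; rewrite /GRing.scale/= mulrN => H.
  apply: oppr_inj; apply: H.
  by near=> z; rewrite IH//; near: z; exact: lt_nbhsr.
have rQ := rapid_Q k hP t0.
have D1 := is_derive_conv_time j x rQ homog1 s0.
have D2 := is_deriveZ (gam R n) (is_derive_addl (is_derive_Q P d (j + k) x (addr_gt0 t0 s0))).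
have := is_derive_unique _ D1 D2; rewrite /GRing.scale/= mulrN [s + t]addrC => H.
apply: oppr_inj; rewrite -H.
  congr (- _); rewrite conv_comm//; last exact: rapid_H.
  by congr conv; apply/funext => y; rewrite QH.
near=> z; have z0 : 0 < z by near: z; exact: lt_nbhsr.
rewrite conv_comm//; last exact: rapid_Q homog1 z0.
rewrite /GRing.scale/= [t + z]addrC -IHj//; congr conv; apply/funext => y; exact: QH.
Unshelve. all: by end_near. Qed.

End kernels.

(** * Integration on a half-line *)

Section half_line.
Variable R : realType.
Local Notation lam := (@lebesgue_measure R).
Implicit Types f F g : R -> R.

Lemma Eint_half f : measurable_fun setT f ->
  (\int[lam]_x (ind R (0 < x)%R * f x)%:E = \int[lam]_(x in `[0%R, +oo[) (f x)%:E)%E.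
Proof.
move=> mf; rewrite -integral_itv_obnd_cbnd; last first.
  by apply/measurable_EFinP; exact: measurable_funTS.
rewrite [RHS]integral_mkcond; apply: eq_integral => x _.
rewrite patchE /ind; case: ifPn => h; case: ifPn => //; rewrite ?mul1r ?mul0r//.
  by rewrite notin_setE/= in_itv/= h.
by rewrite inE/= in_itv/= andbT (negbTE h).
Qed.

Lemma continuous_is_derive F (a : R) (x : R) : is_derive x (1 : R) F a -> {for x, continuous F}.
Proof.
by case=> dF _; apply: differentiable_continuous; apply/derivable1_diffP.
Qed.

Lemma FTC_half_ge0 f F (l : R) : measurable_fun setT f ->
  (forall x : R, 0 <= x -> 0 <= f x) -> (forall x : R, 0 <= x -> is_derive x (1 : R) F (f x)) ->
  (forall x : R, 0 <= x -> {for x, continuous f}) -> F x @[x --> +oo%R] --> l ->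
  intble lam (fun x => ind R (0 < x) * f x) /\ \int[lam]_x (ind R (0 < x) * f x) = l - F 0.
Proof.
move=> mf f0 dF cf Fl.
have E : (\int[lam]_x (ind R (0 < x)%R * f x)%:E = (l - F 0)%:E)%E.
  rewrite Eint_half// EFinB; apply: ge0_continuous_FTC2y => //.
  - apply: continuous_in_subspaceT => x; rewrite inE/= in_itv/= andbT; exact: cf.
  - by move=> x x0; have [] := dF x (ltW x0).
  - by apply: cvg_at_right_filter; exact: continuous_is_derive (dF 0 (lexx _)).
  - by move=> x; rewrite in_itv/= andbT => x0; rewrite derive1E; have [] := dF x (ltW x0).
have i : intble lam (fun x => ind R (0 < x) * f x).
  apply/intble_ge0P; last by rewrite E ltry.
    by apply: measurable_funM => //; exact: measurable_ind_lt.
  by move=> x; rewrite /ind; case: ifPn => h; rewrite ?mul0r// mul1r f0// ltW.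
by split=> //; apply: EFin_inj; rewrite RintE.
Qed.

Lemma dominated_cvg mu_d (T : measurableType mu_d) (mu : {measure set T -> \bar R})
    (h : nat -> T -> R) (h0 : T -> R) (g : T -> R) :
  (forall j, measurable_fun setT (h j)) -> measurable_fun setT h0 -> intble mu g ->
  {ae mu, forall x, h ^~ x @ \oo --> h0 x} ->
  (forall j x, `|h j x| <= g x) ->
  \int[mu]_x h j x @[j --> \oo] --> \int[mu]_x h0 x.
Proof.
move=> mh mh0 ig hc hg.
have [|||||i0 _ c] := @dominated_convergence _ T R mu setT measurableT (fun j => EFin \o h j) (EFin \o h0) (EFin \o g).
- by move=> j; exact/measurable_EFinP.
- exact/measurable_EFinP.
- by apply: filterS hc => x /= hx _; apply: cvg_EFin => //; exact: nearW.
- exact: ig.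
- by apply: aeW => x j _ /=; rewrite lee_fin.
- have := c; rewrite (_ : (\int[mu]_(x in setT) (EFin \o h0) x)%E = (\int[mu]_x h0 x)%:E).
    by move=> /fine_cvg.
  by rewrite RintE.
Qed.

Lemma FTC_seg f F (a b : R) : a < b -> (forall x : R, is_derive x (1 : R) F (f x)) ->
  continuous f -> 
  intble lam (fun x => ind R (a < x < b) * f x) /\ \int[lam]_x (ind R (a < x < b) * f x) = F b - F a.
Proof.
move=> ab dF cf.
have mf : measurable_fun setT f by exact: continuous_measurable_fun.
have mi : measurable_fun setT (fun x : R => ind R (a < x < b)).
  by apply: measurable_ind; apply: measurable_and; exact: measurable_fun_ltr.
have E h : measurable_fun setT h -> 
   (\int[lam]_x (ind R (a < x < b)%R * h x)%:E = \int[lam]_(x in `[a, b]) (h x)%:E)%E.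
  move=> mh; rewrite -integral_itv_obnd_cbnd; last first.
    by apply/measurable_EFinP; exact: measurable_funTS.
  rewrite -integral_itv_bndo_bndc; last first.
    by apply/measurable_EFinP; exact: measurable_funTS.
  rewrite [RHS]integral_mkcond; apply: eq_integral => x _.
  rewrite patchE /ind; case: ifPn => c; case: ifPn => //; rewrite ?mul1r ?mul0r//.
    by rewrite notin_setE/= in_itv/= c.
  by rewrite inE/= in_itv/= (negbTE c).
have i : intble lam (fun x => ind R (a < x < b) * f x).
  apply/intble_normP; first exact: measurable_funM.
  under eq_integral do rewrite normrM ind_norm.
  rewrite E; last exact: measurableT_comp.
  have : lam.-integrable `[a, b] (EFin \o f).
    by apply: continuous_compact_integrable; [exact: segment_compact|exact: continuous_subspaceT].
  by move=> /integrableP[].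
split=> //; apply: EFin_inj; rewrite RintE// E// EFinB; apply: continuous_FTC2 => //.
- exact: continuous_subspaceT.
- split.
  + by move=> x _; have [] := dF x.
  + by apply: cvg_at_right_filter; exact: continuous_is_derive (dF a).
  + by apply: cvg_at_left_filter; exact: continuous_is_derive (dF b).
- by move=> x _; rewrite derive1E; have [] := dF x.
Qed.

Lemma cvg_nat_pinfty F (l : R) : F x @[x --> +oo%R] --> l -> F j.+1%:R @[j --> \oo] --> l.
Proof.
move=> Fl; have h : (j.+1%:R : R) @[j --> \oo] --> +oo%R.
  by have := @cvgr_idn R; rewrite -(cvg_shiftS (fun j : nat => j%:R : R)).
exact: (cvg_comp _ _ h Fl).
Qed.

(** For integrands without a sign: the integral over bounded intervals is evaluated first, and
    integrability allows the limit. *)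
Lemma FTC_half f F (l : R) : (forall x : R, is_derive x (1 : R) F (f x)) ->
  continuous f -> F x @[x --> +oo%R] --> l -> intble lam (fun x => ind R (0 < x) * f x) ->
  \int[lam]_x (ind R (0 < x) * f x) = l - F 0.
Proof.
move=> dF cf Fl i.
have mf : measurable_fun setT f by exact: continuous_measurable_fun.
have mi (b : R) : measurable_fun setT (fun x : R => ind R (0 < x < b)).
  by apply: measurable_ind; apply: measurable_and; exact: measurable_fun_ltr.
have C : \int[lam]_x (ind R (0 < x < j.+1%:R) * f x) @[j --> \oo] --> \int[lam]_x (ind R (0 < x) * f x).
  apply: (@dominated_cvg _ (measurableTypeR R) lam (fun j (x : R) => ind R (0 < x < j.+1%:R) * f x) _ (fun x => `|ind R (0 < x) * f x|)).
  - by move=> j; exact: (measurable_funM (mi _) mf).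
  - exact: intble_measurable i.
  - exact: intble_norm.
  - apply: aeW => x /=; apply: cvgM; last exact: cvg_cst.
    apply: cvg_near_cst; near=> j; have h : x < j.+1%:R.
      near: j; have := nbhs_infty_gtr x; apply: filterS => j /lt_trans; apply.
      by rewrite ltr_nat.
    by rewrite h andbT.
  - move=> j x; rewrite !normrM ler_wpM2r// !ind_norm /ind.
    by case: (0 < x) => //=; case: ifP.
have C2 : (F j.+1%:R - F 0) @[j --> \oo] --> l - F 0.
  by apply: cvgB; [exact: cvg_nat_pinfty|exact: cvg_cst].
have E j : \int[lam]_x (ind R (0 < x < j.+1%:R) * f x) = F j.+1%:R - F 0.
  by apply: (FTC_seg _ dF cf).2; rewrite ltr0n.
by move: C; under eq_cvg do rewrite E; move/cvg_unique; apply.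
Unshelve. all: by end_near. Qed.

Lemma cvg_expRN (a : R) : 0 < a -> expR (- (a * x)) @[x --> +oo%R] --> (0 : R).
Proof.
move=> a0; have h : a * x @[x --> +oo%R] --> +oo%R.
  under eq_fun do rewrite mulrC; apply: gt0_cvgMly => //; exact: cvg_id.
exact: (cvg_comp _ _ h (@cvgr_expR R)).
Qed.

Lemma half_exp (a : R) : 0 < a ->
  intble lam (fun x => ind R (0 < x) * expR (- (a * x))) /\
  \int[lam]_x (ind R (0 < x) * expR (- (a * x))) = a^-1.
Proof.
move=> a0; have an := lt0r_neq0 a0.
have D (x : R) : is_derive x (1 : R) (fun x => - a^-1 * expR (- (a * x))) (expR (- (a * x))).
  have D1 := is_deriveN (is_deriveZ a (is_derive_id x (1 : R))).
  have D2 := @is_derive1_comp R expR _ x _ _ (is_derive_expR _) D1.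
  have D3 := is_deriveZ (- a^-1) D2.
  by apply: (is_derive_eq D3); rewrite /GRing.scale/= mulr1; field.
have D' (x : R) : is_derive x (1 : R) (fun x => expR (- (a * x))) (- a * expR (- (a * x))).
  have D1 := is_deriveN (is_deriveZ a (is_derive_id x (1 : R))).
  have D2 := @is_derive1_comp R expR _ x _ _ (is_derive_expR _) D1.
  by apply: (is_derive_eq D2); rewrite /GRing.scale/= mulr1; ring.
have cf : continuous (fun x : R => expR (- (a * x))) by move=> x; exact: continuous_is_derive (D' x).
have Fl : - a^-1 * expR (- (a * x)) @[x --> +oo%R] --> (0 : R).
  rewrite -[X in _ --> X](mulr0 (- a^-1)); apply: cvgM; first exact: cvg_cst.
  exact: cvg_expRN.
have [|||i E] := @FTC_half_ge0 (fun x => expR (- (a * x))) _ 0 _ _ (fun x _ => D x) _ Fl.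
- exact: continuous_measurable_fun.
- by move=> x _; exact: expR_ge0.
- by move=> x _; exact: cf.
by split=> //; rewrite E mulr0 oppr0 expR0 mulr1; ring.
Qed.

Lemma half_inv2 : intble lam (fun x => ind R (0 < x) * (1 + x) ^- 2).
Proof.
have p (x : R) : 0 <= x -> 1 + x != 0 by move=> x0; rewrite lt0r_neq0// ltr_pwDl.
have D0 (x : R) : is_derive x (1 : R) (fun x => 1 + x) 1.
  have := is_deriveD (is_derive_cst (1 : R) x (1 : R)) (is_derive_id x (1 : R)).
  by move=> h; apply: (is_derive_eq h); rewrite add0r.
have D1 (x : R) : 0 <= x -> is_derive x (1 : R) (fun x => (1 + x)^-1) (- (1 + x) ^- 2).
  move=> x0; have h := @is_deriveV R (fun x => 1 + x) x _ 1 (p x x0) (D0 x).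
  by apply: (is_derive_eq h); rewrite /GRing.scale/= mulr1.
have c (x : R) : 0 <= x -> {for x, continuous (fun x : R => (1 + x) ^- 2)}.
  move=> x0; have h := continuous_is_derive (D1 x x0).
  rewrite (_ : (fun x : R => _) = (fun x : R => (1 + x)^-1 * (1 + x)^-1)); first exact: continuousM.
  by apply/funext => y; rewrite -invfM expr2.
have D2 (x : R) : 0 <= x -> is_derive x (1 : R) (fun x => - (1 + x)^-1) ((1 + x) ^- 2).
  by move=> x0; have h := is_deriveN (D1 x x0); apply: (is_derive_eq h); rewrite opprK.
have Fl : - (1 + x)^-1 @[x --> +oo%R] --> (0 : R).
  rewrite -oppr0; apply: cvgN; apply/(gtr0_cvgV0 (f := fun x : R => 1 + x)).
    near=> x; have : 0 < x by near: x; exact: nbhs_pinfty_gt. 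
    by move=> x0; rewrite addr_gt0.
  apply/cvgryPge => A; near=> x.
  have : A <= x by near: x; apply: nbhs_pinfty_ge; exact: num_real.
  by move=> h; rewrite (le_trans h)// lerDr.
have m : measurable_fun setT (fun x : R => (1 + x) ^- 2).
  rewrite (_ : (fun x : R => _) = (fun x : R => ((1 + x)^-1) ^+ 2)); last first.
    by apply/funext => y; rewrite exprVn.
  by apply: measurable_funX; apply: measurable_inv; exact: measurable_funD.
have h0 (x : R) : 0 <= x -> 0 <= (1 + x) ^- 2 by move=> _; rewrite invr_ge0 sqr_ge0.
by have [] := FTC_half_ge0 m h0 D2 c Fl.
Unshelve. all: by end_near. Qed.

End half_line.

(** * Sums of exponentials and the density identity *)

Section exponential_sums.
Variable R : realType.
Local Notation lam := (@lebesgue_measure R).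

(** Sums of exponentials with coefficient [p.1] and rate [p.2]; dividing by the r-th power of the
    rate amounts to r-fold tail integration in [u]. *)
Definition es (S : seq (R * R)) r (u : R) : R := \sum_(p <- S) p.1 * p.2^-1 ^+ r * expR (- (p.2 * u)).

(* Binomial expansion of 1 - (1 - z)^(2^(j+1)) with z = 2^(-(j+1)u), which tends to
   the indicator function of [u < 1] when [u != 1]. *)
Definition cut j : seq (R * R) :=
  [seq (- ((-1) ^+ k.+1 * 'C(2 ^ j.+1, k.+1)%:R), ln 2 * j.+1%:R * k.+1%:R) | k <- iota 0 (2 ^ j.+1)].

Lemma ln2_gt0 : 0 < ln 2 :> R.
Proof. by rewrite ln_gt0// ltr1n. Qed.

Lemma cut_gt0 j p : p \in cut j -> 0 < p.2.
Proof. by case/mapP => k _ ->/=; rewrite !mulr_gt0// ln2_gt0. Qed.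

Lemma measurable_es S r : measurable_fun setT (es S r).
Proof.
apply: measurable_sum => p; apply: measurable_funM => //; apply: measurableT_comp => //.
by apply: measurable_funN; exact: measurable_funM.
Qed.

Lemma es_tail S r u : (forall p, p \in S -> 0 < p.2) ->
  intble lam (fun s => ind R (0 < s) * es S r (u + s)) /\
  \int[lam]_s (ind R (0 < s) * es S r (u + s)) = es S r.+1 u.
Proof.
elim: S => [|p S IH] hS.
  rewrite (_ : (fun s => _) = cst 0); last by apply/funext => s; rewrite /es big_nil mulr0.
  split; first exact: integrable0.
  by rewrite /es big_nil Rintegral_cst//= mul0r.
have [i E] := IH (fun q qS => hS q (mem_behead (s := p :: S) qS)).
have p0 : 0 < p.2 by apply: hS; rewrite mem_head.
have [i1 E1] := half_exp p0.
pose c := p.1 * p.2^-1 ^+ r * expR (- (p.2 * u)).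
rewrite (_ : (fun s => _) = (fun s => c * (ind R (0 < s) * expR (- (p.2 * s))) + ind R (0 < s) * es S r (u + s))); last first.
  by apply/funext => s; rewrite /es big_cons/= mulrDr (mulrDr p.2) opprD expRD /c; ring.
split; first by apply: intbleD => //; exact: intbleZ.
rewrite RintD//; last exact: intbleZ.
rewrite RintZ// E1 E /es big_cons/= exprSr /c; congr (_ + _); ring.
Qed.

Lemma bernoulli_sub (z : R) k : 0 <= z <= 1 -> 1 - k%:R * z <= (1 - z) ^+ k.
Proof.
move=> /andP[z0 z1]; elim: k => [|k IH]; first by rewrite mul0r subr0.
rewrite exprS; apply: le_trans (ler_wpM2l _ IH); last by rewrite subr_ge0.
have h : 0 <= k%:R * z * z by rewrite !mulr_ge0.
by rewrite -natr1; nra.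
Qed.

Let z j (u : R) : R := expR (- (ln 2 * j.+1%:R * u)).

Let z01 j u : 0 <= u -> 0 <= z j u <= 1.
Proof.
by move=> u0; rewrite expR_ge0/= -expR0 ler_expR oppr_le0 !mulr_ge0// ltW// ln2_gt0.
Qed.

Lemma es_cut j u : es (cut j) 0 u = 1 - (1 - z j u) ^+ (2 ^ j.+1).
Proof.
rewrite exprBn big_ord_recl/= expr0 !expr1n bin0 !mulr1 mulr1n opprD addrA subrr add0r.
rewrite /es big_map (_ : iota 0 (2 ^ j.+1) = index_iota 0 (2 ^ j.+1)); last by rewrite /index_iota subn0.
rewrite big_mkord -sumrN; apply: eq_bigr => k _; rewrite expr0 mulr1 /bump/= add1n expr1n mulr1 /z.
rewrite -expRM_natr -[X in _ = - X]mulr_natr mulNr; congr (- _).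
by rewrite [RHS]mulrAC; congr (_ * _ * expR _); ring.
Qed.

(** This number is 2^((j+1)(1-u)). It tends to infinity for u < 1 and to 0 for u > 1, which decides
    the limit of (1 - z)^(2^(j+1)) in both cases. *)
Let Nz j u : (2 ^ j.+1)%:R * z j u = expR (ln 2 * (1 - u) * j.+1%:R).
Proof.
rewrite natrX -{1}(@lnK R 2) ?posrE// -expRM_natr -expRD; congr expR; ring.
Qed.

Lemma es_cut_le j u : 0 <= u -> 0 <= es (cut j) 0 u <= Num.min 1 (expR (ln 2 * (1 - u) * j.+1%:R)).
Proof.
move=> u0; rewrite es_cut; have /andP[a b] := z01 j u0.
have c : (1 - z j u) ^+ (2 ^ j.+1) <= 1 by rewrite exprn_ile1//; lra.
have d : 0 <= (1 - z j u) ^+ (2 ^ j.+1) by rewrite exprn_ge0//; lra.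
rewrite subr_ge0 c/= le_min -Nz; have := bernoulli_sub (2 ^ j.+1) (z01 j u0).
by move=> h; apply/andP; split; lra.
Qed.

(** The bound is uniform in [j], hence good for dominated convergence. For r = 0 both cases of the
    minimum in [es_cut_le] are at most 2^(1-u); tail integration gives the rest. *)
Lemma es_bound j r u : 0 <= u -> `|es (cut j) r u| <= 2 * (ln 2)^-1 ^+ r * expR (- (ln 2 * u)).
Proof.
have l2 := ln2_gt0.
elim: r u => [|r IH] u u0.
  have /andP[a b] := es_cut_le j u0; rewrite ger0_norm// expr0 mulr1.
  have -> : 2 * expR (- (ln 2 * u)) = expR (ln 2 * (1 - u)).
    by rewrite -{1}(@lnK R 2) ?posrE// -expRD; congr expR; ring.
  apply: le_trans b _; rewrite ge_min; have [u1|u1] := leP u 1.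
    by rewrite -{1}expR0 ler_expR mulr_ge0 ?(ltW l2)// subr_ge0.
  apply/orP; right; rewrite ler_expR.
  have q : ln 2 * (1 - u) < 0 by rewrite pmulr_rlt0// subr_lt0.
  have : (1 : R) <= j.+1%:R by rewrite ler1n.
  by move: (j.+1%:R : R) => J; nra.
have [i E] := es_tail r u (@cut_gt0 j).
have [i1 E1] := half_exp l2.
rewrite -E.
have -> : 2 * (ln 2)^-1 ^+ r.+1 * expR (- (ln 2 * u)) = \int[lam]_s (2 * (ln 2)^-1 ^+ r * expR (- (ln 2 * u)) * (ind R (0 < s) * expR (- (ln 2 * s)))).
  by rewrite RintZ// E1 exprSr; ring.
apply: Rint_norm_le => //; first exact: intbleZ.
move=> s; rewrite normrM ind_norm /ind; case: ifPn => s0; last by rewrite !mul0r mulr0.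
rewrite !mul1r; apply: le_trans (IH _ _) _; first by rewrite addr_ge0// ltW.
by rewrite mulrDr opprD expRD mulrA.
Qed.

(* The [r]-fold iterated tail integral of the indicator function of [u < 1]. *)
Definition om r (u : R) : R := if u < 1 then (1 - u) ^+ r / r`!%:R else 0.

Lemma measurable_om r : measurable_fun setT (om r).
Proof.
apply: measurable_fun_ifT => //; first exact: measurable_fun_ltr.
by apply: measurable_funM => //; apply: measurable_funX; exact: measurable_funB.
Qed.

Lemma om_tail r u : \int[lam]_s (ind R (0 < s) * om r (u + s)) = om r.+1 u.
Proof.
have [u1|u1] := ltP u 1; last first.
  rewrite (_ : (fun s => _) = fun s => 0 * (ind R (0 < s) * expR (- (1 * s)))).
    by rewrite RintZ ?mul0r; [rewrite /om ltNge u1|exact: (half_exp ltr01).1].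
  apply/funext => s; rewrite mul0r /ind; case: ifPn => s0; last by rewrite mul0r.
  by rewrite mul1r /om ltNge (le_trans u1)// lerDl ltW.
pose F (s : R) := - ((1 - u - s) ^+ r.+1 / r.+1`!%:R).
have D0 (s : R) : is_derive s (1 : R) (fun s => 1 - u - s) (- 1).
  have := is_deriveB (is_derive_cst (1 - u) s (1 : R)) (is_derive_id s (1 : R)).
  by move=> h; apply: (is_derive_eq h); rewrite add0r.
have D1 k (s : R) : is_derive s (1 : R) (fun s => (1 - u - s) ^+ k.+1) (- k.+1%:R * (1 - u - s) ^+ k).
  have h := is_deriveX k.+1 (D0 s).
  rewrite (_ : (fun s => _) = (fun s : R => 1 - u - s) ^+ k.+1); last by apply/funext => x; rewrite !fctE.
  by apply: (is_derive_eq h); rewrite /GRing.scale/= -mulr_natl; ring.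
have D2 (s : R) : is_derive s (1 : R) F ((1 - u - s) ^+ r / r`!%:R).
  have h := is_deriveN (is_deriveZ (r.+1`!%:R^-1) (D1 r s)).
  rewrite (_ : F = - (fun s => r.+1`!%:R^-1 *: (1 - u - s) ^+ r.+1)); last first.
    by apply/funext => x; rewrite !fctE /F /GRing.scale/= mulrC.
  apply: (is_derive_eq h); rewrite /GRing.scale/= factS natrM invfM.
  have f0 : r`!%:R != 0 :> R by rewrite pnatr_eq0 -lt0n fact_gt0.
  have f1 : r.+1%:R != 0 :> R by rewrite pnatr_eq0.
  by move: (r.+1%:R : R) f1 => c c0; field; rewrite f0.
have c : continuous (fun s : R => (1 - u - s) ^+ r / r`!%:R).
  move=> s; apply: cvgM; last exact: cvg_cst.
  case: r {F D2} => [|k]; first by under eq_fun do rewrite expr0; exact: cvg_cst.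
  exact: continuous_is_derive (D1 k s).
have p : 0 < 1 - u by rewrite subr_gt0.
have [_] := FTC_seg p D2 c; rewrite /F subrr [0 ^+ _]exprS !mul0r subr0 opprK oppr0 add0r.
rewrite /om u1 => <-; apply: Rint_eq => s.
rewrite /ind; case: (ltP 0 s) => //= s0; last by rewrite !mul0r.
by rewrite ltrBrDl; case: ifP => _; rewrite ?mul0r ?mulr0// !mul1r opprD addrA.
Qed.

Lemma cvg_expRN_nat (a : R) : 0 < a -> expR (- (a * j.+1%:R)) @[j --> \oo] --> (0 : R).
Proof. by move=> a0; exact: cvg_nat_pinfty (cvg_expRN a0). Qed.

Lemma es_lim0 u : 0 <= u -> u != 1 -> es (cut j) 0 u @[j --> \oo] --> om 0 u.
Proof.
move=> u0; rewrite neq_lt => /orP[u1|u1]; rewrite /om.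
  rewrite u1 expr0 fact0 divr1; pose a := ln 2 * (1 - u).
  have a0 : 0 < a by rewrite mulr_gt0 ?ln2_gt0// subr_gt0.
  apply: (@squeeze_cvgr _ _ _ _ (fun j => 1 - expR (- (a * j.+1%:R))) (fun=> 1)).
  - near=> j; have /andP[_] := es_cut_le j u0; rewrite le_min => /andP[-> _].
    rewrite andbT es_cut lerD2l lerN2.
    (* (1 - z)^M <= e^(-M z) with M = 2^(j+1), and M z = e^(a (j+1)) >= a (j+1). *)
    apply: (@le_trans _ _ (expR (- z j u) ^+ (2 ^ j.+1))).
      rewrite lerXn2r ?nnegrE ?expR_ge0//; first by have /andP[] := z01 j u0; lra.
      exact: expR_ge1Dx.
    rewrite -expRM_natr ler_expR mulNr lerN2 [z _ _ * _]mulrC Nz; exact: le_expR.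
  - by rewrite -[X in _ --> X]subr0; apply: cvgB; [exact: cvg_cst|exact: cvg_expRN_nat].
  - exact: cvg_cst.
rewrite ltNge (ltW u1)/=; pose a := ln 2 * (u - 1).
have a0 : 0 < a by rewrite mulr_gt0 ?ln2_gt0// subr_gt0.
apply: (@squeeze_cvgr _ _ _ _ (fun=> 0) (fun j => expR (- (a * j.+1%:R)))).
- near=> j; have /andP[->] := es_cut_le j u0; rewrite le_min => /andP[_].
  by rewrite /= (_ : ln 2 * _ * _ = - (a * j.+1%:R))// /a; ring.
- exact: cvg_cst.
- exact: cvg_expRN_nat.
Unshelve. all: by end_near. Qed.

(** For r = 0 and u = 1 the limit would be 1 - 1/e instead of 0. From r = 1 on, this exceptional
    point is null inside the tail integral. *)
Lemma es_lim r u : 0 <= u -> (u != 1) || (0 < r)%N -> es (cut j) r u @[j --> \oo] --> om r u.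
Proof.
elim: r u => [|r IH] u u0; first by rewrite orbF; exact: es_lim0.
move=> _; rewrite -om_tail.
rewrite (_ : (fun j => _) = (fun j => \int[lam]_s (ind R (0 < s) * es (cut j) r (u + s)))); last first.
  by apply/funext => j; rewrite (es_tail r u (@cut_gt0 j)).2.
have mi : measurable_fun setT (fun s : R => ind R (0 < s)) by exact: measurable_ind_lt.
have ma : measurable_fun setT (fun s : R => u + s) by exact: measurable_funD.
apply: (@dominated_cvg _ _ (measurableTypeR R) lam _ _ (fun s => 2 * (ln 2)^-1 ^+ r * (ind R (0 < s) * expR (- (ln 2 * s))))).
- by move=> j; apply: (measurable_funM mi); exact: measurableT_comp (measurable_es _ _) ma.
- by apply: (measurable_funM mi); exact: measurableT_comp (measurable_om _) ma.
- by apply: intbleZ; exact: (half_exp ln2_gt0).1.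
- exists [set 1 - u]; split=> //; first exact: lebesgue_measure_set1.
  move=> s /=; apply: contra_notP => /eqP su; rewrite /ind; case: ifPn => s0; last first.
    by under eq_fun do rewrite mul0r; rewrite mul0r; exact: cvg_cst.
  under eq_fun do rewrite mul1r; rewrite mul1r; apply: IH.
    by rewrite addr_ge0// ltW.
  by apply/orP; left; apply: contra su => /eqP <-; apply/eqP; ring.
- move=> j s; rewrite normrM ind_norm /ind; case: ifPn => s0; last by rewrite !mul0r mulr0.
  rewrite !mul1r; apply: le_trans (es_bound _ _ _) _; first by rewrite addr_ge0// ltW.
  rewrite ler_wpM2l//; first by rewrite mulr_ge0// exprn_ge0// invr_ge0 ltW// ln2_gt0.
  by rewrite ler_expR lerN2 ler_wpM2l ?(ltW ln2_gt0)// lerDr.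
Qed.

End exponential_sums.

Lemma cvg_sumr (R : realType) (I : Type) (r : seq I) (f : I -> nat -> R) (l : I -> R) :
  (forall i, f i j @[j --> \oo] --> l i) ->
  \sum_(i <- r) f i j @[j --> \oo] --> \sum_(i <- r) l i.
Proof.
move=> fl; elim: r => [|i r IH].
  by under eq_fun do rewrite big_nil; rewrite big_nil; exact: cvg_cst.
by under eq_fun do rewrite big_cons; rewrite big_cons; exact: cvgD.
Qed.

Section density.
Variables (R : realType) (n : nat).
Local Notation V := 'rV[R]_n.
Local Notation mu := (lebesgue_rV R n).
Local Notation poly := (mpoly.mpoly n R).
Implicit Types (P : poly).

Lemma convDr (k f h : V -> R) (x : V) : L2 mu k -> L2 mu f -> L2 mu h ->
  conv k (fun y => f y + h y) x = conv k f x + conv k h x.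
Proof.
move=> Lk Lf Lh; rewrite !convE -RintD; try exact: intble_conv.
by apply: Rint_eq => y; rewrite mulrDr.
Qed.

Lemma convZ (k f : V -> R) (c : R) (x : V) : L2 mu k -> L2 mu f ->
  conv k (fun y => c * f y) x = c * conv k f x.
Proof.
move=> Lk Lf; rewrite !convE -RintZ; last exact: intble_conv.
by apply: Rint_eq => y; rewrite mulrCA.
Qed.

Lemma rapid_ev_exp P d (a : R) : homog d P -> 0 < a -> rapid (fun y : V => ev P y * expR (- (a * sqn y))).
Proof.
move=> hP a0; split.
  by apply: measurable_funM; [exact: measurable_ev|exact: measurable_gauss].
have a2 : 0 < a / 2 by rewrite divr_gt0.
have [C C0 hC] := ev_expR_bound hP a2.
exists C, (a / 2); split=> // y; rewrite normrM (ger0_norm (expR_ge0 _)).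
apply: le_trans (ler_wpM2r (expR_ge0 _) (hC y)) _.
by rewrite -mulrA -expRD (_ : a / 2 * sqn y - a * sqn y = - (a / 2 * sqn y))//; field.
Qed.

Lemma rapid_hornerX_exp (p : {poly R}) (a : R) : 0 < a ->
  rapid (fun y : V => p.[sqn y] * expR (- (a * sqn y))).
Proof.
move=> a0; split.
  apply: measurable_funM; last exact: measurable_gauss.
  have H : measurable_fun setT (horner p) by apply: continuous_measurable_fun; exact: continuous_horner.
  exact: measurableT_comp H (@measurable_sqn R n).
have a2 : 0 < a / 2 by rewrite divr_gt0.
have [C C0 hC] := poly_expR_bound p a2.
exists C, (a / 2); split=> // y; rewrite normrM (ger0_norm (expR_ge0 _)).
apply: le_trans (ler_wpM2r (expR_ge0 _) (hC _ (sqn_ge0 y))) _.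
by rewrite -mulrA -expRD (_ : a / 2 * sqn y - a * sqn y = - (a / 2 * sqn y))//; field.
Qed.

(* For [w r u = l^-r e^(-l u)] this is [l^-(m+1)] times the Laguerre factor of
   [psi n m]; being linear in [w], it applies to every superposition of exponentials
   together with its iterated tail integrals [w r]. *)
Definition prof (m : nat) (w : nat -> R -> R) (u : R) : R :=
  \sum_(i < m.+1) (lag R n m)`_i * u ^+ i * w (m.+1 - i)%N u.

Lemma size_lag N k : (size (lag R N k) <= k.+1)%N.
Proof.
elim: k => [|k IH] /=; first by rewrite size_poly1.
apply: (leq_trans (size_polyD _ _)); rewrite geq_max; apply/andP; split.
  apply: (leq_trans (size_polyD _ _)); rewrite geq_max size_polyN; apply/andP; split.
    rewrite mul_polyC; apply: (leq_trans (size_scale_leq _ _)); exact: leq_trans IH _.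
  by rewrite mulrC; apply: leq_trans (size_polyMleq _ _) _; rewrite size_polyX addn2.
rewrite mulrC; apply: leq_trans (size_polyMleq _ _) _; rewrite size_polyX addn2/=.
have [->|p0] := eqVneq (lag R N k) 0; first by rewrite deriv0 size_poly0.
by apply: (leq_trans (lt_size_deriv p0)); exact: leqW.
Qed.

Lemma prof_exp m (l u : R) : 0 < l ->
  prof m (fun r u => l^-1 ^+ r * expR (- (l * u))) u = (l^-1 ^+ m.+1) * (lag R n m).[l * u] * expR (- (l * u)).
Proof.
move=> l0; have ln := lt0r_neq0 l0.
rewrite (@horner_coef_wide _ m.+1)//; last exact: size_lag.
rewrite mulr_sumr mulr_suml; apply: eq_bigr => i _.
have -> : l^-1 ^+ m.+1 = l^-1 ^+ (m.+1 - i) * l^-1 ^+ i by rewrite -exprD subnK// ltnW.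
have h := expf_neq0 i ln; rewrite exprMn [l^-1 ^+ i]exprVn.
by move: (l^-1 ^+ (m.+1 - i)) => a; field.
Qed.

(** The two sides are the same multiple of Q_(m+1) at time v + 1/l. The powers of [l] agree because
    d - m = m + 1: this is how d = 2m + 1 enters. *)
Lemma density_exp m P (v l : R) (x : V) : homog m.*2.+1 P -> harm P -> 0 < v -> 0 < l ->
  conv (H m.+1 v) (fun y => ev P y * expR (- (l * sqn y))) x =
  conv (Q P m.*2.+1 1 v) (fun y => prof m (fun r u => l^-1 ^+ r * expR (- (l * u))) (sqn y)) x.
Proof.
move=> hP hh v0 l0; set d := m.*2.+1 in hP *.
have s0 : 0 < l^-1 by rewrite invr_gt0.
have ln := lt0r_neq0 l0.
have h1 : Num.sqrt l^-1 != 0 by rewrite lt0r_neq0// sqrtr_gt0.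
pose c := Num.sqrt l^-1 ^+ (d.*2 + n).
have E1 (y : V) : ev P y * expR (- (l * sqn y)) = c * Q P d 0 l^-1 y.
  rewrite !QE psi0 invrK [sqn y * l]mulrC /c.
  by have h2 := expf_neq0 (d.*2 + n) h1; field.
have E2 (y : V) : prof m (fun r u => l^-1 ^+ r * expR (- (l * u))) (sqn y) = c * H m l^-1 y.
  rewrite prof_exp// HE /psi invrK [sqn y * l]mulrC /c exprD -mul2n exprM sqr_sqrtr ?ltW//.
  have h2 := expf_neq0 n h1; have h3 := expf_neq0 m (lt0r_neq0 s0).
  rewrite /d -addnn -addnS exprD.
  by move: (l^-1 ^+ m) (l^-1 ^+ m.+1) h3 => a b a0; field; rewrite a0 h2.
rewrite (_ : (fun y => ev P y * _) = (fun y => c * Q P d 0 l^-1 y)); last exact/funext.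
rewrite (_ : (fun y => prof _ _ _) = (fun y => c * H m l^-1 y)); last exact/funext.
have rH := fun k t t0 => @rapid_H R n k t t0.
have rQ := fun k t t0 => @rapid_Q R n P d k t hP t0.
rewrite !convZ; try by apply: rapid_L2; [exact: rH || exact: rQ].
rewrite conv_HQ// [in RHS]conv_comm; [|exact: rQ|exact: rH].
by rewrite conv_HQ// addn0 addn1 addrC.
Qed.

Lemma density_es m P (v : R) (S : seq (R * R)) (x : V) : homog m.*2.+1 P -> harm P -> 0 < v ->
  (forall p, p \in S -> 0 < p.2) ->
  let A y := ev P y * es S 0 (sqn y) in
  let B y := prof m (es S) (sqn y) in
  [/\ rapid A, rapid B & conv (H m.+1 v) A x = conv (Q P m.*2.+1 1 v) B x].
Proof.
move=> hP hh v0; elim: S => [|p S IH] hS.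
  have EA : (fun y : V => ev P y * es [::] 0 (sqn y)) = (fun y => 0 * H 0 v y).
    by apply/funext => y; rewrite /es big_nil mulr0 mul0r.
  have EB : (fun y : V => prof m (es [::]) (sqn y)) = (fun y => 0 * H 0 v y).
    by apply/funext => y; rewrite /prof big1 ?mul0r// => i _; rewrite /es big_nil mulr0.
  have r := rapid_H n 0 v0.
  rewrite /= EA EB; split; try exact: rapidZ.
  by rewrite !convZ ?mul0r//; first [exact: rapid_L2 (rapid_H n m.+1 v0)|exact: rapid_L2 (rapid_Q 1 hP v0)|exact: rapid_L2 r].
have p0 : 0 < p.2 by apply: hS; rewrite mem_head.
have [rA rB E] := IH (fun q qS => hS q (mem_behead (s := p :: S) qS)).
move=> A B.
have EA : A = fun y : V => p.1 * (ev P y * expR (- (p.2 * sqn y))) + ev P y * es S 0 (sqn y).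
  by apply/funext => y; rewrite /A /es big_cons expr0 mulr1 mulrDr mulrCA.
have EB : B = fun y : V => p.1 * prof m (fun r u => p.2^-1 ^+ r * expR (- (p.2 * u))) (sqn y) + prof m (es S) (sqn y).
  apply/funext => y; rewrite /B /prof mulr_sumr -big_split; apply: eq_bigr => i _ /=.
  by rewrite /es big_cons; ring.
have r1 := rapid_ev_exp hP p0.
have r2 : rapid (fun y : V => prof m (fun r u => p.2^-1 ^+ r * expR (- (p.2 * u))) (sqn y)).
  under eq_fun do rewrite prof_exp//.
  have := rapidZ (p.2^-1 ^+ m.+1) (rapid_hornerX_exp (lag R n m \Po (p.2 *: 'X)) p0).
  congr rapid; apply/funext => y; rewrite horner_comp hornerZ hornerX; ring.
have rH := rapid_H n m.+1 v0; have rQ := rapid_Q 1 hP v0.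
split; first by rewrite EA; apply: rapidD => //; exact: rapidZ.
  by rewrite EB; apply: rapidD => //; exact: rapidZ.
rewrite EA EB !convDr; try (by apply: rapid_L2 => //; exact: rapidZ).
by rewrite !convZ ?E ?density_exp//; exact: rapid_L2.
Qed.

Lemma measurable_sphere : measurable [set y : V | hr_enorm y = 1].
Proof.
have := @measurable_hr_enorm R n measurableT [set 1] (measurable_set1 _).
by rewrite setTI; congr measurable.
Qed.

Lemma sphere_mu0 : mu [set y : V | hr_enorm y = 1] = 0%E.
Proof.
rewrite -[mu _]mul1e -integral_cst; last exact: measurable_sphere.
rewrite integral_mkcond -(sphere_null R n); apply: eq_integral => y _.
rewrite patchE /ind; case: eqP => h; first by rewrite mem_set.
by rewrite memNset.
Qed.

(** Limit of [density_es] along [cut]. On the left the exponential sums converge off the unit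
    sphere, a null set; on the right only indices m + 1 - i >= 1 occur and they converge
    everywhere. *)
Lemma density m P (v : R) (x : V) : homog m.*2.+1 P -> harm P -> 0 < v ->
  conv (H m.+1 v) (fun y => ev P y * om 0 (sqn y)) x =
  conv (Q P m.*2.+1 1 v) (fun y => prof m (@om R) (sqn y)) x.
Proof.
move=> hP hh v0; have l2 := @ln2_gt0 R.
have D j := density_es x hP hh v0 (@cut_gt0 R j).
have rH := rapid_H n m.+1 v0; have rQ := rapid_Q 1 hP v0.
have mH : measurable_fun setT (fun y : V => H m.+1 v (x - y)).
  exact: measurableT_comp (rapid_measurable rH) (measurable_subl x).
have mQ : measurable_fun setT (fun y : V => Q P m.*2.+1 1 v (x - y)).
  exact: measurableT_comp (rapid_measurable rQ) (measurable_subl x).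
have ms := @measurable_sqn R n.
pose b (y : V) := ev P y * expR (- (ln 2 * sqn y)).
have rb : rapid b by exact: (rapid_ev_exp hP l2).
(* Termwise majorant of the profiles, taken from [es_bound] and so uniform in [j]. *)
pose c (y : V) := \sum_(i < m.+1) `|(lag R n m)`_i * 2 * (ln 2)^-1 ^+ (m.+1 - i)| * (('X^i).[sqn y] * expR (- (ln 2 * sqn y))).
have ic : intble mu (fun y => `|Q P m.*2.+1 1 v (x - y)| * c y).
  rewrite /c; under eq_fun do rewrite mulr_sumr.
  apply: intble_sum => i; under eq_fun do rewrite mulrCA.
  apply: intbleZ; apply: L2M.
    exact: L2_norm (L2_subl x (rapid_L2 rQ)).
  exact: rapid_L2 (rapid_hornerX_exp _ l2).
have C1 : conv (H m.+1 v) (fun y => ev P y * es (cut R j) 0 (sqn y)) x @[j --> \oo] -->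
   conv (H m.+1 v) (fun y => ev P y * om 0 (sqn y)) x.
  rewrite convE; under eq_fun do rewrite convE.
  apply: (@dominated_cvg R _ V mu (fun j y => H m.+1 v (x - y) * (ev P y * es (cut R j) 0 (sqn y))) (fun y => H m.+1 v (x - y) * (ev P y * om 0 (sqn y))) (fun y => 2 * `|H m.+1 v (x - y) * b y|)).
  - move=> j; apply: measurable_funM => //; apply: measurable_funM; first exact: measurable_ev.
    exact: measurableT_comp (measurable_es _ _) ms.
  - apply: measurable_funM => //; apply: measurable_funM; first exact: measurable_ev.
    exact: measurableT_comp (@measurable_om R _) ms.
  - apply: intbleZ; apply: intble_norm; apply: intble_conv; exact: rapid_L2.
  - exists [set y | hr_enorm y = 1]; split.
    + exact: measurable_sphere.
    + exact: sphere_mu0.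
    + move=> y /=; apply: contra_notP => y1; apply: cvgM; first exact: cvg_cst.
      apply: cvgM; first exact: cvg_cst.
      apply: es_lim; first exact: sqn_ge0.
      rewrite orbF; apply/eqP => s1; apply: y1.
      by rewrite -[hr_enorm y]ger0_norm ?hr_enorm_ge0// -sqrtr_sqr sqr_hr_enorm s1 sqrtr1.
  - move=> j y; rewrite !normrM [leRHS]mulrCA ler_wpM2l// [leRHS]mulrCA ler_wpM2l//.
    apply: le_trans (es_bound _ _ (sqn_ge0 y)) _.
    by rewrite expr0 mulr1 (ger0_norm (expR_ge0 _)).
have C2 : conv (Q P m.*2.+1 1 v) (fun y => prof m (es (cut R j)) (sqn y)) x @[j --> \oo] -->
   conv (Q P m.*2.+1 1 v) (fun y => prof m (@om R) (sqn y)) x.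
  rewrite convE; under eq_fun do rewrite convE.
  apply: (@dominated_cvg R _ V mu (fun j y => Q P m.*2.+1 1 v (x - y) * prof m (es (cut R j)) (sqn y)) (fun y => Q P m.*2.+1 1 v (x - y) * prof m (@om R) (sqn y)) (fun y => `|Q P m.*2.+1 1 v (x - y)| * c y)).
  - move=> j; apply: measurable_funM => //; apply: measurable_sum => i.
    apply: measurable_funM; last exact: measurableT_comp (measurable_es _ _) ms.
    by apply: measurable_funM => //; exact: measurable_funX.
  - apply: measurable_funM => //; apply: measurable_sum => i.
    apply: measurable_funM; last exact: measurableT_comp (@measurable_om R _) ms.
    by apply: measurable_funM => //; exact: measurable_funX.
  - exact: ic.
  - apply: aeW => y; apply: cvgM; first exact: cvg_cst.
    apply: cvg_sumr => i; apply: cvgM; first exact: cvg_cst.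
    by apply: es_lim; [exact: sqn_ge0|rewrite subn_gt0 ltn_ord orbT].
  - move=> j y; rewrite normrM ler_wpM2l//.
    apply: le_trans (ler_norm_sum _ _ _) _; apply: ler_sum => i _.
    have u0 := exprn_ge0 i (sqn_ge0 y).
    have k0 : 0 <= (ln 2)^-1 ^+ (m.+1 - i) :> R by rewrite exprn_ge0// invr_ge0 ltW.
    rewrite !normrM (ger0_norm u0) (ger0_norm k0) hornerXn (@ger0_norm _ 2)//.
    have := es_bound j (m.+1 - i) (sqn_ge0 y); move: (es _ _ _) => e he.
    apply: le_trans (ler_wpM2l _ he) _; first by rewrite mulr_ge0.
    by rewrite le_eqVlt; apply/orP; left; apply/eqP; ring.
have EC : (fun j => conv (H m.+1 v) (fun y => ev P y * es (cut R j) 0 (sqn y)) x) =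
  (fun j => conv (Q P m.*2.+1 1 v) (fun y => prof m (es (cut R j)) (sqn y)) x).
  by apply/funext => j; have [] := D j.
by move: C1; rewrite EC => /cvg_unique; apply.
Qed.

End density.

(** * Square function and truncated singular integrals *)

Section conv_basics.
Variables (R : realType) (n : nat).
Local Notation V := 'rV[R]_n.
Local Notation mu := (lebesgue_rV R n).
Local Notation gam := (gam R n).
Implicit Types (f h : V -> R).

Lemma conv_kernelZ (k k' : V -> R) (c : R) f (x : V) : (forall y, k' y = c * k y) -> L2 mu k -> L2 mu f ->
  conv k' f x = c * conv k f x.
Proof.
move=> kE Lk Lf; rewrite !convE -RintZ; last exact: intble_conv.
by apply: Rint_eq => y; rewrite kE mulrA.
Qed.

Lemma conv_adj_parity (k : V -> R) (c : R) f h : (forall x, k (- x) = c * k x) -> rapid k ->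
  L2 mu f -> L2 mu h -> \int[mu]_x (h x * conv k f x) = c * \int[mu]_x (f x * conv k h x).
Proof.
move=> kN r Lf Lh; rewrite (conv_adjoint r Lf Lh) -RintZ; last by apply: L2M => //; exact: conv_L2.
apply: Rint_eq => y; rewrite mulrCA; congr (_ * _).
have E x : k (x - y) = c * k (y - x) by have := kN (y - x); rewrite opprB.
rewrite !convE -RintZ; last exact: intble_conv (rapid_L2 r) Lh.
by apply: Rint_eq => x; apply: (etrans (congr1 (fun z => z * h x) (E x))); exact: esym (mulrA _ _ _).
Qed.

Lemma Rint_H0 (t : R) : 0 < t -> \int[mu]_y `|H 0 t y| = gam.
Proof.
move=> t0; have s0 : Num.sqrt t ^+ n != 0 by rewrite expf_neq0// lt0r_neq0// sqrtr_gt0.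
have E (y : V) : `|H 0 t y| = (Num.sqrt t ^+ n)^-1 * expR (- (sqn y / t)).
  by rewrite !HE psi0 ger0_norm// mulr_ge0 ?expR_ge0// invr_ge0 exprn_ge0// sqrtr_ge0.
under eq_Rintegral do rewrite E.
rewrite RintZ; first by rewrite Rint_gauss//; field.
have := @intble_gauss R n t^-1; rewrite invr_gt0 => /(_ t0).
by under eq_fun do rewrite mulrC.
Qed.

End conv_basics.

Section square_function.
Variables (R : realType) (n d : nat) (P : mpoly.mpoly n R).
Local Notation V := 'rV[R]_n.
Local Notation mu := (lebesgue_rV R n).
Local Notation gam := (gam R n).
Hypotheses (hP : homog d P) (hh : harm P) (od : odd d).
Local Notation q k t := (Q P d k t).
Implicit Types (f h : V -> R).

Lemma conv_H_conv_Q j k (s t : R) f (x : V) : 0 < s -> 0 < t -> L2 mu f ->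
  conv (H j s) (conv (q k t) f) x = gam * conv (q (j + k) (s + t)) f x.
Proof.
move=> s0 t0 Lf; have st : 0 < s + t by rewrite addr_gt0.
rewrite conv_assoc//; [|exact: rapid_H|exact: rapid_Q].
apply: conv_kernelZ => //; first by move=> y; rewrite conv_HQ.
exact: rapid_L2 (rapid_Q _ hP st).
Qed.

Lemma conv_Q_conv_H j k (s t : R) f (x : V) : 0 < s -> 0 < t -> L2 mu f ->
  conv (q k t) (conv (H j s) f) x = gam * conv (q (j + k) (s + t)) f x.
Proof.
move=> s0 t0 Lf; have st : 0 < s + t by rewrite addr_gt0.
have rQ := rapid_Q k hP t0; have rH := rapid_H n j s0.
rewrite conv_assoc//.
apply: conv_kernelZ => //; first by move=> y; rewrite conv_comm// conv_HQ.
exact: rapid_L2 (rapid_Q _ hP st).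
Qed.

Lemma conv_H_conv_H (s t : R) f (x : V) : 0 < s -> 0 < t -> L2 mu f ->
  conv (H 0 s) (conv (H 0 t) f) x = gam * conv (H 0 (s + t)) f x.
Proof.
move=> s0 t0 Lf; have st : 0 < s + t by rewrite addr_gt0.
rewrite conv_assoc//; [|exact: rapid_H|exact: rapid_H].
apply: conv_kernelZ => //; first by move=> y; rewrite conv_gauss.
exact: rapid_L2 (rapid_H _ _ st).
Qed.

Lemma conv_H_adj j (t : R) f h : 0 < t -> L2 mu f -> L2 mu h ->
  \int[mu]_x (h x * conv (H j t) f x) = \int[mu]_x (f x * conv (H j t) h x).
Proof.
move=> t0 Lf Lh; rewrite -[RHS]mul1r; apply: conv_adj_parity => //; last exact: rapid_H.
by move=> x; rewrite mul1r; exact: HN.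
Qed.

Lemma conv_Q_adj k (t : R) f h : 0 < t -> L2 mu f -> L2 mu h ->
  \int[mu]_x (h x * conv (q k t) f x) = - \int[mu]_x (f x * conv (q k t) h x).
Proof.
move=> t0 Lf Lh; rewrite -mulN1r; apply: conv_adj_parity => //; last exact: rapid_Q.
by move=> x; rewrite mulN1r; exact: QN hP od.
Qed.

Definition qf f (t : R) : R := locked_with hr_key (\int[mu]_x (conv (q 0 t) f x ^+ 2)).
Definition ef f (t : R) : R := locked_with hr_key (\int[mu]_x (conv (H 0 t) f x ^+ 2)).

Lemma conv_H0_contraction (t : R) f : 0 < t -> L2 mu f ->
  \int[mu]_x (conv (H 0 t) f x ^+ 2) <= gam ^+ 2 * \int[mu]_x (f x ^+ 2).
Proof.
move=> t0 Lf; apply: young Lf; [exact: rapid_intble (rapid_H _ _ t0)|exact: gam_gt0|by rewrite Rint_H0].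
Qed.

Lemma Rint_sqrZ (c : R) f : L2 mu f -> \int[mu]_x ((c * f x) ^+ 2) = c ^+ 2 * \int[mu]_x (f x ^+ 2).
Proof. by move=> Lf; rewrite -RintZ; [apply: Rint_eq => x; rewrite exprMn|exact: Lf.2]. Qed.

Lemma qfE f t : qf f t = \int[mu]_x (conv (q 0 t) f x ^+ 2). Proof. by rewrite /qf unlock. Qed.
Lemma efE f t : ef f t = \int[mu]_x (conv (H 0 t) f x ^+ 2). Proof. by rewrite /ef unlock. Qed.

Lemma qf_ge0 f t : 0 <= qf f t. Proof. by rewrite qfE; apply: Rint_ge0 => x; exact: sqr_ge0. Qed.
Lemma ef_ge0 f t : 0 <= ef f t. Proof. by rewrite efE; apply: Rint_ge0 => x; exact: sqr_ge0. Qed.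

(** Up to the factor gam, the later kernel is a heat average of the earlier one, and [H 0] divided
    by gam is a contraction of L2. *)
Lemma qf_le f (s t : R) : L2 mu f -> 0 < s -> s <= t -> qf f t <= qf f s.
Proof.
move=> Lf s0; rewrite le_eqVlt => /predU1P[->//|st].
have ts : 0 < t - s by rewrite subr_gt0.
have g2 : 0 < gam ^+ 2 by rewrite exprn_gt0// gam_gt0.
have L0 r : 0 < r -> L2 mu (conv (q 0 r) f) by move=> r0; exact: conv_L2 (rapid_Q _ hP r0) Lf.
have E : gam ^+ 2 * qf f t = \int[mu]_x (conv (H 0 (t - s)) (conv (q 0 s) f) x ^+ 2).
  rewrite qfE -(Rint_sqrZ gam (L0 t (lt_trans s0 st))); apply: Rint_eq => x.
  by rewrite (conv_H_conv_Q 0 0 x ts s0 Lf)//= (_ : t - s + s = t)// subrK.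
rewrite -(ler_pM2l g2) E ?qfE ?efE; apply: conv_H0_contraction => //; exact: L0.
Qed.

Lemma ef_le f (s t : R) : L2 mu f -> 0 < s -> s <= t -> ef f t <= ef f s.
Proof.
move=> Lf s0; rewrite le_eqVlt => /predU1P[->//|st].
have ts : 0 < t - s by rewrite subr_gt0.
have g2 : 0 < gam ^+ 2 by rewrite exprn_gt0// gam_gt0.
have L0 r : 0 < r -> L2 mu (conv (H 0 r) f) by move=> r0; exact: conv_L2 (rapid_H _ _ r0) Lf.
have E : gam ^+ 2 * ef f t = \int[mu]_x (conv (H 0 (t - s)) (conv (H 0 s) f) x ^+ 2).
  rewrite efE -(Rint_sqrZ gam (L0 t (lt_trans s0 st))); apply: Rint_eq => x.
  by rewrite (conv_H_conv_H x ts s0 Lf)//= (_ : t - s + s = t)// subrK.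
rewrite -(ler_pM2l g2) E ?qfE ?efE; apply: conv_H0_contraction => //; exact: L0.
Qed.

Lemma ef_bound f (t : R) : L2 mu f -> 0 < t -> ef f t <= gam ^+ 2 * \int[mu]_x (f x ^+ 2).
Proof. by move=> Lf t0; rewrite efE; exact: conv_H0_contraction. Qed.

(* The pairing only depends on the sum of the two times: both kernels can be moved to the mean time. *)
Lemma qf_polar f (s t : R) : L2 mu f -> 0 < s -> 0 < t ->
  \int[mu]_x (conv (q 0 s) f x * conv (q 0 t) f x) = qf f ((s + t) / 2).
Proof.
wlog st : s t / s <= t.
  move=> W Lf s0 t0; case/orP: (le_total s t) => h; first exact: W.
  by rewrite addrC -(W _ _ h Lf t0 s0); apply: Rint_eq => x; exact: mulrC.
move=> Lf s0 t0; move: st; rewrite le_eqVlt => /predU1P[->|st].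
  by rewrite qfE (_ : (t + t) / 2 = t)//; field.
pose r := (s + t) / 2; pose a := (t - s) / 2.
have a0 : 0 < a by rewrite divr_gt0// subr_gt0.
have r0 : 0 < r by rewrite divr_gt0// addr_gt0.
have Lr : L2 mu (conv (q 0 r) f) by exact: conv_L2 (rapid_Q _ hP r0) Lf.
have Ls : L2 mu (conv (q 0 s) f) by exact: conv_L2 (rapid_Q _ hP s0) Lf.
have Lt : L2 mu (conv (q 0 t) f) by exact: conv_L2 (rapid_Q _ hP t0) Lf.
apply: (mulfI (lt0r_neq0 (gam_gt0 R n))).
rewrite -(RintZ gam (L2M Ls Lt)).
transitivity (\int[mu]_x (conv (q 0 s) f x * conv (H 0 a) (conv (q 0 r) f) x)).
  apply: Rint_eq => x; rewrite conv_H_conv_Q//= (_ : a + r = t); first by ring.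
  by rewrite /a /r; field.
rewrite conv_H_adj// qfE -RintZ; last exact: L2M.
apply: Rint_eq => x; rewrite conv_H_conv_Q//= (_ : a + s = r); first by ring.
by rewrite /a /r; field.
Qed.

Lemma ef_polar f (s t : R) : L2 mu f -> 0 < s -> s < t ->
  \int[mu]_x (conv (H 0 s) f x * conv (H 0 t) f x) = ef f ((s + t) / 2).
Proof.
move=> Lf s0 st; have t0 := lt_trans s0 st.
pose r := (s + t) / 2; pose a := (t - s) / 2.
have a0 : 0 < a by rewrite divr_gt0// subr_gt0.
have r0 : 0 < r by rewrite divr_gt0// addr_gt0.
have Lr : L2 mu (conv (H 0 r) f) by exact: conv_L2 (rapid_H _ _ r0) Lf.
have Ls : L2 mu (conv (H 0 s) f) by exact: conv_L2 (rapid_H _ _ s0) Lf.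
have Lt : L2 mu (conv (H 0 t) f) by exact: conv_L2 (rapid_H _ _ t0) Lf.
apply: (mulfI (lt0r_neq0 (gam_gt0 R n))).
rewrite -(RintZ gam (L2M Ls Lt)).
transitivity (\int[mu]_x (conv (H 0 s) f x * conv (H 0 a) (conv (H 0 r) f) x)).
  apply: Rint_eq => x; rewrite conv_H_conv_H//= (_ : a + r = t); first by ring.
  by rewrite /a /r; field.
rewrite conv_H_adj// efE -RintZ; last exact: L2M.
apply: Rint_eq => x; rewrite conv_H_conv_H//= (_ : a + s = r); first by ring.
by rewrite /a /r; field.
Qed.

Definition nQ k : R := \int[mu]_y `|q k 1 y|.

Lemma Rint_Q k (th : R) : 0 < th -> \int[mu]_y `|q k (th ^+ 2) y| = nQ k / th ^+ (d + k.*2).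
Proof.
move=> th0; have tn := lt0r_neq0 th0.
have t20 : 0 < th ^+ 2 by rewrite exprn_gt0.
rewrite (Rint_affine 0 tn (intble_norm (rapid_intble (rapid_Q k hP t20)))) gtr0_norm//.
rewrite /nQ mulrC -RintZr -?RintZr.
- apply: Rint_eq => y; rewrite add0r -[th ^+ 2]mulr1 (Q_scale k _ hP)// normrM ger0_norm.
    have h1 := expf_neq0 n tn; have h2 := expf_neq0 (d + k.*2) tn.
    by rewrite addnAC exprD; field; rewrite h1 h2.
  by rewrite invr_ge0 exprn_ge0// ltW.
- exact/intble_norm/rapid_intble/rapid_Q.
- have := intble_affine 0 tn (intble_norm (rapid_intble (rapid_Q k hP t20))).
  by [].
Qed.

Lemma conv_Q_bound k f (th : R) : 0 < th -> L2 mu f ->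
  \int[mu]_x (conv (q k (th ^+ 2)) f x ^+ 2) <= ((nQ k + 1) / th ^+ (d + k.*2)) ^+ 2 * \int[mu]_x (f x ^+ 2).
Proof.
move=> th0 Lf; have t20 : 0 < th ^+ 2 by rewrite exprn_gt0.
have N0 : 0 <= nQ k by exact: Rint_ge0.
apply: young Lf; first exact: rapid_intble (rapid_Q k hP t20).
  by rewrite divr_gt0 ?exprn_gt0// ltr_wpDl.
by rewrite Rint_Q// ler_wpM2r ?lerDl// invr_ge0 exprn_ge0// ltW.
Qed.

(** The weight makes this scale invariant, since the L1 norm of Q(th^2) is proportional to
    th^(-d). *)
Definition sf f (th : R) := th ^+ d.*2 * qf f (th ^+ 2).

Lemma sf_bound f (th : R) : L2 mu f -> 0 < th -> sf f th <= (nQ 0 + 1) ^+ 2 * \int[mu]_x (f x ^+ 2).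
Proof.
move=> Lf th0; have := conv_Q_bound 0 th0 Lf; rewrite -qfE addn0 => h.
have t0 : 0 < th ^+ d.*2 by rewrite exprn_gt0.
rewrite /sf; apply: le_trans (ler_wpM2l (ltW t0) h) _.
rewrite le_eqVlt; apply/orP; left; apply/eqP.
have := expf_neq0 d (lt0r_neq0 th0); rewrite -muln2 exprM => u; by field.
Qed.

(* With P_t = Q(t) * _ and G_t = H(t) * _ one has
   P_t = P_(t/2) (G_(t/2) - G_(7t/2)) + P_(4t) up to constants, and the squared norm
   of the middle difference is dominated by a telescoping difference of [ef]. *)
Lemma sf_step : (1 <= d)%N -> exists2 C : R, 0 <= C & forall f (th : R), L2 mu f -> 0 < th ->
  sf f th <= C * (ef f (th ^+ 2 / 2) - ef f ((2 * th) ^+ 2 / 2)) + sf f (2 * th) / 2.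
Proof.
move=> d1.
have g0 := gam_gt0 R n; have gn := lt0r_neq0 g0.
pose K := (nQ 0 + 1) ^+ 2 * Num.sqrt 2 ^+ d.*2.
have K0 : 0 <= K by rewrite mulr_ge0 ?sqr_ge0// exprn_ge0// sqrtr_ge0.
exists (2 * K / gam ^+ 2); first by rewrite divr_ge0 ?exprn_ge0 ?(ltW g0)// mulr_ge0.
move=> f th Lf th0; have tn := lt0r_neq0 th0.
pose t := th ^+ 2; have t0 : 0 < t by rewrite exprn_gt0.
have s2 : 0 < Num.sqrt 2 :> R by rewrite sqrtr_gt0.
have r0 : 0 < th / Num.sqrt 2 by rewrite divr_gt0.
have rE : (th / Num.sqrt 2) ^+ 2 = t / 2 by rewrite expr_div_n sqr_sqrtr.
have th2 : 0 < t / 2 by rewrite divr_gt0.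
have t72 : 0 < 7 * t / 2 by rewrite divr_gt0// mulr_gt0.
have t4 : 0 < 4 * t by rewrite mulr_gt0.
pose h x := conv (H 0 (t / 2)) f x - conv (H 0 (7 * t / 2)) f x.
have L1 : L2 mu (conv (H 0 (t / 2)) f) by exact: conv_L2 (rapid_H _ _ th2) Lf.
have L7 : L2 mu (conv (H 0 (7 * t / 2)) f) by exact: conv_L2 (rapid_H _ _ t72) Lf.
have Lh : L2 mu h by exact: L2B.
have LQ r : 0 < r -> L2 mu (conv (q 0 r) f) by move=> r0'; exact: conv_L2 (rapid_Q _ hP r0') Lf.
have E1 x : conv (q 0 (t / 2)) h x = gam * (conv (q 0 t) f x - conv (q 0 (4 * t)) f x).
  have e1 : t / 2 + t / 2 = t by field.
  have e2 : 7 * t / 2 + t / 2 = 4 * t by field.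
  have r := rapid_L2 (rapid_Q 0 hP th2).
  have a1 := @conv_Q_conv_H 0 0 _ _ f x th2 th2 Lf; have a2 := @conv_Q_conv_H 0 0 _ _ f x t72 th2 Lf.
  rewrite e1 in a1; rewrite e2 in a2; rewrite mulrBr -a1 -a2 -[in RHS]mulN1r -convZ//.
  rewrite -convDr//; last exact: L2Z.
  by congr conv; apply/funext => y; rewrite mulN1r.
(* The times t/2 and 7t/2 have mean 2t, so the squared norm is ef(t/2) - 2 ef(2t) + ef(7t/2), and
   the last term is at most ef(2t). *)
have hE : \int[mu]_x (h x ^+ 2) <= ef f (t / 2) - ef f (2 * t).
  have -> : \int[mu]_x (h x ^+ 2) = ef f (t / 2) - 2 * ef f (2 * t) + ef f (7 * t / 2).
    have e3 : 2 * t = (t / 2 + 7 * t / 2) / 2 by field.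
    rewrite e3 -ef_polar//; last by lra.
    rewrite !efE -RintZ; last exact: L2M.
    rewrite -RintB; [|exact: L1.2|by apply: intbleZ; exact: L2M].
    rewrite -RintD; [|by apply: intbleB; [exact: L1.2|apply: intbleZ; exact: L2M]|exact: L7.2].
    by apply: Rint_eq => x; rewrite /h; ring.
  have : ef f (7 * t / 2) <= ef f (2 * t) by apply: ef_le => //; lra.
  by lra.
have Y : gam ^+ 2 * \int[mu]_x ((conv (q 0 t) f x - conv (q 0 (4 * t)) f x) ^+ 2) <=
    K / th ^+ d.*2 * (ef f (t / 2) - ef f (2 * t)).
  rewrite -Rint_sqrZ; last by apply: L2B; exact: LQ.
  under eq_Rintegral do rewrite -E1.
  have := conv_Q_bound 0 r0 Lh; rewrite rE addn0 => y; apply: le_trans y _.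
  have -> : ((nQ 0 + 1) / (th / Num.sqrt 2) ^+ d) ^+ 2 = K / th ^+ d.*2.
    rewrite /K -muln2 !exprM !expr_div_n.
    have := expf_neq0 d tn; have := expf_neq0 d (lt0r_neq0 s2) => a b.
    by field; rewrite a b.
  apply: ler_wpM2l => //.
  by rewrite divr_ge0 ?exprn_ge0 ?(ltW th0)// mulr_ge0 ?sqr_ge0// exprn_ge0// ltW.
have Z : qf f t <= 2 * \int[mu]_x ((conv (q 0 t) f x - conv (q 0 (4 * t)) f x) ^+ 2) + 2 * qf f (4 * t).
  have La := LQ _ t0; have Lb := LQ _ t4; have Lab := L2B La Lb.
  rewrite !qfE -!RintZ ?(Lab.2, Lb.2)//; try exact: Lb.2.
  rewrite -RintD; try (by apply: intbleZ; exact: Lb.2); try (by apply: intbleZ; exact: Lab.2).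
  apply: Rint_le; first exact: La.2.
    by apply: intbleD; apply: intbleZ; [exact: Lab.2|exact: Lb.2].
  move=> x; move: (conv _ _ x) (conv _ _ x) => a b.
  by have := sqr_ge0 (b - 2 * a); nra.
rewrite /sf (_ : (2 * th) ^+ 2 / 2 = 2 * t); last by rewrite /t; field.
rewrite -/t (_ : (2 * th) ^+ 2 = 4 * t); last by rewrite /t; ring.
have td : 0 < th ^+ d.*2 by rewrite exprn_gt0.
have W : \int[mu]_x ((conv (q 0 t) f x - conv (q 0 (4 * t)) f x) ^+ 2) <=
   K / gam ^+ 2 / th ^+ d.*2 * (ef f (t / 2) - ef f (2 * t)).
  rewrite -(ler_pM2l (exprn_gt0 2 g0)); apply: le_trans Y _.
  by rewrite le_eqVlt; apply/orP; left; apply/eqP; field; rewrite gn lt0r_neq0.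
apply: (@le_trans _ _ (th ^+ d.*2 * (2 * (K / gam ^+ 2 / th ^+ d.*2 * (ef f (t / 2) - ef f (2 * t))) + 2 * qf f (4 * t)))).
  by rewrite ler_wpM2l ?(ltW td)//; lra.
rewrite mulrDr lerD//.
  by rewrite le_eqVlt; apply/orP; left; apply/eqP; field; rewrite gn lt0r_neq0.
rewrite exprMn.
(* This turns the factor 2 in front of qf(4t) into the factor 1/2 in front of sf(2 th). *)
have p4 : 4 <= 2 ^+ d.*2 :> R.
  case: (d) d1 => // k _; rewrite doubleS !exprS.
  have : 1 <= 2 ^+ k.*2 :> R by rewrite exprn_ege1// ler1n.
  by move: (2 ^+ k.*2) => z; nra.
have := qf_ge0 f (4 * t) => q0.
have : 0 <= (2 ^+ d.*2 - 4) * (th ^+ d.*2 * qf f (4 * t)) by rewrite !mulr_ge0// ?subr_ge0// ltW.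
by move: (2 ^+ d.*2) (th ^+ d.*2) (qf f (4 * t)) => a b c; nra.
Qed.

End square_function.

(** * Integration on the line against dx/x *)

Section line.
Variable R : realType.
Local Notation lam := (@lebesgue_measure R).
Implicit Types f : R -> R.

Lemma intble_affine1 (a c : R) f : c != 0 -> intble lam f -> intble lam (fun y : R => f (a + c * y)).
Proof.
move=> c0 fi; have mf := intble_measurable fi.
have ma : measurable_fun setT (fun y : R => a + c * y).
  by apply: measurable_funD => //; exact: measurable_funM.
have mfa := measurableT_comp mf ma.
apply/intble_normP => //; have /intble_normP-/(_ mf) := fi.
rewrite (ge0_integral_affine a c0)//; last by apply/measurable_EFinP/measurableT_comp.
have cn : 0 < `|c| by rewrite normr_gt0.
rewrite muleC; move=> h; rewrite ltey; apply/eqP => h'; move: h; rewrite h'.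
by rewrite gt0_mulye ?lte_fin.
Qed.

Lemma Rint_affine1 (a c : R) f : c != 0 -> intble lam f ->
  \int[lam]_y f y = `|c| * \int[lam]_y f (a + c * y).
Proof.
move=> c0 fi; apply: EFin_inj; rewrite EFinM !RintE//; last exact: intble_affine1.
have mf := intble_measurable fi.
have mE : measurable_fun setT (EFin \o f) by exact/measurable_EFinP.
rewrite [LHS]integralE [in RHS]integralE.
rewrite (ge0_integral_affine a c0 (measurable_funepos mE))//.
rewrite (ge0_integral_affine a c0 (measurable_funeneg mE))//.
have -> : (\int[lam]_y (EFin \o f)^\+%E (a + c * y)%R =
    \int[lam]_y (EFin \o (fun y => f (a + c * y)%R))^\+%E y)%E.
  by apply: eq_integral => y _; rewrite !funeposE.
have -> : (\int[lam]_y (EFin \o f)^\-%E (a + c * y)%R =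
    \int[lam]_y (EFin \o (fun y => f (a + c * y)%R))^\-%E y)%E.
  by apply: eq_integral => y _; rewrite !funenegE.
rewrite -muleBr//; apply: fin_num_adde_defr.
by apply: integrable_pos_fin_num => //; exact: intble_affine1.
Qed.

Definition seg (a b x : R) : R := ind R (a < x < b).

Lemma measurable_seg a b : measurable_fun setT (seg a b).
Proof. by apply: measurable_ind; apply: measurable_and; exact: measurable_fun_ltr. Qed.

Lemma seg_intble (a b : R) : a < b -> intble lam (seg a b) /\ \int[lam]_x seg a b x = b - a.
Proof.
move=> ab; have D x : is_derive x (1 : R) (id : R -> R) (cst 1 x) by exact: is_derive_id.
have [i E] := FTC_seg ab D (fun x => cvg_cst _).
rewrite (_ : seg a b = fun x => ind R (a < x < b) * cst 1 x); last by apply/funext => x; rewrite mulr1.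
by split.
Qed.

Lemma seg_ge0 a b x : 0 <= seg a b x. Proof. exact: ind_ge0. Qed.

Lemma seg0 (a b x : R) : 0 < a -> x <= 0 -> seg a b x = 0.
Proof. by move=> a0 x0; rewrite /seg /ind ltNge (le_trans x0 (ltW a0)). Qed.

Lemma seg_split (a a1 b1 c e x : R) : a <= a1 -> b1 <= e -> x != c ->
  seg a1 b1 x <= seg a c x + seg c e x.
Proof.
move=> aa be xc; have [/andP[h1 h2]|h] := boolP (a1 < x < b1); last first.
  by rewrite /seg {1}/ind (negbTE h) addr_ge0// ind_ge0.
move: xc; rewrite neq_lt /seg /ind => /orP[h|h].
  by rewrite h1 h2 h (le_lt_trans aa h1)/= lerDl; case: ifP.
by rewrite h1 h2 h (lt_le_trans h2 be)/= lerDr; case: ifP.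
Qed.

Lemma seg_bounded (a b M : R) f : a < b -> measurable_fun setT f -> (forall x, a < x < b -> `|f x| <= M) ->
  intble lam (fun x => seg a b x * f x).
Proof.
move=> ab mf fM; apply: intble_le (intbleZ M (seg_intble ab).1) _.
  by apply: measurable_funM => //; exact: measurable_seg.
move=> x; rewrite normrM ind_norm /seg /ind; case: ifPn => h; last by rewrite mul0r mulr0.
by rewrite mul1r mulr1; exact: fM.
Qed.

(** The measure dx/x is invariant under dilations. *)
Lemma dlog_scale (c a b : R) f : 0 < c -> intble lam (fun x => seg (c * a) (c * b) x * (f x / x)) ->
  intble lam (fun x => seg a b x * (f (c * x) / x)) /\
  \int[lam]_x (seg a b x * (f (c * x) / x)) = \int[lam]_x (seg (c * a) (c * b) x * (f x / x)).
Proof.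
move=> c0 i; have cn := lt0r_neq0 c0.
have E x : seg a b x * (f (c * x) / x) = c * (seg (c * a) (c * b) (0 + c * x) * (f (0 + c * x) / (0 + c * x))).
  rewrite add0r /seg !ltr_pM2l//; have [->|x0] := eqVneq x 0; first by rewrite mulr0 invr0 !mulr0.
  by field; rewrite cn x0.
have ia := intble_affine1 0 cn i.
under eq_fun do rewrite E; split; first exact: intbleZ.
by rewrite RintZ// [RHS](Rint_affine1 0 cn i) gtr0_norm.
Qed.

Lemma Rint_ae_le d (T : measurableType d) (mu : {measure set T -> \bar R}) (f g : T -> R) :
  intble mu f -> intble mu g -> {ae mu, forall x, f x <= g x} -> \int[mu]_x f x <= \int[mu]_x g x.
Proof.
move=> fi gi fg; rewrite -subr_ge0 -RintB//.
rewrite (@Rint_ae_eq _ _ _ _ _ (fun x => `|g x - f x|)); first exact: Rint_ge0.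
- exact: intble_measurable (intbleB gi fi).
- exact: intble_measurable (intble_norm (intbleB gi fi)).
- by apply: filterS fg => x /= h; rewrite ger0_norm// subr_ge0.
Qed.

Lemma Rint_le_except (c : R) f g : intble lam f -> intble lam g ->
  (forall x : R, x != c -> f x <= g x) -> \int[lam]_x f x <= \int[lam]_x g x.
Proof.
move=> fi gi h; apply: Rint_ae_le => //; exists [set c]; split=> //; first exact: lebesgue_measure_set1.
by move=> x /=; apply: contra_notP => /eqP; exact: h.
Qed.

(** Since dx/x is invariant under doubling, E(x) - E(2x) leaves only the piece over ]a, 2a[, and
    half of the integral of A is absorbed on the left up to the piece over ]b, 2b[. Each such piece
    is at most M, whatever [a] and [b]. *)
Lemma telescope_bound (A E : R -> R) (M C a b : R) : 0 < a -> a < b -> 0 <= C ->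
  measurable_fun setT A -> measurable_fun setT E ->
  (forall x, 0 < x -> 0 <= A x <= M) -> (forall x, 0 < x -> 0 <= E x <= M) ->
  (forall x, 0 < x -> A x <= C * (E x - E (2 * x)) + A (2 * x) / 2) ->
  \int[lam]_x (seg a b x * (A x / x)) <= (2 * C + 1) * M.
Proof.
move=> a0 ab C0 mA mE AM EM AE; have b0 := lt_trans a0 ab.
have M0 : 0 <= M by have /andP[x y] := AM _ a0; exact: le_trans y.
have mV : measurable_fun setT (fun x : R => x^-1) by exact: measurable_inv.
have I (F : R -> R) (u v : R) : measurable_fun setT F -> (forall x : R, 0 < x -> 0 <= F x <= M) -> 0 < u -> u < v ->
    intble lam (fun x => seg u v x * (F x / x)).
  move=> mF FM u0 uv; apply: (@seg_bounded _ _ (M / u)) => //; first exact: measurable_funM.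
  move=> x /andP[ux _]; have x0 := lt_trans u0 ux; have /andP[f0 fM] := FM x x0.
  rewrite ger0_norm; last by rewrite divr_ge0// ltW.
  by apply: ler_pM => //; [rewrite invr_ge0 ltW|rewrite lef_pV2 ?posrE// ltW].
have S (F : R -> R) (u v : R) : measurable_fun setT F -> (forall x : R, 0 < x -> 0 <= F x <= M) -> 0 < u -> u < v ->
    v <= 2 * u -> \int[lam]_x (seg u v x * (F x / x)) <= M.
  move=> mF FM u0 uv v2.
  apply: (@le_trans _ _ (\int[lam]_x (M / u * seg u v x))).
    apply: Rint_le; [exact: I|exact: intbleZ (seg_intble uv).1|move=> x].
    rewrite mulrC /seg /ind; case: ifP => [/andP[ux _]|_]; last by rewrite !mulr0.
    have x0 := lt_trans u0 ux; have /andP[f0 fM] := FM x x0.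
    by rewrite !mulr1; apply: ler_pM => //; [rewrite invr_ge0 ltW|rewrite lef_pV2 ?posrE// ltW].
  rewrite RintZ ?(seg_intble uv).2; last exact: (seg_intble uv).1.
  rewrite mulrAC ler_pdivrMr// ler_wpM2l//; lra.
have P2 : 0 < 2 :> R by [].
have a2 : 0 < 2 * a by rewrite mulr_gt0.
have b2 : 0 < 2 * b by rewrite mulr_gt0.
have ab2 : 2 * a < 2 * b by rewrite ltr_pM2l.
have [iE2 EE2] := dlog_scale P2 (I E _ _ mE EM a2 ab2).
have [iA2 EA2] := dlog_scale P2 (I A _ _ mA AM a2 ab2).
have iA := I A _ _ mA AM a0 ab; have iE := I E _ _ mE EM a0 ab.
have aa2 : a < 2 * a by lra.
have bb2 : b < 2 * b by lra.
have SE := S E _ _ mE EM a0 aa2 (lexx _).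
have SA := S A _ _ mA AM b0 bb2 (lexx _).
have key : \int[lam]_x (seg a b x * (A x / x)) <=
   C * (\int[lam]_x (seg a b x * (E x / x)) - \int[lam]_x (seg (2 * a) (2 * b) x * (E x / x)))
   + 2^-1 * \int[lam]_x (seg (2 * a) (2 * b) x * (A x / x)).
  rewrite -EE2 -EA2 -RintB// -RintZ; last exact: intbleB.
  rewrite -[X in _ <= _ + X]RintZ// -RintD; last 2 first.
  - by apply: intbleZ; exact: intbleB.
  - exact: intbleZ.
  apply: Rint_le => // [|x]; first by apply: intbleD; apply: intbleZ => //; exact: intbleB.
  rewrite /seg /ind; case: ifP => [/andP[ax _]|_]; last by rewrite !mul0r subrr !mulr0 addr0.
  have x0 := lt_trans a0 ax; rewrite !mul1r; have xi : 0 <= x^-1 by rewrite invr_ge0 ltW.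
  apply: le_trans (ler_wpM2r xi (AE x x0)) _.
  by rewrite le_eqVlt; apply/orP; left; apply/eqP; move: (x^-1) => v; field.
have EB : \int[lam]_x (seg a b x * (E x / x)) <= \int[lam]_x (seg a (2 * a) x * (E x / x)) + \int[lam]_x (seg (2 * a) (2 * b) x * (E x / x)).
  rewrite -RintD; [|exact: I|exact: I].
  apply: (@Rint_le_except (2 * a)).
  - exact: iE.
  - by apply: intbleD; exact: I.
  - move=> x xn; have [x0|x0] := leP x 0; first by rewrite !seg0// !mul0r addr0.
    have /andP[e0 _] := EM x x0; rewrite -mulrDl ler_wpM2r ?divr_ge0 ?(ltW x0)//.
    by apply: seg_split => //; exact: ltW.
have AB : \int[lam]_x (seg (2 * a) (2 * b) x * (A x / x)) <= \int[lam]_x (seg a b x * (A x / x)) + \int[lam]_x (seg b (2 * b) x * (A x / x)).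
  rewrite -RintD; [|exact: I|exact: I].
  apply: (@Rint_le_except b).
  - exact: I.
  - by apply: intbleD; exact: I.
  - move=> x xn; have [x0|x0] := leP x 0; first by rewrite !seg0// !mul0r addr0.
    have /andP[e0 _] := AM x x0; rewrite -mulrDl ler_wpM2r ?divr_ge0 ?(ltW x0)//.
    by apply: seg_split => //; exact: ltW.
have A0 : 0 <= \int[lam]_x (seg (2 * a) (2 * b) x * (A x / x)).
  apply: Rint_ge0 => x; rewrite /seg /ind; case: ifP => [/andP[ax _]|_]; last by rewrite mul0r.
  by have x0 := lt_trans a2 ax; have /andP[e0 _] := AM x x0; rewrite mul1r divr_ge0// ltW.
move: key EB AB SE SA A0.
move: (\int[lam]_x _) (\int[lam]_x _) (\int[lam]_x _) (\int[lam]_x _) (\int[lam]_x _) (\int[lam]_x _) => u1 u2 u3 u4 u5 u6.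
move=> h1 h2 h3 h4 h5 h6.
have h7 : C * (u2 - u3) <= C * M by rewrite ler_wpM2l//; lra.
nra.
Qed.

End line.

Lemma iterated_lty d1 d2 (T1 : measurableType d1) (T2 : measurableType d2) (R : realType)
    (m1 : {sigma_finite_measure set T1 -> \bar R}) (m2 : {sigma_finite_measure set T2 -> \bar R})
    (F : T1 -> T2 -> R) (g : T1 -> R) :
  measurable_fun setT (fun z => F z.1 z.2) -> intble m1 g ->
  (forall x, intble m2 (F x)) -> (forall x, \int[m2]_y `|F x y| <= g x) ->
  (\int[m1]_x \int[m2]_y (`|F x y|)%:E < +oo)%E.
Proof.
move=> mF ig iF Fg.
have mN : measurable_fun setT (fun z : T1 * T2 => (`|F z.1 z.2|)%:E).
  by apply/measurable_EFinP; exact: measurableT_comp.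
apply: (@le_lt_trans _ _ (\int[m1]_x (g x)%:E)%E); last first.
  by rewrite -RintE// ltry.
apply: ge0_le_integral => //.
- by move=> x _; apply: integral_ge0.
- exact: (@measurable_ge0_integral _ _ _ _ _ m2 (fun x y => (`|F x y|)%:E)).
- by apply/measurable_EFinP; exact: intble_measurable ig.
- by move=> x _; rewrite -RintE ?lee_fin//; exact: intble_norm.
Qed.

Section truncations.
Variables (R : realType) (n d : nat) (P : mpoly.mpoly n R).
Local Notation V := 'rV[R]_n.
Local Notation mu := (lebesgue_rV R n).
Local Notation lam := (@lebesgue_measure R).
Local Notation gam := (gam R n).
Hypotheses (hP : homog d P) (hh : harm P) (od : odd d).
Local Notation q k t := (Q P d k t).
Implicit Types (f h : V -> R).

Lemma measurable_convQ k f : measurable_fun setT f ->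
  measurable_fun setT (fun z : measurableTypeR R * V => conv (q k z.1) f z.2).
Proof.
move=> mf; under eq_fun do rewrite convE.
apply: (@measurable_Rint _ _ _ _ _ mu (fun (z : measurableTypeR R * V) y => q k z.1 (z.2 - y) * f y)).
apply: measurable_funM; last exact: measurableT_comp mf measurable_snd.
under eq_fun do rewrite QE.
have m : measurable_fun setT (fun z : measurableTypeR R * V * V => z.1.2 - z.2).
  by apply: measurable_rVB => //; exact: measurableT_comp measurable_snd measurable_fst.
apply: measurable_funM; first exact: measurableT_comp (measurable_ev P) m.
apply: measurable_psi; first exact: measurableT_comp measurable_fst measurable_fst.
exact: measurableT_comp (@measurable_sqn R n) m.
Qed.

Lemma measurable_convQ2 k f (g : R -> R) : measurable_fun setT g -> measurable_fun setT f ->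
  measurable_fun setT (fun z : measurableTypeR R * V => conv (q k (g z.1)) f z.2).
Proof.
move=> mg mf.
have m : measurable_fun setT (fun z : measurableTypeR R * V => (g z.1 : measurableTypeR R, z.2)).
  by apply: measurable_fun_pair => //; exact: measurableT_comp mg measurable_fst.
exact: measurableT_comp (measurable_convQ k mf) m.
Qed.

Lemma measurable_qf f (g : R -> R) : measurable_fun setT f -> measurable_fun setT g ->
  measurable_fun setT (fun t => qf d P f (g t)).
Proof.
move=> mf mg; under eq_fun do rewrite qfE.
apply: (@measurable_Rint _ _ (measurableTypeR R) V R mu (fun t x => conv (q 0 (g t)) f x ^+ 2)).
by apply: measurable_funX; exact: measurable_convQ2.
Qed.

Lemma measurable_ef f (g : R -> R) : measurable_fun setT f -> measurable_fun setT g ->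
  measurable_fun setT (fun t => ef f (g t)).
Proof.
move=> mf mg; under eq_fun do rewrite efE.
apply: (@measurable_Rint _ _ (measurableTypeR R) V R mu (fun t x => conv (H 0 (g t)) f x ^+ 2)).
apply: measurable_funX; under eq_fun do rewrite convE.
apply: (@measurable_Rint _ _ _ _ _ mu (fun (z : measurableTypeR R * V) y => H 0 (g z.1) (z.2 - y) * f y)).
apply: measurable_funM; last exact: measurableT_comp mf measurable_snd.
under eq_fun do rewrite HE.
have m : measurable_fun setT (fun z : measurableTypeR R * V * V => z.1.2 - z.2).
  by apply: measurable_rVB => //; exact: measurableT_comp measurable_snd measurable_fst.
apply: measurable_psi; last exact: measurableT_comp (@measurable_sqn R n) m.
by apply: measurableT_comp mg _; exact: measurableT_comp measurable_fst measurable_fst.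
Qed.

Definition nQ2 k : R := \int[mu]_y (q k 1 y ^+ 2).

Lemma Rint_Q2 k (th : R) : 0 < th -> \int[mu]_y (q k (th ^+ 2) y ^+ 2) = nQ2 k / th ^+ (d.*2 + n + 4 * k).
Proof.
move=> th0; have tn := lt0r_neq0 th0.
have t20 : 0 < th ^+ 2 by rewrite exprn_gt0.
have i := (rapid_L2 (rapid_Q k hP t20)).2.
rewrite (Rint_affine 0 tn i) gtr0_norm// /nQ2 -RintZ; last exact: (intble_affine 0 tn i).
rewrite -RintZr; last exact: (rapid_L2 (rapid_Q k hP ltr01)).2.
apply: Rint_eq => y; rewrite add0r -[th ^+ 2]mulr1 (Q_scale k _ hP)// exprMn.
have h1 := expf_neq0 n tn; have h2 := expf_neq0 d tn; have h3 := expf_neq0 k tn.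
rewrite -!addnn (_ : (4 * k = k + k + (k + k))%N); last by rewrite !mulSn mul0n addn0 !addnA.
by rewrite !exprD; field; rewrite h1 h2 h3.
Qed.

Lemma conv_Q_pointwise k f (th : R) (x : V) : 0 < th -> L2 mu f ->
  conv (q k (th ^+ 2)) f x ^+ 2 <= nQ2 k * \int[mu]_y (f y ^+ 2) / th ^+ (d.*2 + n + 4 * k).
Proof.
move=> th0 Lf; have t20 : 0 < th ^+ 2 by rewrite exprn_gt0.
apply: le_trans (conv_norm_bound x (rapid_L2 (rapid_Q k hP t20)) Lf) _.
by rewrite Rint_Q2// mulrAC.
Qed.

(** Smooth substitute for a truncated singular integral: it keeps the heat scales between [a] and
    [b] and is a superposition of kernels Q, for which the semigroup law is available. *)
Definition hs f (a b : R) (x : V) : R :=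
  \int[lam]_t (seg a b t * (t ^+ d.-1 * conv (q 0 (t ^+ 2)) f x)).

Section fixed.
Variables (f : V -> R) (a b : R).
Hypotheses (Lf : L2 mu f) (a0 : 0 < a) (ab : a < b).

Let F (t : R) (x : V) := seg a b t * (t ^+ d.-1 * conv (q 0 (t ^+ 2)) f x).

Let b0 : 0 < b. Proof. exact: lt_trans ab. Qed.

Let mF : measurable_fun setT (fun z : measurableTypeR R * V => F z.1 z.2).
Proof.
apply: measurable_funM; first exact: measurableT_comp (measurable_seg a b) measurable_fst.
apply: measurable_funM; first by apply: measurable_funX; exact: measurable_fst.
by apply: (@measurable_convQ2 0 f (fun t => t ^+ 2)) Lf.1; exact: measurable_funX.
Qed.

Let Lconv (t : R) : 0 < t -> L2 mu (conv (q 0 (t ^+ 2)) f).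
Proof. by move=> t0; apply: conv_L2 Lf; apply: rapid_Q => //; rewrite exprn_gt0. Qed.

Let qfa (t : R) : a < t -> qf d P f (t ^+ 2) <= qf d P f (a ^+ 2).
Proof.
move=> at_; apply: qf_le => //; first by rewrite exprn_gt0.
by rewrite lerXn2r ?nnegrE ?ltW// (lt_trans a0).
Qed.

Lemma hs_pair h : L2 mu h ->
  \int[mu]_x (h x * hs f a b x) =
  \int[lam]_t (seg a b t * (t ^+ d.-1 * \int[mu]_x (h x * conv (q 0 (t ^+ 2)) f x))).
Proof.
move=> Lh; pose G (t : R) (x : V) := h x * F t x.
have mG : measurable_fun setT (fun z : measurableTypeR R * V => G z.1 z.2).
  by apply: measurable_funM => //; exact: measurableT_comp Lh.1 measurable_snd.
have iG t : intble mu (G t).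
  rewrite /G /F /seg /ind; case: ifP => [/andP[at_ _]|_].
    under eq_fun do rewrite mul1r mulrCA; apply: intbleZ; apply: L2M => //.
    by apply: Lconv; exact: lt_trans at_.
  by rewrite (_ : (fun _ => _) = fun x => 0 * (h x ^+ 2)); [exact: intbleZ Lh.2|apply/funext => x; rewrite !mul0r mulr0].
have cI : \int[mu]_x (h x * hs f a b x) = \int[mu]_x \int[lam]_t G t x.
  apply: Rint_eq => x; rewrite /hs -RintZ//.
  apply: (@seg_bounded _ _ _ (b ^+ d.-1 * (nQ2 0 * \int[mu]_y (f y ^+ 2) / a ^+ (d.*2 + n + 4 * 0) + 1))) => //.
    apply: measurable_funM; first exact: measurable_funX.
    have m := @measurable_convQ2 0 f (fun t => t ^+ 2) (measurable_funX 2 (@measurable_id _ _ _)) Lf.1.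
    have mp : measurable_fun setT (fun t : measurableTypeR R => (t, x)) by exact: measurable_fun_pair.
    exact: measurableT_comp m mp.
  move=> t /andP[at_ tb]; have t0 := lt_trans a0 at_.
  rewrite normrM (ger0_norm (exprn_ge0 _ (ltW t0))) ler_pM// ?exprn_ge0 ?(ltW t0)//.
    by rewrite lerXn2r ?nnegrE ?ltW.
  have h2 := conv_Q_pointwise 0 x t0 Lf.
  have h3 : nQ2 0 * \int[mu]_y (f y ^+ 2) / t ^+ (d.*2 + n + 4 * 0) <= nQ2 0 * \int[mu]_y (f y ^+ 2) / a ^+ (d.*2 + n + 4 * 0).
    apply: ler_wpM2l; first by rewrite mulr_ge0//; apply: Rint_ge0 => y; exact: sqr_ge0.
    by rewrite lef_pV2 ?posrE ?exprn_gt0// lerXn2r ?nnegrE ?ltW.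
  have := le_trans h2 h3; rewrite -(real_normK (num_real (conv _ _ _))).
  move: `|conv _ _ _| (nQ2 0 * _ / a ^+ _) => u v uv; have := sqr_ge0 (u - 1); nra.
rewrite cI -(@Rfubini _ _ _ _ _ lam mu G mG).
  apply: Rint_eq => t; rewrite /G /F /seg /ind; case: ifP => [/andP[at_ _]|_].
    rewrite mul1r -RintZ; first by apply: Rint_eq => x; ring.
    by apply: L2M => //; apply: Lconv; exact: lt_trans at_.
  rewrite mul0r (_ : (fun _ => _) = fun x => 0 * (h x ^+ 2)); first by rewrite RintZ ?mul0r//; exact: Lh.2.
  by apply/funext => x; rewrite !mul0r mulr0.
apply: (@iterated_lty _ _ _ _ _ lam mu G (fun t => b ^+ d.-1 * (\int[mu]_x (h x ^+ 2) + qf d P f (a ^+ 2)) * seg a b t)) => //.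
  exact: intbleZ (seg_intble ab).1.
move=> t; rewrite /G /F /seg /ind; case: ifP => [/andP[at_ tb]|_]; last first.
  rewrite mulr0 (_ : (fun _ => _) = fun x => 0 * (h x ^+ 2)); first by rewrite RintZ ?mul0r//; exact: Lh.2.
  by apply/funext => x; rewrite !mul0r mulr0 normr0.
have t0 := lt_trans a0 at_; have Lt := Lconv t0.
rewrite mulr1; apply: (@le_trans _ _ (b ^+ d.-1 * (\int[mu]_x (h x ^+ 2) + qf d P f (t ^+ 2)))); last first.
  by apply: ler_wpM2l; [rewrite exprn_ge0// ltW|rewrite lerD2l qfa].
rewrite qfE -RintD; [|exact: Lh.2|exact: Lt.2].
rewrite -RintZ; last by apply: intbleD; [exact: Lh.2|exact: Lt.2].
have ig : intble mu (fun x => `|h x * (1 * (t ^+ d.-1 * conv (q 0 (t ^+ 2)) f x))|).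
  apply: intble_norm; under eq_fun do rewrite mul1r mulrCA; apply: intbleZ; exact: L2M.
apply: Rint_le => // [|x].
  by apply: intbleZ; apply: intbleD; [exact: Lh.2|exact: Lt.2].
rewrite mul1r mulrCA normrM ger0_norm ?exprn_ge0 ?(ltW t0)// ler_pM// ?exprn_ge0 ?(ltW t0)//.
  by rewrite lerXn2r ?nnegrE ?ltW.
rewrite normrM -(real_normK (num_real (h x))) -(real_normK (num_real (conv _ _ _))).
move: `|h x| `|conv _ _ _| (normr_ge0 (h x)) (normr_ge0 (conv (q 0 (t ^+ 2)) f x)) => u v u0 v0; nra.
Qed.

(** Cauchy-Schwarz in [t] on the bounded segment. The bound so obtained depends on [a] and [b]; the
    uniform one is [hs_bound], which needs square integrability first. *)
Lemma hs_L2 : L2 mu (hs f a b).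
Proof.
have mhs : measurable_fun setT (hs f a b).
  apply: (@measurable_Rint _ _ V (measurableTypeR R) R lam (fun x t => F t x)).
  have ms : measurable_fun setT (fun z : V * measurableTypeR R => (z.2, z.1)).
    by apply: measurable_fun_pair; [exact: measurable_snd|exact: measurable_fst].
  exact: measurableT_comp mF ms.
split=> //; apply/intble_ge0P; [exact: measurable_funX|by move=> x; exact: sqr_ge0|].
have mFt x : measurable_fun setT (F ^~ x).
  have mp : measurable_fun setT (fun t : measurableTypeR R => (t, x)) by exact: measurable_fun_pair.
  exact: measurableT_comp mF mp.
have key x : ((hs f a b x ^+ 2)%:E <= (b - a)%:E * \int[lam]_t (F t x ^+ 2)%:E)%E.
  have i2 : intble lam (fun t => F t x ^+ 2).
    rewrite (_ : (fun _ => _) = fun t => seg a b t * (t ^+ d.-1 * conv (q 0 (t ^+ 2)) f x) ^+ 2); last first.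
      by apply/funext => t; rewrite /F /seg /ind; case: ifP; rewrite ?mul1r// !mul0r expr0n.
    apply: (@seg_bounded _ _ _ ((b ^+ d.-1) ^+ 2 * (nQ2 0 * \int[mu]_y (f y ^+ 2) / a ^+ (d.*2 + n + 4 * 0)))) => //.
      apply: measurable_funX; apply: measurable_funM; first exact: measurable_funX.
      have m := @measurable_convQ2 0 f (fun t => t ^+ 2) (measurable_funX 2 (@measurable_id _ _ _)) Lf.1.
      have mp : measurable_fun setT (fun t : measurableTypeR R => (t, x)) by exact: measurable_fun_pair.
      exact: measurableT_comp m mp.
    move=> t /andP[at_ tb]; have t0 := lt_trans a0 at_.
    rewrite ger0_norm ?sqr_ge0// exprMn ler_pM ?sqr_ge0//.
      by rewrite lerXn2r ?nnegrE ?exprn_ge0 ?(ltW t0) ?(ltW b0)// lerXn2r ?nnegrE ?ltW.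
    apply: le_trans (conv_Q_pointwise 0 x t0 Lf) _.
    apply: ler_wpM2l; first by rewrite mulr_ge0//; apply: Rint_ge0 => y; exact: sqr_ge0.
    by rewrite lef_pV2 ?posrE ?exprn_gt0// lerXn2r ?nnegrE ?ltW.
  have [is_ Es] := seg_intble ab.
  have Ls : L2 lam (seg a b).
    split; first exact: measurable_seg.
    rewrite (_ : (fun _ => _) = seg a b)//; apply/funext => t.
    by rewrite /seg /ind; case: ifP; rewrite ?expr1n ?expr0n.
  rewrite -RintE// -EFinM lee_fin -Es.
  have -> : hs f a b x = \int[lam]_t (seg a b t * F t x).
    apply: Rint_eq => t; rewrite /F /seg /ind; case: ifP; rewrite ?mul1r ?mul0r//.
  apply: le_trans (cauchy_schwarz Ls (conj (mFt x) i2)) _.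
  rewrite (_ : \int[lam]_t (seg a b t ^+ 2) = \int[lam]_t seg a b t)//.
  by apply: Rint_eq => t; rewrite /seg /ind; case: ifP; rewrite ?expr1n ?expr0n.
have mF2 : measurable_fun setT (fun z : V * measurableTypeR R => (F z.2 z.1 ^+ 2)%:E).
  apply/measurable_EFinP; apply: measurable_funX.
  have ms : measurable_fun setT (fun z : V * measurableTypeR R => (z.2, z.1)).
    by apply: measurable_fun_pair; [exact: measurable_snd|exact: measurable_fst].
  exact: measurableT_comp mF ms.
have mI : measurable_fun setT (fun x : V => \int[lam]_t (F t x ^+ 2)%:E)%E.
  by apply: (@measurable_ge0_integral _ _ _ _ _ lam (fun x t => (F t x ^+ 2)%:E)) => // x t; rewrite lee_fin sqr_ge0.
apply: (@le_lt_trans _ _ (\int[mu]_x ((b - a)%:E * \int[lam]_t (F t x ^+ 2)%:E))%E).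
  apply: ge0_le_integral => //.
  - by move=> x _; rewrite lee_fin sqr_ge0.
  - by apply/measurable_EFinP; exact: measurable_funX.
  - by apply: measurable_funeM.
rewrite ge0_integralZl//; last 2 first.
- by move=> x _; apply: integral_ge0 => t _; rewrite lee_fin sqr_ge0.
- by rewrite lee_fin subr_ge0 ltW.
rewrite (@tonelli _ _ _ _ _ mu lam (fun x t => (F t x ^+ 2)%:E))//; last by move=> x t; rewrite lee_fin sqr_ge0.
apply: lte_mul_pinfty; rewrite ?lee_fin ?subr_ge0 ?(ltW ab)//.
apply: (@le_lt_trans _ _ (\int[lam]_t ((b ^+ d.-1) ^+ 2 * qf d P f (a ^+ 2) * seg a b t)%:E)%E); last first.
  by rewrite -RintE ?ltry//; exact: intbleZ (seg_intble ab).1.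
apply: ge0_le_integral => //.
- by move=> t _; apply: integral_ge0 => x _; rewrite lee_fin sqr_ge0.
- apply: (@measurable_ge0_integral _ _ (measurableTypeR R) V R mu (fun t x => (F t x ^+ 2)%:E)).
    by apply/measurable_EFinP; exact: measurable_funX.
  by move=> t x; rewrite lee_fin sqr_ge0.
- by apply/measurable_EFinP; apply: measurable_funM => //; exact: measurable_seg.
- move=> t _; rewrite /F /seg /ind; case: ifP => [/andP[at_ tb]|_]; last first.
    rewrite mulr0 (eq_integral (cst 0%E)) ?integral_cst ?mul0e// => x _.
    by rewrite mul0r expr0n.
  have t0 := lt_trans a0 at_; have Lt := Lconv t0.
  rewrite (eq_integral (fun x => ((t ^+ d.-1) ^+ 2 * conv (q 0 (t ^+ 2)) f x ^+ 2)%:E)); last first.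
    by move=> x _; rewrite mul1r exprMn.
  rewrite -RintE; last exact: intbleZ Lt.2.
  rewrite RintZ; last exact: Lt.2.
  rewrite -qfE mulr1 lee_fin ler_pM ?sqr_ge0 ?qf_ge0 ?qfa//.
  by rewrite lerXn2r ?nnegrE ?exprn_ge0 ?(ltW t0) ?(ltW b0)// lerXn2r ?nnegrE ?ltW.
Qed.

End fixed.

End truncations.

Lemma Rint_le_int d (T : measurableType d) (R : realType) (mu : {measure set T -> \bar R}) (f : T -> R) :
  (forall x, 0 <= f x) -> ((\int[mu]_x f x)%:E <= \int[mu]_x (f x)%:E)%E.
Proof.
move=> f0; have h : (0 <= \int[mu]_x (f x)%:E)%E by apply: integral_ge0 => x _; rewrite lee_fin.
rewrite /Rintegral; move: h; case: (\int[mu]_x (f x)%:E)%E => //= r; rewrite ?leey//.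
Qed.

(** * Uniform L2 bound for truncations in scale *)

Section truncation_bound.
Variables (R : realType) (n d : nat) (P : mpoly.mpoly n R).
Local Notation V := 'rV[R]_n.
Local Notation mu := (lebesgue_rV R n).
Local Notation lam := (@lebesgue_measure R).
Local Notation gam := (gam R n).
Hypotheses (hP : homog d P) (hh : harm P) (od : odd d).
Local Notation q k t := (Q P d k t).
Implicit Types (f h : V -> R).

(** By polarisation the squared norm is the double integral of (t s)^(d-1) qf((t^2 + s^2)/2). On s
    <= t monotonicity replaces qf by its value at t^2/2, and integration in s costs a factor O(t).
    What remains is the integral of the square function [sf] against dt/t, bounded by
    [telescope_bound]. *)
Lemma hs_bound : exists2 C : R, 0 <= C & forall f (a b : R), L2 mu f -> 0 < a -> a < b ->
  \int[mu]_x (hs d P f a b x ^+ 2) <= C * \int[mu]_x (f x ^+ 2).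
Proof.
have d1 : (1 <= d)%N by case: (d) od.
have [C0 C00 step] := sf_step hP hh d1.
have [K [K0 K1 K2]] : exists K : R, [/\ 0 <= K, (nQ d P 0 + 1) ^+ 2 <= K & gam ^+ 2 <= K].
  by exists ((nQ d P 0 + 1) ^+ 2 + gam ^+ 2); rewrite addr_ge0 ?lerDl ?lerDr ?sqr_ge0.
exists (4 * (2 ^+ d * ((2 * C0 + 1) * K))).
  by rewrite !mulr_ge0// ?exprn_ge0// addr_ge0// mulr_ge0.
move=> f a b Lf a0 ab; have b0 := lt_trans a0 ab.
have F0 : 0 <= \int[mu]_x (f x ^+ 2) by apply: Rint_ge0 => x; exact: sqr_ge0.
have [M ME] : exists M : R, M = K * \int[mu]_x (f x ^+ 2) by exists (K * \int[mu]_x (f x ^+ 2)).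
(* The dilation by c = 1 / sqrt 2 turns qf(t^2/2) into the square function at [c * t], and dt/t does
   not notice it. *)
have [c [c0 c2]] : exists c : R, 0 < c /\ c ^+ 2 = 2^-1.
  by exists ((Num.sqrt 2)^-1); rewrite invr_gt0 sqrtr_gt0 exprVn sqr_sqrtr.
have mqf : measurable_fun setT (fun t : R => qf d P f t) by apply: (@measurable_qf _ _ _ P f id) => //; exact: Lf.1.
have mqf2 (g : R -> R) : measurable_fun setT g -> measurable_fun setT (fun t : R => qf d P f (g t)).
  by move=> mg; exact: measurableT_comp mqf mg.
have msf : measurable_fun setT (sf d P f).
  by apply: measurable_funM; [exact: measurable_funX|apply: mqf2; exact: measurable_funX].
have mE : measurable_fun setT (fun t : R => ef f (t ^+ 2 / 2)).
  apply: (@measurable_ef _ _ f (fun t => t ^+ 2 / 2)); first exact: Lf.1.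
  by apply: measurable_funM => //; exact: measurable_funX.
have sfM (x : R) : 0 < x -> 0 <= sf d P f x <= M.
  move=> x0; apply/andP; split; first by rewrite mulr_ge0 ?exprn_ge0 ?qf_ge0 ?ltW.
  apply: le_trans (sf_bound hP Lf x0) _; by rewrite ME ler_wpM2r.
have efM (x : R) : 0 < x -> 0 <= ef f (x ^+ 2 / 2) <= M.
  move=> x0; apply/andP; split; first exact: ef_ge0.
  apply: le_trans (ef_bound Lf _) _; first by rewrite divr_gt0// exprn_gt0.
  by rewrite ME ler_wpM2r.
have ca0 : 0 < c * a by rewrite mulr_gt0.
have cab : c * a < c * b by rewrite ltr_pM2l.
have T := telescope_bound ca0 cab C00 msf mE sfM efM (fun x x0 => step f x Lf x0).
pose f2 (x : R) := 2 ^+ d * sf d P f x.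
have M0 : 0 <= M by rewrite ME mulr_ge0.
have f2E (t : R) : 0 < t -> f2 (c * t) / t = t ^+ (d.-1) * t ^+ d.-1 * qf d P f (t ^+ 2 / 2) * t.
  move=> t0; rewrite /f2 /sf (_ : (c * t) ^+ 2 = t ^+ 2 / 2); last by rewrite exprMn c2 mulrC.
  rewrite -muln2 exprM.
  have -> : ((c * t) ^+ d) ^+ 2 = 2^-1 ^+ d * (t ^+ d.-1 * t) ^+ 2.
    by rewrite -exprSr prednK// [(c * t) ^+ d]exprMn exprMn -[(c ^+ d) ^+ 2]exprM mulnC exprM c2.
  have h2 : 2 ^+ d != 0 :> R by rewrite expf_neq0.
  by rewrite exprVn; field; rewrite h2 lt0r_neq0.
pose g (t : R) := seg a b t * (t ^+ d.-1 * t ^+ d.-1 * qf d P f (t ^+ 2 / 2)).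
have g0 t : 0 <= g t.
  rewrite /g /seg /ind; case: ifP => [/andP[at_ _]|_]; last by rewrite mul0r.
  have t0 := ltW (lt_trans a0 at_).
  by rewrite mul1r mulr_ge0 ?qf_ge0// mulr_ge0// exprn_ge0.
have mg : measurable_fun setT g.
  apply: measurable_funM; first exact: measurable_seg.
  apply: measurable_funM; first by apply: measurable_funM; exact: measurable_funX.
  by apply: mqf2; apply: measurable_funM => //; exact: measurable_funX.
pose Phi (t s : R) := seg a b t * (t ^+ d.-1 * (seg a b s * (s ^+ d.-1 * qf d P f ((t ^+ 2 + s ^+ 2) / 2)))).
(* Majorant on the half s <= t; the range 0 < s < 2t leaves room so that s = t is included. *)
pose Psi (t s : R) := g t * seg 0 (2 * t) s.
have Lhs := hs_L2 hP hh Lf a0 ab.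
have HE : \int[mu]_x (hs d P f a b x ^+ 2) = \int[lam]_t \int[lam]_s Phi t s.
  under eq_Rintegral do rewrite expr2.
  rewrite (hs_pair hP hh Lf a0 ab Lhs); apply: Rint_eq => t.
  have cst0 : \int[lam]_s (0 * seg a b s) = 0 by rewrite RintZ ?mul0r//; exact: (seg_intble ab).1.
  rewrite /Phi /seg /ind; case: ifP => [/andP[at_ tb]|_]; last first.
    rewrite mul0r; apply: esym; rewrite -[RHS]cst0; apply: Rint_eq => s; by rewrite !mul0r.
  have t0 := lt_trans a0 at_.
  have Lt : L2 mu (conv (q 0 (t ^+ 2)) f) by apply: conv_L2 Lf; apply: rapid_Q => //; rewrite exprn_gt0.
  rewrite mul1r.
  under eq_Rintegral do rewrite mulrC.
  rewrite (hs_pair hP hh Lf a0 ab Lt).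
  rewrite (@Rint_eq _ (measurableTypeR R) R lam _ (fun s => seg a b s * (s ^+ d.-1 * qf d P f ((t ^+ 2 + s ^+ 2) / 2)))); last first.
    move=> s; rewrite /seg /ind; case: ifP => [/andP[as_ sb]|_]; last by rewrite !mul0r.
    by rewrite (qf_polar hP hh) ?exprn_gt0// (lt_trans a0).
  rewrite -RintZ; first by apply: Rint_eq => s; rewrite mul1r.
  apply: (@seg_bounded _ _ _ (b ^+ d.-1 * qf d P f (t ^+ 2 / 2))) => //.
    apply: measurable_funM; first exact: measurable_funX.
    apply: mqf2; apply: measurable_funM => //; apply: measurable_funD => //; exact: measurable_funX.
  move=> s /andP[as_ sb]; have s0 := lt_trans a0 as_.
  rewrite ger0_norm ?mulr_ge0 ?qf_ge0 ?exprn_ge0 ?(ltW s0)//.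
  apply: ler_pM; rewrite ?qf_ge0 ?exprn_ge0 ?(ltW s0)//.
    by rewrite lerXn2r ?nnegrE ?ltW.
  apply: qf_le => //; first by rewrite divr_gt0// exprn_gt0.
  by rewrite ler_wpM2r// lerDl sqr_ge0.
have half t s : a < t < b -> a < s < b -> s <= t -> Phi t s <= Psi t s.
  move=> tI sI st; rewrite /Phi /Psi /g /seg /ind tI sI !mul1r.
  move: tI sI => /andP[at_ tb] /andP[as_ sb].
  have s0 := lt_trans a0 as_; have t0 := lt_trans a0 at_.
  have -> : 0 < s < 2 * t by rewrite s0/=; lra.
  rewrite mulr1 mulrA; apply: ler_pM; rewrite ?qf_ge0 ?mulr_ge0 ?exprn_ge0 ?(ltW s0) ?(ltW t0)//.
    apply: ler_wpM2l; first by rewrite exprn_ge0// ltW.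
    by rewrite lerXn2r ?nnegrE ?(ltW s0) ?(ltW t0).
  apply: qf_le => //; first by rewrite divr_gt0// exprn_gt0.
  by rewrite ler_wpM2r// lerDl sqr_ge0.
have Psi0 t s : 0 <= Psi t s by rewrite mulr_ge0// seg_ge0.
have PhiC t s : Phi t s = Phi s t by rewrite /Phi addrC; ring.
have PhiPsi t s : Phi t s <= Psi t s + Psi s t.
  have [tI|tI] := boolP (a < t < b); last first.
    by rewrite /Phi {1}/seg {1}/ind (negbTE tI) mul0r addr_ge0.
  have [sI|sI] := boolP (a < s < b); last first.
    by rewrite PhiC /Phi {1}/seg {1}/ind (negbTE sI) mul0r addr_ge0.
  case/orP: (le_total s t) => h; first by rewrite ler_wpDr// half.
  by rewrite PhiC ler_wpDl// half.
have Phi0 t s : 0 <= Phi t s.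
  rewrite /Phi /seg /ind; case: ifP => [/andP[at_ _]|_]; last by rewrite mul0r.
  case: ifP => [/andP[as_ _]|_]; last by rewrite mul0r !mulr0.
  have s0 := ltW (lt_trans a0 as_); have t0 := ltW (lt_trans a0 at_).
  by rewrite !mul1r !mulr_ge0 ?qf_ge0// exprn_ge0.
have mPhi : measurable_fun setT (fun z : measurableTypeR R * measurableTypeR R => Phi z.1 z.2).
  apply: measurable_funM; first exact: measurableT_comp (measurable_seg a b) measurable_fst.
  apply: measurable_funM; first by apply: measurable_funX; exact: measurable_fst.
  apply: measurable_funM; first exact: measurableT_comp (measurable_seg a b) measurable_snd.
  apply: measurable_funM; first by apply: measurable_funX; exact: measurable_snd.
  apply: measurableT_comp mqf _; apply: measurable_funM => //.
  by apply: measurable_funD; apply: measurable_funX; [exact: measurable_fst|exact: measurable_snd].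
have mPsi : measurable_fun setT (fun z : measurableTypeR R * measurableTypeR R => Psi z.1 z.2).
  apply: measurable_funM; first exact: measurableT_comp mg measurable_fst.
  apply: measurable_ind; apply: measurable_and; apply: measurable_fun_ltr => //.
  by apply: measurable_funM => //; exact: measurable_fst.
have mPsi' : measurable_fun setT (fun z : measurableTypeR R * measurableTypeR R => Psi z.2 z.1).
  exact: (measurableT_comp mPsi (measurable_fun_pair measurable_snd measurable_fst)).
have PhiE0 t s : (0 <= (Phi t s)%:E)%E by rewrite lee_fin.
have PsiE0 t s : (0 <= (Psi t s)%:E)%E by rewrite lee_fin.
have PsiE0' t s : (0 <= (Psi s t)%:E)%E by rewrite lee_fin.
have mPhiE : measurable_fun setT (fun z : measurableTypeR R * measurableTypeR R => (Phi z.1 z.2)%:E) by exact/measurable_EFinP.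
have mPsiE : measurable_fun setT (fun z : measurableTypeR R * measurableTypeR R => (Psi z.1 z.2)%:E) by exact/measurable_EFinP.
have mPsiE' : measurable_fun setT (fun z : measurableTypeR R * measurableTypeR R => (Psi z.2 z.1)%:E) by exact/measurable_EFinP.
have IPsi : (\int[lam]_t \int[lam]_s (Psi t s)%:E <= (2 * (2 ^+ d * ((2 * C0 + 1) * M)))%:E)%E.
  have if2 : intble lam (fun x => seg (c * a) (c * b) x * (f2 x / x)).
    apply: (@seg_bounded _ _ _ (2 ^+ d * M / (c * a))) => //.
      apply: measurable_funM; first exact: measurable_funM.
      exact: measurable_inv.
    move=> x /andP[ax _]; have x0 := lt_trans ca0 ax; have /andP[s0 sM] := sfM x x0.
    rewrite ger0_norm; last by rewrite divr_ge0 ?(ltW x0)// mulr_ge0// exprn_ge0.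
    apply: ler_pM; rewrite ?invr_ge0 ?(ltW x0)//.
    - by rewrite mulr_ge0// exprn_ge0.
    - by rewrite ler_wpM2l// exprn_ge0.
    - by rewrite lef_pV2 ?posrE// ltW.
  have [iD ED] := dlog_scale c0 if2.
  have i1 : intble lam (fun t => 2 * (seg a b t * (f2 (c * t) / t))) by exact: intbleZ.
  have -> : (\int[lam]_t \int[lam]_s (Psi t s)%:E = \int[lam]_t (2 * (seg a b t * (f2 (c * t) / t)))%:E)%E.
    apply: eq_integral => t _; have [tI|tI] := boolP (a < t < b); last first.
      rewrite (eq_integral (cst 0%E)) ?integral_cst ?mul0e//; last first.
        by move=> s _; rewrite /Psi /g {1}/seg {1}/ind (negbTE tI) !mul0r.
      by rewrite /seg /ind (negbTE tI) mul0r mulr0.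
    have t0 : 0 < t by case/andP: tI => h _; exact: lt_trans h.
    have t20 : 0 < 2 * t by rewrite mulr_gt0.
    rewrite -RintE; last exact: intbleZ (seg_intble t20).1.
    rewrite RintZ; last exact: (seg_intble t20).1.
    rewrite (seg_intble t20).2 f2E// /g /seg /ind tI; congr (_%:E); ring.
  rewrite -RintE// lee_fin RintZ// ler_wpM2l// ED.
  rewrite (@Rint_eq _ (measurableTypeR R) R lam _ (fun x => 2 ^+ d * (seg (c * a) (c * b) x * (sf d P f x / x)))); last first.
    by move=> x; rewrite /f2; ring.
  rewrite RintZ; first by rewrite ler_wpM2l// exprn_ge0.
  have h2 : 2 ^+ d != 0 :> R by rewrite expf_neq0.
  rewrite (_ : (fun _ => _) = fun x => (2 ^+ d)^-1 * (seg (c * a) (c * b) x * (f2 x / x))); first exact: intbleZ.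
  apply/funext => x; rewrite /f2 -mulrA; move: (sf d P f x / x) => w.
  by move: (2 ^+ d : R) h2 => z h2; field.
rewrite -lee_fin HE.
apply: le_trans (Rint_le_int _ _) _; first by move=> t; exact: Rint_ge0.
have mI (F : R -> R -> R) : measurable_fun setT (fun z : measurableTypeR R * measurableTypeR R => (F z.1 z.2)%:E) ->
    (forall t s, 0 <= F t s) -> measurable_fun setT (fun t : R => \int[lam]_s (F t s)%:E)%E.
  move=> mF Fnn; apply: (@measurable_ge0_integral _ _ (measurableTypeR R) (measurableTypeR R) R lam (fun t s => (F t s)%:E)) => //.
have i0 (F : R -> R -> R) t : (forall t s, 0 <= F t s) -> (0 <= \int[lam]_s (F t s)%:E)%E.
  by move=> Fnn; apply: integral_ge0 => s _; rewrite lee_fin.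
have Psi0' t s : 0 <= (fun t s => Psi s t) t s by [].
have mP1 := mI Psi mPsiE Psi0.
have mP2 := mI (fun t s => Psi s t) mPsiE' Psi0'.
have m2 (F : R -> R -> R) t : measurable_fun setT (fun z : measurableTypeR R * measurableTypeR R => F z.1 z.2) ->
    measurable_fun setT (fun s : R => (F t s)%:E).
  move=> mF; apply/measurable_EFinP.
  have mp : measurable_fun setT (fun s : measurableTypeR R => (t : measurableTypeR R, s)) by exact: measurable_fun_pair.
  exact: measurableT_comp mF mp.
apply: (@le_trans _ _ (\int[lam]_t (\int[lam]_s (Psi t s)%:E + \int[lam]_s (Psi s t)%:E))%E).
  apply: ge0_le_integral => //.
  - by move=> t _; rewrite lee_fin Rint_ge0.
  - apply/measurable_EFinP.
    exact: (@measurable_Rint _ _ (measurableTypeR R) (measurableTypeR R) R lam Phi mPhi).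
  - by apply: emeasurable_funD.
  - move=> t _; apply: le_trans (@Rint_le_int _ (measurableTypeR R) R lam _ (Phi0 t)) _.
    rewrite -ge0_integralD//; [|exact: (m2 Psi t mPsi)|exact: (m2 (fun t s => Psi s t) t mPsi')].
    apply: ge0_le_integral => //; first exact: (m2 Phi t mPhi).
    + by apply: emeasurable_funD; [exact: (m2 Psi t mPsi)|exact: (m2 (fun t s => Psi s t) t mPsi')].
    + by move=> s _; rewrite -EFinD lee_fin.
rewrite ge0_integralD//; [|by move=> t _; exact: i0|by move=> t _; exact: (i0 (fun t s => Psi s t))].
rewrite [X in (_ + X)%E](@tonelli _ _ _ _ _ lam lam (fun t s => (Psi s t)%:E))//.
apply: le_trans (leeD IPsi IPsi) _; rewrite -EFinD lee_fin ME.
by rewrite le_eqVlt; apply/orP; left; apply/eqP; ring.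
Qed.

End truncation_bound.

(** * The singular kernel as a superposition of heat kernels *)

Section radial_profile.
Variables (R : realType) (N : nat).
Local Notation lam := (@lebesgue_measure R).

(** Radial factor of t^(d-1) Q(t^2, y), with N = d + n + 1 and u = |y|^2. *)
Definition kE (t u : R) : R := (t ^+ N)^-1 * expR (- (u / t ^+ 2)).

Lemma kE_ge0 t u : 0 < t -> 0 <= kE t u.
Proof. by move=> t0; rewrite mulr_ge0 ?expR_ge0// invr_ge0 exprn_ge0// ltW. Qed.

Lemma measurable_kE d (T : measurableType d) (f g : T -> R) :
  measurable_fun setT f -> measurable_fun setT g -> measurable_fun setT (fun x => kE (f x) (g x)).
Proof.
move=> mf mg; apply: measurable_funM; first by apply: measurable_inv; exact: measurable_funX.
apply: measurableT_comp => //; apply: measurable_funN; apply: measurable_funM => //.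
by apply: measurable_inv; exact: measurable_funX.
Qed.

Lemma kE_scale (r t u : R) : 0 < r -> 0 < t -> kE (r * t) (r ^+ 2 * u) = (r ^+ N)^-1 * kE t u.
Proof.
move=> r0 t0; have e : r ^+ 2 * u / (r * t) ^+ 2 = u / t ^+ 2 by field; rewrite !lt0r_neq0.
by rewrite /kE e exprMn invfM mulrA.
Qed.

Lemma expR_inv_bound (a : R) : 0 < a -> exists2 C, 0 <= C & forall t, 0 < t -> t <= 1 ->
  (t ^+ N)^-1 * expR (- (a / t ^+ 2)) <= C.
Proof.
move=> a0; have [C C0 hC] := poly_expR_bound ('X^N) a0; exists C => // t t0 t1.
have i1 : 1 <= t^-1 by rewrite invf_ge1.
have x0 : 0 <= (t ^+ 2)^-1 by rewrite invr_ge0 exprn_ge0// ltW.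
have := hC _ x0; rewrite hornerXn ger0_norm ?exprn_ge0// => h.
(* As t <= 1, t^(-N) is at most the N-th power of t^(-2), a polynomial in the variable of the
   exponential. *)
apply: (@le_trans _ _ (((t ^+ 2)^-1) ^+ N * expR (- (a / t ^+ 2)))).
  rewrite ler_wpM2r ?expR_ge0// -!exprVn lerXn2r ?nnegrE ?exprn_ge0 ?(le_trans ler01)//.
  by rewrite expr2 ler_peMr// (le_trans ler01).
apply: le_trans (ler_wpM2r (expR_ge0 _) h) _.
by rewrite -mulrA -expRD addrN expR0 mulr1.
Qed.

Hypothesis N2 : (2 <= N)%N.

Lemma kE_tail_le (t u : R) : 1 <= t -> 0 <= u -> kE t u <= 4 * (1 + t) ^- 2.
Proof.
move=> t1 u0; have t0 : 0 < t by exact: lt_le_trans t1.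
apply: (@le_trans _ _ ((t ^+ 2)^-1)).
  rewrite /kE -[leRHS]mulr1; apply: ler_pM; rewrite ?expR_ge0 ?invr_ge0 ?exprn_ge0 ?(ltW t0)//.
    by rewrite lef_pV2 ?posrE ?exprn_gt0// ler_weXn2l.
  by rewrite -expR0 ler_expR oppr_le0 divr_ge0// exprn_ge0// ltW.
rewrite -ler_pdivrMl// -invfM lef_pV2 ?posrE ?mulr_gt0 ?exprn_gt0 ?addr_gt0//.
nra.
Qed.

Lemma kE_int (a u : R) : 0 < u -> 0 <= a ->
  intble lam (fun t => ind R (0 < t) * (ind R (a < t) * kE t u)) /\
  intble lam (fun t => ind R (0 < t) * (ind R (t <= a) * kE t u)).
Proof.
move=> u0 a0; have [C C0 hC] := expR_inv_bound u0.
have m : measurable_fun setT (kE ^~ u) by exact: measurable_kE.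
have key (p : R -> bool) : measurable_fun setT (fun t => ind R (p t)) ->
    intble lam (fun t => ind R (0 < t) * (ind R (p t) * kE t u)).
  move=> mp; apply: intble_le (intbleZ (4 * C + 4) (@half_inv2 R)) _.
    by apply: measurable_funM; [exact: measurable_ind_lt|exact: measurable_funM].
  move=> t; rewrite normrM ind_norm /ind; case: ifP => t0; last by rewrite !mul0r mulr0.
  rewrite !mul1r; have k0 := kE_ge0 u t0.
  have k1 : `|(if p t then 1 else 0) * kE t u| <= kE t u.
    by case: ifP => _; rewrite ?mul1r ?mul0r ?normr0// ger0_norm.
  apply: le_trans k1 _.
  have q0 : 0 <= (1 + t) ^- 2 by rewrite invr_ge0 sqr_ge0.
  have [t1|/ltW t1] := leP t 1; last first.
    by apply: le_trans (kE_tail_le t1 (ltW u0)) _; rewrite ler_wpM2r// lerDr mulr_ge0.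
  apply: le_trans (hC t t0 t1) _; apply: (@le_trans _ _ (4 * C * (1 + t) ^- 2)); last first.
    by rewrite ler_wpM2r// lerDl.
  rewrite ler_pdivlMr ?exprn_gt0 ?addr_gt0// mulrC ler_wpM2r//.
  nra.
by split; apply: key; [exact: measurable_ind_lt|exact: measurable_ind_le].
Qed.

(* Radial profile of the difference between the sharply truncated kernel and the
   superposition of the heat kernels of scale [t > del]. *)
Definition eK (del u : R) : R :=
  if del ^+ 2 < u then \int[lam]_t (ind R (0 < t) * (ind R (t <= del) * kE t u))
  else - \int[lam]_t (ind R (0 < t) * (ind R (del < t) * kE t u)).

(** All scales together at |y| = 1. By homogeneity they give cK / r^(N-1) at |y| = r, so this is the
    constant between the kernel of T and the superposition of heat kernels. *)
Definition cK : R := \int[lam]_t (ind R (0 < t) * kE t 1).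

Lemma kE_int_all (u : R) : 0 < u -> intble lam (fun t => ind R (0 < t) * kE t u).
Proof.
move=> u0; have [i _] := kE_int u0 (lexx 0).
rewrite (_ : (fun _ => _) = (fun t => ind R (0 < t) * (ind R (0 < t) * kE t u)))//.
by apply/funext => t; rewrite /ind; case: ifP; rewrite ?mul1r ?mul0r.
Qed.

Lemma cK_gt0 : 0 < cK.
Proof.
have i1 := kE_int_all (@ltr01 R).
have k t : 0 <= ind R (0 < t) * kE t 1.
  by rewrite /ind; case: ifP => t0; rewrite ?mul0r// mul1r kE_ge0.
have h : (1 : R) < 2 by rewrite ltr1n.
apply: (@lt_le_trans _ _ (\int[lam]_t ((2 ^+ N)^-1 * expR (- 1) * seg 1 2 t))).
  rewrite RintZ ?(seg_intble h).2; last exact: (seg_intble h).1.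
  by rewrite mulr_gt0 ?mulr_gt0 ?expR_gt0 ?invr_gt0 ?exprn_gt0// subr_gt0.
apply: Rint_le => //; first exact: intbleZ (seg_intble h).1.
move=> t; rewrite /seg {1}/ind; case: ifP => [/andP[t1 t2]|_]; last by rewrite mulr0.
have t0 : 0 < t by exact: lt_trans t1.
rewrite mulr1 /ind t0 mul1r /kE; apply: ler_pM; rewrite ?expR_ge0 ?invr_ge0 ?exprn_ge0//.
  by rewrite lef_pV2 ?posrE ?exprn_gt0// lerXn2r ?nnegrE ?(ltW t0)// ltW.
rewrite ler_expR lerN2 ler_pdivrMr ?exprn_gt0// mul1r expr_ge1// ltW//.
Qed.

Lemma kE_total (r : R) : 0 < r -> \int[lam]_t (ind R (0 < t) * kE t (r ^+ 2)) = cK / r ^+ N.-1.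
Proof.
move=> r0; have rn := lt0r_neq0 r0.
rewrite (Rint_affine1 0 rn (kE_int_all (exprn_gt0 2 r0))) gtr0_norm//.
rewrite (@Rint_eq _ (measurableTypeR R) R lam _ (fun t => (r ^+ N)^-1 * (ind R (0 < t) * kE t 1))); last first.
  move=> t; rewrite add0r pmulr_rgt0// /ind; case: ifP => t0; rewrite ?mul0r ?mulr0// !mul1r.
  by rewrite -[r ^+ 2]mulr1 kE_scale.
rewrite RintZ; last exact: kE_int_all.
rewrite -/cK -{1}(prednK (ltnW N2)) exprS.
by have := expf_neq0 N.-1 rn => h; field; rewrite h rn.
Qed.

Lemma eK_split (del r : R) : 0 < r -> 0 < del ->
  ind R (del < r) * (cK / r ^+ N.-1) =
  eK del (r ^+ 2) + \int[lam]_t (ind R (0 < t) * (ind R (del < t) * kE t (r ^+ 2))).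
Proof.
move=> r0 del0; have [i1 i2] := kE_int (exprn_gt0 2 r0) (ltW del0).
have E : (del ^+ 2 < r ^+ 2) = (del < r) by rewrite ltr_pXn2r// nnegrE ltW.
rewrite /eK E -kE_total// /ind; case: ifP => _; last by rewrite mul0r addNr.
rewrite mul1r -RintD//; apply: Rint_eq => t; rewrite -mulrDr; congr (_ * _).
by rewrite -mulrDl ltNge; case: ifP => _ /=; rewrite ?addr0 ?add0r mul1r.
Qed.

Lemma eK_scale (del u : R) : 0 < del -> 0 < u -> eK del (del ^+ 2 * u) = (del ^+ N.-1)^-1 * eK 1 u.
Proof.
move=> d0 u0; have dn := lt0r_neq0 d0; have d20 := exprn_gt0 2 d0.
have [i1 i2] := kE_int (mulr_gt0 d20 u0) (ltW d0).
have [j1 j2] := kE_int u0 (@ler01 R).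
have c : del * (del ^+ N)^-1 = (del ^+ N.-1)^-1.
  rewrite -{1}(prednK (ltnW N2)) exprS.
  by have := expf_neq0 N.-1 dn => h; field; rewrite h dn.
rewrite /eK expr1n -{1}[del ^+ 2]mulr1 ltr_pM2l//; case: ifP => _.
  rewrite (Rint_affine1 0 dn i2) gtr0_norm// -c -[RHS]mulrA; congr (_ * _); rewrite -RintZ//.
  apply: Rint_eq => t; rewrite add0r pmulr_rgt0// -{2}[del]mulr1 ler_pM2l//.
  rewrite {1 3}/ind; case: ifP => t0; rewrite ?mul0r ?mulr0// !mul1r kE_scale//; ring.
rewrite mulrN; congr (- _).
rewrite (Rint_affine1 0 dn i1) gtr0_norm// -c -[RHS]mulrA; congr (_ * _); rewrite -RintZ//.
apply: Rint_eq => t; rewrite add0r pmulr_rgt0// -{1}[del]mulr1 ltr_pM2l//.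
rewrite {1 3}/ind; case: ifP => t0; rewrite ?mul0r ?mulr0// !mul1r kE_scale//; ring.
Qed.

(** For u > 1 only scales t <= 1 occur, and there u / t^2 >= 1 / (2 t^2) + u / 2: one part beats
    t^(-N), the other decays in u. For u <= 1 the scales t > 1 give a bounded integral. Sharp and
    smooth truncation thus differ by a rapidly decaying kernel. *)
Lemma eK1_bound : exists2 C, 0 <= C & forall u, 0 < u -> `|eK 1 u| <= C * expR (- (u / 2)).
Proof.
have h2 : (0 : R) < 1 / 2 by rewrite divr_gt0.
have [C C0 hC] := expR_inv_bound h2.
pose D : R := \int[lam]_t (4 * (ind R (0 < t) * (1 + t) ^- 2)).
have D0 : 0 <= D.
  by apply: Rint_ge0 => t; rewrite !mulr_ge0 ?ind_ge0// invr_ge0 sqr_ge0.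
exists (C + D * expR (1 / 2)); first by rewrite addr_ge0// mulr_ge0// expR_ge0.
move=> u u0; have [i1 i2] := kE_int u0 (@ler01 R).
rewrite /eK expr1n; case: ifP => u1.
  apply: (@le_trans _ _ (C * expR (- (u / 2)))); last first.
    by rewrite ler_wpM2r ?expR_ge0// lerDl mulr_ge0// expR_ge0.
  have s01 := @seg_intble R 0 1 ltr01.
  have -> : C * expR (- (u / 2)) = \int[lam]_t (C * expR (- (u / 2)) * seg 0 1 t).
    by rewrite RintZ ?s01.2 ?subr0 ?mulr1//; exact: s01.1.
  rewrite ger0_norm; last first.
    apply: Rint_ge0 => t; rewrite /ind; case: ifP => t0; rewrite ?mul0r// mul1r.
    by case: ifP => _; rewrite ?mul0r// mul1r kE_ge0.
  apply: (@Rint_le_except _ 1) => //; first exact: intbleZ s01.1.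
  move=> t; rewrite neq_lt /seg /ind => /orP[t1|t1]; last first.
    by rewrite [t <= 1]leNgt t1/= mul0r mulr0 [t < 1]ltNge (ltW t1) andbF mulr0.
  rewrite t1 (ltW t1) andbT; case: ifP => t0; last by rewrite mul0r mulr0.
  rewrite !mul1r mulr1; apply: (@le_trans _ _ ((t ^+ N)^-1 * expR (- (1 / 2 / t ^+ 2)) * expR (- (u / 2)))).
    rewrite /kE -mulrA ler_wpM2l ?invr_ge0 ?exprn_ge0 ?(ltW t0)// -expRD ler_expR -opprD lerN2.
    have x1 : 1 <= (t ^+ 2)^-1 by rewrite invf_ge1 ?exprn_gt0// exprn_ile1// ltW.
    by move: (t ^+ 2)^-1 x1 => v v1; nra.
  by rewrite ler_wpM2r ?expR_ge0// hC// ltW.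
rewrite normrN; have u1' : u <= 1 by rewrite leNgt u1.
apply: (@le_trans _ _ (D * expR (1 / 2) * expR (- (u / 2)))); last first.
  by rewrite ler_wpM2r ?expR_ge0// lerDr.
apply: (@le_trans _ _ D).
  apply: Rint_norm_le => //; first by apply: intbleZ; exact: half_inv2.
  move=> t; rewrite normrM ind_norm normrM ind_norm [leRHS]mulrCA ler_wpM2l ?ind_ge0//.
  rewrite /ind; case: ifP => t1; last by rewrite mul0r mulr_ge0// invr_ge0 sqr_ge0.
  have t0 : 0 < t by exact: lt_trans t1.
  by rewrite mul1r ger0_norm ?kE_ge0// kE_tail_le ?ltW.
by rewrite -mulrA -expRD ler_peMr// -{1}expR0 ler_expR; lra.
Qed.

Lemma measurable_eK (del : R) : measurable_fun setT (eK del).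
Proof.
have m (p : R -> bool) : measurable_fun setT (fun t => ind R (p t)) ->
   measurable_fun setT (fun u => \int[lam]_t (ind R (0 < t) * (ind R (p t) * kE t u))).
  move=> mp; apply: (@measurable_Rint _ _ (measurableTypeR R) (measurableTypeR R) R lam (fun u t => (ind R (0 < t) * (ind R (p t) * kE t u)))).
  apply: measurable_funM; first by apply: measurable_ind_lt => //; exact: measurable_snd.
  apply: measurable_funM; first exact: measurableT_comp mp measurable_snd.
  by apply: measurable_kE; [exact: measurable_snd|exact: measurable_fst].
apply: measurable_fun_ifT; first exact: measurable_fun_ltr.
  by apply: m; exact: measurable_ind_le.
by apply: measurable_funN; apply: m; exact: measurable_ind_lt.
Qed.

End radial_profile.

(** * Inversion formula *)

Section decay.
Variable R : realType.
Local Notation lam := (@lebesgue_measure R).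

(** The function (1 + t)^(-3/2). It is the weakest decay that occurs: a convolution with an L2
    function yields 1 / (t sqrt(t^n)), which for n = 1 is just t^(-3/2). *)
Definition h32 (t : R) : R := (1 + t)^-1 * (Num.sqrt (1 + t))^-1.

Lemma h32_ge0 t : 0 <= t -> 0 <= h32 t.
Proof. by move=> t0; rewrite mulr_ge0 ?invr_ge0 ?sqrtr_ge0// addr_ge0. Qed.

Lemma h32M_ge0 (K t : R) : 0 <= K -> 0 <= t -> 0 <= K * h32 t.
Proof. by move=> K0 t0; apply: mulr_ge0 => //; exact: h32_ge0. Qed.

Lemma half_h32 : intble lam (fun x => ind R (0 < x) * h32 x).
Proof.
have p (x : R) : 0 <= x -> 0 < 1 + x by move=> x0; rewrite ltr_pwDl.
have D0 (x : R) : is_derive x (1 : R) (fun x => 1 + x) 1.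
  have := is_deriveD (is_derive_cst (1 : R) x (1 : R)) (is_derive_id x (1 : R)).
  by move=> h; apply: (is_derive_eq h); rewrite add0r.
have D1 (x : R) : 0 <= x -> is_derive x (1 : R) (fun x => (Num.sqrt (1 + x))^-1) (- (1 / 2) * h32 x).
  move=> x0; have h := @is_derive1_comp R _ (fun x => 1 + x) x _ _ (is_derive_sqrtVX 1 (p x x0)) (D0 x).
  rewrite (_ : (fun x => _) = (fun t : R => (Num.sqrt t ^+ 1)^-1) \o (fun x => 1 + x)); last by apply/funext => y /=; rewrite expr1.
  by apply: (is_derive_eq h); rewrite /h32 mulr1 expr1 mulrA.
have D2 (x : R) : 0 <= x -> is_derive x (1 : R) (fun x => - 2 * (Num.sqrt (1 + x))^-1) (h32 x).
  by move=> x0; have h := is_deriveZ (- 2) (D1 x x0); apply: (is_derive_eq h); rewrite /GRing.scale/=; field.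
have DV (x : R) : 0 <= x -> is_derive x (1 : R) (fun x => (1 + x)^-1) (- (1 + x) ^- 2).
  move=> x0; have h := @is_deriveV R (fun x => 1 + x) x _ 1 (lt0r_neq0 (p x x0)) (D0 x).
  by apply: (is_derive_eq h); rewrite /GRing.scale/= mulr1.
have c (x : R) : 0 <= x -> {for x, continuous h32}.
  by move=> x0; apply: continuousM; [exact: continuous_is_derive (DV x x0)|exact: continuous_is_derive (D1 x x0)].
have Fl : - 2 * (Num.sqrt (1 + x))^-1 @[x --> +oo%R] --> (0 : R).
  rewrite -[X in _ --> X](mulr0 (- 2)); apply: cvgM; first exact: cvg_cst.
  apply/(gtr0_cvgV0 (f := fun x : R => Num.sqrt (1 + x))).
    near=> x; have : 0 < x by near: x; exact: nbhs_pinfty_gt.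
    by move=> x0; rewrite sqrtr_gt0 addr_gt0.
  apply/cvgryPge => A; near=> x.
  have h : A ^+ 2 <= x by near: x; apply: nbhs_pinfty_ge; exact: num_real.
  have x0 : 0 <= x by exact: le_trans (sqr_ge0 A) h.
  apply: (@le_trans _ _ `|A|); first exact: ler_norm.
  by rewrite -sqrtr_sqr ler_wsqrtr// (le_trans h)// lerDr.
have m : measurable_fun setT h32.
  have m1 : measurable_fun setT (fun x : R => 1 + x) by exact: measurable_funD.
  apply: measurable_funM; first exact: measurable_inv.
  apply: measurable_inv.
  have H : measurable_fun setT (Num.sqrt : R -> R).
    by apply: continuous_measurable_fun; exact: sqrt_continuous.
  by have := measurableT_comp H m1.
by have [] := FTC_half_ge0 m h32_ge0 D2 c Fl.
Unshelve. all: by end_near. Qed.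

Lemma h32_le (s t : R) : 0 <= s -> s <= t -> h32 t <= h32 s.
Proof.
move=> s0 st; have s1 : 0 < 1 + s by rewrite ltr_pwDl.
have t1 : 0 < 1 + t by rewrite ltr_pwDl// (le_trans s0).
have st1 : 1 + s <= 1 + t by rewrite lerD2l.
apply: ler_pM; rewrite ?invr_ge0 ?sqrtr_ge0 ?(ltW t1)//.
  by rewrite lef_pV2 ?posrE.
by rewrite lef_pV2 ?posrE ?sqrtr_gt0// ler_wsqrtr.
Qed.

Lemma tail_decay (n : nat) (del : R) : (0 < n)%N -> 0 < del -> exists2 C, 0 <= C &
  forall t, del <= t -> (t * Num.sqrt (t ^+ n))^-1 <= C * h32 t.
Proof.
move=> n0 d0; pose r : R := 1 + del^-1.
have r0 : 0 < r by rewrite addr_gt0// invr_gt0.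
exists (r * Num.sqrt (r ^+ n)); first by rewrite mulr_ge0 ?sqrtr_ge0// ltW.
move=> t dt; have t0 : 0 < t by exact: lt_le_trans dt.
have t1 : 0 < 1 + t by rewrite addr_gt0.
have rt : 1 + t <= r * t.
  rewrite /r mulrDl mul1r addrC lerD2l ler_pdivlMl// mulr1//.
have rn : 1 + t <= (r * t) ^+ n.
  apply: (@le_trans _ _ (r * t)) => //; rewrite -[leLHS]expr1 ler_weXn2l//.
  by apply: le_trans rt; rewrite lerDl ltW.
rewrite invfM /h32 mulrACA; apply: ler_pM; rewrite ?invr_ge0 ?sqrtr_ge0 ?(ltW t0)//.
  by rewrite ler_pdivlMr// mulrC ler_pdivrMr.
have sn : 0 < Num.sqrt (t ^+ n) by rewrite sqrtr_gt0 exprn_gt0.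
rewrite ler_pdivlMr ?sqrtr_gt0// mulrC ler_pdivrMr// -sqrtrM ?exprn_ge0 ?(ltW r0)// -exprMn.
exact: ler_wsqrtr.
Qed.

End decay.

Lemma min_split (R : realFieldType) (r p w : R) : 0 < r -> 0 <= p -> 0 <= w ->
  p * w <= Num.min w (r * p) * p + r^-1 * w ^+ 2.
Proof.
move=> r0 p0 w0; case: (leP w (r * p)) => wp.
  by rewrite mulrC lerDl mulr_ge0 ?sqr_ge0 ?invr_ge0 ?(ltW r0).
apply: (@le_trans _ _ (r^-1 * w ^+ 2)); last by rewrite lerDr !mulr_ge0// ltW.
by rewrite expr2 mulrA ler_wpM2r// ler_pdivlMl// ltW.
Qed.

(** * Weak convergence in L2 from bounds and pointwise limits *)

Section weak_convergence.
Context d (T : measurableType d) (R : realType).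
Variable mu : {measure set T -> \bar R}.

Lemma fatou_L2 (h : nat -> T -> R) (h0 : T -> R) (M : R) :
  (forall j, L2 mu (h j)) -> (forall j, \int[mu]_x (h j x ^+ 2) <= M) ->
  measurable_fun setT h0 -> {ae mu, forall x, h ^~ x @ \oo --> h0 x} ->
  L2 mu h0 /\ \int[mu]_x (h0 x ^+ 2) <= M.
Proof.
move=> Lh hM mh0 hc.
have mE j : measurable_fun setT (fun x => (h j x ^+ 2)%:E).
  by apply/measurable_EFinP; apply: measurable_funX; exact: (Lh j).1.
have m0 : measurable_fun setT (fun x => h0 x ^+ 2) by exact: measurable_funX.
have F := @fatou _ T R mu setT measurableT (fun j x => (h j x ^+ 2)%:E) mE
  (fun j x _ => ltac:(by rewrite lee_fin sqr_ge0)).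
have B : (\int[mu]_x (h0 x ^+ 2)%:E <= M%:E)%E.
  apply: le_trans (_ : (limn_einf (fun j => \int[mu]_x (h j x ^+ 2)%:E) <= M%:E)%E); last first.
    rewrite limn_einf_lim; apply: lime_le; first exact: is_cvg_einfs.
    apply: nearW => j; apply: (@le_trans _ _ (\int[mu]_x (h j x ^+ 2)%:E)%E).
      by apply: ereal_inf_lbound; exists j => //=.
    by rewrite -(RintE (Lh j).2) lee_fin.
  apply: le_trans F; rewrite le_eqVlt; apply/orP; left; apply/eqP.
  apply: ae_eq_integral => //.
  - exact/measurable_EFinP.
  - have m : measurable_fun setT (fun x => limn_esup (fun j => (- (h j x ^+ 2)%:E)%E)).
      by apply: measurable_fun_limn_esup => j; exact: measurableT_comp (mE j).
    have mo : measurable_fun setT (-%E : \bar R -> \bar R) by exact: oppe_measurable.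
    by have := measurableT_comp mo m.
  - apply: filterS hc => x hx _; apply/esym.
    have c : (h j x ^+ 2)%:E @[j --> \oo] --> (h0 x ^+ 2)%:E.
      by apply: cvg_EFin; [exact: nearW|rewrite expr2; under eq_fun do rewrite /= expr2; exact: cvgM].
    by rewrite is_cvg_limn_einfE; [exact: (cvg_lim _ c)|exact: cvgP c].
have i : intble mu (fun x => h0 x ^+ 2).
  by apply/intble_ge0P => // [x|]; [exact: sqr_ge0|exact: le_lt_trans B (ltry _)].
by split=> //; rewrite -lee_fin RintE.
Qed.

(* Splitting according to whether [u <= r * |phi|]: the small part is dominated, the large part costs [u ^ 2 / r]. *)
Lemma weak_cvg (h : nat -> T -> R) (h0 phi : T -> R) (M : R) :
  (forall j, L2 mu (h j)) -> (forall j, \int[mu]_x (h j x ^+ 2) <= M) ->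
  L2 mu h0 -> L2 mu phi -> {ae mu, forall x, h ^~ x @ \oo --> h0 x} ->
  \int[mu]_x (phi x * h j x) @[j --> \oo] --> \int[mu]_x (phi x * h0 x).
Proof.
move=> Lh hM Lh0 Lphi hc.
pose u j x := `|h0 x - h j x|.
have Lu j : L2 mu (u j) by apply: L2_norm; exact: L2B.
pose M' := 2 * M + 2 * \int[mu]_x (h0 x ^+ 2).
have uM j : \int[mu]_x (u j x ^+ 2) <= M'.
  apply: (@le_trans _ _ (\int[mu]_x (2 * h j x ^+ 2 + 2 * h0 x ^+ 2))); last first.
    rewrite RintD; [|exact: intbleZ (Lh j).2|exact: intbleZ Lh0.2].
    by rewrite (RintZ _ (Lh j).2) (RintZ _ Lh0.2) lerD// ler_wpM2l.
  apply: Rint_le; first exact: (Lu j).2.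
    by apply: intbleD; apply: intbleZ; [exact: (Lh j).2|exact: Lh0.2].
  by move=> x; rewrite /u real_normK ?num_real//; have := sqr_ge0 (h0 x + h j x); nra.
have M0 : 0 <= M' by apply: le_trans (uM 0%N); apply: Rint_ge0 => x; exact: sqr_ge0.
pose v (r : R) j x := Num.min (u j x) (r * `|phi x|) * `|phi x|.
have mphi : measurable_fun setT (fun x => `|phi x|) by exact: (L2_norm Lphi).1.
have mv r j : measurable_fun setT (v r j).
  apply: measurable_funM => //; apply: measurable_minr; first exact: (Lu j).1.
  exact: measurable_funM.
have vb (r : R) j x : 0 < r -> `|v r j x| <= r * phi x ^+ 2.
  move=> r0; have p0 : 0 <= `|phi x| by [].
  have a0 : 0 <= r * `|phi x| by rewrite mulr_ge0// ltW.
  rewrite ger0_norm; last by rewrite mulr_ge0// le_min a0 normr_ge0.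
  rewrite -[phi x ^+ 2]real_normK ?num_real// expr2 mulrA ler_wpM2r//.
  by rewrite ge_min lexx orbT.
have iv (r : R) j : 0 < r -> intble mu (v r j).
  by move=> r0; apply: intble_le (mv r j) (intbleZ r Lphi.2) (fun x => vb r j x r0).
have vc (r : R) : 0 < r -> \int[mu]_x v r j x @[j --> \oo] --> (0 : R).
  move=> r0; have -> : 0 = \int[mu]_x (0 * phi x ^+ 2) :> R by rewrite RintZ ?mul0r//; exact: Lphi.2.
  apply: (@dominated_cvg _ _ _ mu (v r) _ (fun x => r * phi x ^+ 2)) => //.
  - by apply: measurable_funM => //; apply: measurable_funX; exact: Lphi.1.
  - exact: intbleZ Lphi.2.
  - apply: filterS hc => x hx; rewrite mul0r.
    have uc : u j x @[j --> \oo] --> (0 : R).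
      rewrite -(@normr0 _ R) -(subrr (h0 x)); apply: cvg_norm; apply: cvgB => //; exact: cvg_cst.
    apply: (@squeeze_cvgr _ _ _ _ (fun=> 0) (fun j => u j x * `|phi x|)).
    + near=> j; apply/andP; split.
        by rewrite mulr_ge0// le_min normr_ge0 mulr_ge0// ltW.
      by rewrite ler_wpM2r// ge_min lexx.
    + exact: cvg_cst.
    + by rewrite -[X in _ --> X](mul0r `|phi x|); apply: cvgM => //; exact: cvg_cst.
  - by move=> j x; exact: vb.
have key (r : R) j : 0 < r -> `|\int[mu]_x (phi x * h0 x) - \int[mu]_x (phi x * h j x)| <= \int[mu]_x v r j x + M' / r.
  move=> r0; rewrite -RintB; [|exact: L2M|exact: L2M].
  apply: (@le_trans _ _ (\int[mu]_x (v r j x + r^-1 * u j x ^+ 2))); last first.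
    rewrite RintD; [|exact: iv|exact: intbleZ (Lu j).2].
    by rewrite lerD2l RintZ ?[_ / r]mulrC ?ler_wpM2l ?invr_ge0 ?(ltW r0)//; exact: (Lu j).2.
  apply: Rint_norm_le.
  - by apply: intbleB; exact: L2M.
  - by apply: intbleD; [exact: iv|exact: intbleZ (Lu j).2].
  - move=> x; rewrite -mulrBr normrM -/(u j x) /v.
    by apply: min_split => //; exact: normr_ge0.
apply/cvgrPdist_le => e e0.
pose r := 2 * M' / e + 1.
have r0 : 0 < r by rewrite ltr_wpDl// divr_ge0 ?mulr_ge0// ltW.
have Mr : M' / r <= e / 2.
  rewrite ler_pdivrMr// /r mulrDr mulr1 (_ : e / 2 * (2 * M' / e) = M'); last by field; rewrite lt0r_neq0.
  by rewrite lerDl divr_ge0// ltW.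
have e2 : 0 < e / 2 by rewrite divr_gt0.
have /cvgrPdist_le/(_ _ e2) C := vc r r0.
near=> j; apply: le_trans (key r j r0) _.
have : `|0 - \int[mu]_x v r j x| <= e / 2 by near: j; exact: C.
rewrite sub0r normrN => hv; have := ler_norm (\int[mu]_x v r j x); lra.
Unshelve. all: by end_near. Qed.

End weak_convergence.

(** * Sharp truncations compared with truncations in scale *)

Section singular_kernel.
Variables (R : realType) (n d : nat) (P : mpoly.mpoly n R).
Local Notation V := 'rV[R]_n.
Local Notation mu := (lebesgue_rV R n).
Local Notation lam := (@lebesgue_measure R).
Local Notation gam := (gam R n).
Hypotheses (hP : homog d P) (hh : harm P) (od : odd d) (n0 : (0 < n)%N).
Local Notation q k t := (Q P d k t).
Local Notation N := (d + n).+1.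
Implicit Types (f h : V -> R).

Let d1 : (0 < d)%N. Proof. by case: (d) od. Qed.
Let N2 : (2 <= N)%N. Proof. by rewrite ltnS addn_gt0 d1. Qed.

Definition rk (y : V) : R := ev P y / hr_enorm y ^+ (n + d).
Definition hker (del : R) (y : V) : R := ind R (del < hr_enorm y) * rk y.
Definition Ek (del : R) (y : V) : R := ev P y * eK N del (sqn y).

Lemma Q_kE (t : R) (y : V) : 0 < t -> t ^+ d.-1 * q 0 (t ^+ 2) y = ev P y * kE N t (sqn y).
Proof.
move=> t0; rewrite QE psi0 /kE sqrtr_sqr gtr0_norm// -{3}(prednK d1) -addnn !addSn.
have h1 := expf_neq0 d.-1 (lt0r_neq0 t0); have h2 := expf_neq0 n (lt0r_neq0 t0).
rewrite -[in X in _ * (_ * (X^-1 * _))](prednK d1).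
rewrite !addSn !addnS !exprS !exprD; field; rewrite h1 h2 lt0r_neq0//.
Qed.

Lemma ev00 : ev P 0 = 0.
Proof. by rewrite -(scale0r (0 : V)) (evZ _ _ hP) expr0n -(prednK d1) mul0r. Qed.

Lemma enorm0_or (y : V) : y = 0 \/ 0 < hr_enorm y.
Proof.
have [h|y0] := eqVneq (hr_enorm y) 0; last by right; rewrite lt0r y0 hr_enorm_ge0.
left; apply/rowP => i; rewrite mxE; have := coord_le_hr_enorm y i.
by rewrite h normr_le0 => /eqP.
Qed.

Lemma hker_split (del : R) (y : V) : 0 < del ->
  cK R N * hker del y = Ek del y + \int[lam]_t (ind R (0 < t) * (ind R (del < t) * (ev P y * kE N t (sqn y)))).
Proof.
move=> del0; have [->|y0] := enorm0_or y.
  rewrite /hker /rk /Ek ev00 !mul0r !mulr0 add0r.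
  rewrite (@Rint_eq _ (measurableTypeR R) R lam _ (fun t : R => 0 * seg 0 1 t)); last first.
    by move=> t; rewrite !mul0r !mulr0.
  by rewrite RintZ ?mul0r//; exact: (seg_intble (@ltr01 R)).1.
have := eK_split N2 y0 del0; rewrite sqr_hr_enorm /= => E.
rewrite (@Rint_eq _ (measurableTypeR R) R lam _ (fun t : R => ev P y * (ind R (0 < t) * (ind R (del < t) * kE N t (sqn y))))); last first.
  by move=> t; ring.
rewrite RintZ; last first.
  by rewrite -sqr_hr_enorm; have [] := kE_int N2 (exprn_gt0 2 y0) (ltW del0).
rewrite /Ek -mulrDr -E /hker /rk [(n + d)%N]addnC; ring.
Qed.

Lemma Ek_scale (del : R) (y : V) : 0 < del -> Ek del y = (del ^+ n)^-1 * Ek 1 (del^-1 *: y).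
Proof.
move=> d0; have [->|y0] := enorm0_or y; first by rewrite scaler0 /Ek ev00 !mul0r mulr0.
have dn := lt0r_neq0 d0.
have s0 : 0 < sqn (del^-1 *: y) by rewrite sqnZ mulr_gt0 ?exprn_gt0 ?invr_gt0// -sqr_hr_enorm exprn_gt0.
rewrite /Ek (evZ _ _ hP) (_ : sqn y = del ^+ 2 * sqn (del^-1 *: y)); last first.
  by rewrite sqnZ; field.
rewrite (eK_scale N2)//= exprD exprVn.
by have h1 := expf_neq0 d dn; have h2 := expf_neq0 n dn; field; rewrite h1 h2.
Qed.

Lemma EkN del (y : V) : Ek del (- y) = - Ek del y.
Proof. by rewrite /Ek sqnN (evN _ hP od) mulNr. Qed.

Lemma rapid_Ek1 : rapid (Ek 1).
Proof.
have [C C0 hC] := @eK1_bound R N N2.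
have h2 : 0 < 1 / 2 :> R by rewrite divr_gt0.
have r := rapidZ C (rapid_ev_exp hP h2).
apply: rapid_le r _.
  apply: measurable_funM; first exact: measurable_ev.
  exact: measurableT_comp (@measurable_eK R N 1) (@measurable_sqn R n).
move=> y; have [->|y0] := enorm0_or y; first by rewrite /Ek ev00 !mul0r mulr0.
rewrite /Ek !normrM mulrCA ler_wpM2l// (ger0_norm C0) (ger0_norm (expR_ge0 _)).
have u0 : 0 < sqn y by rewrite -sqr_hr_enorm exprn_gt0.
by apply: le_trans (hC _ u0) _; rewrite (_ : 1 / 2 * sqn y = sqn y / 2)//; ring.
Qed.

Lemma rapid_scale f (a : R) : a != 0 -> rapid f -> rapid (fun y => f (a *: y)).
Proof.
move=> a0 [mf [C [b [C0 b0 hf]]]]; split.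
  have := measurableT_comp mf (@measurable_rV_affine R n 0 a).
  by congr measurable_fun; apply/funext => y /=; rewrite add0r.
exists C, (b * a ^+ 2); split=> //; first by rewrite mulr_gt0// exprn_even_gt0.
by move=> y; apply: le_trans (hf _) _; rewrite sqnZ mulrA.
Qed.

Lemma rapid_Ek (del : R) : 0 < del -> rapid (Ek del).
Proof.
move=> d0; rewrite (_ : Ek del = fun y => (del ^+ n)^-1 * Ek 1 (del^-1 *: y)).
  by apply: rapidZ; apply: rapid_scale; [rewrite invr_eq0 lt0r_neq0|exact: rapid_Ek1].
by apply/funext => y; exact: Ek_scale.
Qed.

Lemma Rint_dilate f (del : R) : 0 < del -> intble mu f ->
  \int[mu]_y ((del ^+ n)^-1 * f (del^-1 *: y)) = \int[mu]_y f y.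
Proof.
move=> d0 i; have dn : del^-1 != 0 by rewrite invr_eq0 lt0r_neq0.
have i2 := intble_affine 0 dn i.
rewrite [RHS](Rint_affine 0 dn i) gtr0_norm ?invr_gt0// exprVn -RintZ//.
by apply: Rint_eq => y; rewrite add0r.
Qed.

Definition eN : R := \int[mu]_y `|Ek 1 y|.

Lemma Rint_Ek (del : R) : 0 < del -> \int[mu]_y `|Ek del y| = eN.
Proof.
move=> d0; rewrite /eN -(Rint_dilate d0 (intble_norm (rapid_intble rapid_Ek1))).
apply: Rint_eq => y; rewrite Ek_scale// normrM ger0_norm//.
by rewrite invr_ge0 exprn_ge0// ltW.
Qed.

Definition sN k f : R := Num.sqrt (nQ2 d P k * \int[mu]_y (f y ^+ 2)).

Lemma sN_ge0 k f : 0 <= sN k f. Proof. exact: sqrtr_ge0. Qed.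

Lemma sqr_sN k f : sN k f ^+ 2 = nQ2 d P k * \int[mu]_y (f y ^+ 2).
Proof. by rewrite sqr_sqrtr// mulr_ge0//; apply: Rint_ge0 => y; exact: sqr_ge0. Qed.

Lemma conv_Q_norm k f (th : R) (x : V) : 0 < th -> L2 mu f ->
  th ^+ d.-1 * \int[mu]_y `|q k (th ^+ 2) (x - y) * f y| <= sN k f / th ^+ k.*2 * (th * Num.sqrt (th ^+ n))^-1.
Proof.
move=> th0 Lf; have t20 : 0 < th ^+ 2 by rewrite exprn_gt0.
have r := rapid_Q k hP t20.
have c := cauchy_schwarz_norm (L2_subl x (rapid_L2 r)) Lf.
rewrite (Rint_subl x (rapid_L2 r).2) Rint_Q2// in c.
set I := \int[mu]_y `|_| in c *.
have I0 : 0 <= I by exact: Rint_ge0.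
have sn : 0 < Num.sqrt (th ^+ n) by rewrite sqrtr_gt0 exprn_gt0.
have B : I <= sN k f / (th ^+ d * Num.sqrt (th ^+ n) * th ^+ k.*2).
  rewrite -(@ler_pXn2r _ 2)// ?nnegrE//; last first.
    by rewrite divr_ge0 ?sN_ge0// !mulr_ge0 ?exprn_ge0 ?sqrtr_ge0// ltW.
  apply: le_trans c _; rewrite expr_div_n sqr_sN !exprMn sqr_sqrtr ?exprn_ge0 ?(ltW th0)//.
  rewrite -!exprM !muln2 -!exprD (_ : (d.*2 + n + k.*2.*2 = d.*2 + n + 4 * k)%N); first by rewrite mulrAC.
  by rewrite -!muln2 -mulnA [(k * _)%N]mulnC.
apply: le_trans (ler_wpM2l (exprn_ge0 _ (ltW th0)) B) _.
rewrite -{2}(prednK d1) exprS.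
have h1 := expf_neq0 d.-1 (lt0r_neq0 th0); have h2 := expf_neq0 k.*2 (lt0r_neq0 th0).
rewrite le_eqVlt; apply/orP; left; apply/eqP; field.
by rewrite h1 h2 !lt0r_neq0.
Qed.

Lemma conv_Q_decay k f (th : R) (x : V) : 0 < th -> L2 mu f ->
  th ^+ d.-1 * `|conv (q k (th ^+ 2)) f x| <= sN k f / th ^+ k.*2 * (th * Num.sqrt (th ^+ n))^-1.
Proof.
move=> th0 Lf; apply: le_trans (conv_Q_norm k x th0 Lf); rewrite ler_wpM2l ?exprn_ge0 ?(ltW th0)// convE.
apply: le_normr_Rintegral => //; apply: intble_conv Lf; apply: rapid_L2.
by apply: rapid_Q => //; rewrite exprn_gt0.
Qed.

(** All scales above [del]: the limit of [hs] when its upper end tends to infinity. *)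
Definition hT (del : R) f (x : V) : R :=
  \int[lam]_t (ind R (0 < t) * (ind R (del < t) * (t ^+ d.-1 * conv (q 0 (t ^+ 2)) f x))).

Definition Td (del : R) f (x : V) : R := \int[mu]_y (hker del y * f (x - y)).

(** Fubini for [hker_split] against [f]. The integrability of the sharp truncation is itself
    obtained from that of the two terms on the right. *)
Lemma Td_split (del : R) f (x : V) : 0 < del -> L2 mu f ->
  intble mu (fun y => hker del y * f (x - y)) /\
  cK R N * Td del f x = conv (Ek del) f x + hT del f x.
Proof.
move=> del0 Lf; have [C C0 hC] := tail_decay n0 del0.
have Lfx := L2_subl x Lf.
pose F (t : R) (y : V) := ind R (0 < t) * (ind R (del < t) * (t ^+ d.-1 * (q 0 (t ^+ 2) y * f (x - y)))).
have mF : measurable_fun setT (fun z : measurableTypeR R * V => F z.1 z.2).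
  apply: measurable_funM; first by apply: measurable_ind_lt => //; exact: measurable_fst.
  apply: measurable_funM; first by apply: measurable_ind_lt => //; exact: measurable_fst.
  apply: measurable_funM; first by apply: measurable_funX; exact: measurable_fst.
  apply: measurable_funM; last exact: measurableT_comp Lfx.1 measurable_snd.
  under eq_fun do rewrite QE.
  apply: measurable_funM; first exact: measurableT_comp (measurable_ev P) measurable_snd.
  apply: measurable_psi; first by apply: measurable_funX; exact: measurable_fst.
  exact: measurableT_comp (@measurable_sqn R n) measurable_snd.
have i0 : intble mu (fun y : V => 0 * f y ^+ 2) by exact: intbleZ Lf.2.
have iF t : intble mu (F t).
  rewrite /F /ind; case: ifP => t0; last first.
    by rewrite (_ : (fun _ => _) = (fun y : V => 0 * f y ^+ 2))//; apply/funext => y; rewrite !mul0r.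
  case: ifP => _; last first.
    by rewrite (_ : (fun _ => _) = (fun y : V => 0 * f y ^+ 2))//; apply/funext => y; rewrite !mul0r mulr0.
  under eq_fun do rewrite !mul1r; apply: intbleZ; apply: L2M => //; apply: rapid_L2.
  by apply: rapid_Q => //; rewrite exprn_gt0.
have bF t : \int[mu]_y `|F t y| <= sN 0 f * C * (ind R (0 < t) * h32 t).
  rewrite /F {1 3}/ind; case: ifP => t0; last first.
    rewrite mul0r mulr0 (@Rint_eq _ _ R mu _ (fun y : V => 0 * f y ^+ 2)); last by move=> y; rewrite !mul0r normr0.
    by rewrite RintZ ?mul0r//; exact: Lf.2.
  have z0 : 0 <= sN 0 f * C * h32 t by apply: h32M_ge0; [exact: mulr_ge0 (sN_ge0 0 f) C0|exact: ltW].
  rewrite mul1r /ind; case: ifP => dt; last first.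
    rewrite (@Rint_eq _ _ R mu _ (fun y : V => 0 * f y ^+ 2)); last by move=> y; rewrite !mul0r mulr0 normr0.
    by rewrite RintZ ?mul0r//; exact: Lf.2.
  have := conv_Q_norm 0 x t0 Lf; rewrite expr0 divr1 => h.
  have tt := ltW t0.
  apply: le_trans (_ : t ^+ d.-1 * \int[mu]_y `|q 0 (t ^+ 2) (x - y) * f y| <= _).
    have i1 : intble mu (fun y => q 0 (t ^+ 2) (x - y) * f y).
      by apply: intble_conv Lf; apply: rapid_L2; apply: rapid_Q => //; rewrite exprn_gt0.
    rewrite -(Rint_subl x (intble_norm i1)) -RintZ; last exact: (intble_subl x (intble_norm i1)).
    rewrite le_eqVlt; apply/orP; left; apply/eqP; apply: Rint_eq => y.
    by rewrite subKr !mul1r normrM ger0_norm// exprn_ge0.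
  apply: le_trans h _; rewrite -mulrA ler_wpM2l ?sN_ge0//.
  by apply: hC; exact: ltW.
have fin := @iterated_lty _ _ _ _ _ lam mu F _ mF (intbleZ (sN 0 f * C) (@half_h32 R)) iF bF.
have mF' : measurable_fun setT (fun z : V * measurableTypeR R => F z.2 z.1).
  exact: (measurableT_comp mF (measurable_fun_pair measurable_snd measurable_fst)).
have fin' : (\int[mu]_y \int[lam]_t (`|F t y|)%:E < +oo)%E.
  rewrite -(@tonelli _ _ _ _ _ lam mu (fun t y => (`|F t y|)%:E))//.
  by apply/measurable_EFinP; exact: measurableT_comp.
have iG := @intble_fubini _ _ _ _ _ mu lam (fun y t => F t y) mF' fin'.
have GE y : cK R N * (hker del y * f (x - y)) = Ek del y * f (x - y) + \int[lam]_t F t y.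
  rewrite mulrA hker_split// mulrDl; congr (_ + _).
  have [->|y0] := enorm0_or y.
    rewrite (@Rint_eq _ (measurableTypeR R) R lam _ (fun t : R => 0 * seg 0 1 t)); last first.
      by move=> t; rewrite ev00 !mul0r !mulr0.
    rewrite [RHS](@Rint_eq _ (measurableTypeR R) R lam _ (fun t : R => 0 * seg 0 1 t)); last first.
      by move=> t; rewrite /F QE ev00 !mul0r !mulr0.
    have i01 := (seg_intble (@ltr01 R)).1.
    by rewrite RintZ ?mul0r.
  rewrite -RintZr; last first.
    have [i _] := kE_int N2 (exprn_gt0 2 y0) (ltW del0); rewrite sqr_hr_enorm in i.
    rewrite (_ : (fun t => _) = fun t : R => ev P y * (ind R (0 < t) * (ind R (del < t) * kE N t (sqn y)))); first exact: intbleZ.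
    by apply/funext => t; ring.
  apply: Rint_eq => t; rewrite /F /ind; case: ifP => t0; last by rewrite !mul0r.
  by rewrite !mul1r -Q_kE//; ring.
have cn := lt0r_neq0 (cK_gt0 R N2).
have iE : intble mu (fun y => Ek del y * f (x - y)).
  by apply: L2M => //; apply: rapid_L2; exact: rapid_Ek.
have ih : intble mu (fun y => hker del y * f (x - y)).
  rewrite (_ : (fun y => _) = fun y => (cK R N)^-1 * (Ek del y * f (x - y) + \int[lam]_t F t y)).
    by apply: intbleZ; exact: intbleD.
  by apply/funext => y; rewrite -GE mulKf.
split=> //; rewrite /Td -RintZ// (@Rint_eq _ _ R mu _ _ GE) RintD//; congr (_ + _).
  by rewrite conv_swap//; apply: rapid_L2; exact: rapid_Ek.
rewrite -(@Rfubini _ _ _ _ _ lam mu F mF fin) /hT; apply: Rint_eq => t.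
rewrite /F /ind; case: ifP => t0; last first.
  by rewrite mul0r (@Rint_eq _ _ R mu _ (fun y : V => 0 * f y ^+ 2)) ?RintZ ?mul0r//; [exact: Lf.2|move=> y; rewrite !mul0r].
case: ifP => dt; last first.
  by rewrite mul0r mulr0 (@Rint_eq _ _ R mu _ (fun y : V => 0 * f y ^+ 2)) ?RintZ ?mul0r//; [exact: Lf.2|move=> y; rewrite !mul0r mulr0].
have rQ : rapid (q 0 (t ^+ 2)) by apply: rapid_Q => //; rewrite exprn_gt0.
rewrite !mul1r conv_swap//; last exact: rapid_L2.
rewrite -RintZ; first by apply: Rint_eq => y; rewrite !mul1r.
by apply: L2M => //; exact: rapid_L2.
Qed.

End singular_kernel.

Section inversion.
Variables (R : realType) (n d : nat) (P : mpoly.mpoly n R).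
Local Notation V := 'rV[R]_n.
Local Notation mu := (lebesgue_rV R n).
Local Notation lam := (@lebesgue_measure R).
Local Notation gam := (gam R n).
Hypotheses (hP : homog d P) (hh : harm P) (od : odd d) (n0 : (0 < n)%N).
Local Notation q k t := (Q P d k t).
Local Notation N := (d + n).+1.
Implicit Types (f h : V -> R).

Let d1 : (0 < d)%N. Proof. by case: (d) od. Qed.
Let N2 : (2 <= N)%N. Proof. by rewrite ltnS addn_gt0 d1. Qed.

Lemma sqn_le_double (x y : V) : sqn x <= 2 * sqn (x + y) + 2 * sqn y.
Proof.
have := sqnD_le (x + y) (- y); rewrite addrK sqnN; lra.
Qed.

Lemma rapid_reflect f (x : V) : rapid f -> rapid (fun y => f (x - y)).
Proof.
move=> [mf [C [a [C0 a0 hf]]]]; split; first exact: measurableT_comp mf (measurable_subl x).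
exists (C * expR (a * sqn x)), (a / 2); split; rewrite ?mulr_ge0 ?expR_ge0 ?divr_gt0//.
move=> y; apply: le_trans (hf _) _; rewrite -mulrA ler_wpM2l// -expRD ler_expR.
have := sqn_le_double (- y) x; rewrite sqnN [- y + x]addrC; nra.
Qed.

Lemma continuous_psi M k (t : R) : continuous (psi M k t).
Proof.
move=> u; have c : {for u, continuous (fun u : R => u / t)}.
  by apply: continuousM; [exact: cvg_id|exact: cvg_cst].
have c1 : {for u, continuous (fun u : R => (lag R M k).[u / t])}.
  exact: (continuous_comp c (@continuous_horner R _ _)).
have c2 : {for u, continuous (fun u : R => expR (- (u / t)))}.
  exact: (continuous_comp (continuousN c) (@continuous_expR R _)).
have c3 : {for u, continuous (fun u : R => (Num.sqrt t ^+ M)^-1 * (t ^+ k)^-1 * (lag R M k).[u / t])}.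
  by apply: continuousM => //; exact: cvg_cst.
exact: continuousM c3 c2.
Qed.

(** Sequential continuity along lines is the only continuity that enters an approximate identity. *)
Definition line_continuous f := forall (y z : V) (r : nat -> R), r j @[j --> \oo] --> (0 : R) ->
  f (y + r j *: z) @[j --> \oo] --> f y.

Lemma line_continuous_H k (s : R) (x : V) : line_continuous (fun y => H k s (x - y)).
Proof.
move=> y z r r0; rewrite HE; under eq_fun do rewrite HE.
have c : sqn (x - (y + r j *: z)) @[j --> \oo] --> sqn (x - y).
  have E j : sqn (x - (y + r j *: z)) = sqn (x - y) + r j * (2 * dotp (x - y) (- z)) + r j * r j * sqn z.
    rewrite (_ : x - (y + r j *: z) = (x - y) + r j *: (- z)); last by rewrite scalerN opprD addrA.
    rewrite sqnD sqnZ sqnN.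
    have -> : dotp (x - y) (r j *: (- z)) = r j * dotp (x - y) (- z).
      by rewrite /dotp mulr_sumr; apply: eq_bigr => i _; rewrite !mxE; ring.
    by ring.
  have c : sqn (x - y) + r j * (2 * dotp (x - y) (- z)) + r j * r j * sqn z @[j --> \oo] -->
      sqn (x - y) + 0 * (2 * dotp (x - y) (- z)) + 0 * 0 * sqn z.
    apply: cvgD; first apply: cvgD.
    - exact: cvg_cst.
    - by apply: cvgM => //; exact: cvg_cst.
    - by apply: cvgM; [exact: cvgM|exact: cvg_cst].
  by rewrite !mul0r !addr0 in c; under eq_fun do rewrite E.
exact: (cvg_comp _ _ c (@continuous_psi _ _ _ _)).
Qed.

Lemma Rint_Ek1 : \int[mu]_y Ek d P 1 y = 0.
Proof.
have r := rapid_intble (rapid_Ek1 hP od).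
have := Rint_opp r; rewrite (@Rint_eq _ _ R mu _ (fun y => -1 * Ek d P 1 y)); last first.
  by move=> y; rewrite (EkN hP od) mulN1r.
by rewrite RintZ// mulN1r => h; lra.
Qed.

(** The kernel is moved onto [phi]; after rescaling, the factor of [f] is the integral of k(z) phi(y
    + r_j z) in z, which tends to (int k) phi(y) and is dominated by a Gaussian uniformly in [j]. *)
Lemma approx_identity (k : V -> R) (kr : nat -> V -> R) f (phi : V -> R) (r : nat -> R) :
  rapid k -> (forall j y, kr j y = (r j ^+ n)^-1 * k ((r j)^-1 *: y)) ->
  L2 mu f -> rapid phi ->
  {ae mu, forall y, forall z, phi (y + r j *: z) @[j --> \oo] --> phi y} ->
  (forall j, 0 < r j <= 1) ->
  \int[mu]_x (phi x * conv (kr j) f x) @[j --> \oo] --> (\int[mu]_y k y) * \int[mu]_x (phi x * f x).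
Proof.
move=> rE1 sc Lf rphi cphi r01.
have rE j : rapid (kr j).
  have /andP[r0 _] := r01 j.
  rewrite (_ : kr j = fun y => (r j ^+ n)^-1 * k ((r j)^-1 *: y)); last exact/funext/sc.
  by apply: rapidZ; apply: rapid_scale rE1; rewrite invr_eq0 lt0r_neq0.
pose w j (y : V) := \int[mu]_z (k z * phi (y + r j *: z)).
have Lphi := rapid_L2 rphi.
have E j : \int[mu]_x (phi x * conv (kr j) f x) = \int[mu]_y (f y * w j y).
  have /andP[r0 _] := r01 j; have rn := lt0r_neq0 r0.
  rewrite (conv_adjoint (rE j) Lf Lphi); apply: Rint_eq => y; congr (_ * _).
  have i : intble mu (fun x => kr j (x - y) * phi x).
    by apply: L2M => //; apply: L2_subr; exact: rapid_L2.
  rewrite (Rint_affine y rn i) gtr0_norm// -RintZ; last exact: (intble_affine y rn i).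
  apply: Rint_eq => z; rewrite [y + _]addrC addrK sc scalerA mulVf// scale1r [_ + y]addrC.
  by have h := expf_neq0 n rn; field.
under eq_fun do rewrite E.
have [mphi [C [a [C0 a0 hC]]]] := rphi; have [mE [C1 [b [C10 b0 hC1]]]] := rE1.
(* As r <= 1, |y|^2 <= 2 |y + r z|^2 + 2 |z|^2. With a' <= a and a' <= b/2, the decay of [phi] and
   half of the decay of [k] yield decay in [y], and the other half of the latter remains for [z]. *)
pose a' := Num.min a (b / 2).
have a'0 : 0 < a' by rewrite lt_min a0 divr_gt0.
have a'a : a' <= a by rewrite ge_min lexx.
have a'b : a' <= b / 2 by rewrite ge_min lexx orbT.
have pw j y z : `|k z * phi (y + r j *: z)| <= C1 * C * expR (- (a' / 2 * sqn y)) * expR (- (b / 2 * sqn z)).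
  have /andP[r0 r1] := r01 j.
  rewrite normrM; apply: le_trans (ler_pM _ _ (hC1 z) (hC _)) _ => //.
  rewrite mulrACA -[leRHS]mulrA ler_wpM2l ?mulr_ge0// -!expRD ler_expR.
  have h1 := sqn_le_double y (r j *: z); rewrite sqnZ in h1.
  have s0 := sqn_ge0 z; have s1 := sqn_ge0 (y + r j *: z).
  have h2 : r j ^+ 2 * sqn z <= sqn z.
    by rewrite ler_piMl// exprn_ile1// ltW.
  have h3 : a' * sqn (y + r j *: z) <= a * sqn (y + r j *: z) by rewrite ler_wpM2r.
  have h4 : a' * sqn z <= b / 2 * sqn z by rewrite ler_wpM2r.
  have h5 : a' / 2 * sqn y <= a' / 2 * (2 * sqn (y + r j *: z) + 2 * sqn z).
    rewrite ler_wpM2l ?divr_ge0 ?(ltW a'0)//; lra.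
  lra.
have b20 : 0 < b / 2 by rewrite divr_gt0.
have iG := @intble_gauss R n _ b20.
have mpr j (y : V) : measurable_fun setT (fun z : V => phi (y + r j *: z)).
  exact: measurableT_comp mphi (@measurable_rV_affine R n y (r j)).
have wb j y : `|w j y| <= C1 * C * (\int[mu]_z expR (- (b / 2 * sqn z))) * expR (- (a' / 2 * sqn y)).
  rewrite mulrAC -RintZ//; apply: Rint_norm_le => //; last exact: intbleZ.
  by apply: intble_le (intbleZ _ iG) (pw j y); exact: measurable_funM.
have wc : {ae mu, forall y, w j y @[j --> \oo] --> (\int[mu]_z k z) * phi y}.
  apply: filterS cphi => y cy; rewrite -RintZr; last exact: rapid_intble.
  apply: (@dominated_cvg _ _ _ mu _ _ (fun z => C1 * C * expR (- (a' / 2 * sqn y)) * expR (- (b / 2 * sqn z)))).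
  - by move=> j; exact: measurable_funM.
  - exact: measurable_funM.
  - exact: intbleZ.
  - by apply: aeW => z; apply: cvgM; [exact: cvg_cst|exact: cy].
  - by move=> j z; exact: pw.
have mw j : measurable_fun setT (w j).
  apply: (@measurable_Rint _ _ _ _ _ mu (fun (y : V) (z : V) => k z * phi (y + r j *: z))).
  apply: measurable_funM; first exact: measurableT_comp mE measurable_snd.
  apply: measurableT_comp mphi _; apply: measurable_rVD; first exact: measurable_fst.
  by apply: measurable_rVZ => //; exact: measurable_snd.
have a20 : 0 < a' / 2 by rewrite divr_gt0.
rewrite -RintZ; last exact: L2M.
pose K := C1 * C * (\int[mu]_z expR (- (b / 2 * sqn z))).
have rg : rapid (fun y : V => expR (- (a' / 2 * sqn y))).
  split; first exact: measurable_gauss.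
  by exists 1, (a' / 2); split=> // y; rewrite mul1r ger0_norm ?expR_ge0.
apply: (@dominated_cvg _ _ _ mu (fun j y => f y * w j y) _ (fun y => K * `|f y * expR (- (a' / 2 * sqn y))|)).
- by move=> j; apply: measurable_funM => //; exact: Lf.1.
- by apply: measurable_funM => //; apply: measurable_funM => //; exact: Lf.1.
- by apply: intbleZ; apply: intble_norm; apply: L2M => //; exact: rapid_L2.
- apply: filterS wc => y wy; rewrite [X in _ --> X](_ : _ = f y * ((\int[mu]_z k z) * phi y)); last by ring.
  by apply: cvgM; [exact: cvg_cst|exact: wy].
- move=> j y; rewrite !normrM mulrCA ler_wpM2l// (ger0_norm (expR_ge0 _)); exact: wb.
Qed.

(** Put r^2 = s + t^2. Then r >= sqrt s keeps away from the singularity at time 0, while r >= t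
    carries the decay at infinity. *)
Lemma conv_Q_shift_decay k (s : R) f : 0 < s -> L2 mu f -> exists2 C, 0 <= C & forall x t, 0 < t ->
  t ^+ d.-1 * `|conv (q k (s + t ^+ 2)) f x| <= C * h32 t.
Proof.
move=> s0 Lf; have ss : 0 < Num.sqrt s by rewrite sqrtr_gt0.
have [C C0 hC] := tail_decay n0 ss.
exists (sN d P k f / Num.sqrt s ^+ k.*2 * C).
  by rewrite !mulr_ge0 ?sN_ge0 ?invr_ge0// exprn_ge0// ltW.
move=> x t t0; pose r := Num.sqrt (s + t ^+ 2).
have st : 0 <= s + t ^+ 2 by rewrite addr_ge0 ?sqr_ge0// ltW.
have rE : r ^+ 2 = s + t ^+ 2 by rewrite sqr_sqrtr.
have sr : Num.sqrt s <= r by rewrite ler_wsqrtr// lerDl sqr_ge0.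
have tr : t <= r by rewrite -[t]ger0_norm ?(ltW t0)// -sqrtr_sqr ler_wsqrtr// lerDr ltW.
have r0 : 0 < r by exact: lt_le_trans sr.
have := conv_Q_decay hP od k x r0 Lf; rewrite rE => B.
apply: (@le_trans _ _ (r ^+ d.-1 * `|conv (q k (s + t ^+ 2)) f x|)).
  by rewrite ler_wpM2r// lerXn2r ?nnegrE ?(ltW t0) ?(ltW r0).
apply: le_trans B _; rewrite -[leRHS]mulrA; apply: ler_pM.
- by rewrite divr_ge0 ?sN_ge0// exprn_ge0// ltW.
- by rewrite invr_ge0 mulr_ge0 ?sqrtr_ge0// ltW.
- apply: ler_wpM2l; first exact: sN_ge0.
  by rewrite lef_pV2 ?posrE ?exprn_gt0// lerXn2r ?nnegrE ?(ltW ss) ?(ltW r0).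
- apply: le_trans (hC _ sr) _; rewrite ler_wpM2l//; apply: h32_le => //; exact: ltW.
Qed.

Section limit.
Variables (f g : V -> R).
Hypotheses (Lf : L2 mu f) (mg : measurable_fun setT g).
Hypothesis fg : {ae mu, forall x, Td d P j.+1%:R^-1 f x @[j --> \oo] --> g x}.

Let r j : R := j.+1%:R^-1.
(** Starts at 2, so that [r j < b j] also for j = 0, where [r j] is 1. *)
Let b j : R := j.+2%:R.
Let r01 j : 0 < r j <= 1.
Proof. by rewrite /r invr_gt0 ltr0n/= invf_le1 ?ltr0n// ler1n. Qed.
Let rb j : r j < b j.
Proof. by have /andP[_ h] := r01 j; apply: le_lt_trans h _; rewrite /b ltr1n. Qed.
Let rc : r j @[j --> \oo] --> (0 : R). Proof. exact: cvg_harmonic. Qed.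

(** The truncation cK Td at radius [r j], except that the scales above [b j] are missing; in this
    form it is in L2 with a bound independent of [j]. *)
Let T j x := conv (Ek d P (r j)) f x + hs d P f (r j) (b j) x.
Let r0 j : 0 < r j. Proof. by have /andP[] := r01 j. Qed.
Let Lhs j : L2 mu (hs d P f (r j) (b j)).
Proof. exact: hs_L2. Qed.
Let LE j : L2 mu (conv (Ek d P (r j)) f).
Proof. by apply: conv_L2 Lf; exact: rapid_Ek. Qed.
Let LT j : L2 mu (T j). Proof. exact: L2D. Qed.

Let TM : exists M, forall j, \int[mu]_x (T j x ^+ 2) <= M.
Proof.
have [C C0 hC] := hs_bound hP hh od.
exists (2 * ((eN d P + 1) ^+ 2 * \int[mu]_x (f x ^+ 2)) + 2 * (C * \int[mu]_x (f x ^+ 2))) => j.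
have e0 : 0 <= eN d P by exact: Rint_ge0.
have Y : \int[mu]_x (conv (Ek d P (r j)) f x ^+ 2) <= (eN d P + 1) ^+ 2 * \int[mu]_x (f x ^+ 2).
  apply: young Lf; first exact: rapid_intble (rapid_Ek hP od (r0 j)).
    by rewrite ltr_wpDl.
  by rewrite (Rint_Ek hP od)// lerDl.
apply: (@le_trans _ _ (\int[mu]_x (2 * conv (Ek d P (r j)) f x ^+ 2 + 2 * hs d P f (r j) (b j) x ^+ 2))).
  apply: Rint_le; first exact: (LT j).2.
    by apply: intbleD; apply: intbleZ; [exact: (LE j).2|exact: (Lhs j).2].
  move=> x; rewrite /T; move: (conv _ _ x) (hs _ _ _ _ _ x) => u v.
  by have := sqr_ge0 (u - v); nra.
rewrite RintD; [|exact: intbleZ (LE j).2|exact: intbleZ (Lhs j).2].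
rewrite (RintZ _ (LE j).2) (RintZ _ (Lhs j).2) lerD ?ler_wpM2l//.
exact: hC.
Qed.

(** The difference consists of the scales t >= b j, hence is at most a constant times the tail of
    the integrable function [h32]. *)
Let Tlim (x : V) : hs d P f (r j) (b j) x - hT d P (r j) f x @[j --> \oo] --> (0 : R).
Proof.
have [C C0 hC] := tail_decay n0 (@ltr01 R).
have S0 := sN_ge0 d P 0 f.
pose U (t : R) := t ^+ d.-1 * conv (q 0 (t ^+ 2)) f x.
have mU : measurable_fun setT U.
  apply: measurable_funM; first exact: measurable_funX.
  have m := @measurable_convQ2 R n d P 0 f (fun t => t ^+ 2) (measurable_funX 2 (@measurable_id _ _ _)) Lf.1.
  have mp : measurable_fun setT (fun t : measurableTypeR R => (t, x)) by exact: measurable_fun_pair.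
  exact: measurableT_comp m mp.
have Ub (t : R) : 0 < t -> `|U t| <= sN d P 0 f * (t * Num.sqrt (t ^+ n))^-1.
  move=> t0; have := conv_Q_decay hP od 0 x t0 Lf; rewrite expr0 divr1.
  by rewrite /U normrM ger0_norm// exprn_ge0// ltW.
have iT (del : R) : 0 < del -> intble lam (fun t => ind R (0 < t) * (ind R (del < t) * U t)).
  move=> del0; have [D D0 hD] := tail_decay n0 del0.
  apply: intble_le (intbleZ (sN d P 0 f * D) (@half_h32 R)) _.
    by apply: measurable_funM; [exact: measurable_ind_lt|apply: measurable_funM => //; exact: measurable_ind_lt].
  move=> t; rewrite normrM ind_norm /ind; case: ifP => t0; last by rewrite !mul0r mulr0.
  have z0 : 0 <= sN d P 0 f * D * h32 t by apply: h32M_ge0; [exact: mulr_ge0|exact: ltW].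
  rewrite !mul1r; case: ifP => dt; last by rewrite mul0r normr0.
  rewrite mul1r; apply: le_trans (Ub t t0) _; rewrite -mulrA ler_wpM2l//; apply: hD; exact: ltW.
have ihs j : intble lam (fun t => seg (r j) (b j) t * U t).
  apply: (@seg_bounded _ _ _ (sN d P 0 f * (r j * Num.sqrt (r j ^+ n))^-1)) => //.
  move=> t /andP[rt _]; have t0 := lt_trans (r0 j) rt.
  apply: le_trans (Ub t t0) _; rewrite ler_wpM2l// lef_pV2 ?posrE ?mulr_gt0 ?sqrtr_gt0 ?exprn_gt0//.
  apply: ler_pM; rewrite ?sqrtr_ge0 ?(ltW (r0 j)) ?(ltW rt)//.
  by rewrite ler_wsqrtr// lerXn2r ?nnegrE ?(ltW t0) ?(ltW (r0 j))// ltW.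
pose K := sN d P 0 f * C.
have vc : \int[lam]_t (ind R (0 < t) * (ind R (b j <= t) * h32 t)) @[j --> \oo] --> (0 : R).
  have mh : measurable_fun setT (fun t : R => ind R (0 < t) * h32 t) := intble_measurable (@half_h32 R).
  have z : \int[lam]_t (0 * (ind R (0 < t) * h32 t)) = 0 by rewrite RintZ ?mul0r//; exact: half_h32.
  suff : \int[lam]_t (ind R (0 < t) * (ind R (b j <= t) * h32 t)) @[j --> \oo] -->
      \int[lam]_t (0 * (ind R (0 < t) * h32 t)) by rewrite z.
  apply: (@dominated_cvg _ _ (measurableTypeR R) lam _ _ (fun t => ind R (0 < t) * h32 t)).
  - move=> j; under eq_fun do rewrite mulrCA; apply: measurable_funM => //; exact: measurable_ind_le.
  - exact: measurable_funM.
  - exact: half_h32.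
  - apply: aeW => t /=; rewrite mul0r; apply: cvg_near_cst; near=> j.
    have h : t < b j.
      near: j; have := nbhs_infty_gtr t; apply: filterS => j /lt_trans; apply.
      by rewrite /b ltr_nat.
    by rewrite [b j <= t]leNgt h/= mul0r mulr0.
  - move=> j t; rewrite /ind; case: ifP => t0; last by rewrite !mul0r normr0.
    rewrite !mul1r; case: ifP => _; rewrite ?mul1r ?mul0r ?normr0 ?h32_ge0 ?(ltW t0)//.
    by rewrite ger0_norm ?h32_ge0 ?(ltW t0).
have ivj j : intble lam (fun t => ind R (0 < t) * (ind R (b j <= t) * h32 t)).
  apply: intble_le (@half_h32 R) _.
    under eq_fun do rewrite mulrCA; apply: measurable_funM; first exact: measurable_ind_le.
    exact: intble_measurable (@half_h32 R).
  move=> t; rewrite /ind; case: ifP => t0; last by rewrite !mul0r normr0.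
  rewrite !mul1r; case: ifP => _; rewrite ?mul1r ?mul0r ?normr0 ?h32_ge0 ?(ltW t0)//.
  by rewrite ger0_norm ?h32_ge0 ?(ltW t0).
apply/cvgrPdist_le => e e0.
have K1 : 0 < K + 1 by rewrite ltr_wpDl// mulr_ge0.
have eK0 : 0 < e / (K + 1) by rewrite divr_gt0.
have /cvgrPdist_le/(_ _ eK0) A := vc.
near=> j; rewrite sub0r normrN.
have : `|0 - \int[lam]_t (ind R (0 < t) * (ind R (b j <= t) * h32 t))| <= e / (K + 1) by near: j; exact: A.
rewrite sub0r normrN; set I := \int[lam]_t _ => hI.
apply: (@le_trans _ _ (K * I)); last first.
  rewrite ler_pdivlMr// in hI; have := ler_norm I; have K0 : 0 <= K by rewrite mulr_ge0.
  have I0 : 0 <= `|I| by []; move=> II.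
  by apply: le_trans (ler_wpM2l K0 II) _; nra.
rewrite -RintB; [|exact: ihs|exact: iT].
rewrite -RintZ//; apply: Rint_norm_le; [apply: intbleB; [exact: ihs|exact: iT]|exact: intbleZ|].
move=> t; rewrite -/(U t) /seg /ind.
case: (ltP 0 t) => t0; last first.
  by rewrite ltNge (le_trans t0 (ltW (r0 j)))/= !mul0r subrr normr0 mulr0.
have hh0 : 0 <= K * h32 t by apply: h32M_ge0; [exact: mulr_ge0|exact: ltW].
rewrite !mul1r; case: (ltP (r j) t) => rt /=; last by rewrite !mul0r subrr normr0; case: ifP; rewrite ?mul1r// mul0r mulr0.
rewrite [b j <= t]leNgt; case: (ltP t (b j)) => tb /=; first by rewrite !mul1r mul0r subrr normr0 mulr0.
rewrite !mul1r mul0r sub0r normrN; apply: le_trans (Ub t t0) _.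
rewrite /K -mulrA ler_wpM2l//; apply: hC; apply: le_trans tb; by rewrite /b ler1n.
Unshelve. all: by end_near. Qed.

Let Tae : {ae mu, forall x, T j x @[j --> \oo] --> cK R N * g x}.
Proof.
apply: filterS fg => x hx.
have E j : T j x = cK R N * Td d P (r j) f x + (hs d P f (r j) (b j) x - hT d P (r j) f x).
  by have [_ ->] := Td_split hP od n0 x (r0 j) Lf; rewrite /T; ring.
under eq_fun do rewrite E.
have -> : cK R N * g x = cK R N * g x + 0 by rewrite addr0.
apply: cvgD; last exact: Tlim.
by apply: cvgM; [exact: cvg_cst|exact: hx].
Qed.

Let cK0 : 0 < cK R N. Proof. exact: cK_gt0. Qed.

Let LKg : L2 mu (fun x => cK R N * g x).
Proof.
have [M hM] := TM.
by have [] := fatou_L2 LT hM (measurable_funM (measurable_cst _) mg) Tae.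
Qed.

Lemma L2_limit : L2 mu g.
Proof.
rewrite (_ : g = fun x => (cK R N)^-1 * (cK R N * g x)); first exact: L2Z.
by apply/funext => x; rewrite mulKf// lt0r_neq0.
Qed.

(* The truncations are bounded in L2 and converge almost everywhere, hence weakly;
   test against a heat kernel, which commutes with [Q]. *)
Lemma inversion k (s : R) (x : V) : 0 < s ->
  intble lam (fun t => ind R (0 < t) * (t ^+ d.-1 * conv (q k (s + t ^+ 2)) f x)) /\
  cK R N * conv (H k s) g x =
  gam * \int[lam]_t (ind R (0 < t) * (t ^+ d.-1 * conv (q k (s + t ^+ 2)) f x)).
Proof.
move=> s0; have rH := rapid_H n k s0.
have rphi := rapid_reflect x rH.
pose phi y := H k s (x - y).
have Lphi : L2 mu phi by exact: rapid_L2.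
have [M hM] := TM.
have W := weak_cvg LT hM LKg Lphi Tae.
(* [Ek] is odd and so has integral 0: its dilates are an approximate identity of mass 0. *)
have V1 : \int[mu]_x (phi x * conv (Ek d P (r j)) f x) @[j --> \oo] --> (0 : R).
  rewrite -(mul0r (\int[mu]_x (phi x * f x))) -Rint_Ek1.
  apply: (approx_identity (rapid_Ek1 hP od)) => //; last first.
    by apply: aeW => y z; exact: (@line_continuous_H k s x y z r rc).
  by move=> j y; have /andP[rj _] := r01 j; exact: Ek_scale.
pose W0 (t : R) := t ^+ d.-1 * conv (q k (s + t ^+ 2)) f x.
have mW : measurable_fun setT W0.
  apply: measurable_funM; first exact: measurable_funX.
  have ms : measurable_fun setT (fun t : R => s + t ^+ 2) by apply: measurable_funD => //; exact: measurable_funX.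
  have m := @measurable_convQ2 R n d P k f (fun t => s + t ^+ 2) ms Lf.1.
  have mp : measurable_fun setT (fun t : measurableTypeR R => (t, x)) by exact: measurable_fun_pair.
  exact: measurableT_comp m mp.
have [C C0 hC] := conv_Q_shift_decay k s0 Lf.
have bW (t : R) : 0 < t -> `|W0 t| <= C * h32 t.
  by move=> t0; rewrite normrM ger0_norm ?exprn_ge0 ?(ltW t0)//; exact: hC.
have iC : intble lam (fun t => C * (ind R (0 < t) * h32 t)) by exact: intbleZ (@half_h32 R).
have iW : intble lam (fun t => ind R (0 < t) * W0 t).
  apply: intble_le iC _; first by apply: measurable_funM => //; exact: measurable_ind_lt.
  move=> t; rewrite normrM ind_norm /ind; case: ifP => t0; last by rewrite !mul0r mulr0.
  by rewrite !mul1r bW.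
split=> //.
have E j : \int[mu]_y (phi y * T j y) = \int[mu]_y (phi y * conv (Ek d P (r j)) f y) +
    gam * \int[lam]_t (seg (r j) (b j) t * W0 t).
  rewrite (@Rint_eq _ _ R mu _ (fun y => phi y * conv (Ek d P (r j)) f y + phi y * hs d P f (r j) (b j) y)); last first.
    by move=> y; rewrite -mulrDr.
  rewrite RintD; [|exact: L2M|exact: L2M]; congr (_ + _).
  rewrite (hs_pair hP hh Lf (r0 j) (rb j) Lphi) -RintZ; last first.
    apply: intble_le iC _; first by apply: measurable_funM => //; exact: measurable_seg.
    move=> t; rewrite normrM ind_norm /seg /ind; case: ifP => [/andP[rt _]|_]; last first.
      by rewrite mul0r; apply: mulr_ge0 => //; case: ifP => t0; rewrite ?mul0r// mul1r h32_ge0// ltW.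
    by have t0 := lt_trans (r0 j) rt; rewrite t0 !mul1r bW.
  apply: Rint_eq => t; rewrite /seg /ind; case: ifP => [/andP[rt _]|_]; last by rewrite !mul0r mulr0.
  have t0 := lt_trans (r0 j) rt; have t20 : 0 < t ^+ 2 by rewrite exprn_gt0.
  have := conv_H_conv_Q hP hh k 0 x s0 t20 Lf; rewrite addn0 convE => ->.
  by rewrite /W0; ring.
have C2 : \int[mu]_y (phi y * T j y) @[j --> \oo] --> gam * \int[lam]_t (ind R (0 < t) * W0 t).
  under eq_fun do rewrite E.
  have -> : gam * \int[lam]_t (ind R (0 < t) * W0 t) = 0 + gam * \int[lam]_t (ind R (0 < t) * W0 t) by rewrite add0r.
  apply: cvgD; first exact: V1.
  apply: cvgM; first exact: cvg_cst.
  apply: (@dominated_cvg _ _ (measurableTypeR R) lam _ _ (fun t => C * (ind R (0 < t) * h32 t))).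
  - by move=> j; apply: measurable_funM => //; exact: measurable_seg.
  - by apply: measurable_funM => //; exact: measurable_ind_lt.
  - exact: iC.
  - apply: aeW => t /=; apply: cvgM; last exact: cvg_cst.
    apply: cvg_near_cst; case: (ltP 0 t) => t0; last first.
      by apply: nearW => j; rewrite seg0.
    near=> j; rewrite /seg (_ : r j < t < b j)//; apply/andP; split.
      near: j; have /cvgrPdist_lt/(_ _ t0) := rc; apply: filterS => j.
      by rewrite sub0r normrN ger0_norm// ltW.
    near: j; have := nbhs_infty_gtr t; apply: filterS => j /lt_trans; apply.
    by rewrite /b ltr_nat.
  - move=> j t; rewrite normrM ind_norm /seg /ind; case: ifP => [/andP[rt _]|_]; last first.
      by rewrite mul0r; apply: mulr_ge0 => //; case: ifP => t0; rewrite ?mul0r// mul1r h32_ge0// ltW.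
    by have t0 := lt_trans (r0 j) rt; rewrite t0 !mul1r bW.
transitivity (\int[mu]_y (phi y * (cK R N * g y))); last exact: cvg_unique W C2.
rewrite convE -RintZ; last exact: intble_conv (rapid_L2 rH) L2_limit.
by apply: Rint_eq => y; rewrite mulrCA.
Unshelve. all: by end_near. Qed.

End limit.
End inversion.

(** * Radial cutoffs *)

Section polynomial_differences.
Variable R : realType.
Implicit Types p : {poly R}.

Lemma poly_lipschitz p : exists2 L, 0 <= L & forall x y, 0 <= x <= 1 -> 0 <= y <= 1 ->
  `|p.[x] - p.[y]| <= L * `|x - y|.
Proof.
elim/poly_ind: p => [|p c [L L0 hL]]; first by exists 0 => // x y _ _; rewrite !horner0 subrr normr0 mul0r.
exists (L + `|p.[1]| + L) => [|x y hx hy]; first by rewrite !addr_ge0.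
have h1 : 0 <= (1 : R) <= 1 by rewrite ler01 lexx.
rewrite !hornerMXaddC; have -> : p.[x] * x + c - (p.[y] * y + c) = (p.[x] - p.[y]) * x + p.[y] * (x - y) by ring.
apply: le_trans (ler_normD _ _) _; rewrite !normrM.
have /andP[x0 x1] := hx; have /andP[y0 y1] := hy.
have A := hL x y hx hy; have B := hL y 1 hy h1.
have y1n : `|y - 1| <= 1 by rewrite ler_norml; lra.
have C : `|p.[y]| <= `|p.[1]| + L.
  rewrite -[p.[y]](subrK p.[1]); apply: le_trans (ler_normD _ _) _; rewrite addrC lerD2l.
  by apply: le_trans B _; rewrite ler_piMr.
rewrite (ger0_norm x0) -addrA mulrDl; apply: lerD.
  by apply: le_trans A; rewrite ler_piMr.
exact: ler_wpM2r.
Qed.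

Lemma poly_second_difference p : exists2 C, 0 <= C & forall a b, 0 <= a + b <= 1 -> 0 <= a - b <= 1 ->
  `|p.[a + b] + p.[a - b] - 2 * p.[a]| <= C * b ^+ 2.
Proof.
elim/poly_ind: p => [|p c [C C0 hC]].
  by exists 0 => // a b _ _; rewrite !horner0 mulr0 subr0 addr0 normr0 mul0r.
have [L L0 hL] := poly_lipschitz p.
exists (C + L * 2) => [|a b h1 h2]; first by rewrite addr_ge0// mulr_ge0.
rewrite !hornerMXaddC.
have -> : p.[a + b] * (a + b) + c + (p.[a - b] * (a - b) + c) - 2 * (p.[a] * a + c) =
    a * (p.[a + b] + p.[a - b] - 2 * p.[a]) + b * (p.[a + b] - p.[a - b]) by ring.
apply: le_trans (ler_normD _ _) _; rewrite !normrM [leRHS]mulrDl; apply: lerD.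
  apply: le_trans (hC a b h1 h2); rewrite ler_piMl// ler_norml.
  by have := h1; have := h2 => /andP[? ?] /andP[? ?]; lra.
apply: le_trans (ler_wpM2l (normr_ge0 b) (hL _ _ h1 h2)) _.
have -> : a + b - (a - b) = 2 * b by ring.
rewrite normrM (ger0_norm (ler0n R 2)) -[in leRHS](real_normK (num_real b)) expr2.
by have -> : `|b| * (L * (2 * `|b|)) = L * 2 * (`|b| * `|b|) by ring.
Qed.

End polynomial_differences.

Section radial_cutoff.
Variables (R : realType) (n : nat) (p : {poly R}).
Hypothesis p1 : p.[1] = 0.
Local Notation V := 'rV[R]_n.
Local Notation mu := (lebesgue_rV R n).
Local Notation nm := (@hr_enorm R n).

Definition cutp (y : V) : R := if sqn y < 1 then p.[sqn y] else 0.

Lemma cutp_out y : 1 <= nm y -> cutp y = 0.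
Proof.
move=> h; rewrite /cutp ltNge -sqr_hr_enorm expr_ge1 ?hr_enorm_ge0//= h//.
Qed.

Lemma cutp_in y : nm y <= 1 -> cutp y = p.[sqn y].
Proof.
move=> h; rewrite /cutp; case: ltP => // h1.
have h2 : sqn y <= 1 by rewrite -sqr_hr_enorm exprn_ile1 ?hr_enorm_ge0.
by rewrite (_ : sqn y = 1) ?p1//; apply/eqP; rewrite eq_le h1 h2.
Qed.

Lemma measurable_cutp : measurable_fun setT cutp.
Proof.
rewrite (_ : cutp = fun y => ind R (sqn y < 1) * p.[sqn y]); last first.
  by apply/funext => y; rewrite /cutp /ind; case: ifP; rewrite ?mul1r ?mul0r.
apply: measurable_funM; first by apply: measurable_ind_lt => //; exact: measurable_sqn.
apply: measurableT_comp (@measurable_sqn R n).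
by apply: continuous_measurable_fun; exact: continuous_horner.
Qed.

Lemma cutp_lipschitz : exists2 L, 0 <= L & forall x y, `|cutp x - cutp y| <= L * `|nm x - nm y|.
Proof.
have [L L0 hL] := poly_lipschitz p.
exists (L * 2) => [|x y]; first exact: mulr_ge0.
have in1 z : nm z <= 1 -> 0 <= sqn z <= 1.
  by move=> h; rewrite sqn_ge0 -sqr_hr_enorm exprn_ile1 ?hr_enorm_ge0.
have key x' y' : nm x' <= 1 -> 1 <= nm y' -> `|cutp x' - cutp y'| <= L * 2 * `|nm x' - nm y'|.
  move=> hx hy; rewrite (cutp_out hy) (cutp_in hx) -p1.
  have h1 : 0 <= (1 : R) <= 1 by rewrite ler01 lexx.
  apply: le_trans (hL _ _ (in1 _ hx) h1) _; rewrite -mulrA ler_wpM2l//.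
  have /andP[h2 h3] := in1 _ hx; have n0 := hr_enorm_ge0 x'.
  rewrite ler0_norm ?subr_le0// ler0_norm ?subr_le0 ?(le_trans hx)//.
  rewrite -sqr_hr_enorm; nra.
case: (leP (nm x) 1) => hx; case: (leP (nm y) 1) => hy.
- rewrite !cutp_in//; apply: le_trans (hL _ _ (in1 _ hx) (in1 _ hy)) _; rewrite -mulrA ler_wpM2l//.
  rewrite -!sqr_hr_enorm subr_sqr normrM mulrC ler_wpM2r//.
  rewrite ger0_norm ?addr_ge0 ?hr_enorm_ge0//; lra.
- by apply: key => //; exact: ltW.
- by rewrite distrC [X in _ * X]distrC; apply: key => //; exact: ltW.
- by rewrite !cutp_out ?(ltW hx) ?(ltW hy)// subrr normr0 mulr_ge0// mulr_ge0.
Qed.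

(* A cutoff is only Lipschitz across the sphere; the gain over the first difference
   is the distance to the sphere. *)
Lemma cutp_second_difference : exists2 C, 0 <= C & forall y z,
  let D := `|cutp (y + z) + cutp (y - z) - 2 * cutp y| in
  D <= C * nm z /\ `|nm y - 1| * D <= C * nm z ^+ 2.
Proof.
have [L L0 hL] := cutp_lipschitz; have [C C0 hC] := poly_second_difference p.
have [L' L'0 hL'] := poly_lipschitz p.
exists (2 * L + 4 * C + 2 * L') => [|y z /=]; first by rewrite !addr_ge0 ?mulr_ge0.
have z0 := hr_enorm_ge0 z.
have d1 : `|nm (y + z) - nm y| <= nm z by have := hr_enorm_distl (y + z) y; rewrite [y + z - y]addrC addKr.
have d2 : `|nm (y - z) - nm y| <= nm z by have := hr_enorm_distl (y - z) y; rewrite [y - z - y]addrC addKr hr_enormN.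
set D := `|_|.
have D1 : D <= 2 * L * nm z.
  have -> : 2 * L * nm z = L * nm z + L * nm z by ring.
  rewrite /D (_ : _ - _ = (cutp (y + z) - cutp y) + (cutp (y - z) - cutp y)); last by ring.
  apply: le_trans (ler_normD _ _) _; apply: lerD.
    by apply: le_trans (hL _ _) _; rewrite ler_wpM2l.
  by apply: le_trans (hL _ _) _; rewrite ler_wpM2l.
have D0 : 0 <= D by exact: normr_ge0.
have Cz : 0 <= C * nm z by rewrite mulr_ge0.
have Lz : 0 <= L' * nm z by rewrite mulr_ge0.
split; first by apply: le_trans D1 _; nra.
have Lz2 : 0 <= L * nm z ^+ 2 by rewrite mulr_ge0 ?sqr_ge0.
have Cz2 : 0 <= C * nm z ^+ 2 by rewrite mulr_ge0 ?sqr_ge0.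
have Lz2' : 0 <= L' * nm z ^+ 2 by rewrite mulr_ge0 ?sqr_ge0.
(* Within |z| of the sphere the Lipschitz bound suffices. Farther outside all three values vanish.
   Farther inside all three points lie in the ball, where the cutoff is a polynomial at a, a + b and
   a - b, with a = |y|^2 + |z|^2 and b = 2 <y, z>, up to the shift from |y|^2 to a. *)
case: (leP `|nm y - 1| (nm z)) => hz.
  apply: le_trans (ler_pM _ _ hz D1) _ => //; nra.
move: d1 d2; rewrite !ler_norml => /andP[a1 a2] /andP[b1 bb2].
case: (leP 1 (nm y)) => hy.
  rewrite ger0_norm ?subr_ge0// in hz.
  rewrite /D !cutp_out//; [|lra|lra]; rewrite addr0 mulr0 subr0 normr0 mulr0.
  by rewrite mulr_ge0 ?sqr_ge0// !addr_ge0// mulr_ge0.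
rewrite ltr0_norm ?subr_lt0// in hz.
have yz1 : nm (y + z) <= 1 by lra.
have yz2 : nm (y - z) <= 1 by lra.
have r1 : `|nm y - 1| <= 1 by have := hr_enorm_ge0 y; rewrite ltr0_norm ?subr_lt0//; lra.
apply: (@le_trans _ _ D); first by rewrite ler_piMl.
have in1 w : nm w <= 1 -> 0 <= sqn w <= 1.
  by move=> h; rewrite sqn_ge0 -sqr_hr_enorm exprn_ile1 ?hr_enorm_ge0.
rewrite /D !cutp_in ?(ltW hy)//.
pose a := sqn y + sqn z; pose b := 2 * dotp y z.
have E1 : sqn (y + z) = a + b by rewrite sqnD /a /b; ring.
have E2 : sqn (y - z) = a - b.
  by have := sqn_parallelogram y z; rewrite E1 /a; lra.
have i1 := in1 _ yz1; have i2 := in1 _ yz2; rewrite E1 in i1; rewrite E2 in i2.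
rewrite E1 E2.
have ia : 0 <= a <= 1 by move: i1 i2 => /andP[? ?] /andP[? ?]; apply/andP; split; lra.
have -> : p.[a + b] + p.[a - b] - 2 * p.[sqn y] = (p.[a + b] + p.[a - b] - 2 * p.[a]) + 2 * (p.[a] - p.[sqn y]) by ring.
apply: le_trans (ler_normD _ _) _.
have bb3 : b ^+ 2 <= 4 * nm z ^+ 2.
  rewrite /b exprMn sqr_hr_enorm (_ : 2 ^+ 2 = 4 :> R); last by rewrite expr2; lra.
  rewrite ler_wpM2l//; apply: le_trans (dotp_sqr_le _ _) _; rewrite ler_piMl ?sqn_ge0//.
  by have /andP[] := in1 _ (ltW hy).
have X1 : `|p.[a + b] + p.[a - b] - 2 * p.[a]| <= C * (4 * nm z ^+ 2).
  by apply: le_trans (hC _ _ i1 i2) _; rewrite ler_wpM2l.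
have X2 : `|2 * (p.[a] - p.[sqn y])| <= 2 * (L' * nm z ^+ 2).
  rewrite normrM (ger0_norm (ler0n R 2)) ler_wpM2l//; apply: le_trans (hL' _ _ ia (in1 _ (ltW hy))) _.
  by rewrite /a addrC addKr ger0_norm ?sqn_ge0// sqr_hr_enorm.
by apply: le_trans (lerD X1 X2) _; nra.
Qed.

Lemma cutp_bounded : exists2 M, 0 <= M & forall y, `|cutp y| <= M * ind R (nm y < 1).
Proof.
have [L L0 hL] := poly_lipschitz p; exists L => // y.
case: (ltP (nm y) 1) => hy; last by rewrite cutp_out// normr0 mulr0.
rewrite /ind mulr1 (cutp_in (ltW hy)) -[p.[_]]subr0 -p1.
have h1 : 0 <= (1 : R) <= 1 by rewrite ler01 lexx.
have /andP[h2 h3] : 0 <= sqn y <= 1 by rewrite sqn_ge0 -sqr_hr_enorm exprn_ile1 ?hr_enorm_ge0 ?(ltW hy).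
apply: le_trans (hL _ _ _ h1) _; first by rewrite h2.
by rewrite ler_piMr// ler0_norm ?subr_le0//; lra.
Qed.

Lemma rapid_cutp : rapid cutp.
Proof.
have [M M0 hM] := cutp_bounded.
apply: (@rapid_le R n cutp (fun y => M * ind R (nm y < 1))); first exact: measurable_cutp.
  by apply: rapidZ; exact: rapid_oball.
by move=> y; rewrite [leRHS]ger0_norm// mulr_ge0 ?ind_ge0.
Qed.

Local Notation c t := (conv (H 1 (t ^+ 2)) cutp).

(** Minus the time derivative of the mass of [H 0 t], which is constant. *)
Lemma Rint_H1 : \int[mu]_y H 1 1 y = 0.
Proof.
have h1 : (0 < n + 1)%N by rewrite addn1.
have [C [a [C0 a0 hC]]] := @Q_unif R n 1 0 1 1 (@homog1 R n) (@ltr01 R).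
have D : is_derive (1 : R) (1 : R) (fun t => \int[mu]_y H 0 t y) (\int[mu]_y (- H 1 1 y)).
  apply: (@is_derive_Rint _ _ R mu (fun t y => H 0 t y) (fun t y => - H 1 t y) 1 (1 / 2) (2 * 1)
    (fun y => C * expR (- (a * sqn y)))).
  - by apply/andP; split; lra.
  - by move=> t /andP[t1 _]; apply: rapid_intble; apply: rapid_H; lra.
  - move=> t y /andP[t1 _]; have t0 : 0 < t by lra.
    have := @is_derive_Q R n 1 0 0 t y t0.
    by rewrite QH (_ : (fun t0 => _) = (fun t0 => H 0 t0 y))//; apply/funext => u; rewrite QH.
  - by move=> t y ht; rewrite normrN -QH; exact: hC.
  - by move=> y; rewrite mulr_ge0 ?expR_ge0.
  - by apply: intbleZ; exact: intble_gauss.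
have E : \forall t \near (1 : R), \int[mu]_y H 0 t y = gam R n.
  near=> t; have t0 : 0 < t by near: t; exact: lt_nbhsr.
  rewrite -(Rint_H0 n t0); apply: Rint_eq => y; rewrite ger0_norm// HE psi0.
  by rewrite mulr_ge0 ?expR_ge0// invr_ge0 exprn_ge0// sqrtr_ge0.
have := is_derive_unique E D (is_derive_cst _ _ _).
rewrite (@Rint_eq _ _ R mu _ (fun y => -1 * H 1 1 y)); last by move=> y; rewrite mulN1r.
by rewrite RintZ ?mulN1r; [lra|exact: rapid_intble (rapid_H _ _ ltr01)].
Unshelve. all: by end_near. Qed.

Lemma H1_scale (t : R) (z : V) : 0 < t -> H 1 (t ^+ 2) (t *: z) = (t ^+ n.+2)^-1 * H 1 1 z.
Proof.
move=> t0; have := @Q_scale R n 1 0 1 t 1 z (@homog1 R n) t0 ltr01.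
by rewrite !QH mulr1 add0n -addnn addnA !addn1.
Qed.

Lemma conv_H1_symm (t : R) y : 0 < t ->
  intble mu (fun z => H 1 1 z * (cutp (y + t *: z) + cutp (y - t *: z) - 2 * cutp y)) /\
  2 * t ^+ 2 * c t y = \int[mu]_z (H 1 1 z * (cutp (y + t *: z) + cutp (y - t *: z) - 2 * cutp y)).
Proof.
move=> t0; have tn := lt0r_neq0 t0; have t20 : 0 < t ^+ 2 by rewrite exprn_gt0.
have rH := rapid_H n 1 t20; have rF := rapid_cutp; have rH1 := rapid_H n 1 (@ltr01 R).
have i0 : intble mu (fun z => H 1 (t ^+ 2) z * cutp (y - z)).
  by apply: L2M (rapid_L2 rH) _; apply: L2_subl; exact: rapid_L2.
have i1 := intble_affine 0 tn i0.
have i2 : intble mu (fun z => H 1 1 z * cutp (y - t *: z)).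
  have := intbleZ (t ^+ n.+2) i1; congr intble; apply/funext => z.
  rewrite add0r H1_scale// mulrA mulrA mulfV ?mul1r//; by rewrite expf_neq0.
have i3 : intble mu (fun z => H 1 1 z * cutp (y + t *: z)).
  have := intble_subl 0 i2; congr intble; apply/funext => z.
  by rewrite sub0r HN scalerN opprK.
have i4 := rapid_intble rH1.
have E0 : t ^+ 2 * c t y = \int[mu]_z (H 1 1 z * cutp (y - t *: z)).
  rewrite (conv_swap y (rapid_L2 rH) (rapid_L2 rF)) (Rint_affine 0 tn i0) gtr0_norm// mulrA -exprD -RintZ//.
  apply: Rint_eq => z; rewrite add0r H1_scale// mulrA mulrA mulfV ?mul1r//; by rewrite expf_neq0.
have E1 : \int[mu]_z (H 1 1 z * cutp (y + t *: z)) = \int[mu]_z (H 1 1 z * cutp (y - t *: z)).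
  rewrite -(Rint_opp i2); apply: Rint_eq => z; by rewrite HN scalerN opprK.
have i5 : intble mu (fun z => - 2 * cutp y * H 1 1 z) by exact: intbleZ.
have EE z : H 1 1 z * (cutp (y + t *: z) + cutp (y - t *: z) - 2 * cutp y) =
    H 1 1 z * cutp (y + t *: z) + H 1 1 z * cutp (y - t *: z) + - 2 * cutp y * H 1 1 z by ring.
split; first by rewrite (funext EE); apply: intbleD i5; exact: intbleD.
rewrite (funext EE) RintD//; last exact: intbleD.
by rewrite RintD// RintZ// Rint_H1 mulr0 addr0 E1 -E0; ring.
Qed.

(** The symmetrised formula has a prefactor t^(-2). A second difference O(t |z|) leaves 1/t, and the
    bound O(t^2 |z|^2) divided by the distance to the sphere leaves the inverse of that distance.
    Combined they give the logarithmic weight after integration in time. *)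
Lemma conv_H1_cutp_le : exists2 C, 0 <= C & forall (t : R) y, 0 < t ->
  t * `|c t y| <= C /\ `|nm y - 1| * `|c t y| <= C.
Proof.
have [D D0 hD] := cutp_second_difference.
have rH1 := rapid_H n 1 (@ltr01 R).
have [K [a [K0 a0 hK]]] := rH1.2.
have sq : rapid (fun z : V => K * ('X : {poly R}).[sqn z] * expR (- (a * sqn z))).
  have := rapidZ K (rapid_hornerX_exp n 'X a0); congr rapid; apply/funext => z; by rewrite mulrA.
pose I := \int[mu]_z (K * ('X : {poly R}).[sqn z] * expR (- (a * sqn z))).
pose J := \int[mu]_z (K * expR (- (a * sqn z))).
have iJ : intble mu (fun z : V => K * expR (- (a * sqn z))) by apply: intbleZ; exact: intble_gauss.
have iI := rapid_intble sq.
have I0 : 0 <= I by apply: Rint_ge0 => z; rewrite hornerX !mulr_ge0 ?expR_ge0 ?sqn_ge0.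
have J0 : 0 <= J by apply: Rint_ge0 => z; rewrite mulr_ge0 ?expR_ge0.
exists (D * (I + J)) => [|t y t0]; first by rewrite mulr_ge0// addr_ge0.
have [ii E] := conv_H1_symm y t0; have t20 : 0 < t ^+ 2 by rewrite exprn_gt0.
have n2 : 0 <= 2 * t ^+ 2 by rewrite mulr_ge0 ?ltW.
have Ec : 2 * t ^+ 2 * `|c t y| = `|2 * t ^+ 2 * c t y| by rewrite normrM (ger0_norm n2).
have z2 (z : V) : nm z <= 1 + sqn z by have := sqr_ge0 (nm z - 1); rewrite -sqr_hr_enorm; nra.
split.
  have B : 2 * t ^+ 2 * `|c t y| <= t * (D * (I + J)).
    have -> : t * (D * (I + J)) = \int[mu]_z (t * D * (K * ('X : {poly R}).[sqn z] * expR (- (a * sqn z)) + K * expR (- (a * sqn z)))).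
      by rewrite RintZ ?RintD//; [rewrite mulrA|exact: intbleD].
    rewrite Ec E; apply: Rint_norm_le => //; first by apply: intbleZ; exact: intbleD.
    move=> z; rewrite normrM; have [h _] := hD y (t *: z).
    rewrite hr_enormZ (gtr0_norm t0) in h.
    apply: le_trans (ler_pM _ _ (hK z) h) _ => //.
    have -> : K * expR (- (a * sqn z)) * (D * (t * nm z)) = (t * D * K * expR (- (a * sqn z))) * nm z by ring.
    rewrite hornerX; have -> : t * D * (K * sqn z * expR (- (a * sqn z)) + K * expR (- (a * sqn z))) =
      (t * D * K * expR (- (a * sqn z))) * (1 + sqn z) by ring.
    by rewrite ler_wpM2l// !mulr_ge0 ?expR_ge0// ltW.
  have DI : 0 <= D * (I + J) by rewrite mulr_ge0// addr_ge0.
  have tc : 0 <= t * `|c t y| by rewrite mulr_ge0// ltW.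
  have B2 : 2 * (t * `|c t y|) <= D * (I + J).
    by rewrite -(ler_pM2l t0); apply: le_trans B; rewrite expr2; lra.
  lra.
have r0 : 0 <= `|nm y - 1| by [].
have B : t ^+ 2 * (2 * (`|nm y - 1| * `|c t y|)) <= t ^+ 2 * (D * I).
  have -> : t ^+ 2 * (D * I) = \int[mu]_z (t ^+ 2 * D * (K * ('X : {poly R}).[sqn z] * expR (- (a * sqn z)))).
    by rewrite RintZ// mulrA.
  have -> : t ^+ 2 * (2 * (`|nm y - 1| * `|c t y|)) = `|\int[mu]_z (`|nm y - 1| * (H 1 1 z * (cutp (y + t *: z) + cutp (y - t *: z) - 2 * cutp y)))|.
    by rewrite RintZ// -E normrM normr_id -Ec; ring.
  apply: Rint_norm_le; [exact: intbleZ|exact: intbleZ|] => z.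
  rewrite normrM normr_id normrM mulrCA; have [_ h] := hD y (t *: z).
  rewrite hr_enormZ (gtr0_norm t0) exprMn sqr_hr_enorm in h.
  apply: le_trans (ler_pM _ _ (hK z) h) _ => //.
  by rewrite hornerX le_eqVlt; apply/orP; left; apply/eqP; ring.
rewrite ler_pM2l// in B.
have DI : 0 <= D * I by rewrite mulr_ge0.
have DJ : 0 <= D * J by rewrite mulr_ge0.
have rc : 0 <= `|nm y - 1| * `|c t y| by rewrite mulr_ge0.
by rewrite mulrDr; lra.
Qed.

(** The number [e] bounds the Gaussian factor over the support of the cutoff; large and small times
    use different choices of it. *)
Lemma conv_H1_cutp_gauss : exists2 C, 0 <= C & forall (t : R) y (e : R), 0 < t ->
  (forall x, nm x < 1 -> expR (- (sqn (y - x) / (2 * t ^+ 2))) <= e) ->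
  `|c t y| <= C * (t ^+ n.+2)^-1 * e.
Proof.
have [K K0 hK] := psi_bound R n 1; have [M M0 hM] := cutp_bounded.
have io : intble mu (fun x : V => ind R (nm x < 1)) by apply: rapid_intble; exact: rapid_oball.
exists (K * M * omega R n) => [|t y e t0 he]; first by rewrite !mulr_ge0 ?omega_ge0.
have t20 : 0 < t ^+ 2 by rewrite exprn_gt0.
have e0 : 0 <= e.
  by apply: le_trans (he 0 _); rewrite ?expR_ge0// hr_enormE sqn0 sqrtr0.
have rH := rapid_H n 1 t20.
have -> : K * M * omega R n * (t ^+ n.+2)^-1 * e = \int[mu]_x (K * (t ^+ n.+2)^-1 * e * M * ind R (nm x < 1)).
  by rewrite RintZ// /omega; ring.
rewrite convE; apply: Rint_norm_le; [exact: intble_conv (rapid_L2 rH) (rapid_L2 rapid_cutp)|exact: intbleZ|].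
move=> x; rewrite normrM; case: (ltP (nm x) 1) => hx; last first.
  by rewrite cutp_out// normr0 mulr0 mulr0.
have h1 := hM x; rewrite hx in h1.
apply: le_trans (ler_wpM2l (normr_ge0 _) h1) _; rewrite mulrA ler_wpM2r ?ind_ge0// ler_wpM2r//.
rewrite HE; apply: le_trans (hK _ _ t20 (sqn_ge0 _)) _.
rewrite sqrtr_sqr gtr0_norm// expr1 -(mulrA K) -invfM -exprD addn2.
apply: ler_wpM2l; last exact: he.
by rewrite mulr_ge0// invr_ge0 exprn_ge0// ltW.
Qed.

Lemma conv_H1_cutp_large : exists2 C, 0 <= C & forall (t : R) y, 1 <= t ->
  `|c t y| <= C * (t ^+ n.+2)^-1 * expR (- (4^-1 * (sqn y / t ^+ 2))).
Proof.
have [C C0 hC] := conv_H1_cutp_gauss.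
(* The factor [expR 1] pays for |x|^2 <= 1 in |y|^2 <= 2 |y - x|^2 + 2 |x|^2, as t >= 1. *)
exists (C * expR 1) => [|t y t1]; first by rewrite mulr_ge0 ?expR_ge0.
have t0 : 0 < t by lra.
have -> : C * expR 1 * (t ^+ n.+2)^-1 * expR (- (4^-1 * (sqn y / t ^+ 2))) =
  C * (t ^+ n.+2)^-1 * (expR 1 * expR (- (4^-1 * (sqn y / t ^+ 2)))) by ring.
apply: hC => // x hx; rewrite -expRD ler_expR.
have x1 : sqn x <= 1 by rewrite -sqr_hr_enorm exprn_ile1 ?hr_enorm_ge0 ?(ltW hx).
have h := sqnD_le (y - x) x; rewrite subrK in h.
have t21 : 1 <= t ^+ 2 by rewrite exprn_ege1.
have t2 : 0 < t ^+ 2 by rewrite exprn_gt0.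
have iv : 0 < (t ^+ 2)^-1 by rewrite invr_gt0.
have iv1 : (t ^+ 2)^-1 <= 1 by rewrite invf_le1.
rewrite invfM; set w := (t ^+ 2)^-1 in iv iv1 *.
have h3 := ler_wpM2r (ltW iv) h.
have := sqn_ge0 x; nra.
Qed.

Lemma conv_H1_cutp_small : exists2 C, 0 <= C & forall (t : R) y, 0 < t -> t <= 1 -> 2 <= nm y ->
  `|c t y| <= C * expR (- (16^-1 * sqn y)).
Proof.
have [C C0 hC] := conv_H1_cutp_gauss.
have [K K0 hK] := @expR_inv_bound R n.+2 4^-1 (ltac:(lra)).
exists (C * K) => [|t y t0 t1 y2]; first by rewrite mulr_ge0.
have t2 : 0 < t ^+ 2 by rewrite exprn_gt0.
have t21 : t ^+ 2 <= 1 by rewrite exprn_ile1// ltW.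
have iv : 1 <= (t ^+ 2)^-1 by rewrite invf_ge1.
have y4 : 4 <= sqn y.
  by rewrite -sqr_hr_enorm (_ : 4 = 2 ^+ 2 :> R); [rewrite lerXn2r ?nnegrE ?hr_enorm_ge0//|rewrite expr2; lra].
(* |y - x| >= |y|/2 gives the exponent |y|^2 / (8 t^2). One half is at least 1 / (4 t^2) because |y|
   >= 2, and beats the power of t; the other is at least |y|^2 / 16 because t <= 1. *)
apply: (@le_trans _ _ (C * (t ^+ n.+2)^-1 * (expR (- (4^-1 / t ^+ 2)) * expR (- (16^-1 * sqn y))))).
  apply: hC => // x hx; rewrite -expRD ler_expR.
  have h1 : nm y / 2 <= nm (y - x).
    have := hr_enormD (y - x) x; rewrite subrK; lra.
  have h2 : sqn y / 4 <= sqn (y - x).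
    rewrite -!sqr_hr_enorm (_ : nm y ^+ 2 / 4 = (nm y / 2) ^+ 2); last by rewrite expr_div_n (_ : 2 ^+ 2 = 4 :> R)// expr2; lra.
    by rewrite lerXn2r ?nnegrE ?hr_enorm_ge0// divr_ge0 ?hr_enorm_ge0.
  rewrite invfM; set w := (t ^+ 2)^-1 in iv *.
  nra.
rewrite !mulrA ler_wpM2r ?expR_ge0// -mulrA ler_wpM2l//; exact: hK.
Qed.

End radial_cutoff.

(** * The pairing with a polynomial on a ball *)

Lemma is_derive_Xn (R : realType) k (t : R) : is_derive t (1 : R) (fun t : R => t ^+ k) (k%:R * t ^+ k.-1).
Proof.
have D := is_deriveX k (is_derive_id t (1 : R)).
rewrite (_ : (fun t => _) = (id : R -> R) ^+ k); last by apply/funext => x; rewrite !fctE.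
by apply: (is_derive_eq D); rewrite /GRing.scale/= mulr1.
Qed.

Lemma is_derive_conv_Q (R : realType) n d (P : mpoly.mpoly n R) (G : 'rV[R]_n -> R) (x : 'rV[R]_n) j (t : R) :
  homog d P -> L2 (lebesgue_rV R n) G -> 0 < t ->
  is_derive t (1 : R) (fun t : R => conv (Q P d j t) G x) (- conv (Q P d j.+1 t) G x).
Proof.
move=> hP LG t0; pose mu := lebesgue_rV R n; have [C [a [C0 a0 hC]]] := Q_unif j.+1 hP t0.
have iQ i (u : R) : 0 < u -> intble mu (fun y => Q P d i u (x - y) * G y).
  by move=> u0; exact: intble_conv x (rapid_L2 (rapid_Q i hP u0)) LG.
have D := @is_derive_Rint _ _ R mu (fun (t : R) (y : 'rV[R]_n) => Q P d j t (x - y) * G y)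
  (fun (t : R) y => - Q P d j.+1 t (x - y) * G y) t (t / 2) (2 * t) (fun y => `|C * expR (- (a * sqn (x - y))) * G y|).
have -> : - conv (Q P d j.+1 t) G x = \int[mu]_y (- Q P d j.+1 t (x - y) * G y).
  rewrite convE -mulN1r -RintZ; last exact: iQ.
  by apply: Rint_eq => y; ring.
rewrite (_ : (fun t => _) = fun t => \int[mu]_y (Q P d j t (x - y) * G y)); last first.
  by apply/funext => u; rewrite convE.
apply: D.
- by apply/andP; split; lra.
- by move=> z /andP[z0 _]; apply: iQ; apply: lt_trans z0; rewrite divr_gt0.
- move=> z y /andP[z0 _]; have zp : 0 < z by apply: lt_trans z0; rewrite divr_gt0.
  have := is_deriveM (is_derive_Q P d j (x - y) zp) (is_derive_cst (G y) z 1).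
  by move=> D; apply: (is_derive_eq D); rewrite scaler0 add0r /GRing.scale/= mulrC.
- move=> z y zI; rewrite !normrM normrN ler_wpM2r//; apply: le_trans (hC z _ zI) _.
  by rewrite -normrM ler_norm.
- by [].
- have rg : rapid (fun y : 'rV[R]_n => C * expR (- (a * sqn y))).
    split; first by apply: measurable_funM => //; exact: measurable_gauss.
    by exists C, a; split=> // y; rewrite ger0_norm// mulr_ge0 ?expR_ge0.
  apply: intble_norm; apply: L2M LG; exact: L2_subl x (rapid_L2 rg).
Qed.

Section heat_chain.
Variables (R : realType) (n : nat).
Local Notation V := 'rV[R]_n.
Local Notation mu := (lebesgue_rV R n).
Local Notation lam := (@lebesgue_measure R).
Hypothesis n0 : (0 < n)%N.
Variables (G : V -> R) (x : V).
Hypothesis LG : L2 mu G.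
Local Notation K j v := (conv (H j v) G x).

Lemma is_derive_conv_H j (t : R) : 0 < t ->
  is_derive t (1 : R) (fun t : R => K j t) (- K j.+1 t).
Proof.
move=> t0; have := is_derive_conv_Q x j (@homog1 R n) LG t0.
have E i u : conv (Q 1 0 i u) G x = K i u by rewrite !convE; apply: Rint_eq => y; rewrite QH.
by rewrite E (_ : (fun t => _) = fun t => K j t)//; apply/funext => u; rewrite E.
Qed.

Lemma conv_H_decay j (th : R) : 0 < th ->
  `|K j (th ^+ 2)| <= sN 0 1 j G / (th ^+ j.*2 * Num.sqrt (th ^+ n)).
Proof.
move=> t0; have := @conv_Q_pointwise R n 0 1 (@homog1 R n) j G th x t0 LG.
rewrite -(sqr_sN 0 1 j G) add0n => h.
have S0 := sN_ge0 0 1 j G; have p0 : 0 <= th ^+ n by rewrite exprn_ge0// ltW.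
have E : conv (Q 1 0 j (th ^+ 2)) G x = K j (th ^+ 2).
  by rewrite !convE; apply: Rint_eq => y; rewrite QH.
rewrite E in h; rewrite -ler_sqr ?nnegrE ?divr_ge0 ?mulr_ge0 ?sqrtr_ge0 ?exprn_ge0 ?(ltW t0)//.
rewrite real_normK ?num_real// expr_div_n exprMn (sqr_sqrtr p0).
rewrite -(exprM th) -exprD.
by have -> : (j.*2 * 2 + n = n + 4 * j)%N by rewrite addnC -muln2 -mulnA mulnC.
Qed.

Variables (s a : R).
Hypotheses (s0 : 0 < s) (a1 : 1 <= a).
Let a0 : 0 < a. Proof. exact: lt_le_trans a1. Qed.
Let v (t : R) := s + a * t ^+ 2.
Let v0 t : 0 < v t. Proof. by rewrite /v ltr_wpDr// mulr_ge0 ?sqr_ge0// ltW. Qed.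
Let th t := Num.sqrt (v t).
Let thE t : th t ^+ 2 = v t. Proof. by rewrite sqr_sqrtr// ltW. Qed.
Let th0 t : 0 < th t. Proof. by rewrite sqrtr_gt0. Qed.
Let ths t : Num.sqrt s <= th t.
Proof. by rewrite ler_wsqrtr// lerDl mulr_ge0 ?sqr_ge0// ltW. Qed.
Let tht t : 0 <= t -> t <= th t.
Proof.
move=> t0; rewrite -[leLHS]ger0_norm// -sqrtr_sqr ler_wsqrtr//.
by rewrite /v ler_wpDl ?(ltW s0)// ler_peMl// sqr_ge0.
Qed.

Let dv (t : R) : is_derive t (1 : R) v (2 * a * t).
Proof.
have D2 := is_deriveZ a (is_derive_Xn 2 t); have D := is_deriveD (is_derive_cst s t (1 : R)) D2.
by apply: (is_derive_eq D); rewrite add0r /GRing.scale/= expr1; ring.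
Qed.

Let dK j (t : R) : is_derive t (1 : R) (fun t : R => K j (v t)) (- K j.+1 (v t) * (2 * a * t)).
Proof.
have D := @is_derive1_comp R (fun u : R => K j u) v t _ _ (is_derive_conv_H j (v0 t)) (dv t).
by apply: (is_derive_eq D).
Qed.

Let F j t := t ^+ j.*2 * K j (v t).
Let f j t := j.*2%:R * t ^+ j.*2.-1 * K j (v t) - 2 * a * (t ^+ j.*2.+1 * K j.+1 (v t)).

Let dF j t : is_derive t (1 : R) (F j) (f j t).
Proof.
have D := is_deriveM (is_derive_Xn j.*2 t) (dK j t); apply: (is_derive_eq D).
by rewrite /GRing.scale/= /f (exprS _ j.*2); ring.
Qed.

Let cK j : continuous (fun t => K j (v t)).
Proof. by move=> t; exact: continuous_is_derive (dK j t). Qed.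

Let cX k : continuous (fun t : R => t ^+ k). Proof. exact: exprn_continuous. Qed.

Let cf j : continuous (f j).
Proof.
move=> t.
have c1 : {for t, continuous (fun t : R => j.*2%:R * t ^+ j.*2.-1)}.
  by apply: continuousM; [exact: cvg_cst|exact: cX].
have c2 : {for t, continuous (fun t : R => t ^+ j.*2.+1 * K j.+1 (v t))}.
  by apply: continuousM; [exact: cX|exact: cK].
have c3 : {for t, continuous (fun t : R => 2 * a * (t ^+ j.*2.+1 * K j.+1 (v t)))}.
  by apply: continuousM; [exact: cvg_cst|exact: c2].
exact: continuousB (continuousM c1 (@cK j t)) c3.
Qed.

Let Fbound j (t : R) : 0 < t -> `|F j t| <= sN 0 1 j G * (Num.sqrt (th t ^+ n))^-1.
Proof.
move=> t0; rewrite /F normrM ger0_norm ?exprn_ge0 ?(ltW t0)// -thE.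
have S0 := sN_ge0 0 1 j G.
have p : 0 < th t ^+ j.*2 by rewrite exprn_gt0.
apply: (@le_trans _ _ (th t ^+ j.*2 * `|K j (th t ^+ 2)|)).
  by rewrite ler_wpM2r// lerXn2r ?nnegrE ?(ltW t0) ?(ltW (th0 t)) ?tht ?(ltW t0).
rewrite -ler_pdivlMl//; apply: le_trans (conv_H_decay j (th0 t)) _.
by rewrite invfM mulrCA.
Qed.

(** K_j decays like th^(-2j-n/2) with th >= t, so the boundary term vanishes at infinity because n >
    0. *)
Let Flim j : F j t @[t --> +oo%R] --> (0 : R).
Proof.
have S0 := sN_ge0 0 1 j G.
apply/cvgrPdist_le => e e0; near=> t; rewrite sub0r normrN.
have t1 : 1 <= t by near: t; exact: nbhs_pinfty_ge.
have t0 : 0 < t by lra.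
apply: le_trans (Fbound j t0) _.
have h1 : Num.sqrt t <= Num.sqrt (th t ^+ n).
  rewrite ler_wsqrtr//; apply: le_trans (tht (ltW t0)) _.
  rewrite -[leLHS]expr1 ler_weXn2l//; apply: le_trans t1 (tht (ltW t0)).
have st : 0 < Num.sqrt t by rewrite sqrtr_gt0.
apply: (@le_trans _ _ (sN 0 1 j G * (Num.sqrt t)^-1)).
  by rewrite ler_wpM2l// lef_pV2 ?posrE// (lt_le_trans st).
rewrite ler_pdivrMr// mulrC -ler_pdivrMr//.
have : (sN 0 1 j G / e) ^+ 2 <= t by near: t; apply: nbhs_pinfty_ge; rewrite num_real.
move=> h; rewrite -[leLHS]ger0_norm ?divr_ge0 ?(ltW e0)// -sqrtr_sqr ler_wsqrtr//.
Unshelve. all: by end_near. Qed.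

Let I j t := ind R (0 < t) * (t ^+ j.*2.+1 * K j.+1 (v t)).

Let iI j : intble lam (I j).
Proof.
have S0 := sN_ge0 0 1 j.+1 G; have ss : 0 < Num.sqrt s by rewrite sqrtr_gt0.
have [C C0 hC] := tail_decay n0 ss.
apply: intble_le (intbleZ (sN 0 1 j.+1 G * C) (@half_h32 R)) _.
  apply: measurable_funM; first exact: measurable_ind_lt.
  apply: measurable_funM; first exact: measurable_funX.
  apply: continuous_measurable_fun; exact: cK.
move=> t; rewrite normrM ind_norm /ind; case: ifP => t0; last by rewrite !mul0r mulr0.
rewrite !mul1r normrM ger0_norm ?exprn_ge0 ?(ltW t0)// -thE.
have p : 0 < th t ^+ j.*2.+1 by rewrite exprn_gt0.
apply: (@le_trans _ _ (th t ^+ j.*2.+1 * `|K j.+1 (th t ^+ 2)|)).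
  by rewrite ler_wpM2r// lerXn2r ?nnegrE ?(ltW t0) ?(ltW (th0 t)) ?tht ?(ltW t0).
apply: (@le_trans _ _ (sN 0 1 j.+1 G * (th t * Num.sqrt (th t ^+ n))^-1)).
  rewrite -ler_pdivlMl//; apply: le_trans (conv_H_decay j.+1 (th0 t)) _.
  by rewrite doubleS [th t ^+ j.*2.+2]exprSr -!mulrA !invfM mulrCA.
rewrite -mulrA ler_wpM2l//; apply: le_trans (hC _ (ths t)) _.
by rewrite ler_wpM2l// h32_le ?tht ?(ltW t0).
Qed.

(** Integration by parts. The derivative of t^(2j+2) K_(j+1)(s + a t^2) relates two consecutive
    integrals, each time derivative being traded for a factor (j + 1) / a; the first integral is
    exact and leaves K_0(s) / (2 a). *)
Lemma heat_radial j : intble lam (fun t => ind R (0 < t) * (t ^+ j.*2.+1 * K j.+1 (s + a * t ^+ 2))) /\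
  \int[lam]_t (ind R (0 < t) * (t ^+ j.*2.+1 * K j.+1 (s + a * t ^+ 2))) =
  j`!%:R / (2 * a ^+ j.+1) * K 0 s.
Proof.
split; first exact: iI.
have an := lt0r_neq0 a0.
elim: j => [|j IH].
  have i1 : intble lam (fun t => ind R (0 < t) * f 0 t).
    have := intbleZ (- (2 * a)) (iI 0); congr intble; apply/funext => t; rewrite /I /f double0; ring.
  have := FTC_half (dF 0%N) (@cf 0%N) (Flim 0%N) i1.
  rewrite (@Rint_eq _ (measurableTypeR R) R lam _ (fun t : R => - (2 * a) * I 0 t)); last first.
    by move=> t; rewrite /I /f double0; ring.
  rewrite (RintZ _ (iI 0)) /F double0 expr0 mul1r /v (expr0n _ 2) mulr0 addr0 sub0r => h.
  have a2 : 2 * a != 0 by rewrite mulf_neq0.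
  apply: (mulfI a2); rewrite -[LHS]opprK -mulNr h opprK fact0 expr1; field.
  exact: an.
have i1 : intble lam (fun t => ind R (0 < t) * f j.+1 t).
  have := intbleB (intbleZ (j.+1.*2%:R) (iI j)) (intbleZ (2 * a) (iI j.+1)).
  congr intble; apply/funext => t; rewrite /I /f doubleS /=; ring.
have := FTC_half (dF j.+1) (@cf j.+1) (Flim j.+1) i1.
rewrite (@Rint_eq _ (measurableTypeR R) R lam _ (fun t : R => j.+1.*2%:R * I j t - 2 * a * I j.+1 t)); last first.
  by move=> t; rewrite /I /f doubleS /=; ring.
rewrite RintB; [|exact: intbleZ (iI j)|exact: intbleZ (iI j.+1)].
rewrite (RintZ _ (iI j)) (RintZ _ (iI j.+1)) IH /F expr0n /= mul0r subr0 => h.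
have a2 : 2 * a != 0 by rewrite mulf_neq0.
apply: (mulfI a2); move: h => /eqP; rewrite subr_eq0 => /eqP <-.
rewrite factS natrM -muln2 natrM (exprS a j.+1); field.
by rewrite expf_neq0.
Qed.

End heat_chain.

Section polar_constant.
Variable R : realType.
Local Notation lam := (@lebesgue_measure R).

Lemma half_inv2_le (m : nat) : intble lam (fun t : R => ind R (0 < t) * ((1 + t ^+ 2) ^+ m.+1)^-1).
Proof.
apply: intble_le (intbleZ 2 (@half_inv2 R)) _.
  apply: measurable_funM; first exact: measurable_ind_lt.
  apply: measurable_inv; apply: measurable_funX; apply: measurable_funD => //; exact: measurable_funX.
move=> t; rewrite normrM ind_norm /ind; case: ifP => t0; last by rewrite !mul0r mulr0.
have p : 0 < 1 + t ^+ 2 by rewrite ltr_pwDl// sqr_ge0.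
have p1 : 1 <= 1 + t ^+ 2 by rewrite lerDl sqr_ge0.
have q : 0 < 1 + t by lra.
rewrite !mul1r ger0_norm ?invr_ge0 ?exprn_ge0 ?(ltW p)//.
apply: (@le_trans _ _ (1 + t ^+ 2)^-1).
  by rewrite lef_pV2 ?posrE ?exprn_gt0// -[leLHS]expr1 ler_weXn2l.
rewrite -[leLHS]mul1r ler_pdivrMr// mulrAC ler_pdivlMr ?exprn_gt0//.
have := sqr_ge0 (1 - t); rewrite !expr2; nra.
Qed.

(* The angular integral left by the substitution xi = t * eta, which replaces polar
   coordinates in the quadrant of pairs (xi, t). *)
Definition polarC (m : nat) : R := \int[lam]_t (ind R (0 < t) * (m`!%:R / (2 * (1 + t ^+ 2) ^+ m.+1))).

Lemma polarC_gt0 m : 0 < polarC m.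
Proof.
have f0 : 0 < m`!%:R :> R by rewrite ltr0n fact_gt0.
have h : (0 : R) < 1 by [].
have i : intble lam (fun t : R => ind R (0 < t) * (m`!%:R / (2 * (1 + t ^+ 2) ^+ m.+1))).
  have := intbleZ (m`!%:R / 2) (@half_inv2_le m); congr intble; apply/funext => t.
  by rewrite invfM; ring.
apply: (@lt_le_trans _ _ (\int[lam]_t (m`!%:R / (2 * 2 ^+ m.+1) * seg 0 1 t))).
  rewrite RintZ ?(seg_intble h).2; last exact: (seg_intble h).1.
  by rewrite mulr_gt0 ?subr_gt0// divr_gt0// mulr_gt0 ?exprn_gt0.
apply: Rint_le => //; first exact: intbleZ (seg_intble h).1.
move=> t; rewrite /seg /ind; case: ifP => [/andP[t0 t1]|_]; last first.
  rewrite mulr0; case: ifP => t0; rewrite ?mul0r// mul1r divr_ge0 ?(ltW f0)// mulr_ge0// exprn_ge0//.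
  by rewrite addr_ge0// sqr_ge0.
have p : 0 < 1 + t ^+ 2 by rewrite ltr_pwDl// sqr_ge0.
rewrite t0 mul1r mulr1 ler_wpM2l ?(ltW f0)// lef_pV2 ?posrE ?mulr_gt0 ?exprn_gt0//.
rewrite ler_wpM2l// lerXn2r ?nnegrE ?(ltW p)//.
by have : t ^+ 2 <= 1; [rewrite exprn_ile1// ltW|lra].
Qed.

End polar_constant.

Section ball_pairing.
Variables (R : realType) (n m : nat) (P : mpoly.mpoly n R).
Local Notation V := 'rV[R]_n.
Local Notation mu := (lebesgue_rV R n).
Local Notation lam := (@lebesgue_measure R).
Local Notation gam := (gam R n).
Local Notation d := m.*2.+1.
Hypotheses (hP : homog d P) (hh : harm P) (n0 : (0 < n)%N).
Local Notation q k t := (Q P d k t).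
Local Notation N := (d + n).+1.
Local Notation nm := (@hr_enorm R n).

Let od : odd d. Proof. by rewrite /= odd_double. Qed.

(** Laguerre coefficients against the iterated tails (1 - u)^r / r! of the indicator. As i <= m, the
    exponent r = m + 1 - i is positive and each summand vanishes at u = 1. *)
Definition pol : {poly R} := \sum_(i < m.+1)
  ((lag R n m)`_i / (m.+1 - i)`!%:R) *: ('X^i * (1 - 'X) ^+ (m.+1 - i)).

Lemma pol1 : pol.[1] = 0.
Proof.
rewrite /pol horner_sum big1// => i _; rewrite hornerZ hornerM horner_exp !hornerE subrr.
by rewrite expr0n subn_eq0 leqNgt ltn_ord/= !mulr0.
Qed.

Lemma prof_om (y : V) : prof n m (@om R) (sqn y) = cutp pol y.
Proof.
rewrite /prof /cutp; case: ifP => h; last first.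
  by rewrite big1// => i _; rewrite /om h mulr0.
rewrite /pol horner_sum; apply: eq_bigr => i _.
have e1 : (1 - 'X : {poly R}).[sqn y] = 1 - sqn y by rewrite !hornerE.
rewrite hornerZ hornerM hornerXn horner_exp e1 /om h.
by move: (_`!%:R^-1) (_ ^+ (m.+1 - i)) => k w; ring.
Qed.

Definition bP (y : V) : R := ev P y * ind R (nm y < 1).

Lemma om0 (y : V) : ev P y * om 0 (sqn y) = bP y.
Proof.
by rewrite /bP /om hr_enorm_lt// expr1n /ind expr0 fact0 divr1.
Qed.

Lemma rapid_bP : rapid bP.
Proof.
apply: (@rapid_le R n bP (fun y => polyC P * ind R (nm y < 1))).
- apply: measurable_funM; first exact: measurable_ev.
  by apply: measurable_ind_lt => //; exact: measurable_hr_enorm.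
- by apply: rapidZ; exact: rapid_oball.
- move=> y; rewrite /bP !normrM ind_norm /ind; case: ifP => h; rewrite ?mulr0// !mulr1.
  rewrite [leRHS]ger0_norm ?polyC_ge0//; apply: le_trans (ev_bound y hP) _.
  by rewrite ler_piMr ?polyC_ge0// exprn_ile1 ?hr_enorm_ge0// ltW.
Qed.

Local Notation F := (@cutp R n pol).
Let rF : rapid F. Proof. apply: rapid_cutp; exact: pol1. Qed.

Lemma density_cutp (v : R) (x : V) : 0 < v -> conv (H m.+1 v) bP x = conv (q 1 v) F x.
Proof.
move=> v0; have := density x hP hh v0.
rewrite (_ : (fun y => _) = bP); last exact/funext/om0.
by rewrite (_ : (fun y => _) = F)//; exact/funext/prof_om.
Qed.

Variable f : V -> R.
Hypothesis Lf : L2 mu f.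

Definition pairU (v : R) : R := \int[mu]_x (F x * conv (q 1 v) f x).
(** The reflection makes the pairing of [bP] with H * f the value at 0 of H * [bPf], to which
    [heat_radial] applies. *)
Definition bPf : V -> R := conv (fun y => bP (- y)) f.

Let rB' : rapid (fun y => bP (- y)).
Proof.
have := @rapid_scale R n bP (-1) (N1_neq0 R) rapid_bP.
by congr rapid; apply/funext => y; rewrite scaleN1r.
Qed.

Lemma L2_bPf : L2 mu bPf. Proof. exact: conv_L2. Qed.

Lemma bP_pair j (v : R) : 0 < v -> \int[mu]_x (bP x * conv (H j v) f x) = conv (H j v) bPf 0.
Proof.
move=> v0; have rH := rapid_H n j v0.
rewrite /bPf (conv_assoc 0 rH rB' Lf).
have -> : conv (H j v) (fun y => bP (- y)) = conv (fun y => bP (- y)) (H j v).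
  by apply/funext => x; exact: conv_comm.
rewrite -(conv_assoc 0 rB' rH Lf) [RHS]convE; apply: Rint_eq => y.
by rewrite sub0r opprK.
Qed.

(** Q is odd in space, so it moves onto the cutoff with a minus sign; [density_cutp] replaces the
    result by H_(m+1) acting on the ball, and H is even. *)
Lemma pairUE (v : R) : 0 < v -> pairU v = - conv (H m.+1 v) bPf 0.
Proof.
move=> v0; rewrite /pairU (conv_Q_adj hP od 1 v0 Lf (rapid_L2 rF)) -bP_pair//; congr (- _).
rewrite (conv_H_adj m.+1 v0 Lf (rapid_L2 rapid_bP)); apply: Rint_eq => x.
by rewrite density_cutp.
Qed.

Lemma measurable_convq1 : measurable_fun setT (fun z : measurableTypeR R * V => conv (q 1 z.1) f z.2).
Proof. exact: (@measurable_convQ2 R n d P 1 f id (@measurable_id _ _ _) Lf.1). Qed.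

Lemma measurable_pairU : measurable_fun setT pairU.
Proof.
apply: (@measurable_Rint _ _ (measurableTypeR R) V R mu (fun v x => F x * conv (q 1 v) f x)).
apply: measurable_funM; first exact: measurableT_comp (rapid_measurable rF) measurable_snd.
exact: measurable_convq1.
Qed.

(** With th^2 = s + xi^2 + t^2 the left-hand side decays like th^(-2) th^(-1-n/2). One factor is
    spent on each variable, which makes the double integral converge absolutely. *)
Lemma pairU_bound (s : R) : 0 < s -> exists2 C, 0 <= C & forall xi t : R, 0 < xi -> 0 < t ->
  `|t ^+ m.*2 * pairU (s + xi ^+ 2 + t ^+ 2)| <= C * (h32 xi * h32 t).
Proof.
move=> s0; have ss : 0 < Num.sqrt s by rewrite sqrtr_gt0.
have [C1 C10 h1] := tail_decay n0 ss; have [C2 C20 h2] := @tail_decay R 2 _ isT ss.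
have S0 := sN_ge0 d P 1 f.
pose I := \int[mu]_x `|F x|.
have I0 : 0 <= I by apply: Rint_ge0.
exists (I * (sN d P 1 f) * C2 * C1) => [|xi t x0 t0]; first by rewrite !mulr_ge0.
pose v := s + xi ^+ 2 + t ^+ 2; pose th := Num.sqrt v.
have v0 : 0 < v by rewrite /v !addr_gt0 ?exprn_gt0.
have th0 : 0 < th by rewrite sqrtr_gt0.
have thE : th ^+ 2 = v by rewrite sqr_sqrtr// ltW.
have x2 := sqr_ge0 xi; have t2 := sqr_ge0 t.
have ths : Num.sqrt s <= th by rewrite ler_wsqrtr// /v; lra.
have tht : t <= th by rewrite -[leLHS]ger0_norm ?(ltW t0)// -sqrtr_sqr ler_wsqrtr// /v; lra.
have thx : xi <= th by rewrite -[leLHS]ger0_norm ?(ltW x0)// -sqrtr_sqr ler_wsqrtr// /v; lra.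
have U1 : th ^+ m.*2 * `|pairU v| <= I * (sN d P 1 f / th ^+ 2 * (th * Num.sqrt (th ^+ n))^-1).
  have -> : th ^+ m.*2 * `|pairU v| = `|\int[mu]_x (th ^+ m.*2 * (F x * conv (q 1 v) f x))|.
    rewrite RintZ ?normrM ?(ger0_norm (exprn_ge0 _ (ltW th0)))//.
    by apply: L2M (rapid_L2 rF) _; apply: conv_L2 Lf; exact: rapid_Q.
  rewrite -RintZr; last exact: rapid_intble (rapid_norm rF).
  apply: Rint_norm_le.
  - by apply: intbleZ; apply: L2M (rapid_L2 rF) _; apply: conv_L2 Lf; exact: rapid_Q.
  - have := intbleZ (sN d P 1 f / th ^+ 2 * (th * Num.sqrt (th ^+ n))^-1) (rapid_intble (rapid_norm rF)).
    by congr intble; apply/funext => x; rewrite mulrC.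
  - move=> x; rewrite !normrM mulrCA ler_wpM2l// ger0_norm ?exprn_ge0 ?(ltW th0)// -thE.
    by have := conv_Q_decay hP od 1 x th0 Lf.
rewrite -/v normrM ger0_norm ?exprn_ge0 ?(ltW t0)//.
apply: (@le_trans _ _ (th ^+ m.*2 * `|pairU v|)).
  by rewrite ler_wpM2r// lerXn2r ?nnegrE ?(ltW t0) ?(ltW th0).
apply: le_trans U1 _.
have -> : I * sN d P 1 f * C2 * C1 * (h32 xi * h32 t) = I * (sN d P 1 f * (C2 * h32 t * (C1 * h32 xi))) by ring.
rewrite ler_wpM2l// -[leLHS]mulrA ler_wpM2l//.
have g1 : (th * Num.sqrt (th ^+ n))^-1 <= C1 * h32 xi.
  by apply: le_trans (h1 _ ths) _; rewrite ler_wpM2l// h32_le// ltW.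
have g2 : (th ^+ 2)^-1 <= C2 * h32 t.
  have := h2 _ ths; rewrite sqrtr_sqr ger0_norm ?(ltW th0)// -expr2 => g.
  by apply: le_trans g _; rewrite ler_wpM2l// h32_le// ltW.
by apply: ler_pM => //; rewrite invr_ge0 ?exprn_ge0 ?mulr_ge0 ?sqrtr_ge0 ?(ltW th0).
Qed.

Variable g : V -> R.
Hypothesis mg : measurable_fun setT g.
Hypothesis fg : {ae mu, forall x, Td d P j.+1%:R^-1 f x @[j --> \oo] --> g x}.

Definition pairPsi (r : R) : R := \int[mu]_x (F x * conv (H 1 r) g x).

Lemma pairPsiE (r : R) : 0 < r ->
  cK R N * pairPsi r = gam * \int[lam]_t (ind R (0 < t) * (t ^+ m.*2 * pairU (r + t ^+ 2))).
Proof.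
move=> r0; have Lg := L2_limit hP hh od n0 Lf mg fg.
have iv := fun x => inversion hP hh od n0 Lf mg fg 1 x r0.
have [C C0 hC] := conv_Q_shift_decay hP od n0 1 r0 Lf.
pose W (x : V) (t : R) := F x * (ind R (0 < t) * (t ^+ m.*2 * conv (q 1 (r + t ^+ 2)) f x)).
have mW : measurable_fun setT (fun z : V * measurableTypeR R => W z.1 z.2).
  apply: measurable_funM; first exact: measurableT_comp (rapid_measurable rF) measurable_fst.
  apply: measurable_funM; first by apply: measurable_ind_lt => //; exact: measurable_snd.
  apply: measurable_funM; first by apply: measurable_funX; exact: measurable_snd.
  have mp : measurable_fun setT (fun z : V * measurableTypeR R => (r + z.2 ^+ 2 : measurableTypeR R, z.1)).
    apply: measurable_fun_pair; last exact: measurable_fst.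
    by apply: measurable_funD => //; apply: measurable_funX; exact: measurable_snd.
  exact: measurableT_comp measurable_convq1 mp.
have iW x : intble lam (W x) by apply: intbleZ; exact: (iv x).1.
have hh0 := @half_h32 R.
have wb (x : V) (t : R) : `|W x t| <= `|F x| * C * (ind R (0 < t) * h32 t).
  rewrite normrM -mulrA ler_wpM2l// normrM ind_norm mulrCA /ind; case: ifP => t0; last by rewrite !mul0r.
  by rewrite !mul1r normrM ger0_norm ?exprn_ge0 ?(ltW t0)//; exact: hC.
have fin : (\int[mu]_x \int[lam]_t (`|W x t|)%:E < +oo)%E.
  apply: (@iterated_lty _ _ _ _ _ mu lam W (fun x => `|F x| * (C * \int[lam]_t (ind R (0 < t) * h32 t)))) => //.
    have := intbleZ (C * \int[lam]_t (ind R (0 < t) * h32 t)) (rapid_intble (rapid_norm rF)).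
    by congr intble; apply/funext => x; rewrite mulrC.
  move=> x; rewrite mulrA -RintZ//; apply: Rint_le; [exact: intble_norm|exact: intbleZ|exact: wb].
rewrite /pairPsi -RintZ; last by apply: L2M (rapid_L2 rF) _; apply: conv_L2 Lg; exact: rapid_H.
rewrite (@Rint_eq _ _ R mu _ (fun x => gam * \int[lam]_t W x t)); last first.
  by move=> x; rewrite mulrCA (iv x).2 mulrCA; congr (_ * _); rewrite RintZ//; exact: (iv x).1.
rewrite RintZ; last exact: (@intble_fubini _ _ _ _ _ mu lam W).
congr (_ * _); rewrite (Rfubini mW fin); apply: Rint_eq => t.
rewrite /ind; case: ifP => t0; last first.
  rewrite !mul0r; rewrite (@Rint_eq _ _ R mu _ (fun x => 0 * F x)).
    by rewrite RintZ ?mul0r//; exact: rapid_intble.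
  by move=> x; rewrite /W /ind t0 !mul0r mulr0.
rewrite mul1r /pairU -RintZ.
  by apply: Rint_eq => x; rewrite /W /ind t0 mul1r mulrCA.
have rt : 0 < r + t ^+ 2 by rewrite ltr_pwDl// sqr_ge0.
by apply: L2M (rapid_L2 rF) _; apply: conv_L2 Lf; exact: rapid_Q.
Qed.

Section fixed_time.
Variable s : R.
Hypothesis s0 : 0 < s.

Let K (xi t : R) := ind R (0 < xi) * (ind R (0 < t) * (t ^+ m.*2 * pairU (s + xi ^+ 2 + t ^+ 2))).
(** The integrand after xi = t * et; the additional power of [t] is the Jacobian. *)
Let K' (t et : R) := ind R (0 < t) * (ind R (0 < et) * (t ^+ m.*2.+1 * pairU (s + (1 + et ^+ 2) * t ^+ 2))).

Let mK : measurable_fun setT (fun z : measurableTypeR R * measurableTypeR R => K z.1 z.2).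
Proof.
apply: measurable_funM; first by apply: measurable_ind_lt => //; exact: measurable_fst.
apply: measurable_funM; first by apply: measurable_ind_lt => //; exact: measurable_snd.
apply: measurable_funM; first by apply: measurable_funX; exact: measurable_snd.
apply: measurableT_comp measurable_pairU _; apply: measurable_funD.
  by apply: measurable_funD => //; apply: measurable_funX; exact: measurable_fst.
by apply: measurable_funX; exact: measurable_snd.
Qed.

Let mK' : measurable_fun setT (fun z : measurableTypeR R * measurableTypeR R => K' z.1 z.2).
Proof.
apply: measurable_funM; first by apply: measurable_ind_lt => //; exact: measurable_fst.
apply: measurable_funM; first by apply: measurable_ind_lt => //; exact: measurable_snd.
apply: measurable_funM; first by apply: measurable_funX; exact: measurable_fst.
apply: measurableT_comp measurable_pairU _; apply: measurable_funD => //.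
apply: measurable_funM; last by apply: measurable_funX; exact: measurable_fst.
by apply: measurable_funD => //; apply: measurable_funX; exact: measurable_snd.
Qed.

Let M := \int[lam]_t (ind R (0 < t) * h32 t).

Let Kb : exists2 C, 0 <= C & forall xi t, `|K xi t| <= C * ((ind R (0 < xi) * h32 xi) * (ind R (0 < t) * h32 t)).
Proof.
have [C C0 hC] := pairU_bound s0; exists C => // xi t.
rewrite /K !normrM !ind_norm /ind; case: ifP => x0; last by rewrite !mul0r mulr0.
case: ifP => t0; last by rewrite !mul0r !mulr0.
by rewrite !mul1r -normrM hC.
Qed.

Let iK xi : intble lam (K xi).
Proof.
have [C C0 hC] := Kb.
apply: intble_le (intbleZ (C * (ind R (0 < xi) * h32 xi)) (@half_h32 R)) _; last first.
  by move=> t; rewrite -mulrA.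
have mp : measurable_fun setT (fun t : measurableTypeR R => (xi : measurableTypeR R, t)) by exact: measurable_fun_pair.
exact: measurableT_comp mK mp.
Qed.

Let iKt t : intble lam (K ^~ t).
Proof.
have [C C0 hC] := Kb.
apply: intble_le (intbleZ (C * (ind R (0 < t) * h32 t)) (@half_h32 R)) _; last first.
  move=> xi; have -> : C * (ind R (0 < t) * h32 t) * (ind R (0 < xi) * h32 xi) =
    C * ((ind R (0 < xi) * h32 xi) * (ind R (0 < t) * h32 t)) by ring.
  exact: hC.
have mp : measurable_fun setT (fun xi : measurableTypeR R => (xi, t : measurableTypeR R)) by exact: measurable_fun_pair.
exact: measurableT_comp mK mp.
Qed.

Let Kfin : (\int[lam]_x \int[lam]_t (`|K x t|)%:E < +oo)%E.
Proof.
have [C C0 hC] := Kb; have hh0 := @half_h32 R.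
apply: (@iterated_lty _ _ _ _ _ lam lam K (fun x => C * M * (ind R (0 < x) * h32 x))) => //.
  exact: intbleZ.
move=> x; have -> : C * M * (ind R (0 < x) * h32 x) = C * (ind R (0 < x) * h32 x) * M by ring.
rewrite -RintZ//; apply: Rint_le; [exact: intble_norm|exact: intbleZ|].
by move=> t; rewrite -mulrA.
Qed.

Let KK' t et : 0 < t -> K' t et = t * K (0 + t * et) t.
Proof.
move=> t0; rewrite /K' /K add0r pmulr_rgt0// /ind t0; case: ifP => _; last by rewrite !mul0r !mulr0.
rewrite !mul1r exprS exprMn -mulrA; congr (_ * (_ * pairU _)); ring.
Qed.

Let K'0 t et : (0 < t) = false -> K' t et = 0.
Proof. by move=> t0; rewrite /K' /ind t0 mul0r. Qed.

Let K0 xi t : (0 < t) = false -> K xi t = 0.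
Proof. by move=> t0; rewrite /K /ind t0 mul0r mulr0. Qed.

Let Rint0 : \int[lam]_x (0 : R) = 0.
Proof.
have := @RintZ _ (measurableTypeR R) R lam 0 _ (@half_h32 R).
by rewrite mul0r => h; rewrite -[RHS]h; apply: Rint_eq => x; rewrite mul0r.
Qed.

Let iK' t : intble lam (K' t).
Proof.
case t0 : (0 < t); last first.
  rewrite (_ : K' t = fun x => 0 * (ind R (0 < x) * h32 x)); first exact: intbleZ (@half_h32 R).
  by apply/funext => et; rewrite K'0// mul0r.
have := intbleZ t (intble_affine1 0 (lt0r_neq0 t0) (iKt t)).
by congr intble; apply/funext => et; rewrite KK'.
Qed.

Let sub_int t : \int[lam]_x K x t = \int[lam]_et K' t et.
Proof.
case t0 : (0 < t); last by apply: Rint_eq => x; rewrite K'0 ?K0.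
rewrite (Rint_affine1 0 (lt0r_neq0 t0) (iKt t)) gtr0_norm// -RintZ; last exact: (intble_affine1 0 (lt0r_neq0 t0) (iKt t)).
by apply: Rint_eq => et; rewrite KK'.
Qed.

Let sub_abs t : \int[lam]_x `|K x t| = \int[lam]_et `|K' t et|.
Proof.
case t0 : (0 < t); last by apply: Rint_eq => x; rewrite K'0 ?K0.
have i := intble_norm (iKt t).
rewrite (Rint_affine1 0 (lt0r_neq0 t0) i) gtr0_norm// -RintZ; last exact: (intble_affine1 0 (lt0r_neq0 t0) i).
by apply: Rint_eq => et; rewrite KK'// [RHS]normrM (gtr0_norm t0).
Qed.

Let K'fin : (\int[lam]_t \int[lam]_x (`|K' t x|)%:E < +oo)%E.
Proof.
have [C C0 hC] := Kb; have hh0 := @half_h32 R.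
apply: (@iterated_lty _ _ _ _ _ lam lam K' (fun t => C * M * (ind R (0 < t) * h32 t))) => //.
  exact: intbleZ.
move=> t; rewrite -sub_abs.
have -> : C * M * (ind R (0 < t) * h32 t) = C * (ind R (0 < t) * h32 t) * M by ring.
rewrite -RintZ//; apply: Rint_le; [exact: intble_norm (iKt t)|exact: intbleZ|].
move=> xi; have -> : C * (ind R (0 < t) * h32 t) * (ind R (0 < xi) * h32 xi) =
  C * ((ind R (0 < xi) * h32 xi) * (ind R (0 < t) * h32 t)) by ring.
exact: hC.
Qed.

(** In the variables t and et = xi / t the radial power is t^(2m+1), exactly the one for which
    [heat_radial] reduces m + 1 time derivatives to none. The remaining integral in [et] is
    [polarC]. *)
Lemma pairPsi_int : intble lam (fun xi => ind R (0 < xi) * pairPsi (s + xi ^+ 2)) /\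
  cK R N * \int[lam]_xi (ind R (0 < xi) * pairPsi (s + xi ^+ 2)) =
  - (gam * polarC R m) * \int[mu]_x (bP x * conv (H 0 s) f x).
Proof.
have c0 : cK R N != 0 by rewrite lt0r_neq0// cK_gt0.
have E xi : cK R N * (ind R (0 < xi) * pairPsi (s + xi ^+ 2)) = gam * \int[lam]_t K xi t.
  have p : 0 < s + xi ^+ 2 by rewrite ltr_pwDl// sqr_ge0.
  rewrite mulrCA pairPsiE// mulrCA /ind; case x0 : (0 < xi); last first.
    by rewrite mul0r (@Rint_eq _ (measurableTypeR R) R lam _ (fun=> 0)) ?Rint0// => t; rewrite /K /ind x0 mul0r.
  by rewrite mul1r; congr (_ * _); apply: Rint_eq => t; rewrite /K /ind x0 mul1r.
have i1 : intble lam (fun xi => gam * \int[lam]_t K xi t).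
  by apply: intbleZ; exact: (@intble_fubini _ _ _ _ _ lam lam K mK Kfin).
have i2 : intble lam (fun xi => ind R (0 < xi) * pairPsi (s + xi ^+ 2)).
  have := intbleZ (cK R N)^-1 i1; congr intble; apply/funext => xi; by rewrite -E mulKf.
split=> //; rewrite -RintZ// (funext E) RintZ; last exact: (@intble_fubini _ _ _ _ _ lam lam K mK Kfin).
rewrite mulNr -mulrA -mulrN; congr (_ * _).
rewrite (Rfubini mK Kfin) (@Rint_eq _ (measurableTypeR R) R lam _ (fun t : R => \int[lam]_et K' t et)); last exact: sub_int.
rewrite (Rfubini mK' K'fin) bP_pair// -mulrN /polarC -RintZr; last first.
  have := intbleZ (m`!%:R / 2) (@half_inv2_le R m); congr intble; apply/funext => t.
  by rewrite invfM; ring.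
apply: Rint_eq => et; rewrite /ind; case e0 : (0 < et); last first.
  rewrite !mul0r (@Rint_eq _ (measurableTypeR R) R lam _ (fun=> 0)) ?Rint0// => t; rewrite /K' /ind e0 mul0r mulr0//.
rewrite mul1r mulrN -mulNr.
have a1 : 1 <= 1 + et ^+ 2 by rewrite lerDl sqr_ge0.
have [i3 E3] := heat_radial n0 0 L2_bPf s0 a1 m.
rewrite mulNr -E3 -mulN1r -RintZ//; apply: Rint_eq => t.
have p : 0 < s + (1 + et ^+ 2) * t ^+ 2 by rewrite ltr_pwDl// mulr_ge0 ?sqr_ge0// (le_trans _ a1).
by rewrite /K' pairUE// /ind e0; ring.
Qed.

End fixed_time.
End ball_pairing.

(** * Layer cake, dilations and the ball bound *)

Section layer_cake.
Variables (R : realType) (n : nat).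
Local Notation V := 'rV[R]_n.
Local Notation mu := (lebesgue_rV R n).
Local Notation lam := (@lebesgue_measure R).
Local Notation nm := (@hr_enorm R n).

Lemma half_poly_exp k (b : R) : 0 < b ->
  intble lam (fun r => ind R (0 < r) * ((1 + r ^+ k) * expR (- (b * r)))).
Proof.
move=> b0; have b2 : 0 < b / 2 by rewrite divr_gt0.
have [C C0 hC] := poly_expR_bound (1 + 'X^k) b2.
apply: intble_le (intbleZ C (half_exp b2).1) _.
  apply: measurable_funM; first exact: measurable_ind_lt.
  apply: measurable_funM; first by apply: measurable_funD => //; exact: measurable_funX.
  by apply: measurableT_comp => //; apply: measurable_funN; exact: measurable_funM.
move=> r; rewrite normrM ind_norm mulrCA /ind; case: ifP => r0; last by rewrite !mul0r.
rewrite !mul1r normrM (ger0_norm (expR_ge0 _)).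
have := hC r (ltW r0); rewrite !hornerE => h.
apply: le_trans (ler_wpM2r (expR_ge0 _) h) _; rewrite -[leLHS]mulrA -expRD ler_wpM2l// ler_expR; lra.
Qed.

Section statement.
Variables (h : V -> R) (w : R -> R) (W b A : R) (k : nat).
Hypotheses (mh : measurable_fun setT h) (mw : measurable_fun setT w) (b0 : 0 < b).
Hypothesis wW : forall r, 0 < r -> `|w r| <= W * expR (- (b * r)).
Hypothesis ih : forall r, 0 < r -> intble mu (fun y => ind R (nm y < r) * h y).
Hypothesis hA : forall r, 0 < r -> \int[mu]_y `|ind R (nm y < r) * h y| <= A * (1 + r ^+ k).

Let F (r : R) (y : V) := w r * (ind R (nm y < r) * h y).

Let mF : measurable_fun setT (fun z : measurableTypeR R * V => F z.1 z.2).
Proof.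
apply: measurable_funM; first exact: measurableT_comp mw measurable_fst.
apply: measurable_funM; last exact: measurableT_comp mh measurable_snd.
apply: measurable_ind_lt; last exact: measurable_fst.
exact: measurableT_comp (@measurable_hr_enorm R n) measurable_snd.
Qed.

Let ind0 (r : R) (y : V) : (0 < r) = false -> ind R (nm y < r) = 0.
Proof.
move=> /negbT; rewrite -leNgt => r0; rewrite /ind ltNge (le_trans r0) ?hr_enorm_ge0//.
Qed.

Let iF r : intble mu (F r).
Proof.
apply: intbleZ; case r0 : (0 < r); first exact: ih.
rewrite (_ : (fun y => _) = fun y => 0 * ind R (nm y < 1)); last by apply/funext => y; rewrite ind0// !mul0r.
by apply: intbleZ; apply: rapid_intble; exact: rapid_oball.
Qed.

Let Ffin : (\int[lam]_r \int[mu]_y (`|F r y|)%:E < +oo)%E.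
Proof.
have i0 := intbleZ (A * W) (@half_poly_exp k b b0).
apply: (@iterated_lty _ _ _ _ _ lam mu F (fun r => A * W * (ind R (0 < r) * ((1 + r ^+ k) * expR (- (b * r)))))) => //.
move=> r; case r0 : (0 < r); last first.
  rewrite (@Rint_eq _ _ R mu _ (fun y => 0 * ind R (nm y < 1))).
    by rewrite RintZ; [rewrite /ind !mul0r mulr0|apply: rapid_intble; exact: rapid_oball].
  by move=> y; rewrite /F ind0// !mul0r mulr0 normr0.
rewrite (@Rint_eq _ _ R mu _ (fun y => `|w r| * `|ind R (nm y < r) * h y|)); last by move=> y; rewrite normrM.
rewrite RintZ; last exact: intble_norm (ih r0).
rewrite {2}/ind mul1r.
have -> : A * W * ((1 + r ^+ k) * expR (- (b * r))) = (W * expR (- (b * r))) * (A * (1 + r ^+ k)) by ring.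
by apply: ler_pM => //; [exact: Rint_ge0|exact: wW|exact: hA].
Qed.

Let Ffin' : (\int[mu]_y \int[lam]_r (`|F r y|)%:E < +oo)%E.
Proof.
rewrite -(@tonelli _ _ _ _ _ lam mu (fun r y => (`|F r y|)%:E))//.
have mn : measurable_fun setT (fun z : measurableTypeR R * V => `|F z.1 z.2|) by exact: measurableT_comp mF.
exact/measurable_EFinP.
Qed.

Let mF' : measurable_fun setT (fun z : V * measurableTypeR R => F z.2 z.1).
Proof.
have ms : measurable_fun setT (fun z : V * measurableTypeR R => (z.2, z.1)).
  by apply: measurable_fun_pair; [exact: measurable_snd|exact: measurable_fst].
exact: measurableT_comp mF ms.
Qed.

Let iw y : intble lam (fun r => ind R (nm y < r) * w r).
Proof.
have i0 := intbleZ W (half_exp b0).1.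
apply: intble_le i0 _.
  by apply: measurable_funM => //; exact: measurable_ind_lt.
move=> r; rewrite normrM ind_norm; case r0 : (0 < r); last by rewrite ind0// /ind mul0r mul0r mulr0.
rewrite {2}/ind mul1r; apply: le_trans (wW r0).
by rewrite ler_piMl// ind_le1.
Qed.

Lemma layer_cake : intble mu (fun y => h y * \int[lam]_r (ind R (nm y < r) * w r)) /\
  \int[mu]_y (h y * \int[lam]_r (ind R (nm y < r) * w r)) =
  \int[lam]_r (w r * \int[mu]_y (ind R (nm y < r) * h y)).
Proof.
have E y : h y * \int[lam]_r (ind R (nm y < r) * w r) = \int[lam]_r F r y.
  by rewrite -RintZ//; apply: Rint_eq => r; rewrite /F; ring.
split.
  rewrite (funext E); exact: (@intble_fubini _ _ _ _ _ mu lam (fun y r => F r y) mF' Ffin').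
rewrite (funext E) -(Rfubini mF Ffin); apply: Rint_eq => r.
rewrite RintZ//; case r0 : (0 < r); first exact: ih.
rewrite (_ : (fun y => _) = fun y => 0 * ind R (nm y < 1)); last by apply/funext => y; rewrite ind0// !mul0r.
by apply: intbleZ; apply: rapid_intble; exact: rapid_oball.
Qed.

(** [A] bounds absolute integrals and serves to justify Fubini; the estimate itself involves the
    signed ball integrals, whose cancellation is what [ball_pairing_bound] provides. *)
Lemma layer_bound N : 0 <= N -> (forall r, 0 < r -> `|\int[mu]_y (ind R (nm y < r) * h y)| <= N * r ^+ k) ->
  `|\int[mu]_y (h y * \int[lam]_r (ind R (nm y < r) * w r))| <=
  W * N * \int[lam]_r (ind R (0 < r) * ((1 + r ^+ k) * expR (- (b * r)))).
Proof.
move=> N0 hN; rewrite layer_cake.2 -RintZ; last exact: half_poly_exp.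
apply: Rint_norm_le.
- have := @intble_fubini _ _ _ _ _ lam mu F mF Ffin; congr intble; apply/funext => r.
  rewrite RintZ//; case r0 : (0 < r); first exact: ih.
  rewrite (_ : (fun y => _) = fun y => 0 * ind R (nm y < 1)); last by apply/funext => y; rewrite ind0// !mul0r.
  by apply: intbleZ; apply: rapid_intble; exact: rapid_oball.
- by apply: intbleZ; exact: half_poly_exp.
move=> r; case r0 : (0 < r); last first.
  rewrite (@Rint_eq _ _ R mu _ (fun y => 0 * ind R (nm y < 1))).
    rewrite RintZ; last by apply: rapid_intble; exact: rapid_oball.
    by rewrite /ind !mul0r !mulr0 normr0.
  by move=> y; rewrite ind0// !mul0r.
rewrite {2}/ind mul1r normrM.
have -> : W * N * ((1 + r ^+ k) * expR (- (b * r))) = (W * expR (- (b * r))) * (N * (1 + r ^+ k)) by ring.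
apply: ler_pM => //; first exact: wW.
by apply: le_trans (hN r r0) _; rewrite ler_wpM2l// lerDr.
Qed.

End statement.

Lemma tail_FTC (F w : R -> R) (l rho : R) : (forall x : R, is_derive x (1 : R) F (w x)) -> continuous w ->
  F x @[x --> +oo%R] --> l -> intble lam (fun r => ind R (rho < r) * w r) ->
  \int[lam]_r (ind R (rho < r) * w r) = l - F rho.
Proof.
move=> dF cw Fl i; have o0 := oner_neq0 R.
have i1 := intble_affine1 rho o0 i.
rewrite (Rint_affine1 rho o0 i) normr1 mul1r.
have E (x : R) : ind R (rho < rho + 1 * x) * w (rho + 1 * x) = ind R (0 < x) * w (rho + x) by rewrite mul1r ltrDl.
rewrite (funext E) in i1 *.
have D (x : R) : is_derive x (1 : R) (fun x => F (rho + x)) (w (rho + x)) by exact: is_derive_addl.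
have cwr : continuous (fun x => w (rho + x)).
  move=> x; have c : {for x, continuous (fun x : R => rho + x)}.
    by apply: continuousD; [exact: cvg_cst|exact: cvg_id].
  exact: (continuous_comp c (@cw _)).
have Fr : F (rho + x) @[x --> +oo%R] --> l.
  apply: cvg_comp Fl; apply/cvgryPge => B; near=> x; rewrite -lerBlDl; near: x; apply: nbhs_pinfty_ge; exact: num_real.
by rewrite (FTC_half D cwr Fr i1) addr0.
Unshelve. all: by end_near. Qed.

Lemma gauss_poly_exp (p : {poly R}) (a : R) : 0 < a -> exists2 W, 0 <= W & forall r, 0 <= r ->
  `|p.[r]| * expR (- (a * r ^+ 2)) <= W * expR (- (1 * r)).
Proof.
move=> a0; have [C C0 hC] := poly_expR_bound p (@ltr01 R).
(* The factor e^(1/a) comes from 2 r <= a r^2 + 1/a. *)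
exists (C * expR (a^-1)) => [|r r0]; first by rewrite mulr_ge0 ?expR_ge0.
apply: le_trans (ler_wpM2r (expR_ge0 _) (hC r r0)) _.
rewrite -!mulrA -!expRD ler_wpM2l// ler_expR.
have h := sqr_ge0 (a * r - 1).
have : 0 <= (a * r - 1) ^+ 2 / a by rewrite divr_ge0// ltW.
have -> : (a * r - 1) ^+ 2 / a = a * r ^+ 2 - 2 * r + a^-1 by field; rewrite lt0r_neq0.
lra.
Qed.

Lemma continuous_gauss (a : R) (p : {poly R}) : continuous (fun r : R => p.[r] * expR (- (a * r ^+ 2))).
Proof.
move=> r; have c1 : {for r, continuous (fun r : R => - (a * r ^+ 2))}.
  apply: continuousN; apply: continuousM; [exact: cvg_cst|exact: exprn_continuous].
have c2 : {for r, continuous (fun r : R => expR (- (a * r ^+ 2)))}.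
  exact: (continuous_comp c1 (@continuous_expR R _)).
exact: continuousM (@continuous_horner R p r) c2.
Qed.

Lemma is_derive_gauss (a : R) (p : {poly R}) (r : R) : is_derive r (1 : R)
  (fun r => p.[r] * expR (- (a * r ^+ 2))) ((p^`() - (2 * a)%:P * 'X * p).[r] * expR (- (a * r ^+ 2))).
Proof.
have D1 := is_deriveN (is_deriveZ a (is_derive_Xn 2 r)).
have D2 := @is_derive1_comp R expR (fun r => - (a * r ^+ 2)) r _ _ (is_derive_expR _) D1.
have D3 := is_deriveM (is_derive_poly p r) D2; apply: (is_derive_eq D3).
by rewrite /GRing.scale/= /GRing.scale/= hornerD hornerN !hornerM hornerC hornerX expr1; ring.
Qed.

Lemma gauss_poly_intble (p : {poly R}) (a c : R) : 0 < a -> 0 <= c ->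
  intble lam (fun r => ind R (c < r) * (p.[r] * expR (- (a * r ^+ 2)))).
Proof.
move=> a0 c0; have [W W0 hW] := gauss_poly_exp p a0.
apply: intble_le (intbleZ W (half_exp ltr01).1) _.
  apply: measurable_funM; first exact: measurable_ind_lt.
  by apply: continuous_measurable_fun; exact: continuous_gauss.
move=> r; rewrite normrM ind_norm {1}/ind; case: ifP => rr; last first.
  by rewrite mul0r mulr_ge0// mulr_ge0 ?ind_ge0 ?expR_ge0.
have rp : 0 < r by exact: le_lt_trans rr.
have -> : ind R (0 < r) = 1 by rewrite /ind rp.
by rewrite [leLHS]mul1r (mul1r (expR _)) normrM (ger0_norm (expR_ge0 _)); apply: hW; exact: ltW.
Qed.

(** The weight is minus the derivative of the right-hand side. Read with rho = |y|, it presents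
    polynomial times Gaussian profiles as superpositions of balls, ready for the layer cake. *)
Lemma gauss_tail (a rho : R) (p : {poly R}) : 0 < a -> 0 <= rho ->
  \int[lam]_r (ind R (rho < r) * (((2 * a)%:P * 'X * p - p^`()).[r] * expR (- (a * r ^+ 2)))) =
  p.[rho] * expR (- (a * rho ^+ 2)).
Proof.
move=> a0 r0; pose w := (2 * a)%:P * 'X * p - p^`().
pose G (r : R) := - (p.[r] * expR (- (a * r ^+ 2))).
pose w' (r : R) := w.[r] * expR (- (a * r ^+ 2)).
have dG (x : R) : is_derive x (1 : R) G (w' x).
  have D := is_deriveN (is_derive_gauss a p x); apply: (is_derive_eq D).
  by rewrite -mulNr -hornerN opprB.
have h2 := gauss_poly_intble w a0 r0.
suff h1 : G x @[x --> +oo%R] --> (0 : R) by rewrite (tail_FTC dG (@continuous_gauss a w) h1 h2) /G sub0r opprK.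
rewrite -oppr0; apply: cvgN.
have [U U0 hU] := gauss_poly_exp p a0.
apply/cvgrPdist_le => e e0.
have U1 : 0 < U + 1 by rewrite ltr_wpDl.
have /cvgrPdist_le/(_ _ (divr_gt0 e0 U1)) E := cvg_expRN (@ltr01 R).
near=> r; rewrite sub0r normrN.
have rr : 0 <= r by near: r; apply: nbhs_pinfty_ge; exact: num_real.
rewrite normrM (ger0_norm (expR_ge0 _)); apply: le_trans (hU r rr) _.
have : `|0 - expR (- (1 * r))| <= e / (U + 1) by near: r; exact: E.
rewrite sub0r normrN ger0_norm ?expR_ge0// ler_pdivlMr// => h3.
have := expR_ge0 (- (1 * r)); lra.
Unshelve. all: by end_near. Qed.

End layer_cake.

Section dilations.
Variables (R : realType) (n : nat).
Local Notation V := 'rV[R]_n.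
Local Notation mu := (lebesgue_rV R n).
Local Notation lam := (@lebesgue_measure R).
Local Notation nm := (@hr_enorm R n).
Implicit Types (f g : V -> R).

Lemma L2_affine (x0 : V) (a : R) f : a != 0 -> L2 mu f -> L2 mu (fun y => f (x0 + a *: y)).
Proof.
move=> an [mf f2]; split; first exact: measurableT_comp mf (@measurable_rV_affine R n x0 a).
exact: (intble_affine x0 an f2).
Qed.

Lemma ae_affine (x0 : V) (a : R) (A : V -> Prop) : a != 0 ->
  {ae mu, forall x, A x} -> {ae mu, forall x, A (x0 + a *: x)}.
Proof.
move=> an [B [mB B0 AB]]; exists ((fun y => x0 + a *: y) @^-1` B).
have mp : measurable ((fun y : V => x0 + a *: y) @^-1` B).
  by rewrite -[X in measurable X]setTI; exact: (@measurable_rV_affine R n x0 a).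
split=> //; last by move=> y /= h; apply: AB.
have m1 : measurable_fun setT (fun y : V => (\1_B y)%:E : \bar R).
  by apply/measurable_EFinP; exact: measurable_indic.
have := @ge0_integral_rV_affine R n x0 a (fun y => (\1_B y)%:E) an m1 (fun y => ltac:(by rewrite lee_fin)).
have -> : (\int[mu]_y (\1_B y)%:E = 0)%E by rewrite integral_indic// setIT.
have -> : (\int[mu]_y (\1_B (x0 + a *: y))%:E = mu ((fun y => (x0 + a *: y)%R) @^-1` B))%E.
  by rewrite -[in RHS](setIT (_ @^-1` _)) -integral_indic.
move=> /esym/eqP; rewrite mule_eq0 eqe expf_eq0 normr_eq0 (negbTE an) andbF/= => /eqP //.
Qed.

(* What [M (M g) 0 <= N] gives, at all scales; the sum over dyadic shells plays the
   role of the weight log (1 / | |y| - 1 |). *)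
Definition maxbd g (N : R) := forall a, 0 < a ->
  (forall r, 0 < r -> \int[mu]_y (ind R (nm y < r) * `|g (a *: y)|) <= N * r ^+ n) /\
  (forall K, \sum_(k < K) \int[mu]_y (ind R (`|nm y - 1| < (2 ^+ k)^-1) * `|g (a *: y)|) <= N).

Lemma maxbd_ge0 g N : maxbd g N -> 0 <= N.
Proof. by move=> h; have [_ /(_ 0%N)] := h 1 ltr01; rewrite big_ord0. Qed.

Lemma maxbd_dil g N a : 0 < a -> maxbd g N -> maxbd (fun y => g (a *: y)) N.
Proof.
move=> a0 h b b0; have [h1 h2] := h (a * b) (mulr_gt0 a0 b0); split=> [r r0|K].
  by have := h1 r r0; under eq_Rintegral do rewrite -scalerA.
by have := h2 K; under eq_bigr do under eq_Rintegral do rewrite -scalerA.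
Qed.

Lemma L2_dil (a : R) f : 0 < a -> L2 mu f -> L2 mu (fun y => f (a *: y)).
Proof.
move=> a0 Lf; have := L2_affine 0 (lt0r_neq0 a0) Lf.
by congr (L2 _ _); apply/funext => y; rewrite add0r.
Qed.

Lemma intble_ball (r : R) f : L2 mu f -> intble mu (fun y => ind R (nm y < r) * f y).
Proof. by move=> Lf; apply: L2M Lf; apply: rapid_L2; exact: rapid_oball. Qed.

(** A Gaussian is a superposition of balls with weight 2 a r e^(-a r^2), so the ball averages of |g|
    control its Gaussian averages. *)
Lemma maxbd_gauss (a : R) : 0 < a -> exists2 C, 0 <= C & forall g N, L2 mu g -> maxbd g N ->
  forall th : R, 0 < th -> intble mu (fun y => expR (- (a * (sqn y / th ^+ 2))) * `|g y|) /\
  \int[mu]_y (expR (- (a * (sqn y / th ^+ 2))) * `|g y|) <= C * N * th ^+ n.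
Proof.
move=> a0; pose w : {poly R} := (2 * a)%:P * 'X * 1 - 1^`().
have [W W0 hW] := gauss_poly_exp w a0.
pose I := \int[lam]_r (ind R (0 < r) * ((1 + r ^+ n) * expR (- (1 * r)))).
have I0 : 0 <= I.
  apply: Rint_ge0 => r; rewrite /ind; case: ifP => r0; last by rewrite mul0r.
  by rewrite mul1r mulr_ge0 ?expR_ge0// addr_ge0// exprn_ge0// ltW.
exists (W * I) => [|g N Lg hg th th0]; first exact: mulr_ge0.
have N0 := maxbd_ge0 hg; have thn := lt0r_neq0 th0.
have rg : rapid (fun y : V => expR (- (a * (sqn y / th ^+ 2)))).
  have at0 : 0 < a / th ^+ 2 by rewrite divr_gt0// exprn_gt0.
  have -> : (fun y : V => expR (- (a * (sqn y / th ^+ 2)))) = fun y => expR (- (a / th ^+ 2 * sqn y)).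
    by apply/funext => y; congr (expR (- _)); ring.
  split; first exact: measurable_gauss.
  by exists 1, (a / th ^+ 2); split=> // y; rewrite mul1r ger0_norm ?expR_ge0.
have ig : intble mu (fun y => expR (- (a * (sqn y / th ^+ 2))) * `|g y|).
  by apply: L2M (rapid_L2 rg) _; exact: L2_norm.
split=> //; rewrite (Rint_affine 0 thn ig) gtr0_norm// mulrC ler_wpM2r ?exprn_ge0 ?(ltW th0)//.
have Lh := L2_norm (L2_dil th0 Lg).
have [hb _] := hg th th0.
pose w' (r : R) := w.[r] * expR (- (a * r ^+ 2)).
have hw' r : 0 < r -> `|w' r| <= W * expR (- (1 * r)).
  by move=> r0; rewrite normrM (ger0_norm (expR_ge0 _)); apply: hW; exact: ltW.
have mw' : measurable_fun setT w' by apply: continuous_measurable_fun; exact: continuous_gauss.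
have abs r : `|\int[mu]_y (ind R (nm y < r) * `|g (th *: y)|)| = \int[mu]_y (ind R (nm y < r) * `|g (th *: y)|).
  by rewrite ger0_norm//; apply: Rint_ge0 => y; rewrite mulr_ge0 ?ind_ge0.
have bd := @layer_bound R n (fun y => `|g (th *: y)|) w' W 1 N n Lh.1 mw' ltr01 hw'
  (fun r _ => intble_ball r Lh) _ N N0 _.
rewrite (@Rint_eq _ _ R mu _ (fun y => `|g (th *: y)| * \int[lam]_r (ind R (nm y < r) * w' r))); last first.
  move=> y; rewrite (@gauss_tail R a (nm y) 1 a0 (hr_enorm_ge0 y)) hornerC mul1r mulrC add0r sqnZ sqr_hr_enorm.
  by congr (_ * expR (- (a * _))); field.
apply: le_trans (ler_norm _) _; rewrite mulrAC; apply: bd => r r0.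
  rewrite (@Rint_eq _ _ R mu _ (fun y => ind R (nm y < r) * `|g (th *: y)|)).
    by apply: le_trans (hb r r0) _; rewrite ler_wpM2l// lerDr.
  by move=> y; rewrite normrM ind_norm normr_id.
by rewrite abs; exact: hb.
Qed.

(** If the sum stops before K then v lies above the next dyadic threshold; otherwise all terms are
    present and sum to a geometric series. The lower bound on [v], which makes finitely many terms
    enough, will come from the positive time [s]. *)
Lemma dyadic_inv K (v : R) : (2 ^+ K)^-1 <= v -> v^-1 <= 1 + \sum_(k < K) 2 ^+ k * ind R (v < (2 ^+ k)^-1).
Proof.
have p k : 0 < (2 : R) ^+ k by rewrite exprn_gt0.
elim: K => [|K IH] hv.
  by rewrite big_ord0 addr0; rewrite expr0 invr1 in hv; rewrite invf_le1// (lt_le_trans _ hv).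
have v0 : 0 < v by apply: lt_le_trans hv; rewrite invr_gt0.
case: (leP (2 ^+ K)^-1 v) => h.
  apply: le_trans (IH h) _; rewrite lerD2l big_ord_recr/= lerDl.
  by rewrite mulr_ge0 ?ind_ge0// ltW.
have E k : (k <= K)%N -> ind R (v < (2 ^+ k)^-1) = 1.
  by move=> kK; rewrite /ind (lt_le_trans h)// lef_pV2 ?posrE// ler_weXn2l// ler1n.
apply: (@le_trans _ _ (2 ^+ K.+1)); first by rewrite -[leRHS]invrK lef_pV2 ?posrE ?invr_gt0.
rewrite (eq_bigr (fun k : 'I_K.+1 => 2 ^+ k)); last by move=> k _; rewrite E ?mulr1// -ltnS.
elim: K.+1 => [|j IHj]; first by rewrite big_ord0 addr0 expr0.
by rewrite big_ord_recr/= exprS; lra.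
Qed.

End dilations.

Lemma cvg_prodr (R : realType) (I : Type) (r : seq I) (f : I -> nat -> R) (l : I -> R) :
  (forall i, f i j @[j --> \oo] --> l i) ->
  \prod_(i <- r) f i j @[j --> \oo] --> \prod_(i <- r) l i.
Proof.
move=> fl; elim: r => [|i r IH].
  by under eq_fun do rewrite big_nil; rewrite big_nil; exact: cvg_cst.
by under eq_fun do rewrite big_cons; rewrite big_cons; exact: cvgM.
Qed.

Section riesz_pairs.
Variables (R : realType) (n m : nat) (P : mpoly.mpoly n R).
Local Notation V := 'rV[R]_n.
Local Notation mu := (lebesgue_rV R n).
Local Notation lam := (@lebesgue_measure R).
Local Notation gam := (gam R n).
Local Notation d := m.*2.+1.
Hypotheses (hP : homog d P) (hh : harm P) (n0 : (0 < n)%N).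
Local Notation q k t := (Q P d k t).
Local Notation N_ := (d + n).+1.
Local Notation nm := (@hr_enorm R n).
Local Notation F := (@cutp R n (pol R n m)).
Implicit Types (f g : V -> R).

Let od : odd d. Proof. by rewrite /= odd_double. Qed.

(** The limit is required along every sequence a / (j + 1), so that the notion is stable under
    dilations. *)
Definition riesz_pair f g := [/\ L2 mu f, measurable_fun setT g &
  forall a : R, 0 < a -> {ae mu, forall x, Td d P (a * j.+1%:R^-1) f x @[j --> \oo] --> g x}].

Lemma riesz_L2 f g : riesz_pair f g -> L2 mu g.
Proof.
move=> [Lf mg fg]; apply: (L2_limit hP hh od n0 Lf mg).
by have := fg 1 ltr01; apply: filterS => x; under eq_fun do rewrite mul1r.
Qed.

Lemma hker_scale (a del : R) y : 0 < a -> hker d P (a * del) (a *: y) = (a ^+ n)^-1 * hker d P del y.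
Proof.
move=> a0; have an := lt0r_neq0 a0.
rewrite /hker /rk hr_enormZ gtr0_norm// ltr_pM2l// (evZ _ _ hP) exprMn exprD invfM.
rewrite invfM; have h1 := expf_neq0 n an; have h2 := expf_neq0 d an.
have -> : a ^+ d * ev P y * ((a ^+ n)^-1 * (a ^+ d)^-1 * (nm y ^+ (n + d))^-1) =
  a ^+ d * (a ^+ d)^-1 * ((a ^+ n)^-1 * (ev P y / nm y ^+ (n + d))) by ring.
by rewrite mulfV// mul1r; ring.
Qed.

Lemma Td_affine (x0 : V) (a del : R) f x : 0 < a -> 0 < del -> L2 mu f ->
  Td d P del (fun y => f (x0 + a *: y)) x = Td d P (a * del) f (x0 + a *: x).
Proof.
move=> a0 del0 Lf; have an := lt0r_neq0 a0; have ad0 := mulr_gt0 a0 del0.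
have [i _] := Td_split hP od n0 (x0 + a *: x) ad0 Lf.
rewrite {2}/Td (Rint_affine 0 an i) gtr0_norm// -RintZ; last exact: (intble_affine 0 an i).
apply: Rint_eq => y; rewrite add0r hker_scale// mulrA mulrA mulfV ?mul1r ?expf_neq0//.
by rewrite scalerBr addrA.
Qed.

Lemma riesz_affine (x0 : V) (a : R) f g : 0 < a -> riesz_pair f g ->
  riesz_pair (fun y => f (x0 + a *: y)) (fun y => g (x0 + a *: y)).
Proof.
move=> a0 [Lf mg fg]; have an := lt0r_neq0 a0; split; first exact: L2_affine.
  exact: measurableT_comp mg (@measurable_rV_affine R n x0 a).
move=> b b0; have := ae_affine x0 an (fg (a * b) (mulr_gt0 a0 b0)).
apply: filterS => x; under eq_fun do rewrite -mulrA.
rewrite (_ : (fun j => _) = fun j => Td d P (b * j.+1%:R^-1) (fun y => f (x0 + a *: y)) x)//.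
by apply/funext => j; rewrite Td_affine// mulr_gt0// invr_gt0.
Qed.

Lemma riesz_dil (a : R) f g : 0 < a -> riesz_pair f g ->
  riesz_pair (fun y => f (a *: y)) (fun y => g (a *: y)).
Proof.
move=> a0 h; have := riesz_affine 0 a0 h.
by congr (riesz_pair _ _); apply/funext => y; rewrite add0r.
Qed.

Lemma line_continuous_ev : line_continuous (fun y : V => ev P y).
Proof.
move=> y z r r0; under eq_fun do rewrite evE; rewrite evE.
apply: cvg_sumr => i; apply: cvgM; first exact: cvg_cst.
apply: cvg_prodr => j; under eq_fun do rewrite !mxE.
have c : y ord0 j + r i * z ord0 j @[i --> \oo] --> y ord0 j.
  rewrite -[X in _ --> X]addr0 -[X in _ + X](mul0r (z ord0 j)).
  by apply: cvgD; [exact: cvg_cst|apply: cvgM => //; exact: cvg_cst].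
exact: (cvg_comp _ _ c (@exprn_continuous R _ _)).
Qed.

Lemma line_bP y : nm y != 1 -> forall (z : V) (r : nat -> R), r j @[j --> \oo] --> (0 : R) ->
  bP P (y + r j *: z) @[j --> \oo] --> bP P y.
Proof.
move=> y1 z r r0; rewrite /bP; apply: cvgM; first exact: line_continuous_ev.
apply: cvg_near_cst.
have e0 : 0 < `|nm y - 1| / (1 + nm z).
  by rewrite divr_gt0 ?normr_gt0 ?subr_eq0// ltr_pwDl// hr_enorm_ge0.
have /cvgrPdist_lt/(_ _ e0) := r0; apply: filterS => j; rewrite sub0r normrN => h.
have z0 := hr_enorm_ge0 z.
have h2 : `|nm (y + r j *: z) - nm y| < `|nm y - 1|.
  apply: le_lt_trans (hr_enorm_distl _ _) _; rewrite [y + _ - y]addrC addKr hr_enormZ.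
  rewrite ltr_pdivlMr ?ltr_pwDl// in h; have := normr_ge0 (r j); nra.
move: h2; rewrite ltr_norml => /andP[h3 h4].
case: (ltgtP (nm y) 1) y1 => // hy _.
  by rewrite ltr0_norm ?subr_lt0// in h4; rewrite /ind (_ : _ < 1)//; lra.
rewrite gtr0_norm ?subr_gt0// in h3; rewrite /ind ltNge (_ : 1 <= _)//; lra.
Qed.

Lemma ae_off_sphere : {ae mu, forall y : V, nm y != 1}.
Proof.
exists [set y : V | nm y = 1]; split; [exact: measurable_sphere|exact: sphere_mu0|].
by move=> y /= /negP; rewrite negbK => /eqP.
Qed.

End riesz_pairs.

Section pairing_bound.
Variables (R : realType) (n m : nat) (P : mpoly.mpoly n R).
Local Notation V := 'rV[R]_n.
Local Notation mu := (lebesgue_rV R n).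
Local Notation lam := (@lebesgue_measure R).
Local Notation gam := (gam R n).
Local Notation d := m.*2.+1.
Hypotheses (hP : homog d P) (hh : harm P) (n0 : (0 < n)%N).
Local Notation nm := (@hr_enorm R n).
Local Notation F := (@cutp R n (pol R n m)).
Implicit Types (f g : V -> R).

Let od : odd d. Proof. by rewrite /= odd_double. Qed.
Let rF : rapid F. Proof. apply: rapid_cutp; exact: pol1. Qed.

Definition shellI g (k : nat) : R := \int[mu]_y (ind R (`|nm y - 1| < (2 ^+ k)^-1) * `|g y|).

Lemma measurable_shell (a : R) : measurable_fun setT (fun y : V => ind R (`|nm y - 1| < a)).
Proof.
apply: measurable_ind_lt => //; apply: measurableT_comp => //.
by apply: measurable_funB => //; exact: measurable_hr_enorm.
Qed.

Lemma rapid_shell (a : R) : rapid (fun y : V => ind R (`|nm y - 1| < a)).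
Proof.
apply: (@rapid_le R n _ (fun y => ind R (nm y < a + 1))); first exact: measurable_shell.
  exact: rapid_oball.
move=> y; rewrite !ind_norm /ind; case: ltP => h; last by case: ifP.
by move: h; rewrite ltr_norml => /andP[_ h]; rewrite (_ : nm y < a + 1)//; lra.
Qed.

Lemma intble_shell (a : R) g : L2 mu g -> intble mu (fun y => ind R (`|nm y - 1| < a) * `|g y|).
Proof. by move=> Lg; apply: L2M (L2_norm Lg); apply: rapid_L2; exact: rapid_shell. Qed.

Lemma shellI_ge0 g k : 0 <= shellI g k.
Proof. by apply: Rint_ge0 => y; rewrite mulr_ge0 ?ind_ge0. Qed.

(** Let t^2 = s + xi^2. For t >= 1 the Gaussian bound gives N t^(-2). For t < 1 the part |y| >= 2 is
    Gaussian again, and on |y| < 2 the kernel is O(1 / max(t, | |y| - 1 |)), which is expanded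
    dyadically; as xi <= t, the k-th term is present only for xi < 2^(-k). *)
Lemma pairPsi_le : exists2 C, 0 <= C & forall g N, L2 mu g -> maxbd g N -> forall (s : R) K, 0 < s ->
  (2 ^+ K)^-1 <= Num.sqrt s -> forall xi, 0 < xi ->
  `|pairPsi m g (s + xi ^+ 2)| <=
  C * (N * (1 + xi) ^- 2 + \sum_(k < K) 2 ^+ k * ind R (xi < (2 ^+ k)^-1) * shellI g k).
Proof.
have p1 := pol1 R n m.
have [C1 C10 h1] := @conv_H1_cutp_le R n _ p1.
have [C2 C20 h2] := @conv_H1_cutp_large R n _ p1.
have [C3 C30 h3] := @conv_H1_cutp_small R n _ p1.
have q4 : 0 < 4^-1 :> R by rewrite invr_gt0.
have q16 : 0 < 16^-1 :> R by rewrite invr_gt0.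
have [G1 G10 g1] := @maxbd_gauss R n _ q4; have [G2 G20 g2] := @maxbd_gauss R n _ q16.
(* The first summand serves t >= 1. For t < 1 one has xi <= 1, so N is at most 4 N (1 + xi)^(-2);
   this is the factor 4 of the second. *)
exists (4 * C2 * G1 + (4 * (C3 * G2 + C1 * 2 ^+ n) + C1)) => [|g N Lg hg s K s0 hK xi x0].
  by rewrite !addr_ge0 ?mulr_ge0 ?addr_ge0 ?mulr_ge0 ?exprn_ge0.
have N0 := maxbd_ge0 hg.
have S0 : 0 <= \sum_(k < K) 2 ^+ k * ind R (xi < (2 ^+ k)^-1) * shellI g k.
  by apply: sumr_ge0 => k _; rewrite mulr_ge0 ?shellI_ge0// mulr_ge0 ?ind_ge0// exprn_ge0.
set Sg := \sum_(k < K) _ in S0 *.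
pose t := Num.sqrt (s + xi ^+ 2).
have v0 : 0 < s + xi ^+ 2 by rewrite ltr_pwDl// sqr_ge0.
have t0 : 0 < t by rewrite sqrtr_gt0.
have tE : t ^+ 2 = s + xi ^+ 2 by rewrite sqr_sqrtr// ltW.
have x2 := sqr_ge0 xi.
have xt : xi <= t by rewrite -[leLHS]ger0_norm ?(ltW x0)// -sqrtr_sqr ler_wsqrtr// lerDr ltW.
have st : Num.sqrt s <= t by rewrite ler_wsqrtr// lerDl.
have rH := rapid_H n 1 v0.
have Lc : L2 mu (conv (H 1 (t ^+ 2)) F) by rewrite tE; apply: conv_L2 rH (rapid_L2 rF).
have igc : intble mu (fun y => g y * conv (H 1 (t ^+ 2)) F y) by exact: L2M.
have E : pairPsi m g (s + xi ^+ 2) = \int[mu]_y (g y * conv (H 1 (t ^+ 2)) F y).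
  by rewrite /pairPsi tE (conv_H_adj 1 v0 Lg (rapid_L2 rF)).
have i0 : 0 <= (1 + xi) ^- 2 by rewrite invr_ge0 exprn_ge0// addr_ge0// ltW.
have A1 : 0 <= 4 * C2 * G1 by rewrite !mulr_ge0.
have A2 : 0 <= C3 * G2 + C1 * 2 ^+ n by rewrite addr_ge0 ?mulr_ge0// exprn_ge0.
have xp : 0 < (1 + xi) ^+ 2 by rewrite exprn_gt0// addr_gt0.
have NX : 0 <= N * (1 + xi) ^- 2 by rewrite mulr_ge0.
rewrite E; case: (leP 1 t) => t1.
  have [ig hgg] := g1 g N Lg hg t t0.
  have B : `|\int[mu]_y (g y * conv (H 1 (t ^+ 2)) F y)| <= C2 * (t ^+ n.+2)^-1 * (G1 * N * t ^+ n).
    apply: (@le_trans _ _ (C2 * (t ^+ n.+2)^-1 * \int[mu]_y (expR (- (4^-1 * (sqn y / t ^+ 2))) * `|g y|))).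
      rewrite -RintZ//; apply: Rint_norm_le => //; first exact: intbleZ.
      by move=> y; rewrite normrM mulrC mulrA ler_wpM2r//; exact: h2.
    by rewrite ler_wpM2l// mulr_ge0// invr_ge0 exprn_ge0// ltW.
  apply: le_trans B _.
  have -> : C2 * (t ^+ n.+2)^-1 * (G1 * N * t ^+ n) = C2 * G1 * N * (t ^+ 2)^-1.
    have h := expf_neq0 n (lt0r_neq0 t0); rewrite (_ : t ^+ n.+2 = t ^+ n * t ^+ 2); last by rewrite -exprD addn2.
    by field; rewrite h lt0r_neq0.
  have t2 : 0 < t ^+ 2 by rewrite exprn_gt0.
  have h4 : (t ^+ 2)^-1 <= 4 * (1 + xi) ^- 2.
    rewrite -[leLHS]mul1r ler_pdivrMr// mulrAC ler_pdivlMr// mul1r tE.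
    have : 1 <= t ^+ 2 by rewrite exprn_ege1.
    by rewrite tE; have := sqr_ge0 (1 - xi); rewrite !expr2; nra.
  apply: (@le_trans _ _ (C2 * G1 * N * (4 * (1 + xi) ^- 2))); first by rewrite ler_wpM2l ?mulr_ge0.
  have -> : C2 * G1 * N * (4 * (1 + xi) ^- 2) = 4 * C2 * G1 * (N * (1 + xi) ^- 2) by ring.
  apply: ler_pM => //; first by rewrite lerDl addr_ge0// mulr_ge0.
  by rewrite lerDl.
have [ig2 hg2] := g2 g N Lg hg 1 ltr01; rewrite (expr1n _ n) mulr1 in hg2.
have [hb _] := hg 1 ltr01; have hb2 := hb 2 (ltac:(by [])).
have Lng := L2_norm Lg.
have igb : intble mu (fun y => ind R (nm y < 2) * `|g y|) by exact: intble_ball.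
pose D y := C3 * (expR (- (16^-1 * (sqn y / 1 ^+ 2))) * `|g y|) + C1 * (ind R (nm y < 2) * `|g y|) +
  C1 * \sum_(k < K) 2 ^+ k * ind R (xi < (2 ^+ k)^-1) * (ind R (`|nm y - 1| < (2 ^+ k)^-1) * `|g y|).
have iS : intble mu (fun y => \sum_(k < K) 2 ^+ k * ind R (xi < (2 ^+ k)^-1) * (ind R (`|nm y - 1| < (2 ^+ k)^-1) * `|g y|)).
  by apply: intble_sum => k; apply: intbleZ; exact: intble_shell.
have iD : intble mu D.
  by apply: intbleD; [apply: intbleD; exact: intbleZ|exact: intbleZ].
have B : `|\int[mu]_y (g y * conv (H 1 (t ^+ 2)) F y)| <= \int[mu]_y D y.
  apply: Rint_norm_le => // y; rewrite normrM mulrC.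
  have G0 : 0 <= `|g y| by [].
  have e0 : 0 <= C3 * (expR (- (16^-1 * (sqn y / 1 ^+ 2))) * `|g y|) by rewrite mulr_ge0// mulr_ge0// expR_ge0.
  have s1 : 0 <= \sum_(k < K) 2 ^+ k * ind R (xi < (2 ^+ k)^-1) * (ind R (`|nm y - 1| < (2 ^+ k)^-1) * `|g y|).
    by apply: sumr_ge0 => k _; rewrite !mulr_ge0 ?ind_ge0// exprn_ge0.
  have Cs1 := mulr_ge0 C10 s1.
  have b0 : 0 <= C1 * (ind R (nm y < 2) * `|g y|) by rewrite mulr_ge0// mulr_ge0 ?ind_ge0.
  case: (ltP (nm y) 2) => y2; last first.
    apply: (@le_trans _ _ (C3 * (expR (- (16^-1 * (sqn y / 1 ^+ 2))) * `|g y|))); last by rewrite /D; lra.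
    rewrite mulrA ler_wpM2r// expr1n divr1; exact: h3 (ltW t1) y2.
  apply: (@le_trans _ _ (C1 * (ind R (nm y < 2) * `|g y|) + C1 * \sum_(k < K) 2 ^+ k * ind R (xi < (2 ^+ k)^-1) * (ind R (`|nm y - 1| < (2 ^+ k)^-1) * `|g y|))); last by rewrite /D; lra.
  rewrite -mulrDr {1}/ind y2 mul1r.
  have -> : `|g y| + \sum_(k < K) 2 ^+ k * ind R (xi < (2 ^+ k)^-1) * (ind R (`|nm y - 1| < (2 ^+ k)^-1) * `|g y|) =
     (1 + \sum_(k < K) 2 ^+ k * (ind R (xi < (2 ^+ k)^-1) * ind R (`|nm y - 1| < (2 ^+ k)^-1))) * `|g y|.
    by rewrite mulrDl mul1r mulr_suml; congr (_ + _); apply: eq_bigr => k _; rewrite !mulrA.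
  rewrite mulrA ler_wpM2r//.
  have [a1 a2] := h1 t y t0.
  (* Both bounds of [conv_H1_cutp_le] at once: [v] times the kernel is at most C1, and v >= t >=
     2^(-K). *)
  pose v := Num.max t `|nm y - 1|.
  have vt : t <= v by rewrite le_max lexx.
  have vr : `|nm y - 1| <= v by rewrite le_max lexx orbT.
  have vp : 0 < v by exact: lt_le_trans vt.
  have a3 : v * `|conv (H 1 (t ^+ 2)) F y| <= C1 by rewrite /v; case: (leP t `|nm y - 1|).
  apply: (@le_trans _ _ (C1 * v^-1)); first by rewrite ler_pdivlMr// mulrC.
  rewrite ler_wpM2l//; apply: le_trans (@dyadic_inv R K v _) _; first exact: le_trans hK (le_trans st vt).
  rewrite lerD2l; apply: ler_sum => k _; rewrite ler_wpM2l ?exprn_ge0//.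
  rewrite /ind; case: (ltP v) => hv; last by rewrite mulr_ge0// -/(ind _ _) ind_ge0.
  by rewrite (le_lt_trans (le_trans xt vt) hv) (le_lt_trans vr hv) mulr1.
apply: le_trans B _.
have -> : \int[mu]_y D y = C3 * \int[mu]_y (expR (- (16^-1 * (sqn y / 1 ^+ 2))) * `|g y|) +
    C1 * \int[mu]_y (ind R (nm y < 2) * `|g y|) + C1 * Sg.
  rewrite RintD; [|apply: intbleD; exact: intbleZ|exact: intbleZ].
  rewrite RintD; [|exact: intbleZ|exact: intbleZ].
  rewrite (RintZ _ ig2) (RintZ _ igb) (RintZ _ iS); congr (_ + _ * _).
  rewrite Rint_sum; last by move=> k; apply: intbleZ; exact: intble_shell.
  by apply: eq_bigr => k _; rewrite RintZ//; exact: intble_shell.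
have hb3 : \int[mu]_y (ind R (nm y < 2) * `|g y|) <= N * 2 ^+ n.
  apply: le_trans hb2; rewrite le_eqVlt; apply/orP; left; apply/eqP.
  by apply: Rint_eq => y; rewrite scale1r.
have N4 : N <= 4 * (N * (1 + xi) ^- 2).
  rewrite mulrCA ler_peMr// ler_pdivlMr// mul1r.
  have : 1 + xi <= 2 by lra.
  by move=> h; rewrite (_ : 4 = 2 ^+ 2 :> R) ?expr2; [rewrite -expr2 lerXn2r ?nnegrE//; lra|lra].
have T1 : C3 * \int[mu]_y (expR (- (16^-1 * (sqn y / 1 ^+ 2))) * `|g y|) <= C3 * (G2 * N) by rewrite ler_wpM2l.
have T2 : C1 * \int[mu]_y (ind R (nm y < 2) * `|g y|) <= C1 * (N * 2 ^+ n) by rewrite ler_wpM2l.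
have T3 := ler_wpM2l A2 N4.
have T4 : 0 <= 4 * C2 * G1 * (N * (1 + xi) ^- 2 + Sg) by rewrite mulr_ge0// addr_ge0.
have T5 : 0 <= C1 * (N * (1 + xi) ^- 2) by rewrite mulr_ge0.
have T6 : 0 <= 4 * (C3 * G2 + C1 * 2 ^+ n) * Sg by rewrite !mulr_ge0.
move: T1 T2 T3 T4 T5 T6; set X := Rintegral _ _ _; set Y := Rintegral _ _ _; set W := N * _ ^- 2.
by move: X Y W (2 ^+ n : R) => X Y W c; lra.
Qed.

(** Integrating 2^k over 0 < xi < 2^(-k) gives 1, so the shells appear with equal weights, in the
    very sum that [maxbd] bounds independently of the number of terms and hence of [s]. *)
Lemma pairPsi_int_le : exists2 C, 0 <= C & forall g N, L2 mu g -> maxbd g N -> forall (s : R), 0 < s ->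
  intble lam (fun xi => ind R (0 < xi) * pairPsi m g (s + xi ^+ 2)) ->
  `|\int[lam]_xi (ind R (0 < xi) * pairPsi m g (s + xi ^+ 2))| <= C * N.
Proof.
have [C C0 hC] := pairPsi_le.
pose I := \int[lam]_xi (ind R (0 < xi) * (1 + xi) ^- 2).
have I0 : 0 <= I.
  apply: Rint_ge0 => r; rewrite /ind; case: ifP => r0; last by rewrite mul0r.
  by rewrite mul1r invr_ge0 exprn_ge0// addr_ge0// ltW.
exists (C * (I + 1)) => [|g N Lg hg s s0 ii]; first by rewrite mulr_ge0// addr_ge0.
have N0 := maxbd_ge0 hg.
have [K hK] : exists K, (2 ^+ K)^-1 <= Num.sqrt s.
  have ss : 0 < Num.sqrt s by rewrite sqrtr_gt0.
  pose K := (Num.truncn (Num.sqrt s)^-1).+1; exists K.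
  rewrite -[leRHS]invrK lef_pV2 ?posrE ?exprn_gt0 ?invr_gt0//.
  have h1 : (Num.sqrt s)^-1 < K%:R by exact: truncnS_gt.
  apply: ltW; apply: lt_trans h1 _; rewrite -natrX ltr_nat; exact: ltn_expl.
have p k : (0 : R) < (2 ^+ k)^-1 by rewrite invr_gt0 exprn_gt0.
pose D xi := C * (N * (ind R (0 < xi) * (1 + xi) ^- 2) + \sum_(k < K) 2 ^+ k * shellI g k * seg 0 (2 ^+ k)^-1 xi).
have iS : intble lam (fun xi => \sum_(k < K) 2 ^+ k * shellI g k * seg 0 (2 ^+ k)^-1 xi).
  by apply: intble_sum => k; apply: intbleZ; exact: (seg_intble (p k)).1.
have i1 : intble lam (fun xi => N * (ind R (0 < xi) * (1 + xi) ^- 2)) by apply: intbleZ; exact: half_inv2.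
have iD : intble lam D by apply: intbleZ; exact: intbleD.
apply: (@le_trans _ _ (\int[lam]_xi D xi)).
  apply: Rint_norm_le => // xi; rewrite normrM ind_norm /D.
  case x0 : (0 < xi); last first.
    rewrite /ind mul0r mul0r mulr0 add0r mulr_ge0// sumr_ge0// => k _.
    by rewrite mulr_ge0 ?seg_ge0// mulr_ge0 ?shellI_ge0// exprn_ge0.
  have h := hC g N Lg hg s K s0 hK xi x0; rewrite (_ : ind R true = 1)// mul1r mul1r.
  apply: le_trans h _; rewrite le_eqVlt; apply/orP; left; apply/eqP; congr (C * (_ + _)).
  by apply: eq_bigr => k _; rewrite /seg x0/=; ring.
rewrite RintZ; last exact: intbleD.
rewrite -mulrA ler_wpM2l// RintD// RintZ; last exact: half_inv2.
rewrite mulrDl mul1r lerD//; first by rewrite mulrC.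
rewrite Rint_sum; last by move=> k; apply: intbleZ; exact: (seg_intble (p k)).1.
have [_ /(_ K)] := hg 1 ltr01; apply: le_trans; apply: ler_sum => k _.
rewrite RintZ ?(seg_intble (p k)).2; last exact: (seg_intble (p k)).1.
rewrite subr0 mulrAC mulfV ?mul1r ?expf_neq0// /shellI le_eqVlt; apply/orP; left; apply/eqP.
by apply: Rint_eq => y; rewrite scale1r.
Qed.

(** [pairPsi_int] bounds the pairing of the ball with H_0(s) * f uniformly in s. As s tends to 0
    this tends to gam times the pairing with [f], since [bP] is discontinuous at most on the sphere,
    a null set. *)
Lemma bP_bound : exists2 C, 0 <= C & forall f g N, riesz_pair m P f g -> maxbd g N ->
  `|\int[mu]_x (bP P x * f x)| <= C * N.
Proof.
have [C C0 hC] := pairPsi_int_le.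
have c0 : 0 < cK R (d + n).+1 by apply: cK_gt0.
have k0 : 0 < gam * polarC R m by rewrite mulr_gt0 ?gam_gt0 ?polarC_gt0.
have G0 := gam_gt0 R n.
exists (cK R (d + n).+1 * C / (gam * polarC R m) / gam) => [|f g N hfg hg].
  by rewrite divr_ge0 ?(ltW G0)// divr_ge0 ?(ltW k0)// mulr_ge0// ltW.
have Lg := riesz_L2 hP hh n0 hfg.
have [Lf mg fg] := hfg.
have fg1 : {ae mu, forall x, Td d P j.+1%:R^-1 f x @[j --> \oo] --> g x}.
  by have := fg 1 ltr01; apply: filterS => x; under eq_fun do rewrite mul1r.
have B (s : R) : 0 < s -> `|\int[mu]_x (bP P x * conv (H 0 s) f x)| <= cK R (d + n).+1 * C / (gam * polarC R m) * N.
  move=> s0; have [ii E] := pairPsi_int hP hh n0 Lf mg fg1 s0.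
  rewrite mulrAC ler_pdivlMr// mulrC.
  have -> : gam * polarC R m * `|\int[mu]_x (bP P x * conv (H 0 s) f x)| =
      `|- (gam * polarC R m) * \int[mu]_x (bP P x * conv (H 0 s) f x)|.
    by rewrite normrM normrN (gtr0_norm k0).
  by rewrite -E normrM (gtr0_norm c0) -mulrA ler_wpM2l ?(ltW c0)//; exact: hC.
pose r j : R := j.+1%:R^-1.
have r01 j : 0 < r j <= 1 by rewrite /r invr_gt0 ltr0n/= invf_le1 ?ltr0n// ler1n.
have rc : r j @[j --> \oo] --> (0 : R) by exact: cvg_harmonic.
have sc j (y : V) : H 0 (r j ^+ 2) y = (r j ^+ n)^-1 * H 0 1 ((r j)^-1 *: y).
  have /andP[r0 _] := r01 j.
  have := @Q_scale R n 1 0 0 (r j) 1 ((r j)^-1 *: y) (@homog1 R n) r0 ltr01.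
  by rewrite !QH mulr1 scalerA mulfV ?lt0r_neq0// scale1r addn0 add0n.
have L := approx_identity (rapid_H n 0 (@ltr01 R)) sc Lf (rapid_bP hP) _ r01.
have H1 : \int[mu]_y H 0 1 y = gam.
  rewrite -(Rint_H0 n (@ltr01 R)); apply: Rint_eq => y; rewrite ger0_norm// HE psi0.
  by rewrite mulr_ge0 ?expR_ge0// invr_ge0 exprn_ge0// sqrtr_ge0.
have L1 : {ae mu, forall y, forall z, bP P (y + r j *: z) @[j --> \oo] --> bP P y}.
  by apply: filterS (@ae_off_sphere R n) => y y1 z; exact: line_bP.
have := L L1; rewrite H1 => L2.
have L3 := @cvg_norm _ _ _ _ _ _ _ L2.
have : `|gam * \int[mu]_x (bP P x * f x)| <= cK R (d + n).+1 * C / (gam * polarC R m) * N.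
  apply: (cvgr_to_le (L3 _)).
  by apply: nearW => j; apply: B; have /andP[r0 _] := r01 j; rewrite exprn_gt0.
rewrite normrM (gtr0_norm G0) => h.
by rewrite [leRHS]mulrAC ler_pdivlMr// mulrC.
Qed.

(** [maxbd] is invariant under dilation; the Jacobian contributes r^n and the homogeneity of P
    contributes r^d. *)
Lemma ball_pairing_bound : exists2 C, 0 <= C & forall f g N, riesz_pair m P f g -> maxbd g N ->
  forall r, 0 < r -> `|\int[mu]_y (ind R (nm y < r) * (ev P y * f y))| <= C * N * r ^+ (n + d).
Proof.
have [C C0 hC] := bP_bound; exists C => // f g N hfg hg r r0.
have := hC _ _ N (riesz_dil hP n0 r0 hfg) (maxbd_dil r0 hg) => h.
have [Lf _ _] := hfg; have rn := lt0r_neq0 r0.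
have ii : intble mu (fun y => ind R (nm y < r) * (ev P y * f y)).
  have rb : rapid (fun y => ind R (nm y < r) * ev P y).
    apply: (@rapid_le R n _ (fun y => polyC P * r ^+ d * ind R (nm y < r))).
    - apply: measurable_funM; last exact: measurable_ev.
      by apply: measurable_ind_lt => //; exact: measurable_hr_enorm.
    - by apply: rapidZ; exact: rapid_oball.
    - move=> y; have pr : 0 <= polyC P * r ^+ d by rewrite mulr_ge0 ?polyC_ge0// exprn_ge0// ltW.
      rewrite normrM [leRHS]normrM !ind_norm (ger0_norm pr) /ind; case: ifP => yr; last by rewrite mul0r mulr0.
      rewrite mul1r mulr1; apply: le_trans (ev_bound y hP) _; rewrite ler_wpM2l ?polyC_ge0//.
      by rewrite lerXn2r ?nnegrE ?hr_enorm_ge0 ?(ltW r0)// ltW.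
  by have := L2M (rapid_L2 rb) Lf; congr intble; apply/funext => y; rewrite mulrA.
rewrite (Rint_affine 0 rn ii) (gtr0_norm r0) normrM (ger0_norm (exprn_ge0 _ (ltW r0))).
rewrite exprD mulrCA ler_wpM2l ?exprn_ge0 ?(ltW r0)//.
have E : \int[mu]_y (ind R (nm (0 + r *: y) < r) * (ev P (0 + r *: y) * f (0 + r *: y))) =
    r ^+ d * \int[mu]_x (bP P x * f (r *: x)).
  rewrite -RintZ; last by apply: L2M (rapid_L2 (rapid_bP hP)) _; exact: L2_dil.
  apply: Rint_eq => y; rewrite add0r hr_enormZ (gtr0_norm r0) (evZ _ _ hP) /bP.
  by rewrite -{2}[r]mulr1 ltr_pM2l//; ring.
rewrite E normrM (ger0_norm (exprn_ge0 _ (ltW r0))).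
by rewrite mulrC ler_wpM2r ?exprn_ge0 ?(ltW r0).
Qed.

End pairing_bound.

(** * From balls to truncations *)

Section profile_layers.
Variables (R : realType) (N : nat).
Local Notation lam := (@lebesgue_measure R).
Hypothesis N2 : (2 <= N)%N.

Let N22 : (2 <= N.+2)%N. Proof. by []. Qed.

(** Minus the derivative in r of the error profile [eK N 1] at r^2, away from its jump. The index
    grows by 2 because differentiating e^(-u/t^2) in u produces t^(-2). *)
Definition wK (r : R) : R := ind R (0 < r) * (2 * r * eK N.+2 1 (r ^+ 2)).

Lemma measurable_wK : measurable_fun setT wK.
Proof.
apply: measurable_funM; first exact: measurable_ind_lt.
apply: measurable_funM; first exact: measurable_funM.
by apply: measurableT_comp (@measurable_eK R N.+2 1) _; exact: measurable_funX.
Qed.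

Lemma wK_bound : exists2 W, 0 <= W & forall r, 0 < r -> `|wK r| <= W * expR (- (1 * r)).
Proof.
have [C C0 hC] := @eK1_bound R N.+2 N22.
have h2 : 0 < 2^-1 :> R by rewrite invr_gt0.
have [W W0 hW] := gauss_poly_exp (2%:P * 'X) h2.
exists (C * W) => [|r r0]; first exact: mulr_ge0.
have rr : 0 < r ^+ 2 by rewrite exprn_gt0.
have := hW r (ltW r0); rewrite hornerM hornerC hornerX => h.
rewrite /wK /ind r0 mul1r normrM; apply: le_trans (ler_wpM2l (normr_ge0 _) (hC _ rr)) _.
rewrite mulrCA -[leRHS]mulrA ler_wpM2l//; apply: le_trans h.
by rewrite ler_wpM2l// ler_expR mulrC.
Qed.

Lemma kE_layer (t c : R) : 0 < t -> 0 <= c ->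
  intble lam (fun r => ind R (c < r) * (2 * r * kE N.+2 t (r ^+ 2))) /\
  \int[lam]_r (ind R (c < r) * (2 * r * kE N.+2 t (r ^+ 2))) = kE N t (c ^+ 2).
Proof.
move=> t0 c0; have t2 : 0 < (t ^+ 2)^-1 by rewrite invr_gt0 exprn_gt0.
pose p : {poly R} := (2 * (t ^+ 2)^-1)%:P * 'X * 1 - 1^`().
have E r : ind R (c < r) * (2 * r * kE N.+2 t (r ^+ 2)) =
    (t ^+ N)^-1 * (ind R (c < r) * (p.[r] * expR (- ((t ^+ 2)^-1 * r ^+ 2)))).
  rewrite /p hornerD hornerN !hornerM !hornerC hornerX derivC horner0 subr0 /kE mulrC.
  rewrite (_ : t ^+ N.+2 = t ^+ N * t ^+ 2); last by rewrite -exprD addn2.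
  by rewrite invfM [r ^+ 2 / _]mulrC; ring.
have i := gauss_poly_intble p t2 c0; rewrite (funext E); split; first exact: intbleZ.
by rewrite RintZ// gauss_tail// hornerC mul1r /kE [_ / t ^+ 2]mulrC.
Qed.

(** At rho = 1 the profile jumps by [cK], from minus the scales t > 1 to plus the scales t <= 1.
    Removing the jump, a multiple of the ball indicator, leaves a continuous function that is the
    tail integral of [wK]. *)
Lemma eK_layer (rho : R) : 0 < rho -> rho != 1 ->
  eK N 1 (rho ^+ 2) = \int[lam]_r (ind R (rho < r) * wK r) - cK R N * ind R (rho < 1).
Proof.
move=> rho0 rho1; pose M := Num.max rho 1.
have M0 : 0 <= M by rewrite le_max (ltW rho0).
have Mr : rho <= M by rewrite le_max lexx.
have M1 : 1 <= M by rewrite le_max lexx orbT.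
(* Both branches of [eK] in one formula: for r > M the scales t <= 1 count with sign +, and for rho
   < r <= M, which forces M = 1, the scales t > 1 count with sign -. *)
pose F (r t : R) := ind R (0 < t) * ((ind R (M < r) - ind R (1 < t) * ind R (rho < r)) * (2 * r * kE N.+2 t (r ^+ 2))).
have mF : measurable_fun setT (fun z : measurableTypeR R * measurableTypeR R => F z.1 z.2).
  have m1 := @measurable_fst _ _ (measurableTypeR R) (measurableTypeR R).
  have m2 := @measurable_snd _ _ (measurableTypeR R) (measurableTypeR R).
  apply: measurable_funM; first exact: measurable_ind_lt.
  apply: measurable_funM.
    apply: measurable_funB; first exact: measurable_ind_lt.
    by apply: measurable_funM; exact: measurable_ind_lt.
  apply: measurable_funM; first exact: measurable_funM.
  by apply: measurable_kE => //; exact: measurable_funX.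
(* For fixed [r] the integrand has constant sign, so its absolute integral is at most |wK r| and
   Fubini applies. *)
have sgF r : exists2 s : R, `|s| <= 1 & forall t, `|F r t| = s * F r t.
  case: (ltP M r) => Mr1.
    exists 1; first by rewrite normr1.
    have rr : rho < r by exact: le_lt_trans Mr1.
    move=> t; rewrite mul1r ger0_norm// /F {1}/ind; case: ifP => t0; last by rewrite mul0r.
    rewrite mul1r mulr_ge0//; first by rewrite /ind Mr1 rr mulr1; case: ifP; rewrite ?subrr ?subr0.
    by rewrite mulr_ge0 ?kE_ge0// mulr_ge0//; exact: ltW (lt_trans rho0 rr).
  exists (-1) => [|t]; first by rewrite normrN1.
  rewrite mulN1r ler0_norm// /F {1}/ind; case: ifP => t0; last by rewrite mul0r.
  rewrite mul1r /ind ltNge Mr1/= sub0r; case: (ltP rho r) => rr; last by rewrite mulr0 oppr0 mul0r.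
  rewrite mulr1 mulNr oppr_le0 mulr_ge0//; first by case: ifP.
  by rewrite mulr_ge0 ?kE_ge0// mulr_ge0//; exact: ltW (lt_trans rho0 rr).
have iFr r : intble lam (F r) /\ \int[lam]_t F r t = ind R (rho < r) * wK r.
  case: (ltP rho r) => rr; last first.
    have E t : F r t = 0 * (ind R (0 < t) * expR (- (1 * t))).
      have e1 : (M < r) = false by apply/negbTE; rewrite -leNgt (le_trans rr).
      have e2 : (rho < r) = false by apply/negbTE; rewrite -leNgt.
      rewrite /F e1 e2 [ind R false]/ind.
      by rewrite mulr0 subr0 !mul0r mulr0.
    rewrite (_ : F r = fun t => 0 * (ind R (0 < t) * expR (- (1 * t)))); last exact/funext.
    by split; [exact: intbleZ (half_exp ltr01).1|rewrite RintZ ?mul0r//; exact: (half_exp ltr01).1].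
  have r0 : 0 < r by exact: lt_trans rr.
  have r2 : 0 < r ^+ 2 by rewrite exprn_gt0.
  have [i1 i2] := @kE_int R N.+2 N22 1 _ r2 ler01.
  rewrite /wK (_ : ind R (0 < r) = 1) /ind ?r0// !mul1r /eK expr1n.
  have -> : (1 < r ^+ 2) = (1 < r) by rewrite -[X in X < _](expr1n R 2) ltr_sqr ?nnegrE ?(ltW r0).
  case: (ltP 1 r) => r1.
    have E t : F r t = 2 * r * (ind R (0 < t) * (ind R (t <= 1) * kE N.+2 t (r ^+ 2))).
      rewrite /F /ind (_ : M < r); last by rewrite gt_max rr r1.
      rewrite rr mulr1 [t <= 1]leNgt; case: (1 < t) => /=; ring.
    by rewrite (funext E); split; [exact: intbleZ|rewrite RintZ].
  have E t : F r t = - (2 * r) * (ind R (0 < t) * (ind R (1 < t) * kE N.+2 t (r ^+ 2))).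
    rewrite /F /ind rr (_ : (M < r) = false); last by apply/negbTE; rewrite -leNgt (le_trans r1).
    by case: (1 < t); ring.
  by rewrite (funext E); split; [exact: intbleZ|rewrite RintZ// mulrN mulNr].
have [W W0 hW] := wK_bound.
have Ffin : (\int[lam]_r \int[lam]_t (`|F r t|)%:E < +oo)%E.
  apply: (@iterated_lty _ _ _ _ _ lam lam F (fun r => W * (ind R (0 < r) * expR (- (1 * r))))) => //.
  - exact: intbleZ (half_exp ltr01).1.
  - by move=> r; exact: (iFr r).1.
  - move=> r; have [s s1 hs] := sgF r; have [i e] := iFr r.
    rewrite (@Rint_eq _ (measurableTypeR R) R lam _ (fun t : R => s * F r t)); last exact: hs.
    rewrite RintZ// e; apply: le_trans (ler_norm _) _; rewrite normrM.
    apply: (@le_trans _ _ `|ind R (rho < r) * wK r|); first by rewrite ler_piMl.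
    rewrite normrM ind_norm /ind; case: ltP => rr.
      have r0 : 0 < r by exact: lt_trans rr.
      by rewrite r0 [leLHS]mul1r; apply: le_trans (hW _ r0) _; rewrite [X in _ <= W * X]mul1r.
    by rewrite mul0r mulr_ge0// mulr_ge0 ?expR_ge0//; case: ifP.
rewrite (@Rint_eq _ (measurableTypeR R) R lam _ (fun r : R => \int[lam]_t F r t)); last by move=> r; rewrite (iFr r).2.
rewrite (Rfubini mF Ffin).
have rr2 : 0 < rho ^+ 2 by rewrite exprn_gt0.
have MM2 : 0 < M ^+ 2 by rewrite exprn_gt0// (lt_le_trans rho0).
have [i1 i2] := @kE_int R N N2 1 _ rr2 ler01.
have iM := @kE_int_all R N N2 _ MM2.
have -> : \int[lam]_t \int[lam]_r F r t = \int[lam]_t (ind R (0 < t) * kE N t (M ^+ 2)) -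
    \int[lam]_t (ind R (0 < t) * (ind R (1 < t) * kE N t (rho ^+ 2))).
  rewrite -RintB//; apply: Rint_eq => t; case t0 : (0 < t); last first.
    rewrite (@Rint_eq _ (measurableTypeR R) R lam _ (fun r : R => 0 * (ind R (0 < r) * expR (- (1 * r))))).
      by rewrite RintZ ?mul0r ?subrr//; exact: (half_exp ltr01).1.
    by move=> r; rewrite /F t0 !mul0r.
  have [j1 k1] := kE_layer t0 M0; have [j2 k2] := kE_layer t0 (ltW rho0).
  rewrite (@Rint_eq _ (measurableTypeR R) R lam _ (fun r : R => ind R (M < r) * (2 * r * kE N.+2 t (r ^+ 2)) -
     ind R (1 < t) * (ind R (rho < r) * (2 * r * kE N.+2 t (r ^+ 2))))); last first.
    by move=> r; rewrite /F /ind t0; ring.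
  by rewrite RintB//; [rewrite RintZ// k1 k2 /ind !mul1r|exact: intbleZ].
rewrite /eK expr1n -[X in X < rho ^+ 2](expr1n R 2) ltr_sqr ?nnegrE ?(ltW rho0)//.
case: (ltgtP rho 1) rho1 => // r1 _.
  have -> : M = 1 by rewrite /M; apply/max_idPr; exact: ltW.
  by rewrite /ind expr1n -/(cK R N) mulr1; rewrite /cK /ind; ring.
have -> : M = rho by rewrite /M; apply/max_idPl; exact: ltW.
rewrite [ind R false]/ind mulr0 subr0 -RintB//; last exact: kE_int_all.
apply: Rint_eq => t; rewrite [t <= 1]leNgt /ind; case: (1 < t) => /=; ring.
Qed.

End profile_layers.

Section truncation_bound.
Variables (R : realType) (n m : nat) (P : mpoly.mpoly n R).
Local Notation V := 'rV[R]_n.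
Local Notation mu := (lebesgue_rV R n).
Local Notation lam := (@lebesgue_measure R).
Local Notation gam := (gam R n).
Local Notation d := m.*2.+1.
Hypotheses (hP : homog d P) (hh : harm P) (n0 : (0 < n)%N).
Local Notation q k t := (Q P d k t).
Local Notation N_ := (d + n).+1.
Local Notation nm := (@hr_enorm R n).
Implicit Types (f g : V -> R).

Let od : odd d. Proof. by rewrite /= odd_double. Qed.
Let NK2 : (2 <= N_)%N. Proof. by []. Qed.

Definition hf f (y : V) : R := ev P y * f y.

Lemma measurable_hf f : L2 mu f -> measurable_fun setT (hf f).
Proof. by move=> Lf; apply: measurable_funM; [exact: measurable_ev|exact: Lf.1]. Qed.

Lemma hf_ball_le f r y : 0 < r -> `|ind R (nm y < r) * hf f y| <=
  polyC P * r ^+ d * (ind R (nm y < r) + f y ^+ 2).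
Proof.
move=> r0; have pr : 0 <= polyC P * r ^+ d by rewrite mulr_ge0 ?polyC_ge0// exprn_ge0// ltW.
rewrite normrM ind_norm /hf /ind; case: ifP => yr; last first.
  by rewrite mul0r add0r mulr_ge0// sqr_ge0.
rewrite mul1r normrM; apply: ler_pM => //.
  apply: le_trans (ev_bound y hP) _; rewrite ler_wpM2l ?polyC_ge0//.
  by rewrite lerXn2r ?nnegrE ?hr_enorm_ge0 ?(ltW r0)// ltW.
rewrite -(real_normK (num_real (f y))); have := sqr_ge0 (1 - `|f y|); rewrite !expr2; nra.
Qed.

Lemma intble_hf_ball f r : L2 mu f -> 0 < r -> intble mu (fun y => ind R (nm y < r) * hf f y).
Proof.
move=> Lf r0; apply: (@intble_le _ _ _ _ _ (fun y => polyC P * r ^+ d * (ind R (nm y < r) + f y ^+ 2))).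
- apply: measurable_funM; last exact: measurable_hf.
  by apply: measurable_ind_lt => //; exact: measurable_hr_enorm.
- apply: intbleZ; apply: intbleD; last exact: Lf.2.
  by apply: rapid_intble; exact: rapid_oball.
- by move=> y; exact: hf_ball_le.
Qed.

(** A crude bound depending on [f]; it supplies the absolute convergence behind the layer cake and
    leaves no trace in the constants. *)
Lemma hf_ball_growth f : L2 mu f -> exists A, forall r, 0 < r ->
  \int[mu]_y `|ind R (nm y < r) * hf f y| <= A * (1 + r ^+ (n + d)).
Proof.
move=> Lf; pose S := \int[mu]_y (f y ^+ 2).
have S0 : 0 <= S by apply: Rint_ge0 => y; exact: sqr_ge0.
have o0 := omega_ge0 R n.
exists (polyC P * (omega R n + S)) => r r0.
have io : intble mu (fun y : V => ind R (nm y < r)) by apply: rapid_intble; exact: rapid_oball.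
apply: (@le_trans _ _ (\int[mu]_y (polyC P * r ^+ d * (ind R (nm y < r) + f y ^+ 2)))).
  apply: Rint_le; first by apply: intble_norm; exact: intble_hf_ball.
    by apply: intbleZ; apply: intbleD => //; exact: Lf.2.
  by move=> y; exact: hf_ball_le.
rewrite RintZ; last by apply: intbleD => //; exact: Lf.2.
rewrite RintD//; last exact: Lf.2.
rewrite Rint_ball// -/S -!mulrA ler_wpM2l ?polyC_ge0//.
have rd : r ^+ d <= 1 + r ^+ (n + d).
  case: (leP r 1) => r1; first by rewrite ler_wpDr ?exprn_ge0 ?(ltW r0)// exprn_ile1// ltW.
  by rewrite ler_wpDl// ler_weXn2l ?(ltW r1)// leq_addl.
have e : r ^+ d * (omega R n * r ^+ n) = omega R n * r ^+ (n + d) by rewrite exprD; ring.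
have := ler_wpM2r S0 rd; rewrite mulrDr e => h.
have := mulr_ge0 o0 (ltW (@ltr01 R)); nra.
Qed.

Lemma hf_layer_bound (w : R -> R) (W : R) : 0 <= W -> measurable_fun setT w ->
  (forall r, 0 < r -> `|w r| <= W * expR (- (1 * r))) ->
  exists2 C, 0 <= C & forall f g N, riesz_pair m P f g -> maxbd g N ->
  intble mu (fun y => hf f y * \int[lam]_r (ind R (nm y < r) * w r)) /\
  `|\int[mu]_y (hf f y * \int[lam]_r (ind R (nm y < r) * w r))| <= C * N.
Proof.
move=> W0 mw hw; have [C C0 hC] := ball_pairing_bound hP hh n0.
pose I := \int[lam]_r (ind R (0 < r) * ((1 + r ^+ (n + d)) * expR (- (1 * r)))).
have I0 : 0 <= I.
  apply: Rint_ge0 => r; rewrite /ind; case: ifP => r0; last by rewrite mul0r.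
  by rewrite mul1r mulr_ge0 ?expR_ge0// addr_ge0// exprn_ge0// ltW.
exists (W * C * I) => [|f g N hfg hg]; first by rewrite !mulr_ge0.
have [Lf _ _] := hfg; have N0 := maxbd_ge0 hg.
have [A hA] := hf_ball_growth Lf.
have ih r (r0 : 0 < r) := intble_hf_ball Lf r0.
split; first exact: (layer_cake (measurable_hf Lf) mw ltr01 hw ih hA).1.
have := layer_bound (measurable_hf Lf) mw ltr01 hw ih hA (mulr_ge0 C0 N0) (fun r r0 => hC f g N hfg hg r r0).
by move=> h; apply: le_trans h _; rewrite -/I le_eqVlt; apply/orP; left; apply/eqP; ring.
Qed.

(** At scale 1 the profile of Q_k is a polynomial in |y|^2 times a Gaussian, hence a superposition
    of balls by [gauss_tail]. Other scales follow by dilating [f] and [g] together. *)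
Lemma conv_Q0_bound k : exists2 C, 0 <= C & forall f g N, riesz_pair m P f g -> maxbd g N ->
  forall th, 0 < th -> `|conv (q k (th ^+ 2)) f 0| <= C * N / th ^+ (d + k.*2).
Proof.
pose p : {poly R} := lag R (d.*2 + n) k \Po 'X^2.
pose wp : {poly R} := (2 * 1)%:P * 'X * p - p^`().
have [W W0 hW] := gauss_poly_exp wp (@ltr01 R).
pose w (r : R) := wp.[r] * expR (- (1 * r ^+ 2)).
have mw : measurable_fun setT w by apply: continuous_measurable_fun; exact: continuous_gauss.
have hw r : 0 < r -> `|w r| <= W * expR (- (1 * r)).
  by move=> r0; rewrite normrM (ger0_norm (expR_ge0 _)); apply: hW; exact: ltW.
have [C C0 hC] := hf_layer_bound W0 mw hw.
exists C => // f g N hfg hg th th0; have thn := lt0r_neq0 th0.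
have [_ h] := hC _ _ N (riesz_dil hP n0 th0 hfg) (maxbd_dil th0 hg).
have [Lf _ _] := hfg; have th20 : 0 < th ^+ 2 by rewrite exprn_gt0.
have rq := rapid_Q k hP th20.
have ii := intble_conv 0 (rapid_L2 rq) Lf.
have E : conv (q k (th ^+ 2)) f 0 = - (th ^+ (d + k.*2))^-1 *
    \int[mu]_y (hf (fun y => f (th *: y)) y * \int[lam]_r (ind R (nm y < r) * w r)).
  rewrite convE (Rint_affine 0 thn ii) gtr0_norm// -RintZ; last exact: (intble_affine 0 thn ii).
  rewrite -RintZ; last exact: (hC _ _ N (riesz_dil hP n0 th0 hfg) (maxbd_dil th0 hg)).1.
  apply: Rint_eq => y.
  have -> : 0 - (0 + th *: y) = th *: (- y) by rewrite !add0r scalerN.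
  rewrite add0r -[X in Q P d k X]mulr1 (Q_scale k _ hP)// (QN _ _ _ hP od) QE.
  rewrite (@gauss_tail R 1 (nm y) p ltr01 (hr_enorm_ge0 y)) mul1r sqr_hr_enorm.
  rewrite /psi sqrtr1 !expr1n invr1 !mul1r mulr1 /p horner_comp hornerXn sqr_hr_enorm /hf.
  have -> : (d + n + k.*2 = n + (d + k.*2))%N by rewrite addnA [(n + d)%N]addnC.
  have h1 := expf_neq0 n thn; have h2 := expf_neq0 (d + k.*2) thn.
  rewrite (exprD th n); field; by rewrite h1 h2.
have pd : 0 < th ^+ (d + k.*2) by rewrite exprn_gt0.
have pi0 : 0 <= (th ^+ (d + k.*2))^-1 by rewrite invr_ge0 ltW.
by rewrite E normrM normrN (ger0_norm pi0) mulrC ler_wpM2r.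
Qed.

(** By [eK_layer] the error kernel is a superposition of balls plus one multiple of the unit ball,
    the latter due to the sharp cut. *)
Lemma conv_Ek_bound : exists2 C, 0 <= C & forall f g N, riesz_pair m P f g -> maxbd g N ->
  `|conv (Ek d P 1) f 0| <= C * N.
Proof.
have [W W0 hW] := @wK_bound R N_.
have [C C0 hC] := hf_layer_bound W0 (@measurable_wK R N_) hW.
have [C' C'0 hC'] := ball_pairing_bound hP hh n0.
have c0 : 0 < cK R N_ by exact: cK_gt0.
exists (C + cK R N_ * C') => [|f g N hfg hg]; first by rewrite addr_ge0 ?mulr_ge0// ltW.
have [Lf _ _] := hfg; have [i1 h1] := hC f g N hfg hg.
have h2 := hC' f g N hfg hg 1 ltr01; rewrite expr1n mulr1 in h2.
have i2 := intble_hf_ball Lf (@ltr01 R).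
have rE := rapid_Ek1 hP od.
have ii := intble_conv 0 (rapid_L2 rE) Lf.
have i3 := intbleZ (cK R N_) i2.
have E : conv (Ek d P 1) f 0 = - (\int[mu]_y (hf f y * \int[lam]_r (ind R (nm y < r) * wK N_ r)) -
    cK R N_ * \int[mu]_y (ind R (nm y < 1) * hf f y)).
  rewrite -(RintZ _ i2) -RintB// -mulN1r -RintZ; last exact: intbleB.
  rewrite convE; apply: Rint_ae_eq; [exact: intble_measurable ii| |].
    exact: intble_measurable (intbleZ (-1) (intbleB i1 i3)).
  apply: filterS (@ae_off_sphere R n) => y y1.
  rewrite sub0r (EkN hP od) /Ek /hf; case: (enorm0_or y) => [->|y0].
    by rewrite (ev00 hP)// !mul0r; ring.
  rewrite -sqr_hr_enorm (@eK_layer R N_ NK2 _ y0 y1).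
  by move: (Rintegral _ _ _) => X; ring.
rewrite E normrN; apply: le_trans (ler_normB _ _) _; rewrite mulrDl; apply: lerD => //.
by rewrite normrM (gtr0_norm c0) -mulrA ler_wpM2l ?(ltW c0).
Qed.

Lemma conv_H0_bound : exists2 C, 0 <= C & forall g N, L2 mu g -> maxbd g N -> `|conv (H 0 1) g 0| <= C * N.
Proof.
have [C C0 hC] := @maxbd_gauss R n 1 ltr01; exists C => // g N Lg hg.
have [i h] := hC g N Lg hg 1 ltr01; rewrite (expr1n _ n) mulr1 in h.
apply: le_trans h; rewrite convE; apply: Rint_norm_le => //.
  exact: intble_conv (rapid_L2 (rapid_H n 0 (@ltr01 R))) Lg.
move=> y; rewrite sub0r HN HE psi0 normrM ler_wpM2r//.
by rewrite sqrtr1 !expr1n invr1 !mul1r !mulr1 ger0_norm ?expR_ge0.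
Qed.

(** Besides the error kernel, the truncation contains the scales t > 1 at time t^2, while inversion
    at s = 1 gives all scales at time 1 + t^2. For t <= 1 the extra terms are bounded; for t > 1 the
    mean value theorem trades the shift in time for one derivative, a gain of t^(-2). The difference
    is integrable in t with a bound proportional to N. *)
Lemma Td_bound : exists2 C, 0 <= C & forall f g N, riesz_pair m P f g -> maxbd g N ->
  `|Td d P 1 f 0| <= C * N.
Proof.
have [CE CE0 hE] := conv_Ek_bound; have [CH CH0 hH] := conv_H0_bound.
have [C0 C00 h0] := conv_Q0_bound 0; have [C1 C10 h1] := conv_Q0_bound 1.
have c0 : 0 < cK R N_ by exact: cK_gt0.
have G0 := gam_gt0 R n.
pose I := \int[lam]_t (ind R (0 < t) * (1 + t) ^- 2).
have I0 : 0 <= I.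
  apply: Rint_ge0 => r; rewrite /ind; case: ifP => r0; last by rewrite mul0r.
  by rewrite mul1r invr_ge0 exprn_ge0// addr_ge0// ltW.
pose D := CE + cK R N_ * CH / gam + 4 * (C0 + C1) * I.
exists (D / cK R N_) => [|f g N hfg hg].
  rewrite divr_ge0 ?(ltW c0)// !addr_ge0// ?divr_ge0 ?mulr_ge0 ?addr_ge0 ?(ltW c0) ?(ltW G0)//.
have [Lf mg fg] := hfg; have Lg := riesz_L2 hP hh n0 hfg; have N0 := maxbd_ge0 hg.
have fg1 : {ae mu, forall x, Td d P j.+1%:R^-1 f x @[j --> \oo] --> g x}.
  by have := fg 1 ltr01; apply: filterS => x; under eq_fun do rewrite mul1r.
have [_ ES] := Td_split hP od n0 0 (@ltr01 R) Lf.
have [iv Ev] := inversion hP hh od n0 Lf mg fg1 0 0 (@ltr01 R).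
rewrite mulrAC ler_pdivlMr// mulrC -{1}(gtr0_norm c0) -normrM ES.
pose A (t : R) := ind R (0 < t) * (t ^+ d.-1 * conv (q 0 (1 + t ^+ 2)) f 0).
pose B (t : R) := ind R (0 < t) * (ind R (1 < t) * (t ^+ d.-1 * conv (q 0 (t ^+ 2)) f 0)).
have mB : measurable_fun setT B.
  apply: measurable_funM; first exact: measurable_ind_lt.
  apply: measurable_funM; first exact: measurable_ind_lt.
  apply: measurable_funM; first exact: measurable_funX.
  have mq := @measurable_convQ2 R n d P 0 f (fun t => t ^+ 2) (measurable_funX 2 (@measurable_id _ _ _)) Lf.1.
  have mp : measurable_fun setT (fun t : measurableTypeR R => (t, 0 : V)) by exact: measurable_fun_pair.
  exact: measurableT_comp mq mp.
have diff t : `|B t - A t| <= 4 * (C0 + C1) * N * (ind R (0 < t) * (1 + t) ^- 2).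
  have CN1 : 0 <= C1 * N by rewrite mulr_ge0.
  have CN0 : 0 <= C0 * N by rewrite mulr_ge0.
  rewrite /A /B; case: (ltP 0 t) => t0; last by rewrite [ind R false]/ind !mul0r subrr normr0 mulr0.
  rewrite [ind R true]/ind !mul1r.
  have p2 : 0 < (1 + t) ^+ 2 by rewrite exprn_gt0// addr_gt0.
  case: (ltP 1 t) => t1; last first.
    rewrite mul0r sub0r normrN.
    have v0 : 0 < 1 + t ^+ 2 by rewrite ltr_pwDl// sqr_ge0.
    have th0 : 0 < Num.sqrt (1 + t ^+ 2) by rewrite sqrtr_gt0.
    have := h0 f g N hfg hg _ th0; rewrite sqr_sqrtr ?(ltW v0)// double0 addn0 => h.
    have th1 : 1 <= Num.sqrt (1 + t ^+ 2) by rewrite -[leLHS]sqrtr1 ler_wsqrtr// lerDl sqr_ge0.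
    have h' : `|conv (q 0 (1 + t ^+ 2)) f 0| <= C0 * N.
      by apply: le_trans h _; rewrite ler_pdivrMr ?exprn_gt0// ler_peMr// exprn_ege1.
    rewrite normrM; apply: (@le_trans _ _ (1 * (C0 * N))).
      by apply: ler_pM => //; rewrite ger0_norm ?exprn_ge0 ?(ltW t0)// exprn_ile1// ?t1 ltW.
    rewrite mul1r; apply: (@le_trans _ _ (4 * (C0 * N) * (1 + t) ^- 2)); last first.
      by rewrite ler_wpM2r ?invr_ge0 ?(ltW p2)//; nra.
    rewrite ler_pdivlMr// [leRHS]mulrC ler_wpM2l//.
    by rewrite (_ : 4 = 2 ^+ 2 :> R) ?lerXn2r ?nnegrE//; [lra|lra|rewrite expr2; lra].
  rewrite mul1r -mulrBr normrM (ger0_norm (exprn_ge0 _ (ltW t0))).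
  pose phi (v : R) := conv (q 0 v) f 0.
  have t20 : 0 < t ^+ 2 by rewrite exprn_gt0.
  have dphi (v : R) : v \in `]t ^+ 2, 1 + t ^+ 2[ -> is_derive v (1 : R) phi (- conv (q 1 v) f 0).
    by rewrite in_itv/= => /andP[v1 _]; apply: is_derive_conv_Q => //; exact: lt_trans v1.
  have cphi : {within `[t ^+ 2, 1 + t ^+ 2], continuous phi}.
    apply: continuous_in_subspaceT => v; rewrite inE/= in_itv/= => /andP[v1 _].
    have v0 : 0 < v by exact: lt_le_trans v1.
    exact: continuous_is_derive (is_derive_conv_Q 0 0 hP Lf v0).
  have le1 : t ^+ 2 <= 1 + t ^+ 2 by rewrite lerDr.
  have [v vI Emv] := MVT_segment le1 dphi cphi.
  rewrite -/(phi (t ^+ 2)) -/(phi (1 + t ^+ 2)) distrC Emv addrK mulr1 normrN.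
  move: vI; rewrite in_itv/= => /andP[v1 _]; have v0 : 0 < v by exact: lt_le_trans v1.
  have sv0 : 0 < Num.sqrt v by rewrite sqrtr_gt0.
  have tv : t <= Num.sqrt v by rewrite -[leLHS]ger0_norm ?(ltW t0)// -sqrtr_sqr ler_wsqrtr.
  have := h1 f g N hfg hg _ sv0; rewrite sqr_sqrtr ?(ltW v0)// => h.
  have h' : `|conv (q 1 v) f 0| <= C1 * N / t ^+ (d + 2).
    by apply: le_trans h _; rewrite ler_wpM2l// lef_pV2 ?posrE ?exprn_gt0// lerXn2r ?nnegrE ?(ltW t0) ?(ltW sv0).
  apply: (@le_trans _ _ (t ^+ d.-1 * (C1 * N / t ^+ (d + 2)))).
    by rewrite ler_wpM2l// exprn_ge0// ltW.
  apply: (@le_trans _ _ (C1 * N * (t ^+ 2)^-1)).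
    have -> : t ^+ (d + 2) = t ^+ d.-1 * t ^+ 2 * t by rewrite -exprD -exprSr; congr (t ^+ _); rewrite /= addSn.
    have a1 : t ^+ d.-1 != 0 by rewrite expf_neq0// lt0r_neq0.
    have -> : t ^+ d.-1 * (C1 * N / (t ^+ d.-1 * t ^+ 2 * t)) = C1 * N * (t ^+ 2)^-1 * t^-1.
      by field; rewrite a1 lt0r_neq0.
    by rewrite ler_piMr ?mulr_ge0 ?invr_ge0 ?(ltW t20)// invf_le1// ltW.
  apply: (@le_trans _ _ (4 * (C1 * N) * (1 + t) ^- 2)); last first.
    by rewrite ler_wpM2r ?invr_ge0 ?(ltW p2)//; nra.
  have -> : 4 * (C1 * N) * (1 + t) ^- 2 = C1 * N * (4 * (1 + t) ^- 2) by ring.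
  rewrite ler_wpM2l// ler_pdivlMr// mulrC ler_pdivrMr//.
  by have := sqr_ge0 (t - 1); rewrite !expr2; nra.
have iA : intble lam A := iv.
have iC := intbleZ (4 * (C0 + C1) * N) (@half_inv2 R).
have mA := intble_measurable iA.
have iBA : intble lam (fun t => B t - A t).
  by apply: intble_le iC diff; exact: measurable_funB.
have iB : intble lam B.
  by have := intbleD iBA iA; congr intble; apply/funext => t; rewrite subrK.
have EhT : hT d P 1 f 0 = \int[lam]_t (B t - A t) + \int[lam]_t A t by rewrite RintB// subrK.
rewrite EhT.
have b1 : `|\int[lam]_t (B t - A t)| <= 4 * (C0 + C1) * I * N.
  have -> : 4 * (C0 + C1) * I * N = \int[lam]_t (4 * (C0 + C1) * N * (ind R (0 < t) * (1 + t) ^- 2)).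
    by rewrite RintZ; [rewrite mulrAC|exact: half_inv2].
  by apply: Rint_norm_le.
have b2 : `|\int[lam]_t A t| <= cK R N_ * CH / gam * N.
  have -> : \int[lam]_t A t = cK R N_ * conv (H 0 1) g 0 / gam.
    by rewrite Ev mulrAC mulfV ?mul1r// lt0r_neq0.
  rewrite !normrM normfV (gtr0_norm c0) (gtr0_norm G0) -mulrA -[leRHS]mulrA -[leRHS]mulrA ler_wpM2l ?(ltW c0)//.
  rewrite [CH * _]mulrCA mulrC ler_wpM2l ?invr_ge0 ?(ltW G0)//; exact: hH.
have -> : D * N = CE * N + (4 * (C0 + C1) * I * N + cK R N_ * CH / gam * N) by rewrite /D; ring.
apply: le_trans (ler_normD _ _) _; apply: lerD; first exact: hE hfg hg.
by apply: le_trans (ler_normD _ _) _; exact: lerD.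
Qed.

End truncation_bound.

(** * The maximal function *)

Section monotonicity.
Variable R : realType.

(* No measurability is required: the maximal function is not known to be measurable here. *)
Lemma le_ge0_integral d (T : measurableType d) (mu : {measure set T -> \bar R}) (f1 f2 : T -> \bar R) :
  (forall x, 0 <= f1 x)%E -> (forall x, f1 x <= f2 x)%E -> (\int[mu]_x f1 x <= \int[mu]_x f2 x)%E.
Proof.
move=> f10 f12; have f20 x : (0 <= f2 x)%E by exact: le_trans (f12 x).
rewrite !ge0_integralTE//; apply: ge_ereal_sup => _ [h hf <-].
by apply: ereal_sup_ubound; exists h => // x; exact: le_trans (hf x) (f12 x).
Qed.

Lemma hr_iint_ge0_any n (f : 'rV[R]_n -> \bar R) : (forall x, 0 <= f x)%E -> (0 <= hr_iint f)%E.
Proof.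
elim: n f => [|n IH] f f0 /=; first exact: f0.
by apply: integral_ge0 => t _; apply: IH => v; exact: f0.
Qed.

Lemma le_hr_iint n (f1 f2 : 'rV[R]_n -> \bar R) :
  (forall x, 0 <= f1 x)%E -> (forall x, f1 x <= f2 x)%E -> (hr_iint f1 <= hr_iint f2)%E.
Proof.
elim: n f1 f2 => [|n IH] f1 f2 f10 f12 /=; first exact: f12.
apply: le_ge0_integral => t; first by apply: hr_iint_ge0_any => v; exact: f10.
by apply: IH => v; [exact: f10|exact: f12].
Qed.

End monotonicity.

Section maximal_function.
Variables (R : realType) (n : nat).
Local Notation V := 'rV[R]_n.
Local Notation mu := (lebesgue_rV R n).
Local Notation nm := (@hr_enorm R n).
Local Notation omega := (omega R n).

Let o0 : 0 < omega := omega_gt0 R n.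
Let on : omega != 0. Proof. exact: lt0r_neq0. Qed.

Lemma indic_ball (x : V) r y : \1_[set z | nm (z - x) < r] y = ind R (nm (y - x) < r).
Proof.
by rewrite indicE /ind; case: ifPn => h; [rewrite mem_set|rewrite memNset//=; exact/negP].
Qed.

(** Lower bounds go through an integrable minorant because [h] will itself be a maximal function,
    with no measurability at hand. *)
Lemma HLmax_lower (h : V -> \bar R) (w : V -> R) (x : V) r : 0 < r -> (forall u, 0 <= w u) -> intble mu w ->
  (forall u, (w u)%:E <= (ind R (nm (u - x) < r))%:E * `|h u|)%E ->
  (((omega * r ^+ n)^-1 * \int[mu]_u w u)%:E <= hr_HLmax h x)%E.
Proof.
move=> r0 w0 iw wh; apply: le_trans (ereal_sup_ubound _); last by exists r.
rewrite hr_ball_volE//= mulrC EFinM lee_pmul2r ?lte_fin ?invr_gt0 ?mulr_gt0 ?exprn_gt0//.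
rewrite -hr_iint_intble//; apply: le_hr_iint => u; first by rewrite lee_fin.
by rewrite indic_ball.
Qed.

Lemma ball_shift_rapid (z : V) r : L2 mu (fun y => ind R (nm (y - z) < r)).
Proof. by have := L2_subr z (rapid_L2 (@rapid_oball R n r)). Qed.

Variable g : V -> R.
Hypothesis Lg : L2 mu g.

Definition ballA (z : V) (r : R) : R := \int[mu]_y (ind R (nm (y - z) < r) * `|g y|).

Lemma intble_ballA z r : intble mu (fun y => ind R (nm (y - z) < r) * `|g y|).
Proof. by apply: L2M; [exact: ball_shift_rapid|exact: L2_norm]. Qed.

Lemma ballA_ge0 z r : 0 <= ballA z r.
Proof. by apply: Rint_ge0 => y; rewrite mulr_ge0 ?ind_ge0. Qed.

Lemma HLmax_ball z r : 0 < r -> (((omega * r ^+ n)^-1 * ballA z r)%:E <= hr_HLmax (fun y => (g y)%:E) z)%E.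
Proof.
move=> r0; apply: (HLmax_lower r0 _ (intble_ballA z r)) => u; last by rewrite EFinM.
by rewrite mulr_ge0 ?ind_ge0.
Qed.

Lemma ballA_scale (x z : V) (a r : R) : 0 < a ->
  ballA (x + a *: z) (a * r) = a ^+ n * \int[mu]_y (ind R (nm (y - z) < r) * `|g (x + a *: y)|).
Proof.
move=> a0; have an := lt0r_neq0 a0; have i := intble_ballA (x + a *: z) (a * r).
rewrite /ballA (Rint_affine x an i) gtr0_norm//; congr (_ * _); apply: Rint_eq => y.
have -> : x + a *: y - (x + a *: z) = a *: (y - z) by rewrite opprD addrACA subrr add0r scalerBr.
by rewrite hr_enormZ gtr0_norm// ltr_pM2l.
Qed.

Variables (x : V) (N : R).
Hypothesis MN : (hr_HLmax (hr_HLmax (fun y => (g y)%:E)) x <= N%:E)%E.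

(** If |u - x| < r, the ball of radius 2r about [u] contains that of radius r about [x]. Hence [c]
    bounds Mg from below on the whole small ball. *)
Lemma ballA_le r : 0 < r -> ballA x r <= N * (omega * (2 * r) ^+ n).
Proof.
move=> r0; have r20 : 0 < 2 * r by rewrite mulr_gt0.
pose c := (omega * (2 * r) ^+ n)^-1 * ballA x r.
have p2 : 0 < omega * (2 * r) ^+ n by rewrite mulr_gt0// exprn_gt0.
have p1 : 0 < omega * r ^+ n by rewrite mulr_gt0// exprn_gt0.
have c0 : 0 <= c by rewrite mulr_ge0 ?ballA_ge0// invr_ge0 ltW.
have ib : intble mu (fun u => ind R (nm (u - x) < r)).
  have io : intble mu (fun u : V => ind R (nm u < r)) by apply: rapid_intble; exact: rapid_oball.
  exact: (intble_subr x io).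
have B := @HLmax_lower (hr_HLmax (fun y => (g y)%:E)) (fun u => c * ind R (nm (u - x) < r)) x r r0.
have {}B : (((omega * r ^+ n)^-1 * \int[mu]_u (c * ind R (nm (u - x) < r)))%:E <= N%:E)%E.
  apply: le_trans MN; apply: B.
  - by move=> u; rewrite mulr_ge0 ?ind_ge0.
  - exact: intbleZ.
  - move=> u; rewrite mulrC /ind; case: ifP => ux; last by rewrite mul0r mul0e.
    rewrite mul1r mul1e; apply: le_trans (lee_abs _); apply: le_trans (HLmax_ball u r20).
    rewrite lee_fin ler_wpM2l ?invr_ge0 ?(ltW p2)//.
    apply: Rint_le; [exact: intble_ballA|exact: intble_ballA|] => y.
    rewrite ler_wpM2r// /ind; case: (ltP (nm (y - x))) => yx; last by case: ifP.
    rewrite (_ : nm (y - u) < 2 * r)//; have -> : y - u = (y - x) + (x - u) by rewrite addrA subrK.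
    apply: le_lt_trans (hr_enormD _ _) _; rewrite -(opprB u x) hr_enormN; lra.
rewrite lee_fin RintZ// in B.
rewrite (@Rint_subr R n (fun u => ind R (nm u < r)) x) in B; last by apply: rapid_intble; exact: rapid_oball.
rewrite Rint_ball// mulrCA mulVf ?mulr1 ?lt0r_neq0// in B.
by move: B; rewrite /c mulrC ler_pdivrMr.
Qed.

Section shells.
Variable a : R.
Hypothesis a0 : 0 < a.

(** A shell outside the sphere at distance about 3 th / 2. For dyadic [th] these shells are
    disjoint, since half of 7/4 is below 5/4. *)
Definition shellw (th : R) (z : V) : R := ind R (5 / 4 * th < nm z - 1 < 7 / 4 * th).
Let G (y : V) := `|g (x + a *: y)|.
Let LG : L2 mu G. Proof. by apply: L2_norm; apply: L2_affine => //; exact: lt0r_neq0. Qed.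
Let G0 y : 0 <= G y. Proof. exact: normr_ge0. Qed.
Let B z r := \int[mu]_y (ind R (nm (y - z) < r) * G y).

Lemma measurable_shellw th : measurable_fun setT (shellw th).
Proof.
apply: measurable_ind; apply: measurable_and; apply: measurable_fun_ltr => //;
  by apply: measurable_funB => //; exact: measurable_hr_enorm.
Qed.

Lemma shellw_ge0 th z : 0 <= shellw th z. Proof. exact: ind_ge0. Qed.

Lemma shellw_out th z : th <= 1 -> 3 <= nm z -> shellw th z = 0.
Proof. by move=> t1 z3; rewrite /shellw /ind; case: ifP => // /andP[_]; lra. Qed.

Lemma intble_shellw th : th <= 1 -> intble mu (shellw th).
Proof.
move=> t1; apply: (@intble_le _ _ _ _ _ (fun z => ind R (nm z < 3))); first exact: measurable_shellw.
  by apply: rapid_intble; exact: rapid_oball.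
move=> z; rewrite ind_norm; case: (ltP (nm z) 3) => z3; first exact: ind_le1.
by rewrite -/(shellw th z) shellw_out.
Qed.

(* The shells are disjoint; the right-hand side makes the induction go through. *)
Lemma shellw_sum K z : \sum_(k < K) shellw (2 ^+ k)^-1 z <= ind R (2 < 2 ^+ K * (nm z - 1)).
Proof.
elim: K => [|K IH]; first by rewrite big_ord0 ind_ge0.
rewrite big_ord_recr/=; apply: le_trans (lerD IH (lexx _)) _.
have p : 0 < (2 : R) ^+ K by rewrite exprn_gt0.
have E : (5 / 4 * (2 ^+ K)^-1 < nm z - 1 < 7 / 4 * (2 ^+ K)^-1) =
    (5 / 4 < 2 ^+ K * (nm z - 1) < 7 / 4).
  by rewrite ltr_pdivrMr// ltr_pdivlMr// [(nm z - 1) * _]mulrC.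
rewrite /shellw E exprS -mulrA; move: (2 ^+ K * _) => v; rewrite /ind.
case: (ltP 2 v) => v2.
  by rewrite (_ : 5 / 4 < v < 7 / 4 = false) ?addr0; [rewrite (_ : 2 < 2 * v)//; lra|apply/negbTE/negP => /andP[_]; lra].
rewrite add0r; case: ifP => [/andP[h _]|_]; last by case: ifP.
by rewrite (_ : 2 < 2 * v)//; lra.
Qed.

(** The point [c] on the ray of [y] at radius 1 + 3 th / 2 is within 5 th / 2 of [y]. The ball of
    radius th / 4 about it stays in the outer shell and within 11 th / 4 < 3 th of [y]. *)
Lemma shell_ball (y : V) th : 0 < th <= 1 -> `|nm y - 1| < th ->
  omega * (th / 4) ^+ n <= \int[mu]_z (shellw th z * ind R (nm (y - z) < 3 * th)).
Proof.
move=> /andP[t0 t1] hy; have q0 : 0 < th / 4 by rewrite divr_gt0.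
have y0 : 0 < nm y by move: hy; rewrite ltr_norml => /andP[h _]; lra.
have yn := lt0r_neq0 y0.
pose c := ((1 + 3 / 2 * th) / nm y) *: y.
have cc : 0 < (1 + 3 / 2 * th) / nm y by rewrite divr_gt0//; lra.
have nc : nm c = 1 + 3 / 2 * th by rewrite /c hr_enormZ gtr0_norm// divfK.
have yc : nm (y - c) <= 5 / 2 * th.
  have -> : y - c = (1 - (1 + 3 / 2 * th) / nm y) *: y by rewrite scalerBl scale1r.
  rewrite hr_enormZ -{2}[nm y]ger0_norm ?(ltW y0)// -normrM mulrBl mul1r divfK//.
  by move: hy; rewrite ltr_norml ler_norml => /andP[h1 h2]; apply/andP; split; lra.
have io : intble mu (fun z : V => ind R (nm z < th / 4)) by apply: rapid_intble; exact: rapid_oball.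
rewrite -(Rint_ball n q0) -(Rint_subr c io).
apply: Rint_le; first exact: (intble_subr c io).
  apply: (@intble_le _ _ _ _ _ (shellw th)); last first.
  - by move=> z; rewrite normrM !ind_norm ler_piMr ?ind_ge0 ?ind_le1.
  - exact: intble_shellw.
  - apply: measurable_funM; first exact: measurable_shellw.
    by apply: measurable_ind_lt => //; apply: measurableT_comp (@measurable_hr_enorm R n) _; exact: measurable_subl.
move=> z; rewrite {1}/ind; case: ifP => zc; last by rewrite mulr_ge0 ?ind_ge0.
have h := hr_enorm_distl z c; rewrite nc ler_norml in h; have /andP[h1 h2] := h.
have h3 : nm (y - z) < 3 * th.
  have -> : y - z = (y - c) - (z - c) by rewrite opprB addrA subrK.
  apply: le_lt_trans (hr_enormD _ _) _; rewrite hr_enormN; lra.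
rewrite /shellw (_ : (_ < _ < _) = true) ?h3 /ind ?mul1r//.
by apply/andP; split; lra.
Qed.

Lemma B_bounded z r : 0 < r -> B z r <= omega * r ^+ n + \int[mu]_y (G y ^+ 2).
Proof.
move=> r0; have io : intble mu (fun y : V => ind R (nm y < r)) by apply: rapid_intble; exact: rapid_oball.
rewrite -(Rint_ball n r0) -(Rint_subr z io) -RintD; [|exact: (intble_subr z io)|exact: LG.2].
apply: Rint_le; first by apply: L2M LG; exact: ball_shift_rapid.
  by apply: intbleD; [exact: (intble_subr z io)|exact: LG.2].
move=> y; rewrite /ind; case: ifP => _; last by rewrite mul0r add0r sqr_ge0.
by rewrite mul1r; have := sqr_ge0 (1 - G y); rewrite !expr2; have := G0 y; nra.
Qed.

(** Fubini for [shell_ball]: balls of radius 3 th centred in the outer shell cover each point of the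
    thin shell around the sphere with total weight at least omega (th / 4)^n. *)
Lemma shell_le th : 0 < th <= 1 ->
  intble mu (fun z => shellw th z * B z (3 * th)) /\
  omega * (th / 4) ^+ n * \int[mu]_y (ind R (`|nm y - 1| < th) * G y) <=
  \int[mu]_z (shellw th z * B z (3 * th)).
Proof.
move=> t01; have /andP[t0 t1] := t01; have t30 : 0 < 3 * th by rewrite mulr_gt0.
pose F (z y : V) := shellw th z * (ind R (nm (y - z) < 3 * th) * G y).
have mF : measurable_fun setT (fun w : V * V => F w.1 w.2).
  apply: measurable_funM; first exact: measurableT_comp (measurable_shellw th) measurable_fst.
  apply: measurable_funM; last exact: measurableT_comp LG.1 measurable_snd.
  apply: measurable_ind_lt => //; apply: measurableT_comp (@measurable_hr_enorm R n) _.
  by apply: measurable_rVB; [exact: measurable_snd|exact: measurable_fst].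
have mF' : measurable_fun setT (fun w : V * V => F w.2 w.1).
  have ms : measurable_fun setT (fun w : V * V => (w.2, w.1)).
    by apply: measurable_fun_pair; [exact: measurable_snd|exact: measurable_fst].
  exact: measurableT_comp mF ms.
have iB z : intble mu (fun y => ind R (nm (y - z) < 3 * th) * G y).
  by apply: L2M LG; exact: ball_shift_rapid.
have F0 z y : 0 <= F z y by rewrite mulr_ge0 ?shellw_ge0// mulr_ge0 ?ind_ge0.
pose b := omega * (3 * th) ^+ n + \int[mu]_y (G y ^+ 2).
have Ffin : (\int[mu]_z \int[mu]_y (`|F z y|)%:E < +oo)%E.
  apply: (@iterated_lty _ _ _ _ _ mu mu F (fun z => b * shellw th z)) => //.
  - by apply: intbleZ; exact: intble_shellw.
  - by move=> z; exact: intbleZ.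
  - move=> z; rewrite (@Rint_eq _ _ R mu _ (F z)); last by move=> y; rewrite ger0_norm.
    by rewrite RintZ// mulrC ler_wpM2r ?shellw_ge0//; exact: B_bounded.
have Ffin' : (\int[mu]_y \int[mu]_z (`|F z y|)%:E < +oo)%E.
  rewrite -(@tonelli _ _ _ _ _ mu mu (fun z y => (`|F z y|)%:E))//.
  have mn : measurable_fun setT (fun w : V * V => `|F w.1 w.2|) by exact: measurableT_comp mF.
  exact/measurable_EFinP.
have E z : shellw th z * B z (3 * th) = \int[mu]_y F z y by rewrite -RintZ.
have iE := @intble_fubini _ _ _ _ _ mu mu F mF Ffin.
rewrite (funext E); split=> //.
rewrite (Rfubini mF Ffin) -RintZ; last first.
  by apply: L2M LG; apply: rapid_L2; exact: rapid_shell.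
apply: Rint_le.
- by apply: intbleZ; apply: L2M LG; apply: rapid_L2; exact: rapid_shell.
- exact: (@intble_fubini _ _ _ _ _ mu mu (fun y z => F z y) mF' Ffin').
move=> y; have iz : intble mu (fun z => shellw th z * ind R (nm (y - z) < 3 * th)).
  apply: (@intble_le _ _ _ _ _ (shellw th)); last first.
  - by move=> z; rewrite normrM !ind_norm ler_piMr ?ind_ge0 ?ind_le1.
  - exact: intble_shellw.
  - apply: measurable_funM; first exact: measurable_shellw.
    by apply: measurable_ind_lt => //; apply: measurableT_comp (@measurable_hr_enorm R n) _; exact: measurable_subl.
have -> : \int[mu]_z F z y = \int[mu]_z (shellw th z * ind R (nm (y - z) < 3 * th)) * G y.
  by rewrite -RintZr//; apply: Rint_eq => z; rewrite /F mulrA.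
rewrite mulrA ler_wpM2r// /ind; case: ifP => hy; last by rewrite mulr0 Rint_ge0// => z; rewrite mulr_ge0 ?shellw_ge0 ?ind_ge0.
by rewrite mulr1; exact: shell_ball.
Qed.

(** Each dyadic shell is charged to Mg on its own outer shell. These are disjoint and lie in |z| <
    3, so the sum is at most 12^n times the integral of Mg over a ball of radius 3, that is 12^n 3^n
    omega N; here 12 is the ratio of the radii 3 th and th / 4. *)
Lemma shells_le K : \sum_(k < K) \int[mu]_y (ind R (`|nm y - 1| < (2 ^+ k)^-1) * G y) <=
  omega * 36 ^+ n * N.
Proof.
pose th k : R := (2 ^+ k)^-1.
have th01 k : 0 < th k <= 1.
  by rewrite invr_gt0 exprn_gt0//= invf_le1 ?exprn_gt0// exprn_ege1// ler1n.
pose T z := \sum_(k < K) (omega * (3 * th k) ^+ n)^-1 * (shellw (th k) z * B z (3 * th k)).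
have p3 k : 0 < omega * (3 * th k) ^+ n.
  by rewrite mulr_gt0// exprn_gt0// mulr_gt0//; case/andP: (th01 k).
have iT : intble mu T.
  by apply: intble_sum => k; apply: intbleZ; exact: (shell_le (th01 k)).1.
have B0 z r : 0 <= B z r by apply: Rint_ge0 => y; rewrite mulr_ge0 ?ind_ge0.
have T0 z : 0 <= T z.
  by apply: sumr_ge0 => k _; rewrite mulr_ge0 ?invr_ge0 ?(ltW (p3 k))// mulr_ge0 ?shellw_ge0.
apply: (@le_trans _ _ (12 ^+ n * \int[mu]_z T z)).
  rewrite Rint_sum; last by move=> k; apply: intbleZ; exact: (shell_le (th01 k)).1.
  rewrite mulr_sumr; apply: ler_sum => k _; have /andP[t0 t1] := th01 k.
  have [i h] := shell_le (th01 k); rewrite RintZ//.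
  have p4 : 0 < omega * (th k / 4) ^+ n by rewrite mulr_gt0// exprn_gt0// divr_gt0.
  rewrite -ler_pdivlMl// in h; apply: le_trans h _; rewrite mulrA le_eqVlt; apply/orP; left; apply/eqP.
  congr (_ * _); have -> : 3 * th k = 12 * (th k / 4) by lra.
  have q0 : (th k / 4) ^+ n != 0 by rewrite expf_neq0// mulf_neq0 ?invr_eq0 ?lt0r_neq0.
  have c12 : (12 : R) ^+ n != 0 by rewrite expf_neq0// pnatr_eq0.
  rewrite [(12 * _) ^+ n]exprMn; move: (_ ^+ n) q0 (_ ^+ n) c12 => u u0 v v0; field.
  by rewrite u0 v0 on.
have an := lt0r_neq0 a0; have ain : a^-1 != 0 by rewrite invr_eq0.
pose w u := T (a^-1 *: (u - x)).
have iw : intble mu w.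
  rewrite (_ : w = fun u => T (- (a^-1 *: x) + a^-1 *: u)); first exact: (intble_affine (- (a^-1 *: x)) ain iT).
  by apply/funext => u; rewrite /w scalerBr addrC.
have a30 : 0 < 3 * a by rewrite mulr_gt0.
have := @HLmax_lower (hr_HLmax (fun y => (g y)%:E)) w x (3 * a) a30 (fun u => T0 _) iw _.
(* Where Mg is infinite nothing is to be shown; elsewhere each ball average is at most Mg, and by
   [shellw_sum] the shell weights at [z] add up to at most 1. *)
have hw u : ((w u)%:E <= (ind R (nm (u - x) < 3 * a))%:E * `|hr_HLmax (fun y => (g y)%:E) u|)%E.
  pose z := a^-1 *: (u - x); have uE : u = x + a *: z by rewrite /z scalerA mulfV// scale1r addrC subrK.
  have -> : (nm (u - x) < 3 * a) = (nm z < 3).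
    by rewrite /z hr_enormZ gtr0_norm ?invr_gt0// [a^-1 * _]mulrC ltr_pdivrMr.
  rewrite /w -/z; case: (ltP (nm z) 3) => z3; last first.
    rewrite mul0e lee_fin /T big1// => k _; rewrite shellw_out ?mul0r ?mulr0//.
    by case/andP: (th01 k).
  rewrite mul1e.
  have hB k : (((omega * (3 * th k) ^+ n)^-1 * B z (3 * th k))%:E <= hr_HLmax (fun y => (g y)%:E) u)%E.
    have /andP[t0 _] := th01 k; have t30 : 0 < 3 * th k by rewrite mulr_gt0.
    have := HLmax_ball u (mulr_gt0 a0 t30); rewrite {1}uE ballA_scale// exprMn.
    apply: le_trans; rewrite lee_fin le_eqVlt; apply/orP; left; apply/eqP.
    by rewrite (mulrCA omega) (invfM (a ^+ n)) mulrACA mulVf ?expf_neq0// mul1r.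
  move: hB; case: (hr_HLmax _ u) => [h| |] hB; [|by rewrite leey|by rewrite leey].
  rewrite lee_fin; apply: le_trans (ler_norm h); rewrite /T.
  have h0 : 0 <= h by have := hB 0%N; rewrite lee_fin; apply: le_trans; rewrite mulr_ge0// invr_ge0 ltW.
  apply: (@le_trans _ _ (\sum_(k < K) shellw (th k) z * h)).
    apply: ler_sum => k _; rewrite mulrCA ler_wpM2l ?shellw_ge0//.
    by have := hB k; rewrite lee_fin.
  rewrite -mulr_suml ler_piMl//; apply: le_trans (shellw_sum K z) _; exact: ind_le1.
move=> /(_ hw) h; have {h} := le_trans h MN; rewrite lee_fin.
rewrite (Rint_affine x an iw) gtr0_norm//.
rewrite (@Rint_eq _ _ R mu _ T); last first.
  have e (z : V) : a^-1 *: (x + a *: z - x) = z by rewrite [x + _]addrC addrK scalerA mulVf// scale1r.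
  by move=> z; rewrite /w e.
have -> : (omega * (3 * a) ^+ n)^-1 * (a ^+ n * \int[mu]_y T y) = (\int[mu]_y T y) / (omega * 3 ^+ n).
  have h1 := expf_neq0 n an; have h2 : (3 : R) ^+ n != 0 by rewrite expf_neq0// pnatr_eq0.
  by rewrite exprMn; field; rewrite h1 h2 on.
have p : 0 < omega * 3 ^+ n by rewrite mulr_gt0// exprn_gt0.
rewrite ler_pdivrMr// => h.
have -> : omega * 36 ^+ n * N = 12 ^+ n * (N * (omega * 3 ^+ n)).
  by rewrite (_ : 36 = 12 * 3 :> R) ?exprMn; [ring|lra].
by rewrite ler_wpM2l// exprn_ge0.
Qed.

End shells.

Lemma maxbd_HLmax : maxbd (fun y => g (x + y)) (omega * 36 ^+ n * N).
Proof.
move=> a a0; split=> [r r0|K]; last exact: shells_le.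
have ar : 0 < a * r by rewrite mulr_gt0.
have h := ballA_le ar.
have E := ballA_scale x 0 r a0; rewrite scaler0 addr0 in E; rewrite E in h.
have an : 0 < a ^+ n by rewrite exprn_gt0.
have N0 : 0 <= N.
  have p : 0 < omega * (2 * (a * r)) ^+ n by rewrite mulr_gt0// exprn_gt0// mulr_gt0.
  by rewrite -(pmulr_lge0 _ p); apply: le_trans h; rewrite -E ballA_ge0.
(* The ball bound has the constant 2^n, weakened to the 36^n of the shells so that one number serves
   both. *)
apply: (@le_trans _ _ (omega * 2 ^+ n * N * r ^+ n)).
  rewrite -(ler_pM2l an); apply: le_trans (_ : N * (omega * (2 * (a * r)) ^+ n) <= _); last first.
    by rewrite !exprMn le_eqVlt; apply/orP; left; apply/eqP; ring.
  apply: le_trans h; rewrite le_eqVlt; apply/orP; left; apply/eqP; congr (_ * _).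
  by apply: Rint_eq => y; rewrite subr0.
rewrite ler_wpM2r ?exprn_ge0 ?(ltW r0)// ler_wpM2r// ler_wpM2l ?(ltW o0)//.
by rewrite lerXn2r ?nnegrE// ler_nat.
Qed.

End maximal_function.

Section bridge.
Variables (R : realType) (n m : nat) (P : mpoly.mpoly n R).
Local Notation V := 'rV[R]_n.
Local Notation mu := (lebesgue_rV R n).
Local Notation d := m.*2.+1.
Hypotheses (hP : homog d P) (n0 : (0 < n)%N).

Lemma hr_borel_measurable (f : V -> R) : hr_borel_fun f -> measurable_fun setT f.
Proof. by move=> h _ B mB; rewrite setTI; exact: h. Qed.

Lemma hr_L2_L2 (f : V -> R) : hr_L2 f -> L2 mu f.
Proof.
move=> [/hr_borel_measurable mf fin]; split=> //.
have m2 : measurable_fun setT (fun y => f y ^+ 2) by exact: measurable_funX.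
apply/intble_ge0P => //; first by move=> y; exact: sqr_ge0.
rewrite -hr_iint_ge0//; first exact/measurable_EFinP.
by move=> y; rewrite lee_fin sqr_ge0.
Qed.

Lemma hr_ae (A : V -> Prop) : hr_ae_Rn A -> {ae mu, forall x, A x}.
Proof.
move=> [B [mB B0 h]]; exists B; split=> //.
  rewrite -B0 hr_iint_ge0; last by move=> y; rewrite lee_fin.
    by rewrite integral_indic// setIT.
  by apply/measurable_EFinP; exact: measurable_indic.
by move=> x /= nA; apply: contrapT => nB; exact: nA (h x nB).
Qed.

Lemma hr_TepsE (f : V -> R) (eps : R) (x : V) : 0 < eps -> L2 mu f ->
  hr_Teps d P f eps x = (Td d P eps f x)%:E.
Proof.
move=> e0 Lf; have od : odd d by rewrite /= odd_double.
have [i _] := Td_split hP od n0 x e0 Lf.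
rewrite /Td -hr_iint_intble//; congr hr_iint; apply/funext => y.
rewrite /hker /ind; case: ifP => _; last by rewrite !mul0r.
by rewrite mul1r mulrC.
Qed.

Lemma hr_is_T_riesz (f g : V -> R) : hr_L2 f -> hr_borel_fun g -> hr_is_T d P f g -> riesz_pair m P f g.
Proof.
move=> /hr_L2_L2 Lf /hr_borel_measurable mg /hr_ae fg; split=> // a a0.
apply: filterS fg => x fx.
have u0 (j : nat) : 0 < a * j.+1%:R^-1 by rewrite mulr_gt0// invr_gt0.
have uc : a * j.+1%:R^-1 @[j --> \oo] --> (0 : R)^'+.
  have c : a * j.+1%:R^-1 @[j --> \oo] --> (0 : R).
    rewrite -[X in _ --> X](mulr0 a); apply: cvgM; [exact: cvg_cst|exact: cvg_harmonic].
  move=> A /= hA.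
  have h1 : \forall j \near \oo, 0 < a * j.+1%:R^-1 -> A (a * j.+1%:R^-1) by exact: c _ hA.
  change (\forall j \near \oo, A (a * j.+1%:R^-1)).
  by apply: filterS h1 => j; apply; exact: u0.
have h := fine_cvg (cvg_comp _ _ uc fx).
have e j : fine (hr_Teps d P f (a * j.+1%:R^-1) x) = Td d P (a * j.+1%:R^-1) f x by rewrite hr_TepsE.
by have := h _; rewrite (_ : fine \o _ = fun j => Td d P (a * j.+1%:R^-1) f x); [apply|exact/funext/e].
Qed.

End bridge.

Theorem theorem2 (R : realType) (n d : nat) (P : mpoly.mpoly n R) :
  (1 <= n)%N -> odd d -> P != 0 ->
  hr_homogeneous d P -> hr_harmonic P ->
  exists C : R, forall (f g : 'rV[R]_n -> R),
    hr_L2 f -> hr_borel_fun g -> hr_is_T d P f g ->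
    forall x : 'rV[R]_n,
      (hr_Tstar d P f x <= C%:E * hr_HLmax (hr_HLmax (fun y => (g y)%:E)) x)%E.
Proof.
move=> n0 od _ /mpoly.dhomogP hP0 hh.
have [m dE] : exists m, d = m.*2.+1 by exists d./2; rewrite -[LHS]odd_double_half od.
move: hP0; rewrite {}dE => hP0 {od}.
have hP : homog m.*2.+1 P by move=> k /hP0.
have [C C0 hC] := Td_bound hP hh n0.
have o0 := omega_gt0 R n.
(* The summand 1 makes the constant positive, so that the right-hand side is infinite wherever the
   iterated maximal function is. *)
exists (C * (omega R n * 36 ^+ n) + 1) => f g hf hg hT x.
have Lf := hr_L2_L2 hf; have hfg := hr_is_T_riesz hP n0 hf hg hT.
have Lg := riesz_L2 hP hh n0 hfg.
have K0 : 0 < C * (omega R n * 36 ^+ n) + 1.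
  by rewrite ltr_wpDl// mulr_ge0// mulr_ge0 ?(ltW o0)// exprn_ge0.
have M0 : (0 <= hr_HLmax (hr_HLmax (fun y => (g y)%:E)) x)%E.
  have := @HLmax_lower R n (hr_HLmax (fun y => (g y)%:E)) (fun=> 0) x 1 ltr01 (fun=> lexx 0).
  have i0 : intble (lebesgue_rV R n) (fun=> 0).
    have := intbleZ 0 (rapid_intble (@rapid_oball R n 1)).
    by congr intble; apply/funext => y; rewrite mul0r.
  move=> /(_ i0) h; apply: le_trans (h _) => [|u]; last by rewrite mule_ge0// lee_fin ind_ge0.
  by rewrite lee_fin mulr_ge0 ?Rint_ge0// invr_ge0 mulr_ge0 ?(ltW o0)// expr1n.
apply: ge_ereal_sup => _ [eps /= e0 <-].
case E : (hr_HLmax (hr_HLmax (fun y => (g y)%:E)) x) M0 => [N| |] // M0; last first.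
  by rewrite gt0_muley ?leey// lte_fin.
have MN : (hr_HLmax (hr_HLmax (fun y => (g y)%:E)) x <= N%:E)%E by rewrite E.
have N0 : 0 <= N by rewrite lee_fin in M0.
rewrite (hr_TepsE hP n0)// lee_fin.
have mb := maxbd_HLmax Lg MN.
(* Translation by [x] and dilation by [eps] carry the truncation at radius [eps] and point [x] to
   radius 1 and the origin, with the same bound. *)
have h1 := riesz_affine hP n0 x e0 hfg.
have h2 := maxbd_dil e0 mb.
have := hC _ _ _ h1 h2; rewrite (Td_affine hP n0 x 0 e0 ltr01 Lf) mulr1 scaler0 addr0 => h.
by apply: le_trans h _; rewrite mulrA mulrDl mul1r lerDl.
Qed.
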